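(* Let $\bar\beta>0$ and let $u\in C^{\bar\beta}_{t,x}(\mathbb{T}^3\times[-2T,2T])$ be a zero-mean weak solution of the Euler equations. Then there exist $\beta>0$, a sequence $\nu_n\to 0$ of viscosities, and a uniformly bounded sequence $v^{(\nu_n)}\in C^0([0,T];H^\beta(\mathbb{T}^3))$ such that each $v^{(\nu_n)}$ is a weak solution to the Navier-Stokes equations with viscosity $\nu_n$, and $$v^{(\nu_n)}\to u\quad\text{strongly in } C^0([0,T];L^2(\mathbb{T}^3)).$$
   Context: $\mathbb{T}^3=\mathbb{R}^3/2\pi\mathbb{Z}^3$; $T>0$; $H^\beta$ is the $L^2$-based Sobolev space of regularity index $\beta$; viscosities are constants in $(0,1]$. $C^{\bar\beta}_{t,x}$ denotes the space of functions that are Hölder continuous of exponent $\bar\beta$ jointly in space and time. The Navier-Stokes equations with viscosity $\nu$ are $$\partial_t v+\operatorname{div}(v\otimes v)+\nabla p-\nu\Delta v=0,\qquad \operatorname{div} v=0,$$ on $\mathbb{T}^3$ (periodic boundary conditions), for $\mathbb{R}^3$-valued $v$ with zero spatial mean; the Euler equations are the same system with $\nu=0$. Weak solution: for an interval $[t_1,t_2]$, a vector field $v\in C^0([t_1,t_2];L^2(\mathbb{T}^3))$ is a weak solution of the system with parameter $\nu\geq 0$ if for every $t\in[t_1,t_2]$ the field $v(\cdot,t)$ is weakly divergence free and has zero mean, and $$\int_{\mathbb{R}}\int_{\mathbb{T}^3} v\cdot\big(\partial_t\varphi+(v\cdot\nabla)\varphi+\nu\Delta\varphi\big)\,dx\,dt=0$$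 for every test vector field $\varphi\in C_0^\infty(\mathbb{T}^3\times(t_1,t_2);\mathbb{R}^3)$ such that $\varphi(\cdot,t)$ is divergence free for all $t$. For the Euler equations take $\nu=0$ and $[t_1,t_2]=[-2T,2T]$; for the Navier-Stokes equations take $[t_1,t_2]=[0,T]$. *)

(* Defs.v *)
From HB Require Import structures.
From mathcomp Require Import all_boot all_order all_algebra.
From mathcomp Require Import all_classical all_reals all_analysis.

Set Implicit Arguments.
Unset Strict Implicit.
Unset Printing Implicit Defensive.
Import Order.TTheory GRing.Theory Num.Theory.
Import numFieldNormedType.Exports.
Local Open Scope classical_set_scope.
Local Open Scope ring_scope.

Section NavierStokes.
Variable R : realType.

(* R^3; functions on T^3 = R^3 / 2 pi Z^3 are represented by functions on R^3
   that are 2 pi-periodic in each coordinate. *)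
Definition point := 'rV[R]_3.
Definition field := point -> 'rV[R]_3.

Definition basis (j : 'I_3) : point := delta_mx 0 j.

Definition torus_periodic (V : zmodType) (f : point -> V) : Prop :=
  forall j : 'I_3, periodic f ((pi *+ 2) *: basis j).

Definition dot (a b : 'rV[R]_3) : R := \sum_(i < 3) a 0 i * b 0 i.

(* Lebesgue measure on T^3, realised on the fundamental domain [0, 2 pi]^3.
   The library has no measure on row vectors, hence the passage through
   R * R * R and [row3]. *)
Definition period : set R := `[0, pi *+ 2].

Lemma measurable_period : measurable (period : set (measurableTypeR R)).
Proof. exact: measurable_itv. Qed.

Lemma period_lty : (lebesgue_measure period < +oo)%E.
Proof.
by rewrite /period lebesgue_measure_itv /=; case: ifP => // _; rewrite -EFinB ltry.
Qed.

Definition circle_measure := mfrestr measurable_period period_lty.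

Definition torus_measure := ((circle_measure \x circle_measure) \x circle_measure)%E.

Definition row3 (p : R * R * R) : point :=
  \row_(i < 3) (if i == 0 then p.1.1 else if i == 1 then p.1.2 else p.2).

Definition torus_int (g : point -> R) : R :=
  \int[torus_measure]_p g (row3 p).

Definition L2 : set field := [set f | torus_periodic f /\
  forall i : 'I_3, (fun p => f (row3 p) 0 i) \in Lfun torus_measure 2%:E].

Definition L2norm (f : field) : \bar R :=
  Lnorm torus_measure 2%:E
    (fun p => (Num.sqrt (dot (f (row3 p)) (f (row3 p))))%:E).

(* |\hat f(k)|^2 for \hat f(k) = (2 pi)^-3 \int_{T^3} f(x) exp(-i k.x) dx,
   summed over the three components of f; the two squares are those of the real
   and imaginary parts. *)
Definition fourier_sq (f : field) (k : 'rV[int]_3) : R :=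
  let kx x := dot (map_mx intr k) x in
  \sum_(i < 3)
    ((torus_int (fun x => f x 0 i * cos (kx x)) / (pi *+ 2) ^+ 3) ^+ 2 +
     (torus_int (fun x => f x 0 i * sin (kx x)) / (pi *+ 2) ^+ 3) ^+ 2).

Definition Hnorm (beta : R) (f : field) : \bar R :=
  ((\esum_(k in [set: 'rV[int]_3])
     ((1 + dot (map_mx intr k) (map_mx intr k)) `^ beta * fourier_sq f k)%:E)
   `^ 2^-1)%E.

(* Only for beta >= 0, where H^beta is a subspace of L^2. *)
Definition Hsob (beta : R) : set field :=
  [set f | L2 f /\ (Hnorm beta f < +oo)%E].

(* C^0([a, b]; X) for a space X of fields normed by N; the values of v at times
   outside [a, b] are irrelevant. *)
Definition C0 (X : set field) (N : field -> \bar R) (a b : R) : set (R -> field) :=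
  [set v | forall t, t \in `[a, b] ->
     X (v t) /\ N (v s \- v t) @[s --> within `[a, b] (nbhs t)] --> 0%E].

Definition C0norm (N : field -> \bar R) (a b : R) (v : R -> field) : \bar R :=
  ereal_sup [set N (v t) | t in `[a, b]].

(* Joint Hoelder continuity. For periodic functions the distance of R^3 and
   that of T^3 give the same class. *)
Definition hoelder_tx (gamma a b : R) (v : R -> field) : Prop :=
  (forall t, t \in `[a, b] -> torus_periodic (v t)) /\
  exists C : R, forall t s x y, t \in `[a, b] -> s \in `[a, b] ->
    `|v t x - v s y| <= C * `|(x, t) - (y, s)| `^ gamma.

Fixpoint Ck (V W : normedModType R) (k : nat) (f : V -> W) : Prop :=
  match k with
  | 0 => continuous f
  | k'.+1 => continuous f /\
      forall v, (forall x, derivable f x v) /\ Ck k' ('D_v f)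
  end.

Definition smooth (V W : normedModType R) (f : V -> W) : Prop :=
  forall k, Ck k f.

Definition div (f : field) (x : point) : R :=
  \sum_(j < 3) ('D_(basis j) f x) 0 j.

Definition grad (g : point -> R) (x : point) : 'rV[R]_3 :=
  \row_(j < 3) 'D_(basis j) g x.

Definition advect (w f : field) (x : point) : 'rV[R]_3 :=
  \sum_(j < 3) w x 0 j *: 'D_(basis j) f x.

Definition laplace (f : field) (x : point) : 'rV[R]_3 :=
  \sum_(j < 3) 'D_(basis j) ('D_(basis j) f) x.

(* C_0^\infty(T^3 x (a, b); R^3), divergence free at each time. As T^3 is
   compact, compact support only restricts the times. *)
Definition test_field (a b : R) (phi : R -> field) : Prop :=
  [/\ smooth (fun z : point * R => phi z.2 z.1),
      (forall t, torus_periodic (phi t)),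
      (exists c d, [/\ a < c, d < b &
         forall t, t \notin `[c, d] -> forall x, phi t x = 0]) &
      forall t x, div (phi t) x = 0].

Definition weakly_div_free (f : field) : Prop :=
  forall g : point -> R, smooth g -> torus_periodic g ->
    torus_int (fun x => dot (f x) (grad g x)) = 0.

Definition zero_mean (f : field) : Prop :=
  forall i : 'I_3, torus_int (fun x => f x 0 i) = 0.

Definition weak_solution (nu a b : R) (v : R -> field) : Prop :=
  [/\ C0 L2 L2norm a b v,
      (forall t, t \in `[a, b] -> weakly_div_free (v t) /\ zero_mean (v t)) &
      forall phi, test_field a b phi ->
        \int[lebesgue_measure]_t torus_int (fun x =>
          dot (v t x) (derive1 (fun s => phi s x) t
                       + advect (v t) (phi t) x
                       + nu *: laplace (phi t) x)) = 0].

End NavierStokes.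

(* Submission.v *)
(* Convex integration at a fixed small viscosity [nu]. Mollifying [u] gives a smooth solution up to a Reynolds
   stress which, the viscous term included, is at most [1 / L]; all fields are approximated by trigonometric
   polynomials of degree at most a power of [L]. In one stage the stress is written as a combination of [xi * xi]
   with coefficients [a ^ 2] over the six vectors [xi = e_i + e_j, e_i - e_j], and for each [xi] in turn the term
   [a ^ 2 xi * xi] is cancelled by adding [sqrt 2 a Th cos(lambda y) xi], made divergence free. Here [Th] is a
   product of powers of cosines of unit [L^2] norm, concentrated near points which travel with speed [N ^ 12] in
   direction [xi]: its [L^1] norm is so small that the linear and viscous errors are small in [L^1], although all
   frequencies are powers of one integer [N], and the oscillation of [a ^ 2 Th ^ 2] along [xi] is absorbed by the
   time derivative of the corrector [N ^ -12 a ^ 2 Th ^ 2 xi]. With [L_{q+1} = L_q ^ E] the stress after [q] stages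
   is at most [1 / L_q] in [L^1], while the increments have squared [L^2] norm at most [C / L_q] and degree at most
   a power of [L_q]; hence the limit is close to [u], lies in an [H^beta] with [beta] independent of [nu], and
   solves the Navier-Stokes equations exactly. *)
From HB Require Import structures.
From mathcomp Require Import all_boot all_order all_algebra.
From mathcomp Require Import all_classical all_reals all_analysis.
From mathcomp Require Import measurable_realfun ring lra zify.
Require Import Defs.
Set Implicit Arguments.
Unset Strict Implicit.
Unset Printing Implicit Defensive.
Import Order.TTheory GRing.Theory Num.Theory.
Import numFieldNormedType.Exports.
Local Open Scope classical_set_scope.
Local Open Scope ring_scope.


(** * Integration over the torus *)

(** Viscosity is the obstacle: a perturbation of unit [L^2] size oscillating at frequency [N ^ 10]
    must have a gradient that is small in [L^1], so its [L^1] norm must be well below [N ^ -10].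
    Concentration near points of a three-dimensional torus allows this: the powers [N ^ 12],
    [N ^ 16], [N ^ 16] of the cosines give an [L^1] norm of order [N ^ -11]. The other exponents
    follow. A space derivative of the profile costs at most [N ^ 9], one power below the
    oscillation, and [Th ^ 2] has [L^2] norm [N ^ 11], one power below the speed, so that the time
    corrector is small in [L^2]. Every error is then a power of the size of the data divided by [N].
    Velocity and stress are merely Hoelder continuous, but perturbations and amplitudes are
    trigonometric polynomials: derivatives, antiderivatives and averages act on lists of modes, and
    divergence identities become algebra. The exponent [beta] does not depend on [nu] because the
    Hoelder class of the mollified data is fixed before [nu] is chosen, and one stage raises sizes
    and degrees to a fixed power. *)

Notation ti := (@torus_int _).
Notation tpi := (pi *+ 2).
Notation le_tr y := (@le_trans _ _ y).
Notation "\oint x , f" := (torus_int (fun x => f)) (at level 200, x name, f at level 200, only parsing) : ring_scope.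

Lemma le_normD (R : numDomainType) (x y z : R) : `|x| + `|y| <= z -> `|x + y| <= z.
Proof. exact: le_trans (ler_normD _ _). Qed.

(** * Iterated integrals over products of measures *)

Section ProductMeasures.
Context d1 d2 (T1 : measurableType d1) (T2 : measurableType d2) (R : realType).
Variables (m1 : {sigma_finite_measure set T1 -> \bar R}) (m2 : {sigma_finite_measure set T2 -> \bar R}).
Variables F F' : T1 * T2 -> R.
Hypothesis iF : (m1 \x m2)%E.-integrable setT (EFin \o F).
Hypothesis iF' : (m1 \x m2)%E.-integrable setT (EFin \o F').

Lemma eq_integral_prod_snd :
  (forall x, \int[m2]_y (F (x, y))%:E = \int[m2]_y (F' (x, y))%:E)%E ->
  (\int[(m1 \x m2)%E]_p (F p)%:E = \int[(m1 \x m2)%E]_p (F' p)%:E)%E.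
Proof.
move=> h; rewrite -(@integral12_prod_meas1 _ _ _ _ R m1 m2 _ iF) -(@integral12_prod_meas1 _ _ _ _ R m1 m2 _ iF').
by apply: eq_integral => x _; exact: h.
Qed.

Lemma eq_integral_prod_fst :
  (forall y, \int[m1]_x (F (x, y))%:E = \int[m1]_x (F' (x, y))%:E)%E ->
  (\int[(m1 \x m2)%E]_p (F p)%:E = \int[(m1 \x m2)%E]_p (F' p)%:E)%E.
Proof.
move=> h; rewrite -(@integral21_prod_meas1 _ _ _ _ R m1 m2 _ iF) -(@integral21_prod_meas1 _ _ _ _ R m1 m2 _ iF').
by apply: eq_integral => x _; exact: h.
Qed.

End ProductMeasures.

Section ProductMeasureExt.
Context d1 d2 (T1 : measurableType d1) (T2 : measurableType d2) (R : realType).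

Lemma product_measure1_ext (m1 m1' : {measure set T1 -> \bar R})
    (m2 m2' : {sigma_finite_measure set T2 -> \bar R}) :
  (forall A, measurable A -> m1 A = m1' A) -> (forall A, measurable A -> m2 A = m2' A) ->
  forall A, measurable A -> (m1 \x m2)%E A = (m1' \x m2')%E A.
Proof.
move=> h1 h2 A mA; rewrite /product_measure1.
rewrite (@eq_measure_integral _ _ _ setT m1'); last by move=> B mB _; exact: h1.
by apply: eq_integral => x _ /=; apply: h2; exact: measurable_xsection.
Qed.

End ProductMeasureExt.

(** Lets a product of two circle measures serve in turn as a factor of a further product, where a
    sigma-finite structure is required. *)
Lemma sigma_finite_copy d (T : measurableType d) (R : realType) (m : {measure set T -> \bar R}) :
  (m setT < +oo)%E -> exists m' : {sigma_finite_measure set T -> \bar R}, forall A, m' A = m A.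
Proof.
move=> mT; have fm := lty_fin_num_fun mT.
have sm : sigma_finite setT m by apply: fin_num_fun_sigma_finite => //; rewrite measure0.
pose H2 := isSFinite.Build d T R m (sfinite_measure_sigma_finite sm).
pose H3 := isSigmaFinite.Build _ _ _ _ sm.
by exists (HB.pack_for (SigmaFiniteMeasure.type T R) (Measure.sort m) H2 H3).
Qed.


Section TripleProduct.
Context d (T : measurableType d) (R : realType).
Variable c : {sigma_finite_measure set T -> \bar R}.
Hypothesis cfin : c setT \is a fin_num.

Lemma bounded_integrable d' (T' : measurableType d') (m : {measure set T' -> \bar R}) (G : T' -> R) (M : R) :
  (m setT < +oo)%E -> measurable_fun setT G -> (forall p, `|G p| <= M) -> m.-integrable setT (EFin \o G).
Proof.
move=> mT mG bG; apply: measurable_bounded_integrable => //.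
by exists M; split; [exact: num_real|move=> N MN p _; exact: le_trans (bG _) (ltW MN)].
Qed.

(* [c2] and [m] are copies of the product measures: deciding that two paths of
   the hierarchy give the same structure on a product is out of reach of unification. *)
Variable c2 : {sigma_finite_measure set (T * T)%type -> \bar R}.
Hypothesis c2E : forall A, measurable A -> c2 A = (c \x c)%E A.
Variable m : {measure set (T * T * T)%type -> \bar R}.
Hypothesis mE : forall A, measurable A -> m A = (c2 \x c)%E A.

Lemma prodT_lty : ((c \x c)%E setT < +oo)%E.
Proof.
rewrite -setXTT product_measure1E//.
by apply: lte_mul_pinfty => //; rewrite ltey_eq cfin.
Qed.

Lemma prod3T_lty : ((c2 \x c)%E setT < +oo)%E.
Proof.
rewrite -setXTT product_measure1E//.
apply: lte_mul_pinfty => //; last by rewrite ltey_eq cfin.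
have h : (c2 setT < +oo)%E by rewrite [X in (X < _)%E]c2E//; exact: prodT_lty.
by rewrite ge0_fin_numE.
Qed.

Variables F F' : T * T * T -> R.
Variable M : R.
Hypothesis mF : measurable_fun setT F.
Hypothesis mF' : measurable_fun setT F'.
Hypothesis bF : forall p, `|F p| <= M.
Hypothesis bF' : forall p, `|F' p| <= M.

Let iF : (c2 \x c)%E.-integrable setT (EFin \o F).
Proof. exact: (bounded_integrable prod3T_lty mF bF). Qed.

Let iF' : (c2 \x c)%E.-integrable setT (EFin \o F').
Proof. exact: (bounded_integrable prod3T_lty mF' bF'). Qed.

Let iF2 z : (c \x c)%E.-integrable setT (EFin \o (fun q => F (q, z))).
Proof.
apply: (bounded_integrable prodT_lty) => //.
by apply: (measurableT_comp mF); exact: measurable_fun_pair.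
Qed.

Let iF2' z : (c \x c)%E.-integrable setT (EFin \o (fun q => F' (q, z))).
Proof.
apply: (bounded_integrable prodT_lty) => //.
by apply: (measurableT_comp mF'); exact: measurable_fun_pair.
Qed.

Let intm (G : T * T * T -> \bar R) : (\int[m]_p G p = \int[(c2 \x c)%E]_p G p)%E.
Proof. by apply: eq_measure_integral => A mA _; exact: mE. Qed.

Let intc2 (G : T * T -> \bar R) : (\int[c2]_p G p = \int[(c \x c)%E]_p G p)%E.
Proof. by apply: eq_measure_integral => A mA _; exact: c2E. Qed.

(** This lemma and the next two serve translations along one coordinate: Fubini makes the chosen
    coordinate innermost, and there a one-dimensional identity is enough. *)
Lemma eq_integral_prod3_3 :
  (forall x y, \int[c]_z (F (x, y, z))%:E = \int[c]_z (F' (x, y, z))%:E)%E ->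
  (\int[m]_p (F p)%:E = \int[m]_p (F' p)%:E)%E.
Proof. by move=> h; rewrite !intm; apply: (eq_integral_prod_snd iF iF') => -[x y]; exact: h. Qed.

Lemma eq_integral_prod3_2 :
  (forall x z, \int[c]_y (F (x, y, z))%:E = \int[c]_y (F' (x, y, z))%:E)%E ->
  (\int[m]_p (F p)%:E = \int[m]_p (F' p)%:E)%E.
Proof.
move=> h; rewrite !intm; apply: (eq_integral_prod_fst iF iF') => z; rewrite !intc2.
by apply: (eq_integral_prod_snd (iF2 z) (iF2' z)) => x; exact: h.
Qed.

Lemma eq_integral_prod3_1 :
  (forall y z, \int[c]_x (F (x, y, z))%:E = \int[c]_x (F' (x, y, z))%:E)%E ->
  (\int[m]_p (F p)%:E = \int[m]_p (F' p)%:E)%E.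
Proof.
move=> h; rewrite !intm; apply: (eq_integral_prod_fst iF iF') => z; rewrite !intc2.
by apply: (eq_integral_prod_fst (iF2 z) (iF2' z)) => x; exact: h.
Qed.

End TripleProduct.

(** * The integral on the torus and its invariance under translations *)

Section TorusInt.
Variable R : realType.
Notation mR := (measurableTypeR R).
Notation mT := (mR * mR * mR)%type.
Implicit Types f g : point R -> R.

Let fl (n : nat) (x : R) : R := (Num.floor (x * n.+1%:R))%:~R / n.+1%:R.

Lemma fl_cvg x : fl n x @[n --> \oo] --> x.
Proof.
apply/cvgrPdist_le => e e0; near=> n.
have n0 : 0 < n.+1%:R :> R by [].
have h1 := floor_le_tmp (x * n.+1%:R); have h2 := floorD1_gt (x * n.+1%:R).
have : `|x - fl n x| <= n.+1%:R^-1.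
  rewrite /fl ger0_norm; last by rewrite subr_ge0 ler_pdivrMr.
  rewrite -[X in X - _](mulfK (lt0r_neq0 n0)) -mulrBl -[leRHS]mul1r.
  rewrite ler_pM2r ?invr_gt0// lerBlDl; move: h2; rewrite intrD => /ltW; rewrite addrC; lra.
move=> /le_trans; apply; near: n; by apply: filterS (near_infty_natSinv_lt (PosNum e0)) => m /= /ltW.
Unshelve. all: by end_near. Qed.

(** Rounding the coordinates down to the grid of mesh [1 / n.+1] gives functions that are constant
    on countably many boxes and converge pointwise to [f]. Borel sets of row vectors never have to
    be compared with the product sigma-algebra. *)
Lemma measurable_row3 f : continuous f ->
  measurable_fun [set: mT] (fun p : mT => f (row3 p)).
Proof.
move=> cf.
pose h n (p : mT) := f (row3 (fl n p.1.1, fl n p.1.2, fl n p.2)).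
apply: (@measurable_realfun.measurable_fun_cvg _ _ _ _ h) => [n|p _]; last first.
  apply: (@continuous_cvg _ _ _ _ _ _ f); first exact: cf.
  apply/cvg_ballP => e e0.
  have H (x : R) : \forall n \near \oo, ball x e (fl n x) by apply: (fl_cvg (nbhsx_ballx _ _ e0)).
  near=> n; split=> // i j; rewrite /row3 !mxE.
  case: ifP => _; [|case: ifP => _]; near: n;
    exact: H.
move=> _ B mB; rewrite setTI.
pose cell (k : int) := [set x : mR | Num.floor (x * n.+1%:R) = k].
have mcell k : measurable (cell k).
  rewrite (_ : cell k = `[k%:~R / n.+1%:R, (k + 1)%:~R / n.+1%:R[%classic).
    exact: measurable_itv.
  apply/seteqP; split=> x /=; rewrite in_itv/= ler_pdivrMr// ltr_pdivlMr//.
    by move=> <-; rewrite floor_le_tmp floorD1_gt.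
  by move=> hx; rewrite /cell/=; apply/eqP; rewrite real_floor_eq// num_real.
pose S (k : int * int * int) : set mT :=
  if f (row3 (k.1.1%:~R / n.+1%:R, k.1.2%:~R / n.+1%:R, k.2%:~R / n.+1%:R)) \in B
  then (cell k.1.1 `*` cell k.1.2) `*` cell k.2 else set0.
rewrite (_ : _ @^-1` _ = \bigcup_k S k).
  apply: countable_bigcupT_measurable => // k; rewrite /S.
  by case: ifP => _ //; apply: measurableX => //; apply: measurableX.
apply/seteqP; split=> p /=.
  move=> Bp; exists (Num.floor (p.1.1 * n.+1%:R), Num.floor (p.1.2 * n.+1%:R), Num.floor (p.2 * n.+1%:R)) => //.
  by rewrite /S /=; case: ifPn => //; rewrite notin_setE; apply.
case=> -[[k1 k2] k3] _; rewrite /S/=; case: ifPn => // /set_mem Bk [[/= e1 e2] e3].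
by rewrite /h /fl e1 e2 e3.
Unshelve. all: by end_near. Qed.


Definition CP f := continuous f /\ torus_periodic f.

Definition box : set (point R) := [set x | forall i, `[0, tpi]%classic (x 0 i)].

Lemma compact_box : compact box.
Proof. apply: (@rV_compact R 3 (fun=> `[0, tpi]%classic)) => i; exact: segment_compact. Qed.

Lemma periodic_int (V : zmodType) (h : point R -> V) (p : point R) (k : int) x :
  periodic h p -> h (x + k%:~R *: p) = h x.
Proof.
move=> hp; have hn n y : h (y + n%:R *: p) = h y.
  by elim: n y => [|n IH] y; rewrite ?scale0r ?addr0// -natr1 scalerDl scale1r addrA hp IH.
case: k => n; first by rewrite -pmulrn hn.
by rewrite NegzE mulrNz scaleNr -pmulrn -(hn n.+1 (x - _)) subrK.
Qed.

Definition mod2pi (x : R) : R := x - tpi * (Num.floor (x / tpi))%:~R.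

Lemma twopi_gt0 : 0 < tpi :> R. Proof. by rewrite pmulrn_lgt0// pi_gt0. Qed.

Lemma mod2pi_itv x : 0 <= mod2pi x < tpi.
Proof.
rewrite /mod2pi; have h0 := twopi_gt0.
have h1 := floor_le_tmp (x / tpi); have h2 := floorD1_gt (x / tpi).
move: h1 h2; rewrite ler_pdivlMr// ltr_pdivrMr// intrD mulrDl mul1r => h1 h2.
by rewrite subr_ge0 mulrC h1/= ltrBlDr addrC.
Qed.

Definition tobox (x : point R) : point R := \row_i mod2pi (x 0 i).

Lemma tobox_in x : box (tobox x).
Proof. by move=> i; rewrite /tobox mxE/= in_itv/=; have /andP[-> /ltW] := mod2pi_itv (x 0 i). Qed.

Variant ord3_spec : 'I_3 -> Type := Ord0 : ord3_spec 0 | Ord1 : ord3_spec 1 | Ord2 : ord3_spec 2%:R.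

Lemma ord3P i : ord3_spec i.
Proof.
case: i => -[|[|[|//]]] hi; [rewrite (_ : Ordinal hi = 0)|rewrite (_ : Ordinal hi = 1)|rewrite (_ : Ordinal hi = 2%:R)];
  by [constructor|apply/val_inj].
Qed.

Lemma ordE : (((0 : 'I_3) == 1) = false) * (((0 : 'I_3) == 2%:R) = false) * (((1 : 'I_3) == 0) = false) *
  (((1 : 'I_3) == 2%:R) = false) * (((2%:R : 'I_3) == 0) = false) * (((2%:R : 'I_3) == 1) = false).
Proof. by []. Qed.

Lemma rowE3 (x : point R) : x = x 0 0 *: basis R 0 + x 0 1 *: basis R 1 + x 0 (2%:R) *: basis R (2%:R).
Proof.
by apply/rowP => i; rewrite !mxE; case: (ord3P i); rewrite ?eqxx ?ordE /= ?mulr1 ?mulr0 ?addr0 ?add0r.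
Qed.

Lemma tobox_per (V : zmodType) (h : point R -> V) x : torus_periodic h -> h (tobox x) = h x.
Proof.
move=> hp; pose k i : int := - Num.floor (x 0 i / tpi).
have -> : tobox x = x + (k 0)%:~R *: (tpi *: basis R 0) + (k 1)%:~R *: (tpi *: basis R 1)
    + (k 2%:R)%:~R *: (tpi *: basis R (2%:R)).
  apply/rowP => i; rewrite !mxE /mod2pi /k !mulrNz.
  by case: (ord3P i); rewrite ?eqxx ?ordE /= ?mulr1 ?mulr0 ?addr0 ?add0r mulNr mulrC.
by rewrite !periodic_int.
Qed.

Lemma CP_bounded f : CP f -> exists2 M, 0 < M & forall x, `|f x| <= M.
Proof.
move=> [cf pf].
have : bounded_set (f @` box).
  by apply: compact_bounded; apply: continuous_compact; [exact: continuous_subspaceT|exact: compact_box].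
move=> [M [_ HM]]; exists (`|M| + 1) => [|x]; first by rewrite ltr_wpDl.
rewrite -(tobox_per x pf); apply: (HM (`|M| + 1)); first by rewrite (le_lt_trans (ler_norm _))// ltrDl.
by exists (tobox x) => //; exact: tobox_in.
Qed.

(** Tube lemma: continuity at [t0] is uniform in [x] because a period cell is compact. *)
Lemma tube (h : point R * R -> R) t0 (e : R) : continuous h ->
  (forall t, torus_periodic (fun x => h (x, t))) -> 0 < e ->
  \forall t \near t0, forall x, `|h (x, t) - h (x, t0)| < e.
Proof.
move=> ch ph e0.
have : \forall t \near t0, box `<=` (fun x => `|h (x, t) - h (x, t0)| < e).
  apply: (proj1 (compact_near_coveringP _) compact_box R (nbhs t0) (fun t x => `|h (x, t) - h (x, t0)| < e)) => x _.
  have h2 : 0 < e / 2 by rewrite divr_gt0.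
  have /cvgrPdist_lt/(_ _ h2)[[/= A B] [nA nB] AB] := ch (x, t0).
  exists (A, B) => //= -[y t] [/= Ay Bt].
  have := AB (y, t); have := AB (y, t0); rewrite /= => /(_ (conj Ay (nbhs_singleton nB))) a1 /(_ (conj Ay Bt)) a2.
  have := ler_distD (h (x, t0)) (h (y, t)) (h (y, t0)).
  rewrite [`|h (y, t) - h (x, t0)|]distrC; move: (`|_|) (`|_|) (`|_|) a1 a2 => a b c; lra.
apply: filterS => t ht x.
have := ht _ (tobox_in x).
by rewrite (tobox_per x (ph t)) (tobox_per x (ph t0)).
Qed.


Lemma CP_cst (c : R) : CP (fun=> c).
Proof. by split => [x|j x]; [exact: cst_continuous|]. Qed.

Lemma CPD f g : CP f -> CP g -> CP (fun x => f x + g x).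
Proof.
move=> [cf pf] [cg pg]; split => [x|j x]; first exact: (cvgD (cf x) (cg x)).
by rewrite pf pg.
Qed.

Lemma CPM f g : CP f -> CP g -> CP (fun x => f x * g x).
Proof.
move=> [cf pf] [cg pg]; split => [x|j x]; first exact: (cvgM (cf x) (cg x)).
by rewrite pf pg.
Qed.

Lemma CPZ c f : CP f -> CP (fun x => c * f x).
Proof. by apply: CPM; exact: CP_cst. Qed.

Lemma CPN f : CP f -> CP (fun x => - f x).
Proof. by move=> /(CPZ (-1)); congr CP; apply/funext => x; rewrite mulN1r. Qed.

Lemma CPB f g : CP f -> CP g -> CP (fun x => f x - g x).
Proof. by move=> hf /CPN; exact: CPD. Qed.

Lemma CP_norm f : CP f -> CP (fun x => `|f x|).
Proof.
move=> [cf pf]; split => [x|j x]; last by rewrite pf.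
exact: (cvg_norm (cf x)).
Qed.

Lemma CP_shift f z : CP f -> CP (fun x => f (x + z)).
Proof.
move=> [cf pf]; split => [x|j x]; last by rewrite addrAC pf.
apply: (@cvg_comp _ _ _ (fun x => x + z) f _ (nbhs (x + z))); [exact: (cvgD cvg_id (cvg_cst z))|exact: cf].
Qed.

Lemma CP_sum (I : Type) (r : seq I) (P : pred I) (F : I -> point R -> R) :
  (forall i, CP (F i)) -> CP (fun x => \sum_(i <- r | P i) F i x).
Proof.
move=> h; elim: r => [|i r IH].
  by rewrite (_ : (fun _ => _) = fun=> 0); [exact: CP_cst|apply/funext => x; rewrite big_nil].
rewrite (_ : (fun _ => _) = fun x => (if P i then F i x else 0) + \sum_(j <- r | P j) F j x).
  by apply: CPD => //; case: (P i) => //; exact: CP_cst.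
by apply/funext => x; rewrite big_cons; case: (P i) => //; rewrite add0r.
Qed.

Lemma CP_exp f n : CP f -> CP (fun x => f x ^+ n).
Proof.
move=> hf; elim: n => [|n IH].
  by rewrite (_ : (fun _ => _) = fun=> 1); [exact: CP_cst|apply/funext => x; rewrite expr0].
rewrite (_ : (fun _ => _) = fun x => f x * f x ^+ n); first exact: CPM.
by apply/funext => x; rewrite exprS.
Qed.

Notation mu := (@torus_measure R).

Lemma circleT : @circle_measure R [set: mR] = tpi%:E.
Proof.
rewrite /circle_measure /mfrestr /mrestr setTI /period lebesgue_measure_itv/= lte_fin twopi_gt0.
by rewrite -EFinB subr0.
Qed.

Lemma muT : mu [set: mT] = (tpi ^+ 3)%:E.
Proof.
rewrite (_ : [set: mT] = ([set: mR] `*` [set: mR]) `*` [set: mR]); last by rewrite !setXTT.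
rewrite /torus_measure product_measure1E//; last exact: measurableX.
rewrite [X in (X * _)%E]product_measure1E//.
by rewrite [X in (X * _)%E](congr2 *%E circleT circleT) [X in (_ * X)%E]circleT -!EFinM !exprS expr0 mulr1 mulrA.
Qed.

Lemma CP_integrable f : CP f -> mu.-integrable [set: mT] (fun p : mT => (f (row3 p))%:E).
Proof.
move=> cf; have [M M0 hM] := CP_bounded cf.
apply: measurable_bounded_integrable => //; [by rewrite [X in (X < _)%E]muT ltry| |].
- exact: (measurable_row3 cf.1).
- by exists M; split; [exact: num_real|move=> N MN p _; exact: le_trans (hM _) (ltW MN)].
Qed.

Lemma tiD f g : CP f -> CP g -> (\oint x, f x + g x) = torus_int f + torus_int g.
Proof. by move=> hf hg; rewrite /torus_int RintegralD//; exact: CP_integrable. Qed.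

Lemma tiZ c f : CP f -> (\oint x, c * f x) = c * torus_int f.
Proof. by move=> hf; rewrite /torus_int RintegralZl//; exact: CP_integrable. Qed.

Lemma tiB f g : CP f -> CP g -> (\oint x, f x - g x) = torus_int f - torus_int g.
Proof. by move=> hf hg; rewrite /torus_int RintegralB//; exact: CP_integrable. Qed.

Lemma ti_cst c : torus_int (fun _ : point R => c) = c * tpi ^+ 3.
Proof. rewrite /torus_int Rintegral_cst//; congr (_ * _).
by rewrite [X in fine X]muT. Qed.

Lemma ti_sum (I : Type) (r : seq I) (P : pred I) (F : I -> point R -> R) :
  (forall i, CP (F i)) ->
  (\oint x, \sum_(i <- r | P i) F i x) = \sum_(i <- r | P i) torus_int (F i).
Proof.
move=> h; elim: r => [|i r IH].
  by rewrite big_nil -[RHS](mul0r (tpi ^+ 3)) -ti_cst; congr torus_int; apply/funext => x; rewrite big_nil.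
rewrite big_cons -IH; case: ifPn => Pi.
  rewrite -tiD//; last exact: CP_sum.
  by congr torus_int; apply/funext => x; rewrite big_cons Pi.
by congr torus_int; apply/funext => x; rewrite big_cons (negbTE Pi).
Qed.

Lemma ti_ge0 f : (forall x, 0 <= f x) -> 0 <= torus_int f.
Proof. by move=> f0; apply: Rintegral_ge0. Qed.

Lemma ti_le f g : CP f -> CP g -> (forall x, f x <= g x) -> torus_int f <= torus_int g.
Proof. by move=> hf hg fg; apply: le_Rintegral => //; exact: CP_integrable. Qed.

Lemma ti_norm f : CP f -> `|torus_int f| <= (\oint x, `|f x|).
Proof. by move=> hf; apply: le_normr_Rintegral => //; exact: CP_integrable. Qed.


Let per1 (h : R -> R) := forall x, h (x + tpi) = h x.

(** The primitive is based at [-1], so that all points of [[0, tpi]], the left end included, are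
    interior and have two-sided derivatives. *)
Lemma primitive_ge0 (h : R -> R) : continuous h ->
  exists F : R -> R, forall x : R, -1 < x -> is_derive x (1 : R) F (h x).
Proof.
move=> ch; exists (fun x => \int[lebesgue_measure]_(t in [set` Interval (BLeft (-1)) (BRight x)]) h t) => x x1.
have i1 : lebesgue_measure.-integrable [set` Interval (BLeft (-1)) (BRight (x + 1))] (EFin \o h).
  apply: continuous_compact_integrable; first exact: segment_compact.
  exact: continuous_subspaceT.
have xx : x < x + 1 by rewrite ltrDl.
have := continuous_FTC1 xx i1; rewrite /= lte_fin => /(_ x1 (ch x)) [d e].
by rewrite -e derive1E; exact: DeriveDef.
Qed.

Lemma FTC2_shift (h F : R -> R) (z : R) : continuous h -> 0 <= z ->
  (forall x : R, -1 < x -> is_derive x (1 : R) F (h x)) ->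
  \int[lebesgue_measure]_(x in `[0, tpi]) h (x + z) = F (tpi + z) - F z.
Proof.
move=> ch z0 dF; have dG (x : R) : -1 < x -> is_derive x (1 : R) (fun y => F (y + z)) (h (x + z)).
  move=> x1; have dF' : is_derive (x + z) (1 : R) F (h (x + z)) by apply: dF; rewrite ltr_wpDr.
  have := @is_derive1_comp R F (fun y => y + z) x (h (x + z)) 1 dF'.
  by rewrite mulr1; apply; rewrite -[X in is_derive _ _ _ X]addr0; apply: is_deriveD.
have cG (x : R) : -1 < x -> {for x, continuous (fun y => F (y + z))}.
  by move=> x1; apply: differentiable_continuous; apply/derivable1_diffP; have [] := dG _ x1.
rewrite /Rintegral (@continuous_FTC2 _ _ (fun y => F (y + z)) 0 tpi) ?twopi_gt0//=.
- by rewrite add0r.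
- apply: continuous_subspaceT => x.
  by apply: (@cvg_comp _ _ _ (fun x => x + z) h _ (nbhs (x + z))); [exact: (cvgD cvg_id (cvg_cst z))|exact: ch].
- split => [x|x|].
  + by rewrite in_itv/= => /andP[x0 _]; have [] := dG x (lt_trans (ltrN10 R) x0).
  + by apply: cvg_at_right_filter; apply: cG.
  + by apply: cvg_at_left_filter; apply: cG; rewrite (lt_trans (ltrN10 R))// twopi_gt0.
- by move=> x; rewrite in_itv/= => /andP[x0 _]; rewrite derive1E; have [_ ->] := dG x (lt_trans (ltrN10 R) x0).
Qed.

(** With a primitive [F], the shifted integral is [F (tpi + z) - F z]. Its derivative in [z]
    vanishes by periodicity, and the mean value theorem compares it with [z = 0]. *)
Lemma Rint_period_ge0 (h : R -> R) (z : R) : continuous h -> per1 h -> 0 <= z ->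
  \int[lebesgue_measure]_(x in `[0, tpi]) h (x + z) = \int[lebesgue_measure]_(x in `[0, tpi]) h x.
Proof.
move=> ch ph z0; have [F dF] := primitive_ge0 ch.
have := FTC2_shift ch (lexx 0) dF; under eq_Rintegral do rewrite addr0; move=> ->.
rewrite (FTC2_shift ch z0 dF).
pose G (y : R) := F (tpi + y) - F y.
have dG (x : R) : -1 < x -> is_derive x (1 : R) G 0.
  move=> x1; rewrite -(subrr (h x)); apply: is_deriveB; last exact: dF.
  have dF' : is_derive (tpi + x) (1 : R) F (h (tpi + x)).
    by apply: dF; rewrite (lt_trans x1)// ltrDr twopi_gt0.
  have := @is_derive1_comp R F (fun y => tpi + y) x _ 1 dF'.
  rewrite mulr1 addrC ph; apply.
  by rewrite -[X in is_derive _ _ _ X]add0r; apply: is_deriveD.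
have cG (x : R) : -1 < x -> {for x, continuous G}.
  by move=> x1; apply: differentiable_continuous; apply/derivable1_diffP; have [] := dG _ x1.
have [->//|zN0] := eqVneq z 0.
have zp : 0 < z by rewrite lt_neqAle eq_sym zN0.
have [||x _ /eqP] := @MVT R G (fun=> 0) 0 z zp.
- by move=> x; rewrite in_itv/= => /andP[x0 _]; apply: dG; exact: lt_trans (ltrN10 R) x0.
- apply: continuous_in_subspaceT => x; rewrite inE/= in_itv/= => /andP[x0 _].
  by apply: cG; exact: lt_le_trans (ltrN10 R) x0.
by rewrite mul0r subr_eq0 => /eqP; rewrite /G addr0.
Qed.

Lemma Rint_period (h : R -> R) (z : R) : continuous h -> per1 h ->
  \int[lebesgue_measure]_(x in `[0, tpi]) h (x + z) = \int[lebesgue_measure]_(x in `[0, tpi]) h x.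
Proof.
move=> ch ph; have /andP[z0 _] := mod2pi_itv z.
rewrite -(Rint_period_ge0 ch ph z0); apply: eq_Rintegral => x _.
have hn (n : nat) y : h (y + tpi * n%:R) = h y.
  by elim: n => [|n IH]; rewrite ?mulr0 ?addr0// -natr1 mulrDr mulr1 addrA ph IH.
rewrite /mod2pi addrA; case: (Num.floor _) => n.
  by rewrite -pmulrn -[RHS](hn n) subrK.
by rewrite NegzE mulrNz mulrN opprK -pmulrn hn.
Qed.

Lemma per1_bounded (h : R -> R) : continuous h -> per1 h -> exists2 M, 0 < M & forall x, `|h x| <= M.
Proof.
move=> ch ph; have : CP (fun x : point R => h (x 0 0)).
  split=> [x|j x]; last first.
    rewrite !mxE eqxx.
    by move: (j) => [] [|[|[|//]]] hj; rewrite ?eqE/= ?mulr1 ?mulr0 ?addr0 ?ph.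
  by apply: (@cvg_comp _ _ _ (fun x : point R => x 0 0) h _ (nbhs (x 0 0))); [exact: coord_continuous|exact: ch].
move=> /CP_bounded[M M0 hM]; exists M => // x.
by have := hM (const_mx x); rewrite mxE.
Qed.

Notation cm := (@circle_measure R).

Lemma circle_int (h : R -> R) : continuous h -> per1 h ->
  (\int[cm]_x (h x)%:E)%E = (\int[lebesgue_measure]_(x in `[0, tpi]) h x)%:E.
Proof.
move=> ch ph; have [M M0 hM] := per1_bounded ch ph.
have mh : measurable_fun setT (h : mR -> R) by exact: measurable_realfun.continuous_measurable_fun.
have hi : (cm).-integrable setT (EFin \o (h : mR -> R)).
  apply: measurable_bounded_integrable => //; first by rewrite [X in (X < _)%E]circleT ltry.
  by exists M; split; [exact: num_real|move=> N MN p _; exact: le_trans (hM _) (ltW MN)].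
rewrite (@negligible_integral _ _ _ cm setT (~` (@period R)))//; last first.
- suff : lebesgue_measure (~` @period R `&` @period R) = 0%E by [].
  by rewrite setICl measure0.
- by apply: measurableC; exact: measurable_period.
rewrite setTD setCK /Rintegral fineK; last first.
  apply: integrable_fin_num => //; apply: continuous_compact_integrable; first exact: segment_compact.
  exact: continuous_subspaceT.
apply: eq_measure_integral => A mA AD.
by rewrite /circle_measure /= /mfrestr /mrestr setIidl.
Qed.


Lemma continuous_row3 (x y z : R) (i : 'I_3) : continuous (fun r : R => row3 (
  if i == 0 then (r, y, z) else if i == 1 then (x, r, z) else (x, y, r)) : point R).
Proof.
move=> r; apply/cvg_ballP => e e0.
have : \forall s \near r, ball r e s by exact: nbhsx_ballx.
apply: filterS => s hs; split=> // i' j; rewrite !mxE.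
by case: (i == 0) => /=; [|case: (i == 1) => /=]; case: ifP => _ //; try exact: ballxx; case: ifP => _ //; exact: ballxx.
Qed.

Lemma CP_coord f (x y z : R) (i : 'I_3) : CP f -> let h := (fun r : R => f (row3 (
  if i == 0 then (r, y, z) else if i == 1 then (x, r, z) else (x, y, r)))) in
  continuous h /\ per1 h.
Proof.
move=> [cf pf] h; split.
  move=> r; apply: (@cvg_comp _ _ _ (fun r : R => row3 (
  if i == 0 then (r, y, z) else if i == 1 then (x, r, z) else (x, y, r)) : point R) f _ (nbhs (row3 (
  if i == 0 then (r, y, z) else if i == 1 then (x, r, z) else (x, y, r))))); [exact: continuous_row3|exact: cf].
move=> r; rewrite /h -[RHS](pf i); congr f; apply/rowP => j; rewrite !mxE eqxx.
by case: (ord3P i); case: (ord3P j); rewrite ?eqxx ?ordE /= ?mulr1 ?mulr0 ?addr0.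
Qed.

Lemma circle_shift f (x y z w : R) (i : 'I_3) : CP f ->
  (\int[cm]_r (f (row3 (if i == 0 then (r, y, z) else if i == 1 then (x, r, z) else (x, y, r)) + w *: basis R i))%:E)%E =
  (\int[cm]_r (f (row3 (if i == 0 then (r, y, z) else if i == 1 then (x, r, z) else (x, y, r))))%:E)%E.
Proof.
move=> cf; have [ch ph] := CP_coord x y z i cf.
move: ch ph; set h := (fun r : R => _) => ch ph.
have ch' : continuous (fun r : R => h (r + w)).
  by move=> r; apply: (@cvg_comp R R R (fun x => x + w) h _ (nbhs (r + w))); [exact: (cvgD cvg_id (cvg_cst w))|exact: ch].
have ph' : per1 (fun r : R => h (r + w)) by move=> r; rewrite addrAC ph.
rewrite (circle_int ch ph) -(Rint_period w ch ph) -(circle_int ch' ph').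
apply: eq_integral => r _; congr ((f _)%:E); apply/rowP => j; rewrite !mxE eqxx.
by case: (ord3P i); case: (ord3P j); rewrite ?eqxx ?ordE /= ?mulr1 ?mulr0 ?addr0.
Qed.

Lemma ti_shift1 f (w : R) i : CP f -> (\oint x, f (x + w *: basis R i)) = torus_int f.
Proof.
move=> cf; have cfw := CP_shift (w *: basis R i) cf.
have [M M0 bf] := CP_bounded cf.
have bw p : `|f (row3 p + w *: basis R i)| <= M by [].
have mf := measurable_row3 cf.1; have mw := measurable_row3 cfw.1.
rewrite /torus_int /Rintegral; congr fine.
(* Copies of the circle measure and of its square, for which the three-fold Fubini lemmas are
   stated. *)
have [cs csE] : exists cs : {sigma_finite_measure set mR -> \bar R}, forall A, cs A = cm A.
  by exists cm.
have csT : cs setT = tpi%:E by rewrite csE circleT.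
have cT : cs setT \is a fin_num by rewrite csT.
have [|c2 c2E] := @sigma_finite_copy _ _ R (cs \x cs)%E; first exact: prodT_lty.
have mE A : measurable A -> mu A = (c2 \x cs)%E A.
  move=> mA; apply: product_measure1_ext => // B mB; rewrite [RHS]c2E//.
  by apply: product_measure1_ext => // C mC; exact/esym/csE.
have ics (h : mR -> \bar R) : (\int[cs]_x h x = \int[cm]_x h x)%E.
  by apply: eq_measure_integral => A mA _; exact: csE.
have c2E' A : measurable A -> c2 A = (cs \x cs)%E A by rewrite c2E.
case: (ord3P i) mw bw => mw bw.
- by apply: (eq_integral_prod3_1 cT c2E' mE mw mf bw (fun p => bf _)) => y z; rewrite !ics; exact: (circle_shift 0 y z w 0 cf).
- by apply: (eq_integral_prod3_2 cT c2E' mE mw mf bw (fun p => bf _)) => x z; rewrite !ics; exact: (circle_shift x 0 z w 1 cf).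
- by apply: (eq_integral_prod3_3 cT c2E' mE mw mf bw (fun p => bf _)) => x y; rewrite !ics; exact: (circle_shift x y 0 w 2%:R cf).
Qed.

Lemma ti_shift f z : CP f -> (\oint x, f (x + z)) = torus_int f.
Proof.
move=> cf; rewrite -[RHS](ti_shift1 (z 0 0) 0 cf).
have c1 := CP_shift (z 0 0 *: basis R 0) cf.
rewrite -[RHS](ti_shift1 (z 0 1) 1 c1).
have c2 := CP_shift (z 0 1 *: basis R 1) c1.
rewrite -[RHS](ti_shift1 (z 0 2%:R) 2%:R c2).
by congr torus_int; apply/funext => x; congr f; rewrite [in LHS](rowE3 z) -!addrA; congr (_ + _); rewrite addrA addrC; congr (_ + _); rewrite addrC.
Qed.

Lemma eq_ti g f : f =1 g -> torus_int f = torus_int g.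
Proof. by move=> /funext ->. Qed.

Lemma ti_eq0 f : f =1 (fun=> 0) -> torus_int f = 0.
Proof. by move=> /funext ->; rewrite ti_cst mul0r. Qed.

Lemma tiN f : CP f -> (\oint x, - f x) = - torus_int f.
Proof.
by move=> cf; rewrite -[RHS]mulN1r -tiZ//; apply: eq_ti => x; rewrite mulN1r.
Qed.

Lemma ti_abs_le f (M : R) : CP f -> (forall x, `|f x| <= M) -> `|torus_int f| <= M * tpi ^+ 3.
Proof.
move=> cf hM; rewrite (le_trans (ti_norm cf))// -ti_cst; apply: ti_le => //.
  exact: CP_norm.
exact: CP_cst.
Qed.

Lemma sq_add (a b : R) : (a + b) ^+ 2 <= 2 * a ^+ 2 + 2 * b ^+ 2.
Proof. by have := sqr_ge0 (a - b); rewrite !expr2; nra. Qed.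

Lemma le_of_eq (x y : R) : x = y -> x <= y.
Proof. by move=> ->. Qed.

(** The limit of the iteration is only square integrable in space, outside the class [CP] of
    continuous periodic functions; [MI] and [S2] are the classes in which it is handled. *)
Definition MI f := mu.-integrable [set: mT] (fun p : mT => (f (row3 p))%:E).
Definition S2 f := measurable_fun [set: mT] (fun p : mT => f (row3 p)) /\ MI (fun x => f x ^+ 2).

Lemma CP_MI f : CP f -> MI f. Proof. exact: CP_integrable. Qed.

Lemma CP_S2 f : CP f -> S2 f.
Proof. by move=> cf; split; [exact: measurable_row3 cf.1|apply: CP_MI; exact: CP_exp]. Qed.

Lemma miD f g : MI f -> MI g -> MI (fun x => f x + g x).
Proof.
move=> hf hg; rewrite /MI; under eq_fun do rewrite EFinD.
exact: (integrableD measurableT hf hg).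
Qed.

Lemma miZ (c : R) f : MI f -> MI (fun x => c * f x).
Proof.
move=> hf; rewrite /MI; under eq_fun do rewrite EFinM.
exact: (integrableZl measurableT c hf).
Qed.

Lemma mi_le f g : measurable_fun [set: mT] (fun p : mT => f (row3 p)) -> (forall x, `|f x| <= g x) -> MI g -> MI f.
Proof.
move=> mf fg; apply: le_integrable => //; first exact/measurable_EFinP.
by move=> p _; rewrite lee_fin (le_trans (fg _))// ler_norm.
Qed.

Lemma s2M f g : S2 f -> S2 g -> MI (fun x => f x * g x).
Proof.
move=> [mf hf] [mg hg]; apply: mi_le (miD hf hg); first exact: measurable_funM.
move=> x; have := sqr_ge0 (f x + g x); have := sqr_ge0 (f x - g x).
have := sqr_ge0 (f x); have := sqr_ge0 (g x) => h1 h2 h3 h4.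
rewrite ler_norml; apply/andP; split; nra.
Qed.

Lemma s2D f g : S2 f -> S2 g -> S2 (fun x => f x + g x).
Proof.
move=> [mf hf] [mg hg]; have mfg := measurable_funD mf mg; split=> //.
apply: mi_le (miD (miZ 2 hf) (miZ 2 hg)); first exact: measurable_funX.
by move=> x; rewrite ger0_norm ?sqr_ge0//; exact: sq_add.
Qed.

Lemma s2Z (c : R) f : S2 f -> S2 (fun x => c * f x).
Proof.
move=> [mf hf]; split; first exact: measurable_funM.
by have := miZ (c ^+ 2) hf; congr MI; apply/funext => x; rewrite exprMn.
Qed.

Lemma s2B f g : S2 f -> S2 g -> S2 (fun x => f x - g x).
Proof.
move=> hf hg; have := s2D hf (s2Z (-1) hg).
by congr S2; apply/funext => x; rewrite mulN1r.
Qed.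

Lemma s2_mi f : S2 f -> MI f.
Proof.
move=> hf; have := s2M hf (CP_S2 (CP_cst (1 : R))).
by congr MI; apply/funext => x; rewrite mulr1.
Qed.

Lemma mti_D f g : MI f -> MI g -> (\oint x, f x + g x) = torus_int f + torus_int g.
Proof. by move=> hf hg; rewrite /torus_int RintegralD. Qed.

Lemma mti_Z c f : MI f -> (\oint x, c * f x) = c * torus_int f.
Proof. by move=> hf; rewrite /torus_int RintegralZl. Qed.

Lemma mti_B f g : MI f -> MI g -> (\oint x, f x - g x) = torus_int f - torus_int g.
Proof. by move=> hf hg; rewrite /torus_int RintegralB. Qed.

Lemma mti_le f g : MI f -> MI g -> (forall x, f x <= g x) -> torus_int f <= torus_int g.
Proof. by move=> hf hg fg; apply: le_Rintegral. Qed.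

(** Discriminant argument: [s ^ 2 A + 2 s r B + r ^ 2 C] is nonnegative for all [s] and [r], being
    the integral of a square. *)
Lemma ti_CS f g : S2 f -> S2 g ->
  (\oint x, f x * g x) ^+ 2 <= (\oint x, f x ^+ 2) * (\oint x, g x ^+ 2).
Proof.
move=> cf cg.
set A := (\oint x, f x ^+ 2); set B := (\oint x, f x * g x); set C := (\oint x, g x ^+ 2).
have cf2 := cf.2; have cg2 := cg.2; have cfg := s2M cf cg.
have q (s r : R) : 0 <= s ^+ 2 * A + 2 * s * r * B + r ^+ 2 * C.
  rewrite /A /B /C -!mti_Z// -mti_D; [|exact: miZ|exact: miZ].
  rewrite -mti_D; [|by apply: miD; exact: miZ|exact: miZ].
  apply: ti_ge0 => x; rewrite (_ : _ + _ = (s * f x + r * g x) ^+ 2) ?sqr_ge0//; ring.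
have A0 : 0 <= A by apply: ti_ge0 => x; exact: sqr_ge0.
have C0 : 0 <= C by apply: ti_ge0 => x; exact: sqr_ge0.
have [Cp|Cn] := ltP 0 C.
  have := q C (- B); nra.
have C00 : C = 0 by apply/le_anti; rewrite Cn C0.
have [->|Bn] := eqVneq B 0; first by rewrite expr0n/= mulr_ge0.
(* When [C = 0] the form is affine in [r]; this [r] would give it the value [-1] if [B] were
   nonzero. *)
have := q 1 (- (A + 1) / (2 * B)); rewrite C00 mulr0 addr0 expr1n mul1r mulr1 => h.
suff h2 : 0 <= A - (A + 1) by exfalso; lra.
by move: h; rewrite (_ : 2 * (- (A + 1) / (2 * B)) * B = - (A + 1))//; field.
Qed.

Lemma continuous_fst_t (h : point R * R -> R) t : continuous h -> continuous (fun x => h (x, t)).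
Proof.
move=> ch x; apply: (@cvg_comp _ _ _ (fun x => (x, t)) h (nbhs x) (nbhs (x, t))); last exact: ch.
exact: (cvg_pair cvg_id (cvg_cst t)).
Qed.

Lemma ti_continuous (h : point R * R -> R) : continuous h ->
  (forall t, torus_periodic (fun x => h (x, t))) -> continuous (fun t => (\oint x, h (x, t))).
Proof.
move=> ch ph t0; have P3 : 0 < tpi ^+ 3 :> R by rewrite exprn_gt0// twopi_gt0.
have ct t : CP (fun x => h (x, t)) by split; [exact: continuous_fst_t|exact: ph].
apply/cvgrPdist_le => e e0.
have e1 : 0 < e / tpi ^+ 3 by rewrite divr_gt0.
apply: filterS (tube t0 ch ph e1) => t ht.
rewrite -tiB//; apply: le_trans (ti_abs_le (M := e / tpi ^+ 3) _ _) _.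
- exact: CPB.
- by move=> x; rewrite distrC ltW.
- by rewrite divfK// gt_eqF.
Qed.

(* If [g] is the derivative of the periodic function [f] in the direction [e],
   difference quotients of [f] have zero integral and converge uniformly to [g]. *)
Lemma ti_deriv0 f g (e : point R) : CP f -> CP g ->
  (forall x (s : R), is_derive s (1 : R) (fun s : R => f (x + s *: e)) (g (x + s *: e))) -> torus_int g = 0.
Proof.
move=> cf cg dfg; apply/eqP; rewrite -normr_le0; apply/ler_addgt0Pr => eps eps0; rewrite add0r.
have P3 : 0 < tpi ^+ 3 :> R by rewrite exprn_gt0// twopi_gt0.
pose h (z : point R * R) := g (z.1 + z.2 *: e).
have ch : continuous h.
  move=> z; apply: (@cvg_comp _ _ _ (fun z : point R * R => z.1 + z.2 *: e) g _ (nbhs (z.1 + z.2 *: e))); last exact: cg.1.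
  apply: cvgD; first exact: cvg_fst.
  by apply: cvgZr_tmp; exact: cvg_snd.
have ph t : torus_periodic (fun x => h (x, t)) by case: (CP_shift (t *: e) cg).
have e1 : 0 < eps / tpi ^+ 3 by rewrite divr_gt0.
have [d /= d0 hd] := tube 0 ch ph e1.
pose s := d / 2; have s0 : 0 < s by rewrite divr_gt0.
have sd : s < d by rewrite ltr_pdivrMr// ltr_pMr// ltr1n.
have cq : CP (fun x => s^-1 * (f (x + s *: e) - f x)) by apply: CPZ; apply: CPB => //; exact: CP_shift.
have q0 : (\oint x, s^-1 * (f (x + s *: e) - f x)) = 0.
  rewrite tiZ; last by apply: CPB => //; exact: CP_shift.
  by rewrite tiB ?ti_shift ?subrr ?mulr0//; exact: CP_shift.
rewrite -[torus_int g]subr0 -q0 -tiB//.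
apply: le_trans (ti_abs_le (M := eps / tpi ^+ 3) _ _) _.
- exact: CPB.
- move=> x.
  have [|c cin hc] := @MVT R (fun r : R => f (x + r *: e)) (fun r => g (x + r *: e)) 0 s s0 (fun r _ => dfg x r).
    apply: continuous_subspaceT => r; apply: differentiable_continuous; apply/derivable1_diffP.
    by have [] := dfg x r.
  move: hc; rewrite scale0r addr0 subr0 => ->; rewrite mulrC mulfK ?gt_eqF// distrC.
  have /(_ c)/= := hd; rewrite sub0r normrN.
  move: cin; rewrite in_itv/= => /andP[c0 cs] /(_ _ x).
  by rewrite /h/= scale0r addr0 => /(_ _)/ltW; apply; rewrite gtr0_norm// (lt_trans cs).
- by rewrite divfK// gt_eqF.
Qed.

(** * Time integrals of compactly supported functions *)

Definition supp (c d : R) (k : R -> R) := continuous k /\ forall t, t \notin `[c, d] -> k t = 0.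

Section Supp.
Variables c d : R.
Implicit Types k : R -> R.
Notation lm := (@lebesgue_measure R).

Lemma supp_integrable_itv k : supp c d k -> lm.-integrable `[c, d] (EFin \o k).
Proof.
move=> [ck _]; apply: continuous_compact_integrable; first exact: segment_compact.
exact: continuous_subspaceT.
Qed.

Lemma supp_restrict k : supp c d k -> k = (k \_ `[c, d]).
Proof.
by move=> [_ k0]; apply/funext => t; rewrite patchE mem_setE; case: ifPn => // /k0.
Qed.

Lemma supp_integrable k : supp c d k -> lm.-integrable setT (EFin \o k).
Proof.
move=> sk; rewrite (supp_restrict sk) -restrict_EFin.
by rewrite -integrable_mkcond//; exact: supp_integrable_itv.
Qed.

Lemma supp_int_itv k : supp c d k -> \int[lm]_t k t = \int[lm]_(t in `[c, d]) k t.
Proof. by move=> sk; rewrite [RHS]Rintegral_mkcond -supp_restrict. Qed.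

Lemma supp_bound k (M : R) : supp c d k -> c <= d -> (forall t, `|k t| <= M) -> `|\int[lm]_t k t| <= M * (d - c).
Proof.
move=> sk cd hM; rewrite (supp_int_itv sk).
have ik := supp_integrable_itv sk.
apply: le_trans (le_normr_Rintegral _ ik) _ => //.
have mE : fine (lm `[c, d]) = d - c.
  by rewrite lebesgue_measure_itv/= lte_fin; case: ltP => //= dc; apply/eqP; rewrite eq_sym subr_eq0 eq_le dc cd.
rewrite -mE -Rintegral_cst//; apply: le_Rintegral => //.
- exact: integrable_norm.
- apply: continuous_compact_integrable; first exact: segment_compact.
  by apply: continuous_subspaceT => x; exact: cvg_cst.
Qed.

End Supp.

Lemma supp_deriv0 (c d : R) (k K : R -> R) : supp c d k -> supp c d K -> c <= d -> (forall t : R, is_derive t (1 : R) K (k t)) ->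
  \int[@lebesgue_measure R]_t k t = 0.
Proof.
move=> [ck k0] [cK K0] cd dK.
(* On the enlarged interval the primitive [K] vanishes at both ends. *)
have sk' : supp (c - 1) (d + 1) k.
  split=> // t; rewrite in_itv/= => h; apply: k0; rewrite in_itv/=; apply: contra h => /andP[h1 h2].
  by apply/andP; split; lra.
rewrite (supp_int_itv sk') /Rintegral (@continuous_FTC2 _ _ K)/=.
- by rewrite !K0 ?subrr// in_itv/=; apply/negP => /andP[]; lra.
- lra.
- exact: continuous_subspaceT.
- split => [x _|x|].
  + by have [] := dK x.
  + by apply: cvg_at_right_filter; apply: cK.
  + by apply: cvg_at_left_filter; apply: cK.
- by move=> x _; rewrite derive1E; have [_ ->] := dK x.
Qed.

End TorusInt.
Arguments eq_ti {R} g {f}.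

(** * Trigonometric polynomials *)

Notation ivec := 'rV[int]_3.
Notation ee i := (delta_mx 0 i : ivec).

Section TrigPoly.
Variable R : realType.
Notation pt := (point R).

(** The mode [amp * cos (wv . x + om * t + ph)]. The phase makes sines and all derivatives cosines
    again. Integer wave vectors give periodicity in space; none is needed in time, so [om] is
    real. *)
Record mono := Mono {amp : R; wv : ivec; om : R; ph : R}.
Notation tp := (seq mono).
Implicit Types (F G H : tp) (t s c : R) (x : pt) (m : mono) (e : ivec).

Definition rv (k : ivec) : pt := map_mx intr k.

Definition kd (k e : ivec) : R := dot (rv k) (rv e).

Lemma dotC (a b : pt) : dot a b = dot b a.
Proof. by apply: eq_bigr => i _; rewrite mulrC. Qed.

Lemma dotDr (a b c : pt) : dot a (b + c) = dot a b + dot a c.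
Proof. by rewrite /dot -big_split; apply: eq_bigr => i _; rewrite mxE mulrDr. Qed.

Lemma dotDl (a b c : pt) : dot (a + b) c = dot a c + dot b c.
Proof. by rewrite !(dotC _ c) dotDr. Qed.

Lemma dotZr (r : R) (a b : pt) : dot a (r *: b) = r * dot a b.
Proof. by rewrite /dot big_distrr/=; apply: eq_bigr => i _; rewrite mxE mulrCA. Qed.

Lemma dotZl (r : R) (a b : pt) : dot (r *: a) b = r * dot a b.
Proof. by rewrite !(dotC _ b) dotZr. Qed.

Lemma dotNr (a b : pt) : dot a (- b) = - dot a b.
Proof. by rewrite -scaleN1r dotZr mulN1r. Qed.

Lemma dotNl (a b : pt) : dot (- a) b = - dot a b.
Proof. by rewrite !(dotC _ b) dotNr. Qed.

Lemma dot0r (a : pt) : dot a 0 = 0.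
Proof. by rewrite -(scale0r 0) dotZr mul0r. Qed.

Lemma dot0l (a : pt) : dot 0 a = 0.
Proof. by rewrite dotC dot0r. Qed.

Lemma dot3 (a b : pt) : dot a b = a 0 0 * b 0 0 + a 0 1 * b 0 1 + a 0 2%:R * b 0 2%:R.
Proof.
rewrite /dot !big_ord_recl big_ord0 addr0 addrA; do 2?congr (_ + _); congr (a 0 _ * b 0 _); exact/val_inj.
Qed.

Lemma rvD (k l : ivec) : rv (k + l) = rv k + rv l.
Proof. by apply/rowP => i; rewrite !mxE intrD. Qed.

Lemma rvN (k : ivec) : rv (- k) = - rv k.
Proof. by apply/rowP => i; rewrite !mxE intrN. Qed.

Lemma rvB (k l : ivec) : rv (k - l) = rv k - rv l.
Proof. by rewrite rvD rvN. Qed.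

Lemma dotBl (a b c : pt) : dot (a - b) c = dot a c - dot b c.
Proof. by rewrite dotDl dotNl. Qed.

Lemma rv0 : rv 0 = 0.
Proof. by apply/rowP => i; rewrite !mxE. Qed.

Lemma rv_delta j : rv (delta_mx 0 j) = basis R j.
Proof. by apply/rowP => i; rewrite !mxE; case: (_ && _). Qed.

Lemma dot_ge0 (a : pt) : 0 <= dot a a.
Proof. by apply: sumr_ge0 => i _; rewrite -expr2 sqr_ge0. Qed.

Lemma dot_eq0 (a : pt) : dot a a = 0 -> a = 0.
Proof.
move=> /eqP; rewrite psumr_eq0 => [/allP h|i _]; last by rewrite -expr2 sqr_ge0.
by apply/rowP => i; have := h i (mem_index_enum _); rewrite mulf_eq0 orbb mxE => /eqP.
Qed.

Lemma kd_eq0 (k : ivec) : (kd k k == 0) = (k == 0).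
Proof.
apply/eqP/eqP => [/dot_eq0 h|->]; last by rewrite /kd rv0 dot0l.
by apply/rowP => i; move/rowP/(_ i): h; rewrite !mxE => /eqP; rewrite intr_eq0 => /eqP.
Qed.

Definition phs m t x := dot (rv (wv m)) x + om m * t + ph m.

Definition ev F t x : R := \sum_(m <- F) amp m * cos (phs m t x).

(** Fourier multiplier with a phase shift. Derivatives and antiderivatives turn the cosine by a
    quarter period, averages do not turn it, and [mop_mop] composes them all. *)
Definition mop (g : mono -> R) (sh : R) F : tp :=
  [seq Mono (amp m * g m) (wv m) (om m) (ph m + sh) | m <- F].

Lemma ev_nil t x : ev [::] t x = 0. Proof. by rewrite /ev big_nil. Qed.

Lemma ev_cons m F t x : ev (m :: F) t x = amp m * cos (phs m t x) + ev F t x.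
Proof. by rewrite /ev big_cons. Qed.

Lemma ev_cat F G t x : ev (F ++ G) t x = ev F t x + ev G t x.
Proof. by rewrite /ev big_cat. Qed.

Lemma ev_mop g sh F t x : ev (mop g sh F) t x = \sum_(m <- F) amp m * g m * cos (phs m t x + sh).
Proof. by rewrite /ev /mop big_map; apply: eq_bigr => m _; rewrite /phs/= addrA. Qed.

Lemma mop_mop g g' sh sh' F : mop g sh (mop g' sh' F) =
  mop (fun m => g' m * g (Mono (amp m * g' m) (wv m) (om m) (ph m + sh'))) (sh' + sh) F.
Proof. by rewrite /mop -map_comp; apply: eq_map => m /=; rewrite mulrA addrA. Qed.

Definition scl c F := mop (fun=> c) 0 F.

Lemma ev_scl c F t x : ev (scl c F) t x = c * ev F t x.
Proof. by rewrite ev_mop /ev big_distrr/=; apply: eq_bigr => m _; rewrite addr0 [amp m * c]mulrC mulrA. Qed.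

Definition one : tp := [:: Mono 1 0 0 0].

Lemma ev_one t x : ev one t x = 1.
Proof. by rewrite ev_cons ev_nil addr0 /phs/= rv0 dot0l mul0r !addr0 cos0 mulr1. Qed.

Definition mulm m m' : tp :=
  [:: Mono (amp m * amp m' / 2) (wv m + wv m') (om m + om m') (ph m + ph m');
      Mono (amp m * amp m' / 2) (wv m - wv m') (om m - om m') (ph m - ph m')].

Definition mul F G : tp := flatten [seq flatten [seq mulm m m' | m' <- G] | m <- F].

Lemma ev_flatten (s : seq tp) t x : ev (flatten s) t x = \sum_(F <- s) ev F t x.
Proof. by rewrite /ev big_flatten. Qed.

Lemma ev_mulm m m' t x : ev (mulm m m') t x = amp m * cos (phs m t x) * (amp m' * cos (phs m' t x)).
Proof.
rewrite /mulm !ev_cons ev_nil addr0.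
rewrite {1 2}/phs/= rvB rvD dotDl dotBl.
set u := dot (rv (wv m)) x; set u' := dot (rv (wv m')) x.
rewrite (_ : u + u' + (om m + om m') * t + (ph m + ph m') = phs m t x + phs m' t x); last by rewrite /phs -/u -/u'; ring.
rewrite (_ : u - u' + (om m - om m') * t + (ph m - ph m') = phs m t x - phs m' t x); last by rewrite /phs -/u -/u'; ring.
by rewrite cosD cosB; field.
Qed.

Lemma ev_mul F G t x : ev (mul F G) t x = ev F t x * ev G t x.
Proof.
rewrite ev_flatten big_map {2}/ev big_distrl/=; apply: eq_bigr => m _.
rewrite ev_flatten big_map {2}/ev big_distrr/=; apply: eq_bigr => m' _.
exact: ev_mulm.
Qed.

(* Differentiation in the space direction [e], or in time. *)
Definition fr (o : option ivec) m : R := if o is Some e then kd (wv m) e else om m.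

Definition D (o : option ivec) F := mop (fr o) (pi / 2) F.

Notation Dx e := (D (Some e)).
Notation Dt := (D None).

Lemma ev_D o F t x : ev (D o F) t x = \sum_(m <- F) - (amp m * fr o m * sin (phs m t x)).
Proof. by rewrite ev_mop; apply: eq_bigr => m _; rewrite cosDpihalf mulrN. Qed.

Definition shx (o : option ivec) (s : R) x : pt := if o is Some e then x + s *: rv e else x.
Definition sht (o : option ivec) (s t : R) : R := if o is Some _ then t else t + s.

Lemma phs_sh o m t x (s : R) : phs m (sht o s t) (shx o s x) = phs m t x + s * fr o m.
Proof.
case: o => [e|] /=; rewrite /phs; last by ring.
by rewrite dotDr dotZr /kd; ring.
Qed.

Lemma is_derive_ev o F t x (s : R) :
  is_derive s (1 : R) (fun s => ev F (sht o s t) (shx o s x)) (ev (D o F) (sht o s t) (shx o s x)).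
Proof.
elim: F => [|m F IH].
  rewrite ev_nil (_ : (fun _ => _) = cst 0); first exact: is_derive_cst.
  by apply/funext => r; rewrite ev_nil.
rewrite (_ : (fun _ => _) = (fun s => amp m * cos (phs m t x + s * fr o m)) + (fun s => ev F (sht o s t) (shx o s x))); last first.
  by apply/funext => r; rewrite ev_cons phs_sh.
rewrite /D /mop [map _ _]/= -/(mop _ _ _) -/(D _ _) ev_cons; apply: is_deriveD.
rewrite [X in cos X](_ : _ = phs m t x + s * fr o m + pi / 2); last by rewrite -phs_sh /phs/=; ring.
rewrite cosDpihalf /=.
have d1 : is_derive s (1 : R) (fun s => phs m t x + s * fr o m) (fr o m).
  have := @is_deriveD _ _ _ (cst (phs m t x)) (fun s => s * fr o m) s 1 0 (fr o m) _ _.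
  rewrite add0r; apply.
  have := @is_deriveM R R id (cst (fr o m)) s 1 1 0 _ _.
  by rewrite scaler0 add0r /cst/= => h; apply: is_derive_eq; rewrite /GRing.scale/= mulr1.
have := @is_deriveZ _ _ _ (fun s => cos (phs m t x + s * fr o m)) (amp m) s 1 (- sin (phs m t x + s * fr o m) * fr o m).
rewrite /GRing.scale/= => h.
have h1 : is_derive s (1 : R) (fun s => cos (phs m t x + s * fr o m)) (- sin (phs m t x + s * fr o m) * fr o m).
  exact: is_derive1_comp.
by apply: (is_derive_eq (h h1)); rewrite mulrA mulrAC.
Qed.

Lemma sh0 o t x : sht o 0 t = t /\ shx o 0 x = x.
Proof. by case: o => [e|] /=; rewrite ?scale0r addr0. Qed.

Lemma ev_D_unique o F t x d :
  is_derive 0 (1 : R) (fun s : R => ev F (sht o s t) (shx o s x)) d -> ev (D o F) t x = d.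
Proof.
move=> h; have := is_derive_ev o F t x 0; have [-> ->] := sh0 o t x => h'.
by rewrite -(@derive_val _ _ _ _ _ _ _ h) -(@derive_val _ _ _ _ _ _ _ h').
Qed.

(** Different lists may represent the same function. As [D] computes the genuine derivative, a list
    may be replaced under it by any other list with the same values. *)
Lemma ev_D_ext o F G : (forall t x, ev F t x = ev G t x) -> forall t x, ev (D o F) t x = ev (D o G) t x.
Proof.
move=> FG t x; apply: ev_D_unique.
rewrite (_ : (fun _ => _) = (fun s => ev G (sht o s t) (shx o s x))); last by apply/funext => s; rewrite FG.
by have := is_derive_ev o G t x 0; have [-> ->] := sh0 o t x.
Qed.

Lemma ev_D_mul o F G t x :
  ev (D o (mul F G)) t x = ev (D o F) t x * ev G t x + ev F t x * ev (D o G) t x.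
Proof.
apply: ev_D_unique.
rewrite (_ : (fun _ => _) = (fun s : R => ev F (sht o s t) (shx o s x)) * (fun s => ev G (sht o s t) (shx o s x))); last first.
  by apply/funext => s; rewrite ev_mul.
have := is_derive_ev o F t x 0; have := is_derive_ev o G t x 0.
have [e1 e2] := sh0 o t x; rewrite e1 e2 => hG hF.
have := is_deriveM hF hG; rewrite e1 e2 /GRing.scale/= => h; apply: is_derive_eq.
by rewrite addrC [_ * ev G t x]mulrC.
Qed.

Lemma D_cat o F G : D o (F ++ G) = D o F ++ D o G.
Proof. exact: map_cat. Qed.

Lemma mop_cat g a F G : mop g a (F ++ G) = mop g a F ++ mop g a G.
Proof. exact: map_cat. Qed.

Lemma D_mop o g a F : D o (mop g a F) = mop (fun m => g m * fr o m) (a + pi / 2) F.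
Proof. by rewrite /D mop_mop; congr mop; apply/funext => m; case: o. Qed.

Lemma ev_D_scl o c F t x : ev (D o (scl c F)) t x = c * ev (D o F) t x.
Proof.
rewrite /scl D_mop !ev_mop big_distrr/=; apply: eq_bigr => m _; rewrite add0r; ring.
Qed.

Lemma ev_DC o o' F t x : ev (D o (D o' F)) t x = ev (D o' (D o F)) t x.
Proof.
rewrite {2 4}/D !D_mop !ev_mop; apply: eq_bigr => m _; congr (_ * _); ring.
Qed.

(* Averages along the direction [e], and primitives in this direction of the
   part of zero average: [0^-1 = 0] kills the modes with [k . e = 0]. *)
Definition av e F := mop (fun m => (kd (wv m) e == 0)%:R) 0 F.
Definition pr e F := mop (fun m => (kd (wv m) e)^-1) (- (pi / 2)) F.
Definition mn F := mop (fun m => (wv m == 0)%:R) 0 F.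
(** Inverse of minus the Laplacian on the modes with nonzero wave vector; the mean is sent to zero,
    again by [0^-1 = 0]. *)
Definition il F := mop (fun m => (kd (wv m) (wv m))^-1) 0 F.
Definition Lap F := mop (fun m => - kd (wv m) (wv m)) 0 F.

Lemma ev_Dpr e F t x : ev (Dx e (pr e F)) t x = ev F t x - ev (av e F) t x.
Proof.
rewrite /pr D_mop !ev_mop /ev -sumrB; apply: eq_bigr => m _; rewrite addNr addr0 /fr.
case: eqP => [->|/eqP h]; first by rewrite !mulr0 mulr1 mul0r subrr.
by rewrite mulVf// mulr1 mulr0 mul0r subr0.
Qed.

Lemma ev_D_mn e F t x : ev (Dx e (mn F)) t x = 0.
Proof.
rewrite /mn D_mop ev_mop big1// => m _; rewrite /fr.
case: eqP => [->|_]; last by rewrite mul0r mulr0 mul0r.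
by rewrite /kd rv0 dot0l !mulr0 mul0r.
Qed.

Lemma ev_mn_D e F t x : ev (mn (Dx e F)) t x = 0.
Proof.
rewrite /mn /D mop_mop ev_mop big1// => m _ /=.
case: eqP => [->|_]; last by rewrite !mulr0 mul0r.
by rewrite /kd rv0 dot0l !mul0r mulr0 mul0r.
Qed.

Lemma ev_mn_cst F t x y : ev (mn F) t x = ev (mn F) t y.
Proof.
rewrite /mn !ev_mop; apply: eq_bigr => m _; case: eqP => [e|_]; last by rewrite mulr0 !mul0r.
by rewrite /phs e rv0 !dot0l.
Qed.

Lemma ev_Lap_il F t x : ev (Lap (il F)) t x = ev (mn F) t x - ev F t x.
Proof.
rewrite /Lap /il /mn mop_mop !ev_mop /ev -sumrB; apply: eq_bigr => m _; rewrite !addr0 /=.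
case: eqP => [->|/eqP h]; first by rewrite /kd rv0 dot0l oppr0 !mulr0 mulr1 mul0r subrr.
by rewrite mulrN mulVf ?kd_eq0// mulr0 mul0r sub0r mulrN1 mulNr.
Qed.

Lemma continuous_phs m : continuous (fun z : pt * R => phs m z.2 z.1).
Proof.
move=> z; rewrite /phs; apply: cvgD; last exact: cvg_cst.
apply: cvgD; last by apply: cvgM; [exact: cvg_cst|exact: cvg_snd].
rewrite dot3 (_ : (fun x : pt * R => dot (rv (wv m)) x.1) = (fun x : pt * R => rv (wv m) 0 0 * x.1 0 0 + rv (wv m) 0 1 * x.1 0 1 + rv (wv m) 0 2%:R * x.1 0 2%:R)); last first.
  by apply/funext => x; rewrite dot3.
have cc j : (x.1 : pt) 0 j @[x --> z] --> (z.1 : pt) 0 j.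
  by apply: (@cvg_comp _ _ _ (fun x : pt * R => x.1) (fun x : pt => x 0 j) _ (nbhs z.1)); [exact: cvg_fst|exact: coord_continuous].
by apply: cvgD; [apply: cvgD|]; apply: cvgM; try exact: cc; exact: cvg_cst.
Qed.

Lemma continuous_ev F : continuous (fun z : pt * R => ev F z.2 z.1).
Proof.
elim: F => [|m F IH] z.
  have -> : (fun z : pt * R => ev [::] z.2 z.1) = cst 0 by apply/funext => y; rewrite ev_nil.
  exact: cst_continuous.
have -> : (fun z : pt * R => ev (m :: F) z.2 z.1) = (fun z : pt * R => amp m * cos (phs m z.2 z.1) + ev F z.2 z.1).
  by apply/funext => y; rewrite ev_cons.
apply: cvgD; last exact: IH.
apply: cvgM; first exact: cvg_cst.
apply: (@cvg_comp _ _ _ (fun z : pt * R => phs m z.2 z.1) cos _ (nbhs (phs m z.2 z.1))).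
  exact: continuous_phs.
exact: continuous_cos.
Qed.

Lemma cos_addint (y : R) (k : int) : cos (y + k%:~R * tpi) = cos y.
Proof.
have hn n (z : R) : cos (z + n%:R * tpi) = cos z.
  by elim: n z => [|n IH] z; rewrite ?mul0r ?addr0// -natr1 mulrDl mul1r addrA cosD2pi IH.
case: k => n; first by rewrite -pmulrn hn.
by rewrite NegzE mulrNz mulNr -pmulrn -(hn n.+1 (y - _)) subrK.
Qed.

Lemma ev_periodic F t : torus_periodic (ev F t).
Proof.
move=> j x; apply: eq_bigr => m _; congr (_ * _); rewrite -[RHS](cos_addint _ (wv m 0 j)); congr cos.
rewrite /phs dotDr dotZr.
rewrite (_ : dot (rv (wv m)) (basis R j) = (wv m 0 j)%:~R); first by ring.
by rewrite dot3 !mxE; case: (ord3P j); rewrite ?eqxx ?ordE /= ?mulr1 ?mulr0 ?addr0 ?add0r.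
Qed.

Lemma CP_ev F t : CP (ev F t).
Proof.
split; last exact: ev_periodic.
move=> x; exact: (@continuous_fst_t R (fun z => ev F z.2 z.1) t (@continuous_ev F) x).
Qed.

(* [nA] is the Wiener norm. *)
Definition nA F : R := \sum_(m <- F) `|amp m|.

Definition dgm (L : R) m : bool := [forall j, `|(wv m 0 j)%:~R| <= L] && (`|om m| <= L).

(** One number controls the Wiener norm, the degree in space and the frequency in time, so that each
    operation costs no more than a fixed power of it. *)
Definition bdd (L : R) F := nA F <= L /\ all (dgm L) F.

Lemma nA_cat F G : nA (F ++ G) = nA F + nA G. Proof. exact: big_cat. Qed.

Lemma nA_ge0 F : 0 <= nA F. Proof. by apply: sumr_ge0 => m _. Qed.

Lemma ev_le_nA F t x : `|ev F t x| <= nA F.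
Proof.
apply: le_trans (ler_norm_sum _ _ _) _; apply: ler_sum => m _.
by rewrite normrM ler_piMr// cos_max.
Qed.

Lemma bdd_le (L L' : R) F : bdd L F -> L <= L' -> bdd L' F.
Proof.
move=> [h1 h2] LL; split; first exact: le_trans LL.
apply: sub_all h2 => m /andP[/forallP a b]; apply/andP; split; last exact: le_trans LL.
by apply/forallP => j; exact: le_trans LL.
Qed.

Lemma bdd_cat L L' F G : 0 <= L -> 0 <= L' -> bdd L F -> bdd L' G -> bdd (L + L') (F ++ G).
Proof.
move=> l l' hF hG; have [_ dF] := bdd_le hF (ler_wpDr l' (lexx L)).
have [_ dG] := bdd_le hG (ler_wpDl l (lexx L')).
by split; [rewrite nA_cat lerD// ?hF.1 ?hG.1|rewrite all_cat dF dG].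
Qed.

Lemma nA_mop (c : R) (g : mono -> R) (a : R) F : 0 <= c -> all (fun m => `|g m| <= c) F -> nA (mop g a F) <= c * nA F.
Proof.
move=> c0; rewrite /nA big_map big_distrr/=; elim: F => [|m F IH] /=; first by rewrite !big_nil.
by move=> /andP[hm hF]; rewrite !big_cons lerD ?IH// normrM mulrC ler_wpM2r.
Qed.

Lemma all_mop L g a F : all (dgm L) (mop g a F) = all (dgm L) F.
Proof. by rewrite /mop all_map; apply: eq_all. Qed.

Lemma bdd_mop1 L (g : mono -> R) a F : (forall m, `|g m| <= 1) -> bdd L F -> bdd L (mop g a F).
Proof.
move=> g1 [h1 h2]; split; last by rewrite all_mop.
apply: le_trans h1; rewrite -[leRHS]mul1r; apply: nA_mop => //.
by elim: (F) => //= m F' ->; rewrite g1.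
Qed.

Definition small_vec e := forall j, (`|e 0 j| <= 1)%R.

Lemma kd_le L m e : small_vec e -> dgm L m -> `|kd (wv m) e| <= 3 * L.
Proof.
move=> se /andP[/forallP h _]; rewrite /kd /dot.
apply: le_trans (ler_norm_sum _ _ _) _.
apply: (le_tr (\sum_(i < 3) L)); last by rewrite sumr_const card_ord mulr_natl.
apply: ler_sum => i _; rewrite !mxE normrM (le_trans _ (h i))// ler_piMr//.
by rewrite -intr_norm -[1]/(1%:~R) ler_int.
Qed.

Definition small_dir (o : option ivec) := if o is Some e then small_vec e else True.

Lemma bdd_D L o F : 1 <= L -> small_dir o -> bdd L F -> bdd (3 * L ^+ 2) (D o F).
Proof.
move=> L1 so [h1 h2]; have L0 : 0 <= L by lra.
split; last first.
  rewrite all_mop; apply: sub_all h2 => m /andP[/forallP a b].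
  have LL : L <= 3 * L ^+ 2 by nra.
  apply/andP; split; last exact: le_trans LL.
  by apply/forallP => j; exact: le_trans LL.
apply: le_trans (nA_mop (c := 3 * L) _ _ _) _; first by rewrite mulr_ge0.
  apply: sub_all h2 => m hm; case: o so => [e|] so; first exact: kd_le.
  by move: hm => /andP[_ b]; apply: le_trans b _; rewrite /=; nra.
by rewrite expr2 mulrA ler_wpM2l// mulr_ge0.
Qed.

Lemma bdd_scl (c L C : R) F : `|c| <= C -> 1 <= C -> bdd L F -> bdd (C * L) (scl c F).
Proof.
move=> cC C1 hF; have L0 : 0 <= L := le_trans (nA_ge0 F) hF.1.
split; last first.
  have h : L <= C * L by rewrite ler_peMl.
  by rewrite all_mop; case: (bdd_le hF h).
apply: le_trans (nA_mop (c := C) _ _ _) _; first by lra.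
  by elim: (F) => //= m F' ->; rewrite cC.
by rewrite ler_wpM2l//; [lra|exact: hF.1].
Qed.

Lemma nA_mul F G : nA (mul F G) <= nA F * nA G.
Proof.
rewrite /nA /mul big_flatten big_map big_distrl/=; apply: ler_sum => m _.
rewrite big_flatten big_map big_distrr/=; apply: ler_sum => m' _.
rewrite /mulm !big_cons big_nil addr0 /= !normrM [`|2^-1|]ger0_norm ?invr_ge0//; lra.
Qed.

Lemma all_flatten (T : Type) (a : pred T) (ss : seq (seq T)) : all a (flatten ss) = all (all a) ss.
Proof. by elim: ss => //= s ss IH; rewrite all_cat IH. Qed.

Lemma all_mul L L' F G : all (dgm L) F -> all (dgm L') G -> all (dgm (L + L')) (mul F G).
Proof.
move=> hF hG; rewrite /mul all_flatten all_map; apply: sub_all hF => m /andP[/forallP a b] /=.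
rewrite all_flatten all_map; apply: sub_all hG => m' /andP[/forallP a' b'] /=.
rewrite andbT; apply/andP; split; (apply/andP; split; [apply/forallP => j; rewrite !mxE|]) => /=.
- by rewrite intrD (le_trans (ler_normD _ _))// lerD.
- by rewrite (le_trans (ler_normD _ _))// lerD.
- by rewrite intrD intrN (le_trans (ler_normB _ _))// lerD.
- by rewrite (le_trans (ler_normB _ _))// lerD.
Qed.

Lemma dgm_le L L' F : L <= L' -> all (dgm L) F -> all (dgm L') F.
Proof.
move=> LL; apply: sub_all => m /andP[/forallP a b]; apply/andP; split; last exact: le_trans LL.
by apply/forallP => j; exact: le_trans LL.
Qed.

Lemma bdd_mul L L' F G : 2 <= L -> 2 <= L' -> bdd L F -> bdd L' G -> bdd (L * L') (mul F G).
Proof.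
move=> l l' [h1 h2] [k1 k2]; split.
  by apply: le_trans (nA_mul F G) _; apply: ler_pM => //; exact: nA_ge0.
by apply: dgm_le (all_mul h2 k2); nra.
Qed.

(* [maj n B th F]: the derivatives of [F] of order at most [n] are dominated by
   [th], up to the weights [wt] of the differentiations. *)
Section Maj.
Variables (I : Type) (dv : I -> option ivec) (wt : I -> R).
Hypothesis wt0 : forall i, 0 <= wt i.
Implicit Types (n : nat) (B : R) (th : R -> pt -> R).

Fixpoint maj n B th F : Prop :=
  (forall t x, `|ev F t x| <= B * th t x) /\
  if n is n'.+1 then forall i, maj n' (B * wt i) th (D (dv i) F) else True.

Lemma maj0 n B th F : maj n B th F -> forall t x, `|ev F t x| <= B * th t x.
Proof. by case: n => [|n] []. Qed.

Lemma majD n B th F i : maj n.+1 B th F -> maj n (B * wt i) th (D (dv i) F).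
Proof. by move=> [_]; exact. Qed.

Lemma maj_ext n B th F G : (forall t x, ev F t x = ev G t x) -> maj n B th F -> maj n B th G.
Proof.
elim: n B F G => [|n IH] B F G FG hF; have hG t x : `|ev G t x| <= B * th t x by rewrite -FG (maj0 hF).
  by split.
by split => // i; apply: IH (majD i hF) => t x; exact: ev_D_ext.
Qed.

Lemma maj_leB n B B' th F : (forall t x, 0 <= th t x) -> B <= B' -> maj n B th F -> maj n B' th F.
Proof.
move=> th0; elim: n B B' F => [|n IH] B B' F BB hF;
  have hG t x : `|ev F t x| <= B' * th t x by apply: le_trans (maj0 hF t x) _; exact: ler_wpM2r.
  by split.
by split => // i; apply: IH (majD i hF); exact: ler_wpM2r.
Qed.

Lemma maj_pred n B th F : maj n.+1 B th F -> maj n B th F.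
Proof.
elim: n B F => [|n IH] B F [h1 h2]; first by split.
by split => // i; apply: IH; exact: h2.
Qed.

Lemma maj_leq n n' B th F : (n' <= n)%N -> maj n B th F -> maj n' B th F.
Proof.
move=> /subnK <-; elim: (n - n')%N => [|k IH]; first by rewrite add0n.
by rewrite addSn => /maj_pred /IH.
Qed.

Lemma maj_cat n B B' th F G : maj n B th F -> maj n B' th G -> maj n (B + B') th (F ++ G).
Proof.
elim: n B B' F G => [|n IH] B B' F G hF hG;
  have h t x : `|ev (F ++ G) t x| <= (B + B') * th t x
    by rewrite ev_cat mulrDl (le_trans (ler_normD _ _))// lerD ?(maj0 hF) ?(maj0 hG).
  by split.
by split => // i; rewrite D_cat mulrDl; apply: IH; exact: majD.
Qed.

Lemma maj_scl n B c th F : maj n B th F -> maj n (`|c| * B) th (scl c F).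
Proof.
elim: n B F => [|n IH] B F hF;
  have h t x : `|ev (scl c F) t x| <= `|c| * B * th t x
    by rewrite ev_scl normrM -mulrA ler_wpM2l// (maj0 hF).
  by split.
split => // i; rewrite -mulrA; apply: maj_ext (IH _ _ (majD i hF)) => t x.
by rewrite ev_scl ev_D_scl.
Qed.

(** By the Leibniz rule each differentiation doubles the number of terms, whence [2 ^ n]. *)
Lemma maj_mul n B B' th th' F G : (forall t x, 0 <= th t x) -> (forall t x, 0 <= th' t x) ->
  maj n B th F -> maj n B' th' G ->
  maj n (2 ^+ n * B * B') (fun t x => th t x * th' t x) (mul F G).
Proof.
move=> t0 t0'; elim: n B B' F G => [|n IH] B B' F G hF hG.
  split => // t x; rewrite ev_mul normrM expr0 mul1r mulrACA; apply: ler_pM => //.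
    exact: (maj0 hF).
  exact: (maj0 hG).
have h0 t x : `|ev (mul F G) t x| <= 2 ^+ n.+1 * B * B' * (th t x * th' t x).
  have a := maj0 hF t x; have b := maj0 hG t x.
  have ab : `|ev (mul F G) t x| <= (B * th t x) * (B' * th' t x) by rewrite ev_mul normrM ler_pM.
  apply: le_trans ab _.
  rewrite (_ : 2 ^+ n.+1 * B * B' * (th t x * th' t x) = 2 ^+ n.+1 * ((B * th t x) * (B' * th' t x))); last by ring.
  by rewrite ler_peMl ?exprn_ege1 ?ler1n// mulr_ge0// ?(le_trans _ a)// (le_trans _ b).
split=> // i.
have h1 := IH _ _ _ _ (majD i hF) (maj_pred hG).
have h2 := IH _ _ _ _ (maj_pred hF) (majD i hG).
have := maj_cat h1 h2; rewrite (_ : _ + _ = 2 ^+ n.+1 * B * B' * wt i); last by rewrite exprS; ring.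
apply: maj_ext => t x; by rewrite ev_cat !ev_mul ev_D_mul.
Qed.

Lemma maj_bdd n L F : 0 <= L -> (forall i, small_dir (dv i)) -> (forall i, 3 * L <= wt i) ->
  bdd L F -> maj n L (fun _ _ => 1) F.
Proof.
move=> L0 sd hw [hA hd]; move: {1 2}L hA => B hA.
elim: n B F hA hd => [|n IH] B F hA hd;
  have h0 t x : `|ev F t x| <= B * 1 by rewrite mulr1 (le_trans (ev_le_nA _ _ _)).
  by split.
split=> // i; apply: IH; last by rewrite all_mop.
apply: le_trans (nA_mop (c := wt i) _ _ _) _ => //.
  apply: sub_all hd => m hm; case: (dv i) (sd i) (hw i) => [e|] so hi.
    by apply: le_trans hi; exact: kd_le.
  by move: hm => /andP[_ b]; apply: le_trans b _; apply: le_trans hi; lra.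
by rewrite mulrC ler_wpM2r.
Qed.

End Maj.

End TrigPoly.

Notation dj j := (D (Some (ee j))).

(** * Averages, antiderivatives and the symmetric antidivergence *)

Section TrigInt.
Variable R : realType.
Notation pt := (point R).
Notation tp := (seq (mono R)).
Notation Dx e := (D (Some e)).
Notation Dt := (D None).
Implicit Types (F G : tp) (t s : R) (x : pt) (e : ivec) (m : mono R).

Lemma ti_Dx e F t : ti (ev (Dx e F) t) = 0.
Proof.
apply: (@ti_deriv0 R (ev F t) _ (rv R e)); try exact: CP_ev.
by move=> x s; exact: (is_derive_ev (Some e) F t x s).
Qed.

Lemma ev_shift_mvt e F t x (s : R) : 0 < s -> exists2 c : R, 0 <= c <= s &
  ev F t (x + s *: rv R e) - ev F t x = s * ev (Dx e F) t (x + c *: rv R e).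
Proof.
move=> s0.
have [|c cin hc] := @MVT R (fun r : R => ev F t (x + r *: rv R e)) (fun r => ev (Dx e F) t (x + r *: rv R e)) 0 s s0
   (fun r _ => is_derive_ev (Some e) F t x r).
  apply: continuous_subspaceT => r; apply: differentiable_continuous; apply/derivable1_diffP.
  by have [] := is_derive_ev (Some e) F t x r.
exists c; first by move: cin; rewrite in_itv/= => /andP[/ltW -> /ltW ->].
by move: hc; rewrite scale0r addr0 subr0 mulrC.
Qed.

Lemma ev_lip e F t x (s : R) : 0 <= s -> `|ev F t (x + s *: rv R e) - ev F t x| <= s * nA (Dx e F).
Proof.
rewrite le_eqVlt => /predU1P[<-|s0]; first by rewrite scale0r addr0 subrr normr0 mul0r.
have [c _ ->] := ev_shift_mvt e F t x s0.
by rewrite normrM gtr0_norm// ler_wpM2l ?ev_le_nA// ltW.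
Qed.

Lemma ev_taylor e F t x (s : R) : 0 <= s ->
  `|ev F t (x + s *: rv R e) - ev F t x| <= s * `|ev (Dx e F) t x| + s ^+ 2 * nA (Dx e (Dx e F)).
Proof.
rewrite le_eqVlt => /predU1P[<-|s0]; first by rewrite scale0r addr0 subrr normr0 expr0n/= !mul0r addr0.
have [c /andP[c0 cs] ->] := ev_shift_mvt e F t x s0.
rewrite normrM gtr0_norm// expr2 -mulrA -mulrDr ler_wpM2l// ?(ltW s0)//.
have := ev_lip e (Dx e F) t x c0 => h.
have h2 : c * nA (Dx e (Dx e F)) <= s * nA (Dx e (Dx e F)) by rewrite ler_wpM2r ?nA_ge0.
have := ler_normD (ev (Dx e F) t (x + c *: rv R e) - ev (Dx e F) t x) (ev (Dx e F) t x).
rewrite subrK; lra.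
Qed.

Definition n1 F t : R := (\oint x, `|ev F t x|).

Lemma n1_ge0 F t : 0 <= n1 F t. Proof. by apply: ti_ge0. Qed.

Lemma CP_nev F t : CP (fun x => `|ev F t x|). Proof. exact/CP_norm/CP_ev. Qed.

Notation vol := (tpi ^+ 3 : R).

Lemma vol_gt0 : 0 < vol. Proof. by rewrite exprn_gt0// twopi_gt0. Qed.

Lemma CP_diff e F t (s : R) : CP (fun x => `|ev F t (x + s *: rv R e) - ev F t x|).
Proof. by apply: CP_norm; apply: CPB; [apply: CP_shift|]; exact: CP_ev. Qed.

Lemma n1_shift1 e F t (h : R) : 0 <= h ->
  (\oint x, `|ev F t (x + h *: rv R e) - ev F t x|) <= h * n1 (Dx e F) t + h ^+ 2 * nA (Dx e (Dx e F)) * vol.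
Proof.
move=> h0; rewrite /n1 -tiZ; last exact: CP_nev.
rewrite -ti_cst -tiD; [|exact/CPZ/CP_nev|exact: CP_cst].
apply: ti_le; [exact: CP_diff|by apply: CPD; [exact/CPZ/CP_nev|exact: CP_cst]|].
by move=> x; exact: ev_taylor.
Qed.

(** Every step is a translate of the first, so the [L^1] errors simply add. The quadratic remainders
    sum to a multiple of [M h ^ 2], which tends to zero when [M h] is kept fixed. *)
Lemma n1_shiftM e F t (h : R) (M : nat) : 0 <= h ->
  (\oint x, `|ev F t (x + (M%:R * h) *: rv R e) - ev F t x|) <=
    M%:R * (h * n1 (Dx e F) t + h ^+ 2 * nA (Dx e (Dx e F)) * vol).
Proof.
move=> h0; elim: M => [|M IH].
  rewrite (eq_ti (fun=> 0)) => [|x]; first by rewrite ti_cst !mul0r.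
  by rewrite mul0r scale0r addr0 subrr normr0.
rewrite -natr1 [leRHS]mulrDl [1 * _ in leRHS]mul1r; apply: (le_trans _ (lerD IH (n1_shift1 e F t h0))).
have sh := @ti_shift R (fun x => `|ev F t (x + h *: rv R e) - ev F t x|) ((M%:R * h) *: rv R e) (CP_diff e F t h).
rewrite -sh -tiD; [|exact: CP_diff|exact: (CP_shift _ (CP_diff e F t h))].
apply: ti_le; [exact: CP_diff|apply: CPD; [exact: CP_diff|exact: (CP_shift _ (CP_diff e F t h))]|].
move=> x; rewrite mulrDl mul1r scalerDl addrA addrC.
apply: le_trans (ler_normD _ _); apply: le_of_eq; congr (`| _ |).
by ring.
Qed.

(* Poincare-type bound, by cutting the segment into short steps. *)
Lemma n1_shift e F t (s : R) : 0 <= s ->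
  (\oint x, `|ev F t (x + s *: rv R e) - ev F t x|) <= s * n1 (Dx e F) t.
Proof.
move=> s0; apply/ler_addgt0Pr => eps eps0.
pose C := s ^+ 2 * nA (Dx e (Dx e F)) * vol.
have C0 : 0 <= C by apply: mulr_ge0; [apply: mulr_ge0; [exact: sqr_ge0|exact: nA_ge0]|exact: (ltW vol_gt0)].
pose M := (Num.trunc (C / eps)).+1.
have M0 : 0 < M%:R :> R by [].
have CM : C / M%:R <= eps.
  by rewrite ler_pdivrMr// mulrC -ler_pdivrMr//; exact/ltW/truncnS_gt.
have := n1_shiftM e F t M (divr_ge0 s0 (ltW M0)).
rewrite mulrC divfK ?gt_eqF// => /le_trans; apply.
rewrite (_ : M%:R * _ = s * n1 (Dx e F) t + C / M%:R); first by rewrite lerD2l.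
by rewrite /C; field; rewrite gt_eqF.
Qed.

Definition multiple (sg : R) e m : bool := `[< exists z : int, kd R (wv m) e = sg * z%:~R >].

(** Multiplied by [2 sin b], where [2 b] is the increment of the phase, the sum telescopes; its ends
    differ by a multiple of the period. The condition [|z| < M] makes [sin b] nonzero. *)
Lemma sum_cos_step (th : R) (z : int) (M : nat) : (z != 0)%R -> (`|z| < M%:Z)%R ->
  \sum_(j < M) cos (th + (z%:~R * tpi / M%:R) * j%:R) = 0 :> R.
Proof.
move=> z0 zM; have M0 : 0 < M%:R :> R by rewrite ltr0n; lia.
pose b : R := z%:~R * pi / M%:R.
have sb : sin b != 0.
  have hp : forall n : nat, (0 < n)%N -> (n < M)%N -> 0 < sin (n%:R * pi / M%:R :> R).
    move=> n n0 nM; apply: sin_gt0_pi; rewrite divr_gt0 ?mulr_gt0 ?ltr0n ?pi_gt0 ?(leq_ltn_trans _ nM)//=.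
    by rewrite ltr_pdivrMr// mulrC ltr_pM2l ?pi_gt0// ltr_nat.
  rewrite /b {b}; case: z z0 zM => n z0 zM.
    by rewrite gt_eqF// -pmulrn hp//; lia.
  rewrite NegzE mulrNz !mulNr sinN oppr_eq0 gt_eqF// -pmulrn hp//; lia.
have hb : z%:~R * tpi / M%:R = b *+ 2 by rewrite mulrnAr mulrnAl.
have hbM : b *+ 2 * M%:R = z%:~R * tpi by rewrite -hb divfK// gt_eqF.
rewrite hb; clearbody b.
have tel n : sin b *+ 2 * \sum_(j < n) cos (th + (b *+ 2) * j%:R) =
    sin (th - b + (b *+ 2) * n%:R) - sin (th - b).
  elim: n => [|n IH]; first by rewrite big_ord0 mulr0 mulr0 addr0 subrr.
  rewrite big_ord_recr/= mulrDr IH.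
  rewrite -natr1 mulrDr mulr1.
  rewrite (_ : th - b + (b *+ 2 * n%:R + b *+ 2) = (th + b *+ 2 * n%:R) + b); last by rewrite -mulr_natr; ring.
  rewrite (_ : th - b + b *+ 2 * n%:R = (th + b *+ 2 * n%:R) - b); last by ring.
  by rewrite (sinD (th + _) b) (sinB (th + _) b) -mulr_natr; ring.
apply: (mulfI (x := sin b *+ 2)); first by rewrite mulrn_eq0/= (negbTE sb).
rewrite tel mulr0; apply/eqP; rewrite subr_eq0; apply/eqP.
rewrite hbM.
rewrite -(cosBpihalf (_ + _)) -(cosBpihalf (th - b)) addrAC; exact: cos_addint.
Qed.

(** Equally spaced translates annihilate each mode with [k . e <> 0] exactly, provided that [M]
    exceeds its frequency. Thus [av] is a finite average of translations, over the period [tpi / sg]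
    when all [k . e] are multiples of [sg]. *)
Lemma disc_avg (sg : R) (M : nat) e F t x : 0 < sg -> all (multiple sg e) F ->
  all (fun m => `|kd R (wv m) e| < sg * M%:R) F ->
  \sum_(j < M) ev F t (x + (tpi * j%:R / (sg * M%:R)) *: rv R e) = M%:R * ev (av e F) t x.
Proof.
move=> sg0; elim: F => [|m F IH] /=.
  by move=> _ _; rewrite ev_nil mulr0 big1// => j _; rewrite ev_nil.
move=> /andP[/asboolP[z hz] mF] /andP[hM hF].
rewrite [in RHS]ev_cons mulrDr -IH//.
under eq_bigr do rewrite ev_cons; rewrite big_split/=; congr (_ + _).
rewrite -big_distrr/= hz.
have [z0|z0] := eqVneq z 0.
  rewrite z0 mulr0 eqxx mulr1 mulrCA; congr (_ * _).
  rewrite (eq_bigr (fun=> cos (phs m t x))) => [|j _]; last first.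
    by congr cos; rewrite /phs dotDr dotZr -/(kd R (wv m) e) hz z0 !mulr0 addr0.
  by rewrite sumr_const card_ord mulr_natl /phs/= addr0.
rewrite mulf_eq0 gt_eqF//= intr_eq0 (negbTE z0) mulr0 mul0r mulr0.
rewrite (eq_bigr (fun j : 'I_M => cos (phs m t x + (z%:~R * tpi / M%:R) * j%:R))) => [|j _].
  rewrite sum_cos_step ?mulr0//.
  move: hM; rewrite hz normrM gtr0_norm// ltr_pM2l// -intr_norm -[M%:R]/(M%:Z%:~R) ltr_int.
  by [].
have M0 : 0 < M%:R :> R by rewrite ltr0n; case: j => /= j; lia.
congr cos; rewrite /phs dotDr dotZr -/(kd R (wv m) e) hz.
rewrite (_ : tpi * j%:R / (sg * M%:R) * (sg * z%:~R) = z%:~R * tpi / M%:R * j%:R); last by field; rewrite !gt_eqF.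
ring.
Qed.

Lemma ex_freq_bound e F (sg : R) : 0 < sg -> exists M0 : nat, forall M, (M0 <= M)%N ->
  (0 < M)%N /\ all (fun m => `|kd R (wv m) e| < sg * M%:R) F.
Proof.
move=> sg0; elim: F => [|m F [M0 IH]]; first by exists 1%N => M.
exists (M0 + (Num.trunc (`|kd R (wv m) e| / sg)).+1)%N => M hM.
have [|Mp hM'] := IH M; first by apply: leq_trans hM; rewrite leq_addr.
split=> //=; rewrite hM' andbT mulrC -ltr_pdivrMr//.
apply: lt_le_trans (truncnS_gt _) _; rewrite ler_nat.
by apply: leq_trans hM; rewrite leq_addl.
Qed.

Lemma kd_int k e : exists z : int, kd R k e = z%:~R.
Proof.
exists (k 0 0 * e 0 0 + k 0 1 * e 0 1 + k 0 2%:R * e 0 2%:R).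
by rewrite /kd dot3 !mxE !intrD !intrM.
Qed.

Lemma multiple1 e F : all (multiple 1 e) F.
Proof.
elim: F => //= m F ->; rewrite andbT; apply/asboolP.
by have [z hz] := kd_int (wv m) e; exists z; rewrite mul1r.
Qed.

(** An average of translations is a contraction in [L^1]. *)
Lemma n1_av e F t : n1 (av e F) t <= n1 F t.
Proof.
have [M0 /(_ _ (leqnn _))[Mp hM]] := ex_freq_bound e F ltr01.
have M1 : 0 < M0%:R :> R by rewrite ltr0n.
rewrite -(ler_pM2l M1) /n1 -!tiZ; try exact: CP_nev.
apply: (le_tr ((\oint x, \sum_(j < M0) `|ev F t (x + (tpi * j%:R / (1 * M0%:R)) *: rv R e)|))).
  apply: ti_le; [exact/CPZ/CP_nev|by apply: CP_sum => j; exact: (CP_shift _ (CP_nev F t))|].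
  move=> x; rewrite -{1}(gtr0_norm M1) -normrM -(disc_avg t x ltr01 (multiple1 e F) hM).
  exact: ler_norm_sum.
rewrite ti_sum => [|j]; last exact: (CP_shift _ (CP_nev F t)).
rewrite (eq_bigr (fun=> n1 F t)) => [|j _]; last exact: (@ti_shift R (fun x => `|ev F t x|) _ (CP_nev F t)).
rewrite sumr_const card_ord tiZ; last exact: CP_nev.
by rewrite mulr_natl.
Qed.

Lemma all_mopP (p : pred (mono R)) (g : mono R -> R) a F :
  (forall m, p m -> p (Mono (amp m * g m) (wv m) (om m) (ph m + a))) -> all p F -> all p (mop g a F).
Proof. by move=> h; elim: F => //= m F IH /andP[/h -> /IH]. Qed.

Lemma ev_av_pr e F t x : ev (av e (pr e F)) t x = 0.
Proof.
rewrite /av /pr mop_mop ev_mop big1// => m _ /=.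
by case: eqP => [->|_]; rewrite ?invr0 ?mul0r ?mulr0 ?mul0r.
Qed.

Lemma ev_sub F G t x : ev (F ++ scl (-1) G) t x = ev F t x - ev G t x.
Proof. by rewrite ev_cat ev_scl mulN1r. Qed.

Lemma n1_sub F G t : (\oint x, `|ev F t x - ev G t x|) <= n1 F t + n1 G t.
Proof.
rewrite /n1 -tiD; try exact: CP_nev.
apply: ti_le => [||x]; last exact: ler_normB.
  by apply: CP_norm; apply: CPB; exact: CP_ev.
by apply: CPD; exact: CP_nev.
Qed.

(** Source of all gains of a factor [1 / N]. As [G = pr e F] has zero average along [e], [- M G] is
    the sum of the differences between [M] translates of [G] and [G]. The translations are at most
    one period [tpi / sg] long, and the derivative [F - av e F] of [G] has at most twice the norm of
    [F]. *)
Lemma n1_pr (sg : R) e F t : 0 < sg -> all (multiple sg e) F -> n1 (pr e F) t <= (pi *+ 4) / sg * n1 F t.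
Proof.
move=> sg0 mF; set G := pr e F.
have mG : all (multiple sg e) G by apply: all_mopP mF.
have [M /(_ _ (leqnn _))[Mp hM]] := ex_freq_bound e G sg0.
have M0 : 0 < M%:R :> R by rewrite ltr0n.
pose st (j : nat) : R := tpi * j%:R / (sg * M%:R).
have st0 j : 0 <= st j by apply: divr_ge0; apply: mulr_ge0 => //; [exact: (ltW (@twopi_gt0 R))|exact: ltW].
have stM (j : 'I_M) : st j <= tpi / sg.
  rewrite /st ler_pdivrMr ?mulr_gt0// mulrA divfK ?gt_eqF// ler_pM2l ?twopi_gt0// ler_nat.
  exact/ltnW/ltn_ord.
have dG : n1 (Dx e G) t <= 2 * n1 F t.
  rewrite /n1 (eq_ti (fun x => `|ev F t x - ev (av e F) t x|)) => [|x]; last by rewrite ev_Dpr.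
  by apply: le_trans (n1_sub _ _ _) _; rewrite mulr_natl mulr2n lerD2l n1_av.
rewrite -(ler_pM2l M0) {1}/n1 -tiZ; last exact: CP_nev.
apply: (le_tr (\oint x, \sum_(j < M) `|ev G t (x + st j *: rv R e) - ev G t x|)).
  apply: ti_le; [exact/CPZ/CP_nev|by apply: CP_sum => j; exact: CP_diff|].
  move=> x; apply: le_trans (ler_norm_sum _ _ _).
  rewrite sumrB disc_avg// ev_av_pr mulr0 sub0r normrN sumr_const card_ord.
  by rewrite normrMn mulr_natl.
rewrite ti_sum => [|j]; last exact: CP_diff.
apply: (le_tr (\sum_(j < M) (tpi / sg * (2 * n1 F t)))).
  apply: ler_sum => j _; apply: le_trans (n1_shift e G t (st0 j)) _.
  by apply: ler_pM => //; exact: n1_ge0.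
rewrite sumr_const card_ord -[_ *+ M]mulr_natl ler_pM2l//; apply: le_of_eq.
by rewrite mulrA; congr (_ * _); rewrite mulrAC; congr (_ / _); rewrite mulr_natr -mulrnA.
Qed.

(* Symmetric antidivergence: [g_i] is freed from [x_i] by a diagonal entry,
   and the resulting shear forces are the divergence of off-diagonal entries. *)

Definition aT (g : 'I_3 -> tp) (i j : 'I_3) : tp :=
  if i == j then pr (ee i) (g i)
  else if j == (if i == 0 then 1 else 0) then pr (ee j) (av (ee i) (g i))
  else pr (ee j) (av (ee (if i == 0 then 1 else 0)) (av (ee i) (g i))).

Definition Rop (g : 'I_3 -> tp) (i j : 'I_3) : tp :=
  if i == j then aT g i i else aT g i j ++ aT g j i.

Lemma Rop_sym g i j t x : ev (Rop g i j) t x = ev (Rop g j i) t x.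
Proof. by rewrite /Rop eq_sym; case: eqP => [->//|_]; rewrite !ev_cat addrC. Qed.

(** This makes the symmetrization in [Rop] harmless: for [i <> j] the entry [aT g j i] has been
    averaged along [x_j], so it contributes nothing to the divergence of row [i]. *)
Lemma ev_Dx_pr_av e e' F t x : ev (Dx e (pr e' (av e F))) t x = 0.
Proof.
rewrite /pr /av mop_mop D_mop ev_mop big1// => m _ /=.
by case: eqP => [->|_]; rewrite ?mul0r ?mulr0 ?mul0r.
Qed.

Lemma ev_Dx_pr_av2 e e' e'' F t x : ev (Dx e (pr e' (av e'' (av e F)))) t x = 0.
Proof.
rewrite /pr /av !mop_mop D_mop ev_mop big1// => m _ /=.
by case: eqP => [->|_]; rewrite ?mul0r ?mulr0 ?mul0r.
Qed.

Lemma kd_delta k (j : 'I_3) : kd R k (ee j) = (k 0 j)%:~R.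
Proof.
rewrite /kd rv_delta dot3 !mxE; case: (ord3P j); rewrite ?eqxx ?ordE /=;
by rewrite ?mulr1 ?mulr0 ?addr0 ?add0r.
Qed.

Lemma ev_av3 (i j k : 'I_3) F t x : (forall l, [|| l == i, l == j | l == k]) ->
  ev (av (ee k) (av (ee j) (av (ee i) F))) t x = ev (mn F) t x.
Proof.
move=> hl; rewrite /av /mn !mop_mop !ev_mop; apply: eq_bigr => m _ /=; rewrite !addr0 !kd_delta !intr_eq0.
congr (_ * _ * _).
have [w0|w0] := eqVneq (wv m) 0; first by rewrite w0 !mxE !eqxx !mulr1.
rewrite -!natrM !mulnb (_ : _ && _ = false)//; apply/negbTE; apply: contra w0 => /and3P[/eqP hi /eqP hj /eqP hk].
by apply/eqP/rowP => l; rewrite mxE; case/or3P: (hl l) => /eqP ->.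
Qed.

Lemma ev_D_cat o F G t x : ev (D o (F ++ G)) t x = ev (D o F) t x + ev (D o G) t x.
Proof. by rewrite D_cat ev_cat. Qed.

Lemma sum3 (f : 'I_3 -> R) : \sum_(j < 3) f j = f 0 + f 1 + f 2%:R.
Proof.
rewrite !big_ord_recl big_ord0 addr0 addrA; do 2?congr (_ + _); congr f; exact/val_inj.
Qed.

Lemma div_Rop g i t x :
  \sum_(j < 3) ev (Dx (ee j) (Rop g i j)) t x = ev (g i) t x - ev (mn (g i)) t x.
Proof.
rewrite sum3 /Rop /aT; case: (ord3P i); rewrite ?eqxx ?ordE /= ?eqxx ?ordE /= ?ev_D_cat !ev_Dpr
  ?ev_Dx_pr_av ?ev_Dx_pr_av2 -?(@ev_av3 0 1 2%:R (g 0)) -?(@ev_av3 1 0 2%:R (g 1)) -?(@ev_av3 2%:R 0 1 (g 2%:R));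
  try by move=> l; case: (ord3P l).
- ring.
- ring.
- ring.
Qed.

Lemma n1_cat F G t : n1 (F ++ G) t <= n1 F t + n1 G t.
Proof.
rewrite /n1 -tiD; try exact: CP_nev.
apply: ti_le => [||x]; [exact: CP_nev|by apply: CPD; exact: CP_nev|by rewrite ev_cat ler_normD].
Qed.

Lemma n1_aT g i j t : n1 (aT g i j) t <= (pi *+ 4) * n1 (g i) t.
Proof.
have h e F : n1 (pr e F) t <= (pi *+ 4) * n1 F t.
  by have := n1_pr t ltr01 (multiple1 e F); rewrite divr1.
have p4 : 0 < pi *+ 4 :> R by rewrite pmulrn_lgt0// pi_gt0.
rewrite /aT; case: ifP => _ //; case: ifP => _; apply: le_trans (h _ _) _; rewrite ler_pM2l//.
  exact: n1_av.
by apply: le_trans (n1_av _ _ _) _; exact: n1_av.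
Qed.

Lemma n1_Rop g i j t : n1 (Rop g i j) t <= (pi *+ 4) * (n1 (g i) t + n1 (g j) t).
Proof.
have p4 : 0 <= pi *+ 4 :> R by rewrite mulrn_wge0// pi_ge0.
rewrite /Rop; case: eqP => [->|_].
  by apply: le_trans (n1_aT _ _ _ _) _; rewrite ler_wpM2l// lerDl n1_ge0.
by apply: le_trans (n1_cat _ _ _) _; rewrite mulrDr lerD ?n1_aT.
Qed.

Lemma bdd_pr L e F : bdd L F -> bdd L (pr e F).
Proof.
apply: bdd_mop1 => m; have [z ->] := kd_int (wv m) e.
have [->|z0] := eqVneq z 0; first by rewrite invr0 normr0.
rewrite normfV invf_le1 ?normr_gt0 ?intr_eq0// -intr_norm -[1]/(1%:~R) ler_int.
by lia.
Qed.

Lemma bdd_av L e F : bdd L F -> bdd L (av e F).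
Proof. by apply: bdd_mop1 => m; case: eqP; rewrite ?normr1 ?normr0. Qed.

Lemma bdd_Rop L g i j : (forall i, bdd L (g i)) -> bdd (L + L) (Rop g i j).
Proof.
move=> hg; have L0 : 0 <= L := le_trans (nA_ge0 _) (hg 0).1.
have hT i' j' : bdd L (aT g i' j') by rewrite /aT; do 2?case: ifP => _; do ?(apply: bdd_pr || apply: bdd_av).
rewrite /Rop; case: ifP => _; last exact: bdd_cat.
by apply: bdd_le (hT _ _) _; rewrite lerDl.
Qed.

End TrigInt.

(** * Concentrated profiles *)

Section Profile.
Variable R : realType.
Notation pt := (point R).
Notation tp := (seq (mono R)).
Notation Dx e := (D (Some e)).
Notation Dt := (D None).
Implicit Types (F G : tp) (t s : R) (x : pt) (e : ivec) (m : mono R) (n Q : nat).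

Section Phase.
Variables (k : ivec) (o : R).

Definition m1 : mono R := Mono 1 k o 0.
Definition cosm : tp := [:: m1].
Definition sinm : tp := [:: Mono 1 k o (- (pi / 2))].
(** The squared cosine of half the phase. Its powers [P n] concentrate where the phase is a multiple
    of [tpi], on a scale of order [n ^ (-1/2)]. *)
Definition zt : tp := [:: Mono 2^-1 0 0 0; Mono 2^-1 k o 0].
Definition P n := iter n (mul zt) (one R).
Definition Sn n := mul sinm (P n).

Definition zf t x : R := (1 + cos (phs m1 t x)) / 2.
Definition sf t x : R := sin (phs m1 t x).

Lemma ev_cosm t x : ev cosm t x = cos (phs m1 t x).
Proof. by rewrite ev_cons ev_nil addr0 mul1r. Qed.

Lemma ev_sinm t x : ev sinm t x = sf t x.
Proof. by rewrite ev_cons ev_nil addr0 mul1r /phs/= /sf /phs/= addr0 cosBpihalf. Qed.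

Lemma ev_zt t x : ev zt t x = zf t x.
Proof.
rewrite !ev_cons ev_nil addr0 /phs/= rv0 dot0l mul0r !addr0 cos0 /zf /phs/= !addr0.
by field.
Qed.

Lemma ev_P n t x : ev (P n) t x = zf t x ^+ n.
Proof. by elim: n => [|n IH] /=; rewrite ?ev_one// ev_mul IH ev_zt exprS. Qed.

Lemma ev_Sn n t x : ev (Sn n) t x = sf t x * zf t x ^+ n.
Proof. by rewrite ev_mul ev_sinm ev_P. Qed.

Lemma zf_itv t x : 0 <= zf t x <= 1.
Proof.
have := cos_le1 (phs m1 t x); have := cos_geN1 (phs m1 t x); rewrite /zf => h1 h2.
by apply/andP; split; lra.
Qed.

Lemma sf2 t x : sf t x ^+ 2 = 4 * zf t x * (1 - zf t x).
Proof. by rewrite /sf /zf sin2cos2; field. Qed.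

Lemma cfE t x : cos (phs m1 t x) = 2 * zf t x - 1.
Proof. by rewrite /zf; field. Qed.

Lemma ev_D_zt d t x : ev (D d zt) t x = - (fr d m1 / 2 * sf t x).
Proof.
rewrite ev_D !big_cons big_nil addr0 /= /sf.
have -> : fr d (Mono 2^-1 0 0 0) = 0 :> R by case: d => [e|] //=; rewrite /kd rv0 dot0l.
rewrite mulr0 mul0r oppr0 add0r; congr (- _).
rewrite (_ : fr d (Mono 2^-1 k o 0) = fr d m1); last by case: d.
by rewrite [2^-1 * _]mulrC.
Qed.

Lemma ev_D_sinm d t x : ev (D d sinm) t x = fr d m1 * (2 * zf t x - 1).
Proof.
rewrite ev_D !big_cons big_nil addr0 /= -cfE.
rewrite (_ : fr d (Mono 1 k o (- (pi / 2))) = fr d m1); last by case: d.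
rewrite mul1r /phs/= sinB cos_pihalf sin_pihalf !addr0; ring.
Qed.

Lemma ev_D_cosm d t x : ev (D d cosm) t x = - (fr d m1 * sf t x).
Proof. by rewrite ev_D !big_cons big_nil addr0 /= mul1r. Qed.

Lemma ev_D2_cosm d t x : ev (D d (D d cosm)) t x = - (fr d m1 ^+ 2 * ev cosm t x).
Proof.
have h y u : ev (D d cosm) u y = ev (scl (- fr d m1) sinm) u y.
  by rewrite ev_D_cosm ev_scl ev_sinm mulNr.
by rewrite (ev_D_ext d (fun u y => h y u)) ev_D_scl ev_D_sinm ev_cosm cfE; ring.
Qed.

Lemma ev_D_P d n t x : ev (D d (P n)) t x = - (n%:R / 2 * fr d m1 * ev (Sn n.-1) t x).
Proof.
rewrite ev_Sn; elim: n => [|n IH].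
  rewrite !mul0r oppr0 ev_D big_cons big_nil /=.
  by rewrite (_ : fr d _ = 0) ?mulr0 ?mul0r ?oppr0 ?addr0//; case: d => [e|] //=; rewrite /kd rv0 dot0l.
rewrite [P _]/= ev_D_mul IH ev_D_zt ev_P ev_zt; case: n {IH} => [|n] /=; first by rewrite expr0; field.
by rewrite exprS -[n.+2%:R]natr1; field.
Qed.

(** As [sin ^ 2 = 4 zf (1 - zf)], the functions [zf ^ n] and [sin zf ^ n] are closed under
    differentiation. Integrated, this identity is also the Wallis recursion. *)
Lemma ev_D_Sn d n t x :
  ev (D d (Sn n)) t x = fr d m1 * ((2 * n%:R + 2) * ev (P n.+1) t x - (2 * n%:R + 1) * ev (P n) t x).
Proof.
rewrite /Sn ev_D_mul ev_D_P ev_D_sinm ev_sinm ev_Sn !ev_P.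
case: n => [|n] /=; first by rewrite expr0 expr1; ring.
have s2 := sf2 t x; rewrite [zf t x ^+ n.+2]exprS [zf t x ^+ n.+1]exprS -[n.+1%:R]natr1.
rewrite (_ : sf t x * - ((n%:R + 1) / 2 * fr d m1 * (sf t x * zf t x ^+ n)) =
  - ((n%:R + 1) / 2 * fr d m1 * (sf t x ^+ 2 * zf t x ^+ n))); last by ring.
by rewrite s2; field.
Qed.

Lemma zf_pow_le t x n n' : (n <= n')%N -> zf t x ^+ n' <= zf t x ^+ n.
Proof. by have /andP[z0 z1] := zf_itv t x; move=> nn; apply: ler_wiXn2l. Qed.

Lemma zf_pow_ge0 t x n : 0 <= zf t x ^+ n.
Proof. by have /andP[z0 z1] := zf_itv t x; exact: exprn_ge0. Qed.

(** [1 - z ^ Q] is the sum of [Q] terms [z ^ i (1 - z)], and each of them is at least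
    [z ^ Q (1 - z)]. *)
Lemma onem_pow_le t x Q : Q%:R * (1 - zf t x) * zf t x ^+ Q <= 1.
Proof.
have /andP[z0 z1] := zf_itv t x; move: (zf t x) z0 z1 => z z0 z1.
have h : \sum_(i < Q) z ^+ i * (1 - z) = 1 - z ^+ Q.
  rewrite -big_distrl/=; elim: Q => [|Q IH]; first by rewrite big_ord0 mul0r expr0 subrr.
  by rewrite big_ord_recr/= mulrDl IH exprS; ring.
apply: (le_tr (1 - z ^+ Q)); last by rewrite gerBl exprn_ge0.
rewrite -h -mulrA mulr_natl -[X in _ *+ X]card_ord -sumr_const; apply: ler_sum => i _.
by rewrite mulrC ler_wpM2r ?subr_ge0// ler_wiXn2l// ltnW.
Qed.

(* Pointwise bounds of the derivatives of order at most 3 of [zf ^+ (8 Q)]: each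
   factor [sin] gains [Q^(-1/2)] and each factor [1 - zf] gains [Q^-1]. *)
Section Bounds.
Variables (Q : nat) (r : R).
Hypotheses (Q0 : (0 < Q)%N) (r0 : 0 < r) (rQ : r ^+ 2 = Q%:R).
Notation m := (8 * Q)%N.

Lemma sf_pow_le t x : `|sf t x| * zf t x ^+ (2 * Q) <= 2 / r * zf t x ^+ Q.
Proof.
have /andP[z0 z1] := zf_itv t x.
rewrite -(@ler_pXn2r _ 2) ?nnegrE ?mulr_ge0 ?exprn_ge0 ?divr_ge0 ?invr_ge0 ?(ltW r0)//.
have -> : (2 / r * zf t x ^+ Q) ^+ 2 = 4 / Q%:R * (zf t x ^+ Q) ^+ 2 by rewrite -rQ; field; rewrite gt_eqF.
rewrite exprMn -normrX ger0_norm ?sqr_ge0// sf2 -[_ ^+ (2 * Q) ^+ 2]exprM.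
have h := onem_pow_le t x Q; have Qp : 0 < Q%:R :> R by rewrite ltr0n.
rewrite (_ : (2 * Q * 2)%N = (Q + (3 * Q))%N); last by lia.
rewrite exprD (_ : 4 * zf t x * _ * _ = 4 / Q%:R * (Q%:R * (1 - zf t x) * zf t x ^+ Q) * (zf t x ^+ (3 * Q) * zf t x)); last first.
  by field; rewrite gt_eqF.
rewrite -[4 / Q%:R in leRHS]mulr1.
apply: ler_pM; rewrite ?mulr_ge0 ?exprn_ge0 ?subr_ge0 ?ler0n ?invr_ge0//.
  by apply: ler_wpM2l => //; rewrite divr_ge0.
rewrite -exprM -exprSr; apply: zf_pow_le; lia.
Qed.

Lemma sf_onem_le t x : `|sf t x| * (1 - zf t x) * zf t x ^+ (3 * Q) <= 2 / r ^+ 3 * zf t x ^+ Q.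
Proof.
have /andP[z0 z1] := zf_itv t x.
have h := onem_pow_le t x Q; have Qp : 0 < Q%:R :> R by rewrite ltr0n.
rewrite (_ : (3 * Q)%N = (Q + 2 * Q)%N); last by lia.
rewrite exprD (_ : _ * _ = (Q%:R * (1 - zf t x) * zf t x ^+ Q) * (`|sf t x| * zf t x ^+ (2 * Q)) / Q%:R); last first.
  by field; rewrite gt_eqF.
rewrite ler_pdivrMr//; apply: (le_trans (y := 1 * (2 / r * zf t x ^+ Q))).
  by apply: ler_pM => //; rewrite ?mulr_ge0 ?exprn_ge0 ?subr_ge0//; exact: sf_pow_le.
by rewrite -rQ; apply: le_of_eq; field; rewrite gt_eqF.
Qed.

(** Derivatives of orders 0 to 3 of [zf ^ (8 Q)] with respect to the phase. The exponent [8 Q]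
    leaves spare factors [zf ^ Q] to be spent on the gains, while [zf ^ Q] survives as the common
    majorant. *)
Definition P0 := P m.
Definition P1 := scl (- (m%:R / 2)) (Sn m.-1).
Definition P2 := scl (m%:R * (m%:R - 2^-1)) (P m.-1) ++ scl (- m%:R ^+ 2) (P m).
Definition P3 := scl (- (m%:R * (m%:R - 2^-1) * (m%:R - 1) / 2)) (Sn m.-2) ++ scl (m%:R ^+ 3 / 2) (Sn m.-1).

Let mE : m%:R = 8 * Q%:R :> R. Proof. by rewrite natrM. Qed.
Let Q1 : 1 <= Q%:R :> R. Proof. by rewrite ler1n. Qed.
Let rS : m.-1.+1 = m. Proof. by rewrite prednK// muln_gt0. Qed.
Let m1R : m.-1%:R = m%:R - 1 :> R.
Proof. by rewrite -[in RHS]rS -natr1 addrK. Qed.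

Lemma D_P0 d t x : ev (D d P0) t x = fr d m1 * ev P1 t x.
Proof. by rewrite ev_D_P ev_scl; ring. Qed.

Lemma D_P1 d t x : ev (D d P1) t x = fr d m1 * ev P2 t x.
Proof. by rewrite /P1 /P2 ev_D_scl ev_D_Sn ev_cat !ev_scl rS m1R; field. Qed.

Lemma D_P2 d t x : ev (D d P2) t x = fr d m1 * ev P3 t x.
Proof. by rewrite /P2 /P3 ev_D_cat !ev_D_scl !ev_D_P ev_cat !ev_scl m1R; field. Qed.

Lemma P0_le t x : `|ev P0 t x| <= zf t x ^+ Q.
Proof. by rewrite ev_P ger0_norm ?zf_pow_ge0//; apply: zf_pow_le; lia. Qed.

Lemma P1_le t x : `|ev P1 t x| <= 9 * r * zf t x ^+ Q.
Proof.
apply: (le_tr (8 * r * zf t x ^+ Q)); last by rewrite ler_wpM2r ?zf_pow_ge0 ?ler_wpM2r ?(ltW r0) ?ler_nat.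
rewrite /P1 ev_scl ev_Sn normrM normrN [`|_ / 2|]ger0_norm ?divr_ge0// normrM.
have h := sf_pow_le t x; have hz : zf t x ^+ m.-1 <= zf t x ^+ (2 * Q) by apply: zf_pow_le; lia.
rewrite [`|_ ^+ _|]ger0_norm ?zf_pow_ge0// mE -rQ.
apply: (le_tr (8 * r ^+ 2 / 2 * (2 / r * zf t x ^+ Q))); last first.
  by apply: le_of_eq; field; rewrite gt_eqF.
apply: ler_wpM2l; first by have := sqr_ge0 r; lra.
by apply: le_trans h; rewrite ler_wpM2l.
Qed.

Lemma P2_le t x : `|ev P2 t x| <= (9 * r) ^+ 2 * zf t x ^+ Q.
Proof.
(* [68 = 64 + 4] comes from the two terms below. The bounds with [8], [68] and [608] are all relaxed
   to powers of [9], so that one weight [9 r] per derivative serves every order. *)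
apply: (le_tr (68 * r ^+ 2 * zf t x ^+ Q)).
  2: by rewrite [(9 * r) ^+ _]exprMn; apply: ler_wpM2r; [exact: zf_pow_ge0|apply: ler_wpM2r; [exact: sqr_ge0|lra]].
have /andP[z0 z1] := zf_itv t x.
rewrite /P2 ev_cat !ev_scl !ev_P.
rewrite (_ : _ + _ = m%:R ^+ 2 * ((1 - zf t x) * zf t x ^+ m.-1) - m%:R / 2 * zf t x ^+ m.-1); last first.
  have -> : zf t x ^+ m = zf t x * zf t x ^+ m.-1 by rewrite -exprS rS.
  by field.
have a : (1 - zf t x) * zf t x ^+ m.-1 <= Q%:R^-1 * zf t x ^+ Q.
  have h := onem_pow_le t x Q; have Qp : 0 < Q%:R :> R by rewrite ltr0n.
  have hz : zf t x ^+ m.-1 <= zf t x ^+ Q * zf t x ^+ Q by rewrite -exprD; apply: zf_pow_le; lia.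
  apply: (le_tr ((1 - zf t x) * (zf t x ^+ Q * zf t x ^+ Q))); first by rewrite ler_wpM2l ?subr_ge0.
  rewrite mulrA ler_wpM2r ?zf_pow_ge0// -[leRHS]mulr1 mulrC ler_pdivlMl ?mulrA//.
  by rewrite -mulrA mulrC; lra.
have b : zf t x ^+ m.-1 <= zf t x ^+ Q by apply: zf_pow_le; lia.
have b0 := zf_pow_ge0 t x m.-1.
apply: le_trans (ler_normB _ _) _; rewrite !ger0_norm ?mulr_ge0 ?divr_ge0 ?sqr_ge0 ?subr_ge0//.
rewrite mE rQ.
apply: (le_tr ((8 * Q%:R) ^+ 2 * (Q%:R^-1 * zf t x ^+ Q) + 8 * Q%:R / 2 * zf t x ^+ Q)).
  by apply: lerD; apply: ler_wpM2l; rewrite ?sqr_ge0 ?divr_ge0 ?mulr_ge0.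
apply: le_of_eq; field.
by rewrite gt_eqF// (lt_le_trans ltr01 Q1).
Qed.

Lemma P3_le t x : `|ev P3 t x| <= (9 * r) ^+ 3 * zf t x ^+ Q.
Proof.
apply: (le_tr (512 * (1 + 3 / 16) * r ^+ 3 * zf t x ^+ Q)).
  2: by rewrite [(9 * r) ^+ _]exprMn; apply: ler_wpM2r; [exact: zf_pow_ge0|apply: ler_wpM2r; [exact/exprn_ge0/ltW|lra]].
have /andP[z0 z1] := zf_itv t x.
rewrite /P3 ev_cat !ev_scl !ev_Sn.
have rS2 : m.-1 = m.-2.+1 by lia.
rewrite (_ : _ + _ = sf t x / 2 * (m%:R ^+ 3 * (zf t x - 1) + 3 / 2 * m%:R ^+ 2 - m%:R / 2) * zf t x ^+ m.-2); last first.
  have -> : zf t x ^+ m.-1 = zf t x * zf t x ^+ m.-2 by rewrite -exprS -rS2.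
  by field.
have h1 := sf_pow_le t x; have h2 := sf_onem_le t x.
have hz2 : zf t x ^+ m.-2 <= zf t x ^+ (2 * Q) by apply: zf_pow_le; lia.
have hz3 : zf t x ^+ m.-2 <= zf t x ^+ (3 * Q) by apply: zf_pow_le; lia.
rewrite normrM [`|_ ^+ _|]ger0_norm ?zf_pow_ge0// normrM normrM [`|2^-1|]ger0_norm ?invr_ge0//.
apply: (le_tr (`|sf t x| * 2^-1 * (m%:R ^+ 3 * (1 - zf t x) + 3 / 2 * m%:R ^+ 2) * zf t x ^+ m.-2)).
  apply: ler_wpM2r; first exact: zf_pow_ge0.
  apply: ler_wpM2l; first by rewrite mulr_ge0.
  have M1 : 1 <= m%:R :> R by rewrite ler1n muln_gt0.
  have A : 0 <= m%:R ^+ 3 * (1 - zf t x) by rewrite mulr_ge0 ?exprn_ge0 ?subr_ge0.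
  have B : m%:R / 2 <= 3 / 2 * m%:R ^+ 2 :> R by rewrite expr2; nra.
  rewrite (_ : zf t x - 1 = - (1 - zf t x)); last by ring.
  by rewrite mulrN ler_norml; apply/andP; split; lra.
rewrite (_ : _ * _ = m%:R ^+ 3 / 2 * (`|sf t x| * (1 - zf t x) * zf t x ^+ m.-2) + 3 / 4 * m%:R ^+ 2 * (`|sf t x| * zf t x ^+ m.-2)); last by field.
have k1 : `|sf t x| * (1 - zf t x) * zf t x ^+ m.-2 <= 2 / r ^+ 3 * zf t x ^+ Q.
  by apply: le_trans h2; rewrite ler_wpM2l// mulr_ge0// subr_ge0.
have k2 : `|sf t x| * zf t x ^+ m.-2 <= 2 / r * zf t x ^+ Q by apply: le_trans h1; rewrite ler_wpM2l.
apply: (le_tr (m%:R ^+ 3 / 2 * (2 / r ^+ 3 * zf t x ^+ Q) + 3 / 4 * m%:R ^+ 2 * (2 / r * zf t x ^+ Q))).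
  by apply: lerD; apply: ler_wpM2l; rewrite ?divr_ge0 ?mulr_ge0 ?exprn_ge0.
by rewrite mE -rQ; apply: le_of_eq; field; rewrite gt_eqF.
Qed.

Section ProfMaj.
Variables (I : Type) (dv : I -> option ivec) (wt : I -> R).
Hypothesis hwt : forall i, `|fr (dv i) m1| * (9 * r) <= wt i.

Lemma maj_D n B B' th F G : (forall t x, 0 <= th t x) -> 0 <= B' ->
  (forall t x, `|ev F t x| <= B * th t x) -> B' <= B * (9 * r) ->
  (forall d t x, ev (D d F) t x = fr d m1 * ev G t x) -> maj dv wt n B' th G -> 0 <= B ->
  maj dv wt n.+1 B th F.
Proof.
move=> th0 B'0 h0 BB hD hG B0; split => // i.
have wt0 j : 0 <= wt j by apply: le_trans (hwt j); rewrite mulr_ge0 ?mulr_ge0 ?(ltW r0).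
apply: (maj_ext (F := scl (fr (dv i) m1) G)) => [t x|]; first by rewrite ev_scl hD.
apply: maj_leB (maj_scl _ hG) => //.
apply: (le_tr (`|fr (dv i) m1| * (B * (9 * r)))); first by rewrite ler_wpM2l.
by rewrite mulrCA ler_wpM2l.
Qed.

Lemma maj_P : maj dv wt 3 1 (fun t x => zf t x ^+ Q) P0.
Proof.
have th0 t x := zf_pow_ge0 t x Q.
have h9 : 0 <= 9 * r by rewrite mulr_ge0 ?(ltW r0).
apply: (maj_D (B' := 9 * r) th0 h9 _ _ D_P0) => //; rewrite ?mul1r//.
  by move=> t x; rewrite mul1r P0_le.
apply: (maj_D (B' := (9 * r) ^+ 2) th0 (exprn_ge0 2 h9) P1_le _ D_P1) => //.
apply: (maj_D (B' := (9 * r) ^+ 3) th0 (exprn_ge0 3 h9) P2_le _ D_P2) => //.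
  by rewrite [leLHS]exprSr.
  2: exact: exprn_ge0.
split=> //; exact: P3_le.
Qed.

End ProfMaj.
End Bounds.

Lemma nA_P n : nA (P n) <= 1.
Proof.
elim: n => [|n IH] /=; first by rewrite /nA big_cons big_nil normr1 addr0.
apply: le_trans (nA_mul _ _) _; apply: mulr_ile1; rewrite ?nA_ge0//.
by rewrite /nA !big_cons big_nil/= !ger0_norm ?invr_ge0//; lra.
Qed.

Lemma dgm_P (L : R) n : dgm L m1 -> all (dgm (n%:R * L)) (P n).
Proof.
move=> hL; have L0 : 0 <= L by have /andP[_] := hL; apply: le_trans.
have h0 (c : R) : dgm L (Mono c 0 0 0).
  by apply/andP; split; [apply/forallP => j; rewrite mxE normr0|rewrite /= normr0].
elim: n => [|n IH] /=.
  rewrite mul0r andbT; apply/andP; split; [apply/forallP => j; rewrite mxE normr0//|by rewrite /= normr0].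
rewrite -natr1 mulrDl mul1r addrC; apply: all_mul => //=; rewrite andbT h0/=.
exact: hL.
Qed.

Lemma bdd_P (L : R) n : dgm L m1 -> bdd (n%:R * L + 1) (P n).
Proof.
move=> hL; have L0 : 0 <= L by have /andP[_] := hL; apply: le_trans.
split; first by apply: le_trans (nA_P n) _; rewrite lerDr mulr_ge0.
by apply: dgm_le (dgm_P n hL); rewrite lerDl.
Qed.

Lemma all_mulP (p q r : pred (mono R)) F G : (forall m m', p m -> q m' -> all r (mulm m m')) ->
  all p F -> all q G -> all r (mul F G).
Proof.
move=> h; elim: F => //= m F IH /andP[pm pF] qG; rewrite /mul/= all_cat [X in _ && X]IH// andbT.
by elim: (G) qG => //= m' G' IH' /andP[qm qG]; have /= /and3P[-> -> _] := h _ _ pm qm; rewrite /= IH'.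
Qed.

Lemma multiple_mul (sg : R) e F G : all (multiple sg e) F -> all (multiple sg e) G -> all (multiple sg e) (mul F G).
Proof.
apply: all_mulP => m' m'' /asboolP[z' hz'] /asboolP[z'' hz''].
apply/and3P; split=> //; apply/asboolP => /=.
  by exists (z' + z''); rewrite /kd rvD dotDl -!/(kd R _ _) hz' hz'' intrD mulrDr.
by exists (z' - z''); rewrite /kd rvB dotBl -!/(kd R _ _) hz' hz'' intrB mulrBr.
Qed.

Lemma multiple_P (sg : R) e n : multiple sg e m1 -> all (multiple sg e) (P n).
Proof.
move=> hk; elim: n => [|n IH] /=.
  by rewrite andbT; apply/asboolP; exists 0; rewrite /kd rv0 dot0l mulr0.
apply: multiple_mul => //=; rewrite andbT; apply/andP; split.
  by apply/asboolP; exists 0; rewrite /kd rv0 dot0l mulr0.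
by move/asboolP: hk => [z hz]; apply/asboolP; exists z.
Qed.

End Phase.

(** The mean of [cos ^ (2 n)] over a period, [(2 n - 1)!! / (2 n)!!], of order [n ^ (-1/2)]. *)
Definition wal n : R := \prod_(i < n) ((2 * i%:R + 1) / (2 * i%:R + 2)).

Lemma wal_gt0 n : 0 < wal n.
Proof. by apply: prodr_gt0 => i _; rewrite divr_gt0// ltr_wpDl// mulr_ge0. Qed.

Lemma walS n : wal n.+1 = wal n * ((2 * n%:R + 1) / (2 * n%:R + 2)).
Proof. by rewrite /wal big_ord_recr. Qed.

(** The left side decreases in [n], as [(2 n + 1) (2 n + 3) <= (2 n + 2) ^ 2]. In the companion
    lower bound [wal n ^ 2 * 4 n] increases from its value 1 at [n = 1]. *)
Lemma wal_ub n : wal n ^+ 2 * (2 * n%:R + 1) <= 1.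
Proof.
elim: n => [|n IH]; first by rewrite /wal big_ord0 expr1n mulr0 add0r mulr1.
apply: le_trans IH; rewrite walS exprMn -mulrA ler_wpM2l ?sqr_ge0// -natr1.
have n0 : 0 <= n%:R :> R by [].
rewrite expr_div_n mulrAC ler_pdivrMr; last by rewrite exprn_gt0//; lra.
have : (2 * n%:R + 1) * ((2 * n%:R + 1) * (2 * (n%:R + 1) + 1)) <= (2 * n%:R + 1) * (2 * n%:R + 2) ^+ 2 :> R.
  by rewrite ler_wpM2l; [|lra|rewrite expr2; nra].
by move=> h; apply: le_trans h; apply: le_of_eq; ring.
Qed.

Lemma wal_lb n : (0 < n)%N -> 1 <= wal n ^+ 2 * (4 * n%:R).
Proof.
case: n => // n _; elim: n => [|n IH].
  by rewrite /wal big_ord_recl big_ord0 /= !mulr0 !add0r !mulr1 expr_div_n expr1n; lra.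
apply: le_trans IH _; rewrite [in leRHS]walS exprMn -[leRHS]mulrA ler_wpM2l ?sqr_ge0//.
have n0 : 0 <= n%:R :> R by [].
rewrite -!natr1 expr_div_n mulrAC ler_pdivlMr; last by rewrite exprn_gt0//; lra.
by rewrite !expr2; nra.
Qed.

(** The derivative along [e] of [Sn n] times [G] integrates to zero. As [G] is constant along [e],
    this is the recursion of [wal]; it also factorizes integrals of products over the three
    directions. *)
Lemma ti_P k o e n G t : fr (Some e) (m1 k o) != 0 -> (forall x, ev (Dx e G) t x = 0) ->
  ti (ev (mul (P k o n) G) t) = wal n * ti (ev G t).
Proof.
move=> k0 hG; elim: n => [|n IH].
  rewrite /wal big_ord0 mul1r; apply: eq_ti => x; by rewrite ev_mul ev_P expr0 mul1r.
rewrite walS mulrAC -IH.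
have /eqP := ti_Dx e (mul (Sn k o n) G) t.
rewrite (eq_ti (fun x => fr (Some e) (m1 k o) * ((2 * n%:R + 2) * ev (mul (P k o n.+1) G) t x - (2 * n%:R + 1) * ev (mul (P k o n) G) t x))) => [|x]; last first.
  by rewrite ev_D_mul hG mulr0 addr0 ev_D_Sn !ev_mul; ring.
have c F : CP (ev F t) by exact: CP_ev.
rewrite tiZ; last by apply: CPB; exact: CPZ.
rewrite tiB ?tiZ//; try exact: CPZ.
rewrite mulf_eq0 (negbTE k0)/= subr_eq0 => /eqP h.
have n2 : 2 * n%:R + 2 != 0 :> R by rewrite gt_eqF// ltr_wpDl// mulr_ge0.
by apply: (mulfI n2); rewrite h; field.
Qed.

End Profile.

(** * One convex integration step in a lattice direction *)

Section Dirs.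
Variable R : realType.

(* [sv, yv, zv] is the basis of R^3 dual to [xi, et, ze]. *)
Record dirs := Dirs {xi : ivec; et : ivec; ze : ivec; sv : ivec; yv : ivec; zv : ivec}.

Record good (d : dirs) : Prop := Good {
  g_sx : kd R (sv d) (xi d) = 1; g_se : kd R (sv d) (et d) = 0; g_sz : kd R (sv d) (ze d) = 0;
  g_yx : kd R (yv d) (xi d) = 0; g_ye : kd R (yv d) (et d) = 1; g_yz : kd R (yv d) (ze d) = 0;
  g_zx : kd R (zv d) (xi d) = 0; g_ze : kd R (zv d) (et d) = 0; g_zz : kd R (zv d) (ze d) = 1;
  g_xi : small_vec (xi d); g_et : small_vec (et d); g_zeta : small_vec (ze d);
  g_sv : small_vec (sv d); g_yv : small_vec (yv d); g_zv : small_vec (zv d);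
  g_inj : forall k, kd R k (xi d) = 0 -> kd R k (et d) = 0 -> kd R k (ze d) = 0 -> k = 0 }.

(** [et] and [ze] complete [xi] to a basis of the integer lattice. The dual basis is then integral
    too, so functions of the dual coordinates are periodic on the torus, and all entries stay in
    [{-1, 0, 1}]. *)
Definition mkdir (i j l : 'I_3) (s : int) : dirs :=
  Dirs (ee i + s *: ee j) (- s *: ee j) (ee l) (ee i) (ee i - s *: ee j) (ee l).

Lemma good_mkdir (i j l : 'I_3) (s : int) : s = 1 \/ s = -1 -> i != j -> i != l -> j != l ->
  good (mkdir i j l s).
Proof.
move=> hs ij il jl.
have s1 : (s%:~R * s%:~R = 1 :> R) by case: hs => ->; rewrite ?mulr1 ?mulrNN ?mulr1.
have eqC : ((j == i) = false) * ((l == i) = false) * ((l == j) = false) * ((i == j) = false) * ((i == l) = false) * ((j == l) = false).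
  by rewrite ![_ == i]eq_sym [l == j]eq_sym (negbTE ij) (negbTE il) (negbTE jl).
have db (a b : 'I_3) : dot (basis R a) (basis R b) = (a == b)%:R.
  rewrite dot3 !mxE; case: (ord3P a); case: (ord3P b); rewrite ?eqxx ?ordE /=; ring.
have rvZ (z : int) (k : ivec) : rv R (z *: k) = z%:~R *: rv R k.
  by apply/rowP => m; rewrite !mxE intrM.
have kE (k : ivec) (b : 'I_3) : dot (rv R k) (basis R b) = (k 0 b)%:~R by rewrite -rv_delta -kd_delta.
have sm1 (a : 'I_3) : small_vec (ee a) by move=> m; rewrite mxE; case: (_ && _).
have sm2 (a b : 'I_3) (z : int) : a != b -> z = 1 \/ z = -1 -> small_vec (ee a + z *: ee b).
  move=> ab hz m; rewrite !mxE /=; case: (ord3P m) ab; case: (ord3P a); case: (ord3P b); rewrite ?eqxx ?ordE //=; case: hz => ->; by rewrite ?mulr1 ?mulr0 ?addr0 ?add0r.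
have hs' : - s = 1 \/ - s = -1 by case: hs => ->; [right|left].
split; rewrite /= /kd ?rvD ?rvN ?rvZ ?rv_delta ?dotDl ?dotDr ?dotNl ?dotNr ?dotZl ?dotZr ?db ?eqxx ?eqC /= ?intrN; rewrite ?dotZl ?dotZr ?dotNl ?db ?eqxx ?eqC/=; try ring.
- by rewrite !mulr0 !mulr1 s1 oppr0 addr0 sub0r subrr.
- by rewrite mulr1 mulr0 sub0r mulrN opprK s1.
- exact: sm2.
- by move=> m; have := sm1 j m; rewrite !mxE; case: (_ && _); case: hs' => ->; rewrite ?mulr1 ?mulr0.
- exact: sm1.
- exact: sm1.
- rewrite -scaleNr; exact: sm2.
- exact: sm1.
move=> k; rewrite dotDr !dotZr !kE => h1 h2 h3.
have kj : (k 0 j)%:~R = 0 :> R.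
  by apply/eqP; move/eqP: h2; rewrite mulf_eq0 oppr_eq0 intr_eq0; case: hs => ->; rewrite ?oppr_eq0 oner_eq0.
have ki : (k 0 i)%:~R = 0 :> R by move: h1; rewrite kj mulr0 addr0.
apply/rowP => m; rewrite mxE; apply/eqP; rewrite -(intr_eq0 R).
have : [|| m == i, m == j | m == l].
  by case: (ord3P m) ij il jl; case: (ord3P i); case: (ord3P j); case: (ord3P l).
by case/or3P => /eqP ->; apply/eqP.
Qed.

End Dirs.

Section Blocks.
Variable R : realType.
Notation pt := (point R).
Notation tp := (seq (mono R)).
Implicit Types (F G H : tp) (t s : R) (x : pt) (e : ivec) (m : mono R) (n Q : nat).

Lemma kdMn (k e : ivec) n : kd R (k *+ n) e = n%:R * kd R k e.
Proof.
rewrite /kd -dotZl; congr dot; apply/rowP => i; rewrite !mxE; elim: n => [|n IH].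
  by rewrite mulr0n mxE mul0r.
by rewrite mulrS mxE intrD IH -natr1; ring.
Qed.

Lemma ev_Ddir e F t x : \sum_(j < 3) rv R e 0 j * ev (dj j F) t x = ev (D (Some e) F) t x.
Proof.
under eq_bigr do rewrite ev_D big_distrr/=.
rewrite exchange_big ev_D; apply: eq_bigr => m _ /=.
rewrite sum3 !kd_delta /kd dot3 !mxE; ring.
Qed.

(** By the antidivergence applied to the vector with all components [F], everything in [F] except
    its zero mode is a divergence. *)
Lemma ti_mn F t x : ti (ev F t) = tpi ^+ 3 * ev (mn F) t x.
Proof.
rewrite (eq_ti (fun y => ev (mn F) t y + \sum_(j < 3) ev (dj j (Rop (fun=> F) 0 j)) t y)) => [|y]; last first.
  by rewrite div_Rop addrC subrK.
have cR j : CP (fun y => ev (dj j (Rop (fun=> F) 0 j)) t y) by exact: CP_ev.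
rewrite tiD; [|exact: CP_ev|by apply: CP_sum].
rewrite [X in _ + X](_ : _ = 0) ?addr0; last by rewrite ti_sum// big1// => j _; exact: ti_Dx.
rewrite (eq_ti (fun _ => ev (mn F) t x)) => [|y]; last exact: ev_mn_cst.
by rewrite ti_cst mulrC.
Qed.

Inductive dix := Xi | Et | Ze | Ti | Ex of 'I_3.

(** * The perturbation in one direction and the stress that it produces *)

Section SubStep.
Variables (d : dirs) (N : nat) (a : tp) (nu : R).
Hypothesis gd : good R d.
Hypothesis N1 : (0 < N)%N.

Definition dv (i : dix) : option ivec :=
  match i with Xi => Some (xi d) | Et => Some (et d) | Ze => Some (ze d) | Ti => None | Ex j => Some (ee j) end.
Notation Df i := (D (dv i)).

Definition X : R := N%:R.
(** [nn] is the exponent along the motion, [Qn] the one across it. At base frequency [N], a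
    derivative of the profile costs [N ^ 7] along and [N ^ 9] across. The weaker concentration along
    the motion keeps time derivatives at [N ^ 12 * N ^ 7]. *)
Definition Qn := (N ^ 16)%N.
Definition nn := (N ^ 12)%N.
Definition k1 := sv d *+ N.
(** Together with [k1] this is the phase [N (sv . x - N ^ 12 t)]. As [sv . xi = 1] and [xi] is
    orthogonal to [yv] and [zv], the whole profile moves with velocity [N ^ 12 xi]. *)
Definition o1 : R := - (X * X ^+ 12).
Definition k2 := yv d *+ N.
Definition k3 := zv d *+ N.
Definition kL := yv d *+ (N ^ 10).
Definition kL2 := yv d *+ (2 * N ^ 10).
Definition Lam : R := X ^+ 10.

(** Normalizes the mean of [Th ^ 2] to 1; squaring doubles the exponents [8 nn] and [8 Qn] of
    [Th]. *)
Definition Bn : R := Num.sqrt (wal R (16 * nn) * (wal R (16 * Qn) * wal R (16 * Qn)))^-1.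
Definition Pr (c1 c2 c3 : nat) := mul (P k1 o1 c1) (mul (P k2 (0 : R) c2) (P k3 (0 : R) c3)).
Definition Th := scl Bn (Pr (8 * nn) (8 * Qn) (8 * Qn)).
(** Common majorant of [Th] and its derivatives, with the lowered exponents that [maj_P]
    provides. *)
Definition tht := scl Bn (Pr nn Qn Qn).
Definition th t x : R := ev tht t x.
Definition cosL := cosm kL (0 : R).
Definition cos2L := cosm kL2 (0 : R).
Definition aa := mul a a.
Definition b := mul a Th.
Definition ThTh := mul Th Th.
Definition bb := mul b b.
(** Potential of the main perturbation: two derivatives along [et] restore [sqrt 2 a Th cos (Lam y)]
    to leading order. The factor [sqrt 2] compensates the mean [1/2] of the squared cosine. *)
Definition c := scl (- (Num.sqrt 2 / Lam ^+ 2)) (mul b cosL).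

Definition xr i : R := rv R (xi d) 0 i.
Definition er i : R := rv R (et d) 0 i.
Definition zr i : R := rv R (ze d) 0 i.

(** [xi D_et - et D_xi] applied to [D_et c] is divergence free for any [c]. The second part is small
    since derivatives along [xi] never meet the fast oscillation. *)
Definition wp i := scl (xr i) (Df Et (Df Et c)) ++ scl (- er i) (Df Xi (Df Et c)).
(** Because the profile travels, the fast part of the time derivative of [FF] is
    [- aa D_xi (Th ^ 2)]: the part of the force, along [xi], that no antidivergence could make
    small. *)
Definition FF := scl (X ^+ 12)^-1 (mul aa ThTh).
Definition pp := Df Xi (il FF).
Definition wt i := (scl (xr i) FF ++ scl (- xr i) (mn FF)) ++ Df (Ex i) pp.
Definition w i := wp i ++ wt i.

Definition lapl F := Df (Ex 0) (Df (Ex 0) F) ++ (Df (Ex 1) (Df (Ex 1) F) ++ Df (Ex 2%:R) (Df (Ex 2%:R) F)).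
(** A symmetric tensor whose divergence is the operator that builds [wp] from [c]. The linear terms
    of [wp] thus get an explicit stress with one derivative less. *)
Definition Sc F i j := scl (xr i * er j + er i * xr j) (Df Et F) ++ scl (- (2 * er i * er j)) (Df Xi F).
Definition f0 := Df Ti c ++ scl (- nu) (lapl c).
(** The tensor square of [xi D_et - et D_xi] applied to [G]: symmetric and divergence free. With
    [G = ct] it removes the part of the squared perturbation that oscillates at the double
    frequency. *)
Definition DF G i j := scl (xr i * xr j) (Df Et (Df Et G)) ++
  (scl (- (xr i * er j + er i * xr j)) (Df Xi (Df Et G)) ++ scl (er i * er j) (Df Xi (Df Xi G))).
Definition ct := scl (- (4 * Lam ^+ 2)^-1) (mul bb cos2L).
Definition q := ThTh ++ scl (-1) (one R).
Definition fx := Df Xi aa.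
(** [q] has zero mean; [qx], [qe], [qz] are antiderivatives of its parts along the three basis
    directions, each taken after averaging in the preceding ones. *)
Definition qx := pr (xi d) q.
Definition qe := pr (et d) (av (xi d) q).
Definition qz := pr (ze d) (av (et d) (av (xi d) q)).
(** Antidivergence of the slow-times-fast force [xi fx q]. In the remainder [lo] the derivative has
    moved onto [fx]; with the slow time derivative [hh] it forms [gg], already small, for which the
    general [Rop] is enough. *)
Definition T1 i j := scl (xr i * xr j) (mul fx qx) ++
  (scl (xr i * er j + er i * xr j) (mul fx qe) ++ scl (xr i * zr j + zr i * xr j) (mul fx qz)).
Definition lo i := scl (xr i) (mul (Df Xi fx) qx ++ (mul (Df Et fx) qe ++ mul (Df Ze fx) qz)) ++
  (scl (er i) (mul (Df Xi fx) qe) ++ scl (zr i) (mul (Df Xi fx) qz)).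
Definition hh := scl (X ^+ 12)^-1 (mul (Df Ti aa) ThTh).
Definition gg i := scl (-1) (lo i) ++ scl (xr i) hh.
Definition T2 := Rop gg.
Definition S4 i j := scl (xr i) (Df (Ex j) FF) ++ scl (xr j) (Df (Ex i) FF).
(** In order: evolution of [wp], correction of the mean square, removal of the double frequency,
    viscosity of [wt], slow-times-fast force, remainder. *)
Definition Sh i j := Sc f0 i j ++ (scl (- (xr i * xr j)) (bb ++ scl (-1) aa) ++ (scl (-1) (DF ct i j) ++
  (scl (- nu) (S4 i j) ++ (T1 i j ++ T2 i j)))).
Definition ppi := scl (-1) (Df Ti pp) ++ (scl nu (lapl pp) ++ scl (- nu) (Df Xi FF)).

Lemma ev_xi F t x : xr 0 * ev (Df (Ex 0) F) t x + xr 1 * ev (Df (Ex 1) F) t x + xr 2%:R * ev (Df (Ex 2%:R) F) t x = ev (Df Xi F) t x.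
Proof. by rewrite -[RHS]ev_Ddir sum3. Qed.
Lemma ev_et F t x : er 0 * ev (Df (Ex 0) F) t x + er 1 * ev (Df (Ex 1) F) t x + er 2%:R * ev (Df (Ex 2%:R) F) t x = ev (Df Et F) t x.
Proof. by rewrite -[RHS]ev_Ddir sum3. Qed.
Lemma ev_ze F t x : zr 0 * ev (Df (Ex 0) F) t x + zr 1 * ev (Df (Ex 1) F) t x + zr 2%:R * ev (Df (Ex 2%:R) F) t x = ev (Df Ze F) t x.
Proof. by rewrite -[RHS]ev_Ddir sum3. Qed.

Lemma ev_lapl F t x : ev (lapl F) t x = \sum_(j < 3) ev (Df (Ex j) (Df (Ex j) F)) t x.
Proof. by rewrite sum3 !ev_cat addrA. Qed.

Lemma ev_lapl_ext F G : (forall t x, ev F t x = ev G t x) -> forall t x, ev (lapl F) t x = ev (lapl G) t x.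
Proof. by move=> FG t x; rewrite !ev_lapl; apply: eq_bigr => j _; do 2!apply: ev_D_ext => ? ?. Qed.

Lemma ev_lapl_cat F G t x : ev (lapl (F ++ G)) t x = ev (lapl F) t x + ev (lapl G) t x.
Proof. by rewrite !ev_lapl -big_split; apply: eq_bigr => j _; rewrite !D_cat ev_cat. Qed.

Lemma ev_D_scl2 o o' r F t x : ev (D o (D o' (scl r F))) t x = r * ev (D o (D o' F)) t x.
Proof. by rewrite (ev_D_ext o (fun u y => etrans (ev_D_scl o' r F u y) (esym (ev_scl r (D o' F) u y)))) ev_D_scl. Qed.

Lemma ev_lapl_scl r F t x : ev (lapl (scl r F)) t x = r * ev (lapl F) t x.
Proof. by rewrite !ev_lapl big_distrr; apply: eq_bigr => j _; rewrite ev_D_scl2. Qed.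

Lemma ev_D_lapl o F t x : ev (D o (lapl F)) t x = ev (lapl (D o F)) t x.
Proof.
rewrite !D_cat !ev_cat; congr (_ + (_ + _)); by rewrite ev_DC; apply: ev_D_ext => u y; rewrite ev_DC.
Qed.

Lemma div_Sc F i t x :
  \sum_(j < 3) ev (Df (Ex j) (Sc F i j)) t x = xr i * ev (Df Et (Df Et F)) t x - er i * ev (Df Xi (Df Et F)) t x.
Proof.
under eq_bigr do rewrite ev_D_cat !ev_D_scl.
rewrite sum3 -(ev_et (Df Et F)) -(ev_xi (Df Et F)).
have e := ev_et (Df Xi F) t x; rewrite [RHS in _ = RHS]ev_DC -ev_xi in e.
have {}e : er 0 * ev (Df (Ex 0) (Df Xi F)) t x + er 1 * ev (Df (Ex 1) (Df Xi F)) t x + er 2%:R * ev (Df (Ex 2%:R) (Df Xi F)) t x = xr 0 * ev (Df (Ex 0) (Df Et F)) t x + xr 1 * ev (Df (Ex 1) (Df Et F)) t x + xr 2%:R * ev (Df (Ex 2%:R) (Df Et F)) t x by exact: e.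
move: e; set u := _ + _; set v := _ + _ => e.
transitivity (xr i * (er 0 * ev (Df (Ex 0) (Df Et F)) t x + er 1 * ev (Df (Ex 1) (Df Et F)) t x + er 2%:R * ev (Df (Ex 2%:R) (Df Et F)) t x) - er i * v - 2 * er i * (u - v)).
  by rewrite /u /v; ring.
by rewrite e subrr mulr0 subr0.
Qed.

Lemma div_DF G i t x : \sum_(j < 3) ev (Df (Ex j) (DF G i j)) t x = 0.
Proof.
under eq_bigr do rewrite !ev_D_cat !ev_D_scl.
rewrite sum3.
have e1 := ev_xi (Df Et (Df Et G)) t x.
have e2 := ev_et (Df Xi (Df Et G)) t x.
have e3 := ev_xi (Df Xi (Df Et G)) t x.
have e4 := ev_et (Df Xi (Df Xi G)) t x.
have e5 : ev (Df Et (Df Xi (Df Et G))) t x = ev (Df Xi (Df Et (Df Et G))) t x by rewrite ev_DC.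
have e6 : ev (Df Et (Df Xi (Df Xi G))) t x = ev (Df Xi (Df Xi (Df Et G))) t x by rewrite ev_DC; apply: ev_D_ext => u y; rewrite ev_DC.
rewrite e5 -e1 in e2; rewrite e6 -e3 in e4.
move: e2 e4; set A0 := ev _ _ _; set A1 := ev _ _ _; set A2 := ev _ _ _; set B0 := ev _ _ _; set B1 := ev _ _ _; set B2 := ev _ _ _.
set C0 := ev _ _ _; set C1 := ev _ _ _; set C2 := ev _ _ _ => e2 e4.
transitivity (xr i * (xr 0 * B0 + xr 1 * B1 + xr 2%:R * B2 - (er 0 * A0 + er 1 * A1 + er 2%:R * A2)) + er i * (er 0 * C0 + er 1 * C1 + er 2%:R * C2 - (xr 0 * A0 + xr 1 * A1 + xr 2%:R * A2))).
  ring.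
by rewrite e2 e4 !subrr !mulr0 addr0.
Qed.

Lemma ev_mn_cat F G t x : ev (mn (F ++ G)) t x = ev (mn F) t x + ev (mn G) t x.
Proof. by rewrite /mn mop_cat ev_cat. Qed.

Lemma ev_Dt_mn F t x : ev (Df Ti (mn F)) t x = ev (mn (Df Ti F)) t x.
Proof.
rewrite /mn D_mop /D mop_mop !ev_mop; apply: eq_bigr => m _ /=; rewrite addr0 add0r; ring.
Qed.

Lemma ev_wp_div t x : \sum_(j < 3) ev (Df (Ex j) (wp j)) t x = 0.
Proof.
under eq_bigr do rewrite ev_D_cat !ev_D_scl.
rewrite sum3.
have e1 := ev_xi (Df Et (Df Et c)) t x.
have e2 := ev_et (Df Xi (Df Et c)) t x.
have e5 : ev (Df Et (Df Xi (Df Et c))) t x = ev (Df Xi (Df Et (Df Et c))) t x by rewrite ev_DC.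
rewrite e5 -e1 in e2.
by transitivity (0 : R) => //; move: e2; lra.
Qed.

Lemma lapl_Lap F t x : ev (lapl F) t x = ev (Lap F) t x.
Proof.
rewrite ev_lapl /Lap; under eq_bigr do rewrite /= {2}/D D_mop ev_mop.
rewrite exchange_big ev_mop; apply: eq_bigr => m _ /=.
rewrite addr0 (eq_bigr (fun j => - (kd R (wv m) (ee j) ^+ 2 * (amp m * cos (phs m t x))))) => [|j _]; last first.
  rewrite addrA cosDpihalf sinDpihalf; ring.
rewrite sumrN -big_distrl/= sum3 !kd_delta /kd dot3 !mxE; ring.
Qed.

Lemma ev_wt_div t x : \sum_(j < 3) ev (Df (Ex j) (wt j)) t x = 0.
Proof.
under eq_bigr do rewrite ev_D_cat ev_D_cat ev_D_scl ev_D_scl ev_D_mn mulr0 addr0.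
rewrite big_split/= -[X in _ + X](ev_lapl pp) /pp -ev_D_lapl.
have -> : \sum_(j < 3) xr j * ev (Df (Ex j) FF) t x = ev (Df Xi FF) t x by rewrite -ev_xi sum3.
rewrite (ev_D_ext (dv Xi) (F := lapl (il FF)) (G := mn FF ++ scl (-1) FF)); last first.
  by move=> u y; rewrite lapl_Lap ev_Lap_il ev_sub.
by rewrite ev_D_cat ev_D_mn ev_D_scl; ring.
Qed.

Lemma w_div t x : \sum_(j < 3) ev (Df (Ex j) (w j)) t x = 0.
Proof. by under eq_bigr do rewrite ev_D_cat; rewrite big_split/= ev_wp_div ev_wt_div addr0. Qed.

Lemma w_mean i t : ti (ev (w i) t) = 0.
Proof.
have cp F : CP (ev F t) by exact: CP_ev.
rewrite (eq_ti (fun x => ev (wp i) t x + ev (wt i) t x)) => [|x]; last by rewrite ev_cat.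
rewrite tiD// (ti_mn (wp i) t 0) ev_mn_cat.
have mns r F : ev (mn (scl r F)) t 0 = r * ev (mn F) t 0.
  rewrite /mn /scl mop_mop !ev_mop big_distrr; apply: eq_bigr => m _ /=; rewrite !addr0; ring.
rewrite !mns !ev_mn_D !(mulr0, addr0) add0r (ti_mn (wt i) t 0) !ev_mn_cat (mns (xr i) FF) (mns (- xr i) (mn FF)) ev_mn_D addr0.
rewrite (_ : ev (mn (mn FF)) t 0 = ev (mn FF) t 0); first by ring.
by rewrite /mn mop_mop !ev_mop; apply: eq_bigr => m _ /=; case: eqP => _; rewrite !addr0 ?mulr1 ?mulr0.
Qed.

Lemma fr_Mn k o n e : fr (Some e) (m1 (k *+ n) o) = n%:R * kd R k e.
Proof. exact: kdMn. Qed.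

Lemma X_gt0 : 0 < X. Proof. by rewrite ltr0n. Qed.

Definition frE : (fr (dv Xi) (m1 k1 o1) = X) * (fr (dv Et) (m1 k1 o1) = 0) * (fr (dv Ze) (m1 k1 o1) = 0) *
  (fr (dv Xi) (m1 k2 (0 : R)) = 0) * (fr (dv Et) (m1 k2 (0 : R)) = X) * (fr (dv Ze) (m1 k2 (0 : R)) = 0) *
  (fr (dv Xi) (m1 k3 (0 : R)) = 0) * (fr (dv Et) (m1 k3 (0 : R)) = 0) * (fr (dv Ze) (m1 k3 (0 : R)) = X).
Proof.
rewrite !fr_Mn (g_sx gd) (g_se gd) (g_sz gd) (g_yx gd) (g_ye gd) (g_yz gd) (g_zx gd) (g_ze gd) (g_zz gd).
by rewrite !mulr1 !mulr0.
Qed.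

Lemma D_P0' o k om n t x : fr o (m1 k om) = 0 -> ev (D o (P k om n)) t x = 0.
Proof. by move=> h; rewrite ev_D_P h mulr0 mul0r oppr0. Qed.

Lemma D_mul0 o F G t x : (forall t x, ev (D o F) t x = 0) -> (forall t x, ev (D o G) t x = 0) ->
  ev (D o (mul F G)) t x = 0.
Proof. by move=> hF hG; rewrite ev_D_mul hF hG mul0r mulr0 addr0. Qed.

Lemma ti_Pr c1 c2 c3 t : ti (ev (Pr c1 c2 c3) t) = wal R c1 * (wal R c2 * wal R c3) * tpi ^+ 3.
Proof.
have X0 : X != 0 by rewrite gt_eqF// X_gt0.
have e1 : fr (Some (xi d)) (m1 k1 o1) = X by rewrite frE.
have e2 : fr (Some (et d)) (m1 k2 (0 : R)) = X by rewrite frE.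
have e3 : fr (Some (ze d)) (m1 k3 (0 : R)) = X by rewrite frE.
rewrite /Pr (@ti_P R k1 o1 (xi d)) ?e1// => [|x]; last first.
  by apply: (D_mul0 (o := dv Xi)) => u y; apply: D_P0'; rewrite frE.
rewrite (@ti_P R k2 0 (et d)) ?e2// => [|x]; last first.
  by apply: (D_P0' (o := dv Et)); rewrite frE.
rewrite (eq_ti (ev (mul (P k3 (0 : R) c3) (one R)) t)) => [|x]; last by rewrite ev_mul ev_one mulr1.
rewrite (@ti_P R k3 0 (ze d)) ?e3// => [|x]; last first.
  rewrite ev_D big_cons big_nil /= /kd rv0 dot0l !(mulr0, mul0r) oppr0 addr0//.
rewrite (eq_ti (fun _ => 1)) => [|x]; last by rewrite ev_one.
by rewrite ti_cst; ring.
Qed.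

Lemma ev_Pr c1 c2 c3 t x : ev (Pr c1 c2 c3) t x = zf k1 o1 t x ^+ c1 * (zf k2 0 t x ^+ c2 * zf k3 0 t x ^+ c3).
Proof. by rewrite !ev_mul !ev_P. Qed.

Lemma Bn2 : Bn ^+ 2 = (wal R (16 * nn) * (wal R (16 * Qn) * wal R (16 * Qn)))^-1.
Proof. by rewrite sqr_sqrtr// invr_ge0 !mulr_ge0// ltW// wal_gt0. Qed.

Lemma ev_ThTh t x : ev ThTh t x = Bn ^+ 2 * ev (Pr (16 * nn) (16 * Qn) (16 * Qn)) t x.
Proof.
rewrite ev_mul ev_scl !ev_Pr (_ : (16 * nn = 8 * nn + 8 * nn)%N); last by lia.
by rewrite (_ : (16 * Qn = 8 * Qn + 8 * Qn)%N) ?exprD; [ring|lia].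
Qed.

Lemma ti_ThTh t : ti (ev ThTh t) = tpi ^+ 3.
Proof.
rewrite (eq_ti (fun x => Bn ^+ 2 * ev (Pr (16 * nn) (16 * Qn) (16 * Qn)) t x)); last exact: ev_ThTh.
rewrite tiZ ?ti_Pr ?Bn2; last exact: CP_ev.
by rewrite mulrA mulVf ?mul1r// gt_eqF// !mulr_gt0// wal_gt0.
Qed.

Lemma ev_q t x : ev q t x = ev ThTh t x - 1.
Proof. by rewrite ev_sub ev_one. Qed.

Lemma ti_q t : ti (ev q t) = 0.
Proof.
rewrite (eq_ti (fun x => ev ThTh t x - 1)) => [|x]; last exact: ev_q.
rewrite tiB; [|exact: CP_ev|exact: CP_cst].
by rewrite ti_ThTh ti_cst mul1r subrr.
Qed.

(** A wave vector orthogonal to all three basis vectors is zero, so what is left after three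
    averages is the mean of [q], which vanishes by the normalization of [Th]. *)
Lemma q_split t x : ev q t x = ev (Df Xi qx) t x + ev (Df Et qe) t x + ev (Df Ze qz) t x.
Proof.
rewrite !ev_Dpr.
have -> : ev (av (ze d) (av (et d) (av (xi d) q))) t x = 0; last by ring.
have m0 : ev (mn q) t x = 0.
  have /eqP := ti_q t; rewrite (ti_mn q t x) mulf_eq0 gt_eqF ?vol_gt0//=; exact/eqP.
rewrite -[RHS]m0 /av /mn !mop_mop !ev_mop; apply: eq_bigr => m _ /=; rewrite !addr0.
congr (_ * _ * _); have [->|h] := eqVneq (wv m) 0.
  by rewrite /kd rv0 !dot0l eqxx !mulr1.
rewrite -!natrM !mulnb; apply/eqP; rewrite pnatr_eq0 eqb0; apply: contra h => /andP[/eqP h1 /andP[/eqP h2 /eqP h3]].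
by apply/eqP/(g_inj gd).
Qed.

Lemma D_qe t x : ev (Df Xi qe) t x = 0. Proof. exact: ev_Dx_pr_av. Qed.

Lemma D_qz t x : ev (Df Xi qz) t x = 0. Proof. exact: ev_Dx_pr_av2. Qed.

(** Transport equation: time and the direction [xi] enter only the first factor, through the same
    phase. *)
Lemma Dt_Pr c1 c2 c3 t x : ev (Df Ti (Pr c1 c2 c3)) t x = - X ^+ 12 * ev (Df Xi (Pr c1 c2 c3)) t x.
Proof.
rewrite !ev_D_mul !ev_D_P !frE /= !(mulr0, mul0r, oppr0, add0r, addr0) /o1; ring.
Qed.

Lemma Dt_ThTh t x : ev (Df Ti ThTh) t x = - X ^+ 12 * ev (Df Xi ThTh) t x.
Proof.
have h u y : ev ThTh u y = ev (scl (Bn ^+ 2) (Pr (16 * nn) (16 * Qn) (16 * Qn))) u y by rewrite ev_ThTh ev_scl.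
by rewrite !(ev_D_ext _ h) !ev_D_scl Dt_Pr; ring.
Qed.

Lemma ev_aa t x : ev aa t x = ev a t x ^+ 2. Proof. by rewrite ev_mul expr2. Qed.

Lemma ev_bb t x : ev bb t x = ev aa t x * ev ThTh t x.
Proof. by rewrite !ev_mul; ring. Qed.

Lemma D_bbaa t x : ev (Df Xi (bb ++ scl (-1) aa)) t x = ev fx t x * ev q t x - X ^- 12 * ev aa t x * ev (Df Ti ThTh) t x.
Proof.
rewrite ev_D_cat ev_D_scl (ev_D_ext _ (G := mul aa ThTh)) => [|u y]; last by rewrite ev_bb ev_mul.
rewrite ev_D_mul Dt_ThTh ev_q /fx; field; by rewrite gt_eqF// X_gt0.
Qed.

Lemma Dt_FF t x : ev (Df Ti FF) t x = ev hh t x + X ^- 12 * ev aa t x * ev (Df Ti ThTh) t x.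
Proof. by rewrite ev_D_scl ev_D_mul ev_scl ev_mul; ring. Qed.

Lemma div_T1 i t x : \sum_(j < 3) ev (Df (Ex j) (T1 i j)) t x = xr i * (ev fx t x * ev q t x) + ev (lo i) t x.
Proof.
under eq_bigr do rewrite /T1 2!ev_D_cat 3!ev_D_scl.

rewrite sum3.
have e1 := ev_xi (mul fx qx) t x; have e2 := ev_xi (mul fx qe) t x; have e3 := ev_xi (mul fx qz) t x.
have e4 := ev_et (mul fx qe) t x; have e5 := ev_ze (mul fx qz) t x.
transitivity (xr i * ev (Df Xi (mul fx qx)) t x + xr i * ev (Df Et (mul fx qe)) t x + er i * ev (Df Xi (mul fx qe)) t x +
   xr i * ev (Df Ze (mul fx qz)) t x + zr i * ev (Df Xi (mul fx qz)) t x).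
  by rewrite -e1 -e2 -e3 -e4 -e5; ring.
rewrite !ev_D_mul D_qe D_qz q_split /lo !ev_cat !ev_scl !ev_cat !ev_mul; ring.
Qed.

Lemma ev_gg i t x : ev (gg i) t x = xr i * ev hh t x - ev (lo i) t x.
Proof. by rewrite /gg ev_cat 2!ev_scl; ring. Qed.

(** [Rop] ignores the mean of [gg], which must be the mean of the time derivative of [xi FF] that
    [wt] subtracts. Indeed the difference [gg - xi D_t FF] is a sum of derivatives, by [D_bbaa],
    [Dt_FF] and [div_T1]. *)
Lemma mn_gg i t x : ev (mn (gg i)) t x = xr i * ev (mn (Df Ti FF)) t x.
Proof.
apply: (mulfI (x := tpi ^+ 3)); first by rewrite gt_eqF ?vol_gt0.
rewrite -ti_mn mulrCA -ti_mn -tiZ; last exact: CP_ev.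
apply/eqP; rewrite -subr_eq0 -tiB; [|exact: CP_ev|exact/CPZ/CP_ev].
have cT : CP (fun y => \sum_(j < 3) ev (Df (Ex j) (T1 i j)) t y) by apply: CP_sum => j; exact: CP_ev.
rewrite (eq_ti (fun y => xr i * ev (Df Xi (bb ++ scl (-1) aa)) t y - \sum_(j < 3) ev (Df (Ex j) (T1 i j)) t y)) => [|y]; last first.
  by rewrite D_bbaa Dt_FF ev_gg div_T1; ring.
rewrite tiB//; last exact/CPZ/CP_ev.
rewrite tiZ; last exact: CP_ev.
rewrite ti_Dx mulr0 sub0r oppr_eq0 ti_sum => [|j]; last exact: (CP_ev (Df (Ex j) (T1 i j))).
by rewrite big1// => j _; exact: ti_Dx.
Qed.

(** The fast time derivatives in [D_bbaa] and [Dt_FF] cancel, the means cancel by [mn_gg], and the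
    gradients left by the projection in [wt] and by [S4] are collected in the pressure [ppi]. *)
Lemma div_Sh i t x : \sum_(j < 3) ev (Df (Ex j) (Sh i j)) t x =
  ev (Df Ti (w i)) t x - nu * ev (lapl (w i)) t x + ev (Df (Ex i) ppi) t x.
Proof.
pose cc := bb ++ scl (-1) aa.
have h j : ev (Df (Ex j) (Sh i j)) t x = ev (Df (Ex j) (Sc f0 i j)) t x - xr i * (xr j * ev (Df (Ex j) cc) t x) -
    ev (Df (Ex j) (DF ct i j)) t x - nu * (xr i * ev (Df (Ex j) (Df (Ex j) FF)) t x + xr j * ev (Df (Ex j) (Df (Ex i) FF)) t x) +
    ev (Df (Ex j) (T1 i j)) t x + ev (Df (Ex j) (T2 i j)) t x.
  have g (o : option ivec) A r1 B r2 C r3 E F G : ev (D o (A ++ (scl r1 B ++ (scl r2 C ++ (scl r3 E ++ (F ++ G)))))) t x =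
      ev (D o A) t x + r1 * ev (D o B) t x + r2 * ev (D o C) t x + r3 * ev (D o E) t x + ev (D o F) t x + ev (D o G) t x.
    by rewrite !ev_D_cat !ev_D_scl !addrA.
  rewrite g -/cc [ev (D _ (S4 i j)) _ _]ev_D_cat 2!ev_D_scl; ring.
under eq_bigr do rewrite h.
rewrite !big_split/= !sumrN -!big_distrr/= big_split/= -!big_distrr/=.
rewrite div_Sc div_DF div_T1 -[X in nu * (xr i * X + _)]ev_lapl.
have -> : \sum_(j < 3) xr j * ev (Df (Ex j) cc) t x = ev (Df Xi cc) t x by rewrite sum3 ev_xi.
have -> : \sum_(j < 3) xr j * ev (Df (Ex j) (Df (Ex i) FF)) t x = ev (Df (Ex i) (Df Xi FF)) t x by rewrite sum3 ev_xi ev_DC.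
have -> : \sum_(j < 3) ev (Df (Ex j) (T2 i j)) t x = ev (gg i) t x - ev (mn (gg i)) t x by exact: div_Rop.
rewrite D_bbaa mn_gg ev_gg.
have wE u y : ev (w i) u y = ev (wp i ++ (scl (xr i) FF ++ (scl (- xr i) (mn FF) ++ Df (Ex i) pp))) u y by rewrite !ev_cat !addrA.
rewrite (ev_D_ext _ wE) (ev_lapl_ext wE) /wp.
rewrite !ev_lapl_cat 4!ev_D_cat 4!ev_D_scl !ev_lapl_scl /ppi 2!ev_D_cat 3!ev_D_scl.
have -> : ev (lapl (mn FF)) t x = 0.
  by rewrite ev_lapl big1// => j _; rewrite (ev_D_ext _ (G := [::])) => [|u y]; rewrite ?ev_nil ?ev_D_mn.
rewrite -(ev_D_lapl (dv (Ex i)) pp) Dt_FF.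
rewrite ev_Dt_mn.
rewrite (ev_DC (dv (Ex i)) (dv Ti) pp).
have f0E k : ev (Df k f0) t x = ev (Df k (Df Ti c)) t x - nu * ev (Df k (lapl c)) t x.
  by rewrite /f0 ev_D_cat ev_D_scl; ring.
have -> : ev (Df Et (Df Et f0)) t x = ev (Df Ti (Df Et (Df Et c))) t x - nu * ev (lapl (Df Et (Df Et c))) t x.
  rewrite (ev_D_ext _ (G := Df Ti (Df Et c) ++ scl (- nu) (Df Et (lapl c)))) => [|u y]; last first.
    by rewrite ev_cat ev_scl /f0 ev_D_cat ev_D_scl ev_DC.
  rewrite ev_D_cat ev_D_scl ev_DC mulNr; congr (_ - _ * _).
  by rewrite (ev_D_ext _ (ev_D_lapl (dv Et) c)) ev_D_lapl.
have -> : ev (Df Xi (Df Et f0)) t x = ev (Df Ti (Df Xi (Df Et c))) t x - nu * ev (lapl (Df Xi (Df Et c))) t x.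
  rewrite (ev_D_ext _ (G := Df Ti (Df Et c) ++ scl (- nu) (Df Et (lapl c)))) => [|u y]; last first.
    by rewrite ev_cat ev_scl /f0 ev_D_cat ev_D_scl ev_DC.
  rewrite ev_D_cat ev_D_scl ev_DC mulNr; congr (_ - _ * _).
  by rewrite (ev_D_ext _ (ev_D_lapl (dv Et) c)) ev_D_lapl.
ring.
Qed.

Lemma Sh_sym i j t x : ev (Sh i j) t x = ev (Sh j i) t x.
Proof.
have t2 := Rop_sym gg i j t x; rewrite /Sh !ev_cat -!/(T2 _ _) /T2 t2.
rewrite /Sc /DF /T1 /S4 !ev_scl !ev_cat !ev_scl; ring.
Qed.

End SubStep.
End Blocks.

(** * Estimates of the perturbation *)

Section MajExtra.
Variable R : realType.
Notation pt := (point R).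
Notation tp := (seq (mono R)).
Variables (I : Type) (dv : I -> option ivec).
Implicit Types (F G : tp) (wt : I -> R) (th : R -> pt -> R).

Lemma maj_wt wt wt' n B th F : (forall i, 0 <= wt' i) -> (forall i, wt i <= wt' i) -> (forall t x, 0 <= th t x) -> 0 <= B ->
  maj dv wt n B th F -> maj dv wt' n B th F.
Proof.
move=> wt0 ww th0; elim: n B F => [|n IH] B F B0 hF; first by split; rewrite ?(maj0 hF)//; case: hF.
split; first exact: (maj0 hF).
move=> i; have := majD i hF; have := ww i; have := wt0 i => a1 a2.
move=> hD; have [b0|b0] := leP 0 (wt i).
  apply: (@maj_leB _ _ _ _ _ n (B * wt i)) => //; first by rewrite ler_wpM2l.
  by apply: IH => //; rewrite mulr_ge0.
(* If the old weight is negative, the bound itself forces the derivative to vanish. *)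
have hz t x : ev (D (dv i) F) t x = 0.
  apply/eqP; rewrite -normr_le0; apply: le_trans (maj0 hD t x) _.
  by rewrite -mulrA mulr_ge0_le0// mulr_le0_ge0// ltW.
have h0 : maj dv wt' n 0 th [::].
  elim: n {IH hF hD} => [|n IH]; first by split=> // t x; rewrite ev_nil normr0 mul0r.
  by split=> [t x|j]; rewrite ?ev_nil ?normr0 !mul0r.
apply: (@maj_leB _ _ _ _ _ n 0) => //; first by rewrite mulr_ge0.
by apply: maj_ext h0 => t x; rewrite hz ev_nil.
Qed.

Lemma maj_th wt n (c B : R) th F : maj dv wt n (c * B) th F -> maj dv wt n B (fun t x => c * th t x) F.
Proof.
elim: n B F => [|n IH] B F h; (split=> [t x|]; first by rewrite mulrA [B * c]mulrC; exact: (maj0 h)).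
  by [].
by move=> i; apply: IH; rewrite mulrA; exact: majD.
Qed.

Lemma maj_eq_th wt n B th th' F : (forall t x, th t x = th' t x) -> maj dv wt n B th F -> maj dv wt n B th' F.
Proof. by move=> h; congr (maj _ _ _ _ _ _); apply/funext => t; apply/funext => x. Qed.

Lemma maj_freq wt n B F : (forall i, 0 <= wt i) -> nA F <= B -> (forall i, all (fun m => `|fr (dv i) m| <= wt i) F) ->
  maj dv wt n B (fun _ _ => 1) F.
Proof.
move=> wt0; elim: n B F => [|n IH] B F hA hd;
  have h0 t x : `|ev F t x| <= B * 1 by rewrite mulr1 (le_trans (ev_le_nA _ _ _)).
  by split.
split=> // i; apply: IH => [|j].
  by apply: le_trans (nA_mop _ (wt0 i) (hd i)) _; rewrite mulrC ler_wpM2r.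
by rewrite /D /mop all_map; apply: sub_all (hd j) => m /=; case: (dv j).
Qed.

End MajExtra.

Section Est.
Variable R : realType.
Notation pt := (point R).
Notation tp := (seq (mono R)).
Implicit Types (F G H : tp) (t s : R) (x : pt).

Lemma ti_le_th f F (k t : R) : CP f -> (forall x, `|f x| <= k * ev F t x) ->
  (\oint x, `|f x|) <= k * ti (ev F t).
Proof.
move=> cf h; rewrite -tiZ; last exact: CP_ev.
by apply: ti_le => //; [exact: CP_norm|exact/CPZ/CP_ev].
Qed.

Lemma ti_norm_mul f g (A B : R) : CP f -> CP g -> 0 <= A -> 0 <= B ->
  (\oint x, f x ^+ 2) <= A ^+ 2 -> (\oint x, g x ^+ 2) <= B ^+ 2 ->
  (\oint x, `|f x * g x|) <= A * B.
Proof.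
move=> cf cg A0 B0 hf hg.
have h := ti_CS (CP_S2 (CP_norm cf)) (CP_S2 (CP_norm cg)).
rewrite -(@ler_pXn2r _ 2) ?nnegrE ?mulr_ge0 ?ti_ge0//.
rewrite (eq_ti (fun x => `|f x| * `|g x|)) => [|x]; last exact: normrM.
apply: le_trans h _; rewrite exprMn; apply: ler_pM; try (apply: ti_ge0 => x; exact: sqr_ge0).
  by rewrite (eq_ti (fun x => f x ^+ 2))// => x; rewrite -normrX ger0_norm ?sqr_ge0.
by rewrite (eq_ti (fun x => g x ^+ 2))// => x; rewrite -normrX ger0_norm ?sqr_ge0.
Qed.

Section SubStepEst.
Variables (d : dirs) (N : nat) (a : tp) (nu K : R).
Hypothesis gd : good R d.
Hypothesis K9 : 9 <= K.
Hypothesis KN : K <= N%:R.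
Hypothesis ha : bdd K a.
Hypothesis nu01 : 0 <= nu <= 1.

Notation X := (N%:R : R).
Notation dv := (dv d).
Notation Df i := (D (dv i)).
Notation Th := (Th R d N).
Notation tht := (tht R d N).
Notation th := (th d N).
Notation th2 t x := (th t x * th t x).
Notation cosL := (cosL R d N).
Notation cos2L := (cos2L R d N).
Notation aa := (aa a).
Notation b := (b d N a).
Notation bb := (bb d N a).
Notation ThTh := (ThTh R d N).
Notation c := (c d N a).
Notation xr := (xr R d).
Notation er := (er R d).
Notation zr := (zr R d).
Notation FF := (FF d N a).
Notation wp := (wp d N a).
Notation wt := (wt d N a).
Notation w := (w d N a).
Notation Sh := (Sh d N a nu).
Notation Lam := (X ^+ 10).
Notation vol := (tpi ^+ 3 : R).
Notation Bn := (Bn R N).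
Notation Qn := (Qn N).
Notation nn := (nn N).

Let X9 : 9 <= X. Proof. exact: le_trans KN. Qed.
Let X0 : 0 < X. Proof. by apply: lt_le_trans X9. Qed.
Let K0 : 0 < K. Proof. by apply: lt_le_trans K9. Qed.
Let X1 : 1 <= X. Proof. by apply: le_trans X9; rewrite ler1n. Qed.
Let K1 : 1 <= K. Proof. by apply: le_trans K9; rewrite ler1n. Qed.
Let N1 : (0 < N)%N. Proof. by rewrite -(ltr0n R). Qed.

(** Since [K >= 9], numerical constants up to [9 ^ j] are absorbed in [j] powers of [K]. All
    estimates below are kept in the form [K ^ i * X ^ j]. *)
Lemma kc j (k : R) i : 0 <= k -> k <= 9 ^+ j -> k * K ^+ i <= K ^+ (j + i).
Proof.
move=> k0 hk; rewrite exprD ler_wpM2r ?exprn_ge0 ?(ltW K0)//.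
by apply: le_trans hk _; apply: lerXn2r; rewrite ?nnegrE ?(ltW K0).
Qed.

Lemma Kexp i j : (i <= j)%N -> K ^+ i <= K ^+ j.
Proof. by move=> ij; apply: ler_weXn2l. Qed.

Lemma Ksum2 i j : (i <= j)%N -> K ^+ j + K ^+ i <= K ^+ j.+1.
Proof. by move=> /Kexp h; have := @kc 1 2 j; rewrite expr1 => /(_ (ler0n _ 2)) h2; have := K9; lra. Qed.

Lemma Xexp i j : (i <= j)%N -> X ^+ i <= X ^+ j.
Proof. by move=> ij; apply: ler_weXn2l. Qed.

(** Cost of one derivative: [wts] for the profile alone, [wtf] in the presence of the oscillation.
    It is the frequency ([N], or [N ^ 13] in time) times 9 times the root ([N ^ 6] or [N ^ 8]) of
    the exponent. *)
Definition wts (i : dix) : R := match i with Xi => 9 * X ^+ 7 | Ti => 9 * X ^+ 19 | _ => 9 * X ^+ 9 end.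
Definition wtf (i : dix) : R := match i with Xi => 9 * X ^+ 7 | Ti => 9 * X ^+ 19 | _ => 2 * X ^+ 10 end.

Lemma wts0 i : 0 <= wts i. Proof. by case: i => *; rewrite mulr_ge0 ?exprn_ge0. Qed.
Lemma wtf0 i : 0 <= wtf i. Proof. by case: i => *; rewrite mulr_ge0 ?exprn_ge0. Qed.
Lemma wtsf i : wts i <= wtf i.
Proof.
have h : 9 * X ^+ 9 <= 2 * X ^+ 10.
  rewrite [X ^+ 10]exprS mulrA; apply: ler_wpM2r; [exact/exprn_ge0/ltW|have := X9; lra].
by case: i.
Qed.

Lemma zf_ge0 k (o : R) t x n : 0 <= zf k o t x ^+ n. Proof. exact: zf_pow_ge0. Qed.

Lemma Bn_ge0 : 0 <= Bn. Proof. exact: sqrtr_ge0. Qed.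

Lemma thE t x : th t x = Bn * (zf (k1 d N) (o1 R N) t x ^+ nn * (zf (k2 d N) 0 t x ^+ Qn * zf (k3 d N) 0 t x ^+ Qn)).
Proof. by rewrite /th /tht ev_scl ev_Pr. Qed.

Lemma th_ge0 t x : 0 <= th t x.
Proof. by rewrite thE !mulr_ge0 ?zf_ge0 ?Bn_ge0. Qed.

Lemma small_kd (k : ivec) j : small_vec k -> `|kd R k (ee j)| <= 1.
Proof. by move=> h; rewrite kd_delta -intr_norm -[1]/(1%:~R) ler_int. Qed.

Lemma hwt1 i : `|fr (dv i) (m1 (k1 d N) (o1 R N))| * (9 * X ^+ 6) <= wts i.
Proof.
case: i => [||||j]; rewrite ?(frE N gd) /Submission.X.
- by rewrite ger0_norm// /X mulrCA -exprS.
- by rewrite normr0 mul0r wts0.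
- by rewrite normr0 mul0r wts0.
- by rewrite /= normrN -exprS ger0_norm ?exprn_ge0// mulrCA -exprD.
rewrite fr_Mn normrM ger0_norm//.
apply: (le_tr (X * (9 * X ^+ 6))).
  by apply: ler_wpM2r; [rewrite mulr_ge0 ?exprn_ge0|rewrite ler_piMr// small_kd//; exact: g_sv gd].
by rewrite mulrCA -exprS ler_wpM2l// Xexp.
Qed.

Lemma hwt2 i : `|fr (dv i) (m1 (k2 d N) 0)| * (9 * X ^+ 8) <= wts i.
Proof.
case: i => [||||j]; rewrite ?(frE N gd) /Submission.X.
- by rewrite normr0 mul0r wts0.
- by rewrite ger0_norm// /X mulrCA -exprS.
- by rewrite normr0 mul0r wts0.
- by rewrite /= normr0 mul0r (wts0 Ti).
rewrite fr_Mn normrM ger0_norm//.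
apply: (le_tr (X * (9 * X ^+ 8))).
  by apply: ler_wpM2r; [rewrite mulr_ge0 ?exprn_ge0|rewrite ler_piMr// small_kd//; exact: g_yv gd].
by rewrite mulrCA -exprS.
Qed.

Lemma hwt3 i : `|fr (dv i) (m1 (k3 d N) 0)| * (9 * X ^+ 8) <= wts i.
Proof.
case: i => [||||j]; rewrite ?(frE N gd) /Submission.X.
- by rewrite normr0 mul0r wts0.
- by rewrite normr0 mul0r wts0.
- by rewrite ger0_norm// /X mulrCA -exprS.
- by rewrite /= normr0 mul0r (wts0 Ti).
rewrite fr_Mn normrM ger0_norm//.
apply: (le_tr (X * (9 * X ^+ 8))).
  by apply: ler_wpM2r; [rewrite mulr_ge0 ?exprn_ge0|rewrite ler_piMr// small_kd//; exact: g_zv gd].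
by rewrite mulrCA -exprS.
Qed.

Lemma maj_Th0 : maj dv wts 3 (2 ^+ 3 * 1 * (2 ^+ 3 * 1 * 1)) th Th.
Proof.
have p1 : maj dv wts 3 1 (fun t x => zf (k1 d N) (o1 R N) t x ^+ nn) (P (k1 d N) (o1 R N) (8 * nn)).
  apply: (@maj_P _ _ _ nn (X ^+ 6)); rewrite ?expn_gt0 ?N1 ?exprn_gt0//.
    by rewrite -exprM natrX.
  exact: hwt1.
have p2 : maj dv wts 3 1 (fun t x => zf (k2 d N) 0 t x ^+ Qn) (P (k2 d N) (0 : R) (8 * Qn)).
  apply: (@maj_P _ _ _ Qn (X ^+ 8)); rewrite ?expn_gt0 ?N1 ?exprn_gt0//.
    by rewrite -exprM natrX.
  exact: hwt2.
have p3 : maj dv wts 3 1 (fun t x => zf (k3 d N) 0 t x ^+ Qn) (P (k3 d N) (0 : R) (8 * Qn)).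
  apply: (@maj_P _ _ _ Qn (X ^+ 8)); rewrite ?expn_gt0 ?N1 ?exprn_gt0//.
    by rewrite -exprM natrX.
  exact: hwt3.
have h23 := maj_mul (fun t x => zf_ge0 _ 0 t x Qn) (fun t x => zf_ge0 _ 0 t x Qn) p2 p3.
have h123 := maj_mul (fun t x => zf_ge0 _ _ t x nn) (fun t x => mulr_ge0 (zf_ge0 _ 0 t x Qn) (zf_ge0 _ 0 t x Qn)) p1 h23.
have := maj_scl Bn h123; rewrite ger0_norm ?Bn_ge0// => /maj_th.
by apply: maj_eq_th => t x; rewrite thE.
Qed.

Lemma maj_Th : maj dv wts 3 (K ^+ 2) th Th.
Proof.
apply: (maj_leB wts0 th_ge0 _ maj_Th0); rewrite !mulr1 -exprD.
have := @kc 2 64 0; rewrite expr0 mulr1 => h; apply: le_trans (h _ _) => //; lra.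
Qed.

Lemma sd i : small_dir (dv i).
Proof.
case: i => [||||j] /=; [exact: g_xi gd|exact: g_et gd|exact: g_zeta gd|by []|].
by move=> m; rewrite mxE; case: (_ && _).
Qed.

Lemma maj_a : maj dv wts 3 K (fun _ _ => 1) a.
Proof.
apply: (@maj_bdd _ _ dv wts wts0 3 K) => //; [exact: ltW|exact: sd|move=> i].
have h j : (1 <= j)%N -> 3 * K <= 9 * X ^+ j.
  move=> j1; apply: (le_tr (9 * X)); first by have := KN; have := K0; lra.
  by rewrite ler_wpM2l// -{1}(expr1 X) Xexp.
by case: i => *; apply: h.
Qed.

Let one0 (t : R) (x : pt) : 0 <= 1 :> R. Proof. by []. Qed.

Lemma maj_b : maj dv wts 3 (K ^+ 4) th b.
Proof.
apply: (maj_leB wts0 th_ge0 _ (maj_eq_th _ (maj_mul one0 th_ge0 maj_a maj_Th))).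
- by rewrite -mulrA -exprS; apply: (@kc 1) => //; lra.
- by move=> t x; rewrite mul1r.
Qed.

Let th2_ge0 t x : 0 <= th2 t x. Proof. by rewrite mulr_ge0 ?th_ge0. Qed.

Lemma maj_bb : maj dv wts 3 (K ^+ 9) (fun t x => th2 t x) bb.
Proof.
apply: (maj_leB wts0 th2_ge0 _ (maj_mul th_ge0 th_ge0 maj_b maj_b)).
by rewrite -mulrA -exprD; apply: (@kc 1) => //; lra.
Qed.

Lemma maj_ThTh : maj dv wts 3 (K ^+ 5) (fun t x => th2 t x) ThTh.
Proof.
apply: (maj_leB wts0 th2_ge0 _ (maj_mul th_ge0 th_ge0 maj_Th maj_Th)).
by rewrite -mulrA -exprD; apply: (@kc 1) => //; lra.
Qed.

Lemma maj_FF : maj dv wts 3 (K ^+ 9 / X ^+ 12) (fun t x => th2 t x) FF.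
Proof.
have haa := maj_mul one0 one0 maj_a maj_a.
have h := maj_mul (fun t x => mulr_ge0 (one0 t x) (one0 t x)) th2_ge0 haa maj_ThTh.
have := maj_scl (X ^+ 12)^-1 h => h'.
apply: (maj_leB wts0 th2_ge0 _ (maj_eq_th _ h')).
- rewrite ger0_norm ?invr_ge0 ?exprn_ge0// [leRHS]mulrC ler_wpM2l ?invr_ge0 ?exprn_ge0//.
  rewrite (_ : _ * _ = 64 * K ^+ 7); last by ring.
  by apply: (@kc 2) => //; lra.
- by move=> t x; rewrite !mul1r.
Qed.

Lemma fr_cosL i : `|fr (dv i) (m1 (kL d N) 0)| <= wtf i.
Proof.
case: i => [||||j]; rewrite ?fr_Mn ?(g_yx gd) ?(g_ye gd) ?(g_yz gd) ?mulr1 ?mulr0.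
- by rewrite normr0 wtf0.
- by rewrite ger0_norm// natrX /=; have := exprn_ge0 10 (ltW X0); lra.
- by rewrite normr0 (wtf0 Ze).
- by rewrite /= normr0 (wtf0 Ti).
rewrite normrM ger0_norm// natrX /= mulrC; apply: ler_pM; rewrite ?exprn_ge0//.
by apply: le_trans (small_kd _ (g_yv gd)) _; lra.
Qed.

Lemma fr_cos2L i : `|fr (dv i) (m1 (kL2 d N) 0)| <= wtf i.
Proof.
case: i => [||||j]; rewrite ?fr_Mn ?(g_yx gd) ?(g_ye gd) ?(g_yz gd) ?mulr1 ?mulr0.
- by rewrite normr0 wtf0.
- by rewrite ger0_norm// natrM natrX.
- by rewrite normr0 (wtf0 Ze).
- by rewrite /= normr0 (wtf0 Ti).
by rewrite normrM ger0_norm// natrM natrX /= ler_piMr ?mulr_ge0 ?exprn_ge0// small_kd//; exact: g_yv gd.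
Qed.

Lemma maj_cos k : (forall i, `|fr (dv i) (m1 k (0 : R))| <= wtf i) -> maj dv wtf 3 1 (fun _ _ => 1) (cosm k (0 : R)).
Proof.
move=> h; apply: maj_freq => [i||i]; first exact: wtf0.
  by rewrite /nA big_cons big_nil /= normr1 addr0.
by rewrite /= andbT h.
Qed.

Lemma sqrt2_le : 0 <= Num.sqrt (2 : R) <= 2.
Proof. by rewrite sqrtr_ge0 -(@ler_pXn2r _ 2) ?nnegrE ?sqrtr_ge0// sqr_sqrtr//; lra. Qed.

Lemma maj_c : maj dv wtf 3 (K ^+ 6 / X ^+ 20) th c.
Proof.
have hb := maj_wt wtf0 wtsf th_ge0 (exprn_ge0 4 (ltW K0)) maj_b.
have h := maj_scl (- (Num.sqrt 2 / (Submission.Lam R N) ^+ 2)) (maj_mul th_ge0 one0 hb (maj_cos fr_cosL)).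
apply: (maj_leB wtf0 th_ge0 _ (maj_eq_th _ h)); last by move=> t x; rewrite mulr1.
have /andP[s0 s2] := sqrt2_le.
rewrite normrN ger0_norm ?mulr_ge0 ?invr_ge0 ?exprn_ge0// -exprM mulr1 mulrAC ler_wpM2r ?invr_ge0 ?exprn_ge0//.
apply: (le_tr (16 * K ^+ 4)); last by apply: (@kc 2) => //; lra.
rewrite mulrA ler_wpM2r ?exprn_ge0 ?(ltW K0)//; lra.
Qed.


Lemma wal_le (r : R) n : 0 < r -> r ^+ 2 <= 2 * n%:R + 1 -> wal R n <= r^-1.
Proof.
move=> r0 hr; have w0 := wal_gt0 R n.
rewrite -(@ler_pXn2r _ 2) ?nnegrE ?invr_ge0 ?(ltW w0) ?(ltW r0)//.
rewrite exprVn -[leRHS]mul1r ler_pdivlMr ?exprn_gt0//.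
by apply: le_trans (wal_ub R n); rewrite ler_wpM2l ?sqr_ge0.
Qed.

Lemma wal_inv_le (r : R) n : 0 < r -> r ^+ 2 = n%:R -> (wal R (16 * n))^-1 <= 8 * r.
Proof.
move=> r0 hr; have w0 := wal_gt0 R (16 * n).
have : 0 < n%:R :> R by rewrite -hr exprn_gt0.
rewrite ltr0n => np; have n0 : (0 < 16 * n)%N by rewrite muln_gt0.
rewrite -(@ler_pXn2r _ 2) ?nnegrE ?invr_ge0 ?mulr_ge0 ?(ltW w0) ?(ltW r0)//.
rewrite exprVn -[leLHS]mul1r ler_pdivrMr ?exprn_gt0//.
apply: le_trans (wal_lb R n0) _; rewrite natrM -hr mulrC exprMn ler_wpM2r ?sqr_ge0//.
by have := sqr_ge0 r; lra.
Qed.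

Let Xe k : 0 < X ^+ k. Proof. exact: exprn_gt0. Qed.
Let Ke k : 0 < K ^+ k. Proof. exact: exprn_gt0. Qed.

Ltac p0 := solve [repeat (first [ exact: (ltW (Xe _)) | exact: (ltW (Ke _)) | exact: (ltW X0) | exact: (ltW K0)
 | exact: th_ge0 | exact: Bn_ge0 | exact: (ltW (wal_gt0 _ _)) | exact: (ltW (vol_gt0 R)) | exact: ler0n | exact: ler01
 | exact: normr_ge0 | rewrite invr_ge0 | apply: mulr_ge0 | apply: addr_ge0 | exact: sqr_ge0 | apply: exprn_ge0 ])].

Lemma vol_le : vol <= K ^+ 3.
Proof.
apply: lerXn2r; rewrite ?nnegrE ?(ltW K0) ?(ltW (twopi_gt0 R))//.
apply: le_trans K9; have := @pihalf_lt2 R; rewrite -mulr_natr; lra.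
Qed.

(** Lower Wallis bound for exponents with square roots [N ^ 6], [N ^ 8], [N ^ 8]; [22 = 6 + 8 + 8],
    and the constant is [8 ^ 3]. *)
Lemma Bn2_le : Bn ^+ 2 <= 2 ^+ 9 * X ^+ 22.
Proof.
rewrite Bn2 !invfM.
have a1 := wal_inv_le (Xe 6) (etrans (esym (exprM X 6 2)) (esym (natrX R N 12))).
have a2 := wal_inv_le (Xe 8) (etrans (esym (exprM X 8 2)) (esym (natrX R N 16))).
have p n : 0 <= (wal R n)^-1 by rewrite invr_ge0 ltW// wal_gt0.
rewrite (_ : 2 ^+ 9 * X ^+ 22 = (8 * X ^+ 6) * ((8 * X ^+ 8) * (8 * X ^+ 8))); last by ring.
by apply: ler_pM => //; [rewrite mulr_ge0|apply: ler_pM].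
Qed.

Lemma Bn_le : Bn <= K ^+ 2 * X ^+ 11.
Proof.
rewrite -(@ler_pXn2r _ 2)// ?nnegrE; [|p0|p0].
apply: le_trans Bn2_le _; rewrite exprMn -!exprM ler_wpM2r ?(ltW (Xe _))//.
by have := @kc 4 (2 ^+ 9) 0; rewrite expr0 mulr1; apply; lra.
Qed.

Definition tht2 := mul tht tht.
Definition tht4 := mul tht2 tht2.

Lemma ev_tht2 t x : ev tht2 t x = th2 t x. Proof. exact: ev_mul. Qed.
Lemma ev_tht4 t x : ev tht4 t x = (th2 t x) ^+ 2. Proof. by rewrite ev_mul ev_tht2. Qed.

Lemma wal3_le m : (0 < m)%N -> wal R (m * nn) * (wal R (m * Qn) * wal R (m * Qn)) <= (X ^+ 22)^-1.
Proof.
move=> m0.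
have h k n : (n = k * 2)%N -> wal R (m * N ^ n) <= (X ^+ k)^-1.
  move=> ->; apply: wal_le => //; rewrite -exprM -natrX.
  have h1 : (N ^ (k * 2))%:R <= (m * N ^ (k * 2))%:R :> R by rewrite ler_nat leq_pmull.
  have h2 := ler0n R (m * N ^ (k * 2)); lra.
rewrite (_ : (X ^+ 22)^-1 = (X ^+ 6)^-1 * ((X ^+ 8)^-1 * (X ^+ 8)^-1)).
  by apply: ler_pM; [p0|p0|exact: h|apply: ler_pM; [p0|p0|exact: h|exact: h]].
by rewrite -!invfM -!exprD.
Qed.

(** Amplitude [N ^ 11] on a set of measure of order [N ^ -22]: the smallness in [L^1] for which the
    profile is built. *)
Lemma ti_th t : ti (ev tht t) <= K ^+ 5 / X ^+ 11.
Proof.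
rewrite (eq_ti (fun x => Bn * ev (Pr R d N nn Qn Qn) t x)) => [|x]; last exact: ev_scl.
rewrite tiZ ?ti_Pr//; last exact: CP_ev.
have := @wal3_le 1 isT; rewrite !mul1n => h.
rewrite (_ : K ^+ 5 / X ^+ 11 = (K ^+ 2 * X ^+ 11) * ((X ^+ 22)^-1 * K ^+ 3)).
  by apply: ler_pM; [p0|p0|exact: Bn_le|apply: ler_pM; [p0|p0|exact: h|exact: vol_le]].
by rewrite (exprD K 2 3) (exprD X 11 11); field; rewrite gt_eqF.
Qed.

Lemma ti_th2 t : ti (ev tht2 t) <= K ^+ 6.
Proof.
rewrite (eq_ti (fun x => Bn ^+ 2 * ev (Pr R d N (2 * nn) (2 * Qn) (2 * Qn)) t x)) => [|x]; last first.
  by rewrite ev_tht2 thE ev_Pr !mul2n -!addnn !exprD; ring.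
rewrite tiZ ?ti_Pr//; last exact: CP_ev.
have h := @wal3_le 2 isT.
apply: (le_tr ((2 ^+ 9 * X ^+ 22) * ((X ^+ 22)^-1 * K ^+ 3))).
  by apply: ler_pM; [p0|p0|exact: Bn2_le|apply: ler_pM; [p0|p0|exact: h|exact: vol_le]].
rewrite -mulrA mulVKf ?gt_eqF//; apply: (@kc 3); lra.
Qed.

Lemma ti_th4 t : ti (ev tht4 t) <= K ^+ 9 * X ^+ 22.
Proof.
rewrite (eq_ti (fun x => (Bn ^+ 2) ^+ 2 * ev (Pr R d N (4 * nn) (4 * Qn) (4 * Qn)) t x)) => [|x]; last first.
  have e4 (z : R) n : z ^+ (4 * n) = z ^+ n ^+ 4 by rewrite mulnC exprM.
  rewrite ev_tht4 thE ev_Pr !e4.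
  by move: (_ ^+ nn) (zf (k2 d N) 0 t x ^+ Qn) (_ ^+ Qn) Bn => z1 z2 z3 B; ring.
rewrite tiZ ?ti_Pr//; last exact: CP_ev.
have h := @wal3_le 4 isT.
apply: (le_tr ((2 ^+ 9 * X ^+ 22) ^+ 2 * ((X ^+ 22)^-1 * K ^+ 3))).
  apply: ler_pM; [p0|p0| |by apply: ler_pM; [p0|p0|exact: h|exact: vol_le]].
  by apply: lerXn2r; rewrite ?nnegrE; [p0|p0|exact: Bn2_le].
rewrite (_ : _ * _ = 2 ^+ 18 * K ^+ 3 * X ^+ 22); last by field; rewrite gt_eqF.
rewrite ler_wpM2r ?(ltW (Xe _))//; apply: (@kc 6); lra.
Qed.

Lemma ev_D2_mul o F G t x : ev (D o (D o (mul F G))) t x =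
  ev (D o (D o F)) t x * ev G t x + 2 * (ev (D o F) t x * ev (D o G) t x) + ev F t x * ev (D o (D o G)) t x.
Proof.
rewrite (ev_D_ext _ (G := mul (D o F) G ++ mul F (D o G))) => [|u y]; last by rewrite ev_cat !ev_mul ev_D_mul.
by rewrite D_cat ev_cat !ev_D_mul; ring.
Qed.

(** The leading term has both derivatives on the cosine. The others put one or two of them on [G],
    at cost [9 X ^ 9] each. *)
Lemma dd_cos G k (ka B t : R) (h : R -> pt -> R) x : fr (dv Et) (m1 k (0 : R)) = ka -> 0 <= ka -> maj dv wts 2 B h G ->
  `|ev (Df Et (Df Et (mul G (cosm k (0 : R))))) t x + ka ^+ 2 * (ev G t x * ev (cosm k (0 : R)) t x)| <=
    B * (81 * X ^+ 18 + 18 * X ^+ 9 * ka) * h t x.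
Proof.
move=> hk ka0 hG; rewrite ev_D2_mul ev_D2_cosm hk.
rewrite (_ : _ + _ + _ + _ = ev (Df Et (Df Et G)) t x * ev (cosm k (0 : R)) t x + 2 * (ev (Df Et G) t x * ev (Df Et (cosm k (0 : R))) t x)); last by ring.
have b2 := maj0 (majD Et (majD Et hG)) t x; have b1 := maj0 (majD Et hG) t x.
have c0 : `|ev (cosm k (0 : R)) t x| <= 1 by rewrite ev_cosm cos_max.
have c1 : `|ev (Df Et (cosm k (0 : R))) t x| <= ka.
  by rewrite ev_D_cosm hk normrN normrM ger0_norm// ler_piMr// sin_max.
apply: le_normD; rewrite !normrM [`|2|]ger0_norm//.
apply: (le_tr (B * wts Et * wts Et * h t x * 1 + 2 * (B * wts Et * h t x * ka))).
  by apply: lerD; [apply: ler_pM|rewrite ler_wpM2l//; apply: ler_pM].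
apply: le_of_eq; rewrite /= (exprD X 9 9); ring.
Qed.

Definition beta t x := Num.sqrt 2 * (ev b t x * ev cosL t x).

Lemma xr_le i : `|xr i| <= 1.
Proof. by rewrite /xr mxE -intr_norm -[1]/(1%:~R) ler_int; exact: g_xi gd i. Qed.
Lemma er_le i : `|er i| <= 1.
Proof. by rewrite /er mxE -intr_norm -[1]/(1%:~R) ler_int; exact: g_et gd i. Qed.
Lemma zr_le i : `|zr i| <= 1.
Proof. by rewrite /zr mxE -intr_norm -[1]/(1%:~R) ler_int; exact: g_zeta gd i. Qed.

Lemma beta_le t x : `|beta t x| <= K ^+ 5 * th t x.
Proof.
have /andP[s0 s2] := sqrt2_le; have hb := maj0 maj_b t x.
rewrite /beta !normrM ger0_norm//.
apply: (le_tr (2 * (K ^+ 4 * th t x * 1))).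
  by apply: ler_pM => //; apply: ler_pM => //; rewrite ev_cosm cos_max.
rewrite mulr1 mulrA ler_wpM2r ?th_ge0//; apply: (@kc 1) => //; lra.
Qed.

Lemma A_err t x : `|ev (Df Et (Df Et c)) t x - beta t x| <= K ^+ 6 / X * th t x.
Proof.
have /andP[s0 s2] := sqrt2_le.
have hk : fr (dv Et) (m1 (kL d N) (0 : R)) = X ^+ 10 by rewrite fr_Mn (g_ye gd) mulr1 natrX.
have h := dd_cos t x hk (ltW (Xe 10)) (maj_leq (isT : (2 <= 3)%N) maj_b).
rewrite /c ev_D_scl2 /beta /Submission.Lam /Submission.X.
rewrite (_ : _ - _ = - (Num.sqrt 2 / X ^+ 20) * (ev (Df Et (Df Et (mul b cosL))) t x + (X ^+ 10) ^+ 2 * (ev b t x * ev cosL t x))); last first.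
  by rewrite (exprD X 10 10); field; rewrite gt_eqF.
rewrite normrM normrN [`|_ / X ^+ 20|]ger0_norm; last by rewrite divr_ge0 ?(ltW (Xe _)).
apply: (le_tr (2 / X ^+ 20 * (K ^+ 4 * (81 * X ^+ 18 + 18 * X ^+ 9 * X ^+ 10) * th t x))).
  by apply: ler_pM; [rewrite divr_ge0 ?(ltW (Xe _))|exact: normr_ge0|apply: ler_wpM2r => //; p0|exact: h].
rewrite mulrA ler_wpM2r ?th_ge0//.
apply: (le_tr (54 * K ^+ 4 / X)); last by rewrite ler_wpM2r ?invr_ge0 ?(ltW X0)//; apply: (@kc 2) => //; lra.
rewrite (_ : 54 * K ^+ 4 / X = 2 / X ^+ 20 * (K ^+ 4 * (9 * X * X ^+ 18 + 18 * X ^+ 9 * X ^+ 10))); last first.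
  by field; rewrite gt_eqF.
rewrite ler_wpM2l ?divr_ge0 ?(ltW (Xe _))// ler_wpM2l ?(ltW (Ke _))// lerD2r ler_wpM2r ?(ltW (Xe _))//.
by have := X9; lra.
Qed.

Lemma c2_le i j t x : `|ev (Df i (Df j c)) t x| <= K ^+ 6 / X ^+ 20 * wtf j * wtf i * th t x.
Proof. exact: maj0 (majD i (majD j maj_c)) t x. Qed.

Lemma c3_le i j k t x : `|ev (Df i (Df j (Df k c))) t x| <= K ^+ 6 / X ^+ 20 * wtf k * wtf j * wtf i * th t x.
Proof. exact: maj0 (majD i (majD j (majD k maj_c))) t x. Qed.

Lemma Xinv k : (X ^+ k.+1)^-1 <= X^-1.
Proof. by rewrite lef_pV2 ?posrE// -{1}(expr1 X) Xexp. Qed.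

Lemma B_err t x : `|ev (Df Xi (Df Et c)) t x| <= K ^+ 8 / X * th t x.
Proof.
apply: le_trans (c2_le _ _ _ _) _; rewrite ler_wpM2r ?th_ge0//=.
rewrite (_ : _ * _ = (18 * K ^+ 6) * (X ^+ 3)^-1); last by field; rewrite gt_eqF.
apply: ler_pM; [p0|p0| |exact: Xinv].
apply: (@kc 2) => //; lra.
Qed.

Lemma KX k : K ^+ k.+1 / X <= K ^+ k.
Proof. by rewrite ler_pdivrMr// exprSr ler_wpM2l ?(ltW (Ke _)). Qed.

Lemma wp_err i t x : `|ev (wp i) t x - xr i * beta t x| <= K ^+ 9 / X * th t x.
Proof.
rewrite /wp ev_cat !ev_scl.
rewrite (_ : _ - _ = xr i * (ev (Df Et (Df Et c)) t x - beta t x) - er i * ev (Df Xi (Df Et c)) t x); last by ring.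
apply: le_trans (ler_normB _ _) _; rewrite !normrM.
apply: (le_tr (1 * (K ^+ 6 / X * th t x) + 1 * (K ^+ 8 / X * th t x))).
  by apply: lerD; apply: ler_pM => //; [exact: xr_le|exact: A_err|exact: er_le|exact: B_err].
rewrite !mul1r -mulrDl -mulrDl ler_wpM2r ?th_ge0// ler_wpM2r ?invr_ge0 ?(ltW X0)//.
have := @Ksum2 6 8 isT; lra.
Qed.

Lemma wp_le i t x : `|ev (wp i) t x| <= K ^+ 9 * th t x.
Proof.
rewrite -[ev _ _ _](subrK (xr i * beta t x)); apply: le_normD.
apply: (le_tr (K ^+ 8 * th t x + 1 * (K ^+ 5 * th t x))).
  apply: lerD; first by apply: le_trans (wp_err _ _ _) _; rewrite ler_wpM2r ?th_ge0// KX.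
  by rewrite normrM; apply: ler_pM => //; [exact: xr_le|exact: beta_le].
rewrite mul1r -mulrDl ler_wpM2r ?th_ge0//.
have := @Ksum2 5 8 isT; lra.
Qed.

Lemma wpwp i j t x : `|ev (wp i) t x * ev (wp j) t x - xr i * xr j * beta t x ^+ 2| <= K ^+ 19 / X * (th2 t x).
Proof.
rewrite (_ : _ - _ = ev (wp i) t x * (ev (wp j) t x - xr j * beta t x) + (xr j * beta t x) * (ev (wp i) t x - xr i * beta t x)); last by ring.
apply: le_normD; rewrite (normrM (ev (wp i) t x)) (normrM (xr j * beta t x)) (normrM (xr j)).
apply: (le_tr (K ^+ 9 * th t x * (K ^+ 9 / X * th t x) + 1 * (K ^+ 5 * th t x) * (K ^+ 9 / X * th t x))).
  apply: lerD; apply: ler_pM => //; rewrite ?wp_le ?wp_err//.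
  by apply: ler_pM => //; [exact: xr_le|exact: beta_le].
rewrite (_ : _ + _ = (K ^+ 18 + K ^+ 14) / X * (th2 t x)); last by rewrite (exprD K 9 9) (exprD K 5 9); ring.
rewrite ler_wpM2r ?mulr_ge0 ?th_ge0// ler_wpM2r ?invr_ge0 ?(ltW X0)//.
have := @Ksum2 14 18 isT; lra.
Qed.

Lemma ti_wp2 i t : (\oint x, ev (wp i) t x ^+ 2) <= (K ^+ 12) ^+ 2.
Proof.
have cp : CP (fun x => ev (wp i) t x ^+ 2) by apply: CP_exp; exact: CP_ev.
apply: (le_tr (\oint x, K ^+ 18 * ev tht2 t x)).
  apply: ti_le => //; first exact/CPZ/CP_ev.
  move=> x; rewrite ev_tht2 -[_ ^+ 2]ger0_norm ?sqr_ge0// normrX.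
  rewrite (_ : K ^+ 18 * _ = (K ^+ 9 * th t x) ^+ 2); last by ring.
  by apply: lerXn2r; rewrite ?nnegrE; [p0|p0|exact: wp_le].
rewrite tiZ; last exact: CP_ev.
by rewrite -exprM (exprD K 18 6) ler_wpM2l ?(ltW (Ke _))// ti_th2.
Qed.

Lemma FF_le t x : `|ev FF t x| <= K ^+ 9 / X ^+ 12 * (th2 t x).
Proof. exact: maj0 maj_FF t x. Qed.

(** Here the speed beats the concentration: [N ^ -24] from the square of the factor [N ^ -12]
    against the fourth moment [N ^ 22] of the profile. *)
Lemma ti_FF2 t : (\oint x, ev FF t x ^+ 2) <= K ^+ 27 / X ^+ 2.
Proof.
have cp : CP (fun x => ev FF t x ^+ 2) by apply: CP_exp; exact: CP_ev.
apply: (le_tr (\oint x, K ^+ 18 / X ^+ 24 * ev tht4 t x)).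
  apply: ti_le => //; first exact/CPZ/CP_ev.
  move=> x; rewrite ev_tht4 -[_ ^+ 2]ger0_norm ?sqr_ge0// normrX.
  rewrite (_ : K ^+ 18 / _ * _ = (K ^+ 9 / X ^+ 12 * (th2 t x)) ^+ 2); last by field; rewrite gt_eqF.
  by apply: lerXn2r; rewrite ?nnegrE; [p0|p0|exact: FF_le].
rewrite tiZ; last exact: CP_ev.
rewrite (_ : K ^+ 27 / X ^+ 2 = K ^+ 18 / X ^+ 24 * (K ^+ 9 * X ^+ 22)); last by field; rewrite gt_eqF.
by rewrite ler_wpM2l ?ti_th4// divr_ge0 ?(ltW (Ke _)) ?(ltW (Xe _)).
Qed.

Lemma ti_wt i t : ti (ev (wt i) t) = 0.
Proof.
rewrite (ti_mn (wt i) t 0) ev_mn_cat ev_mn_cat ev_mn_D addr0.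
have mns r F : ev (mn (scl r F)) t 0 = r * ev (mn F) t 0.
  rewrite /mn /scl mop_mop !ev_mop big_distrr; apply: eq_bigr => m _ /=; rewrite !addr0; ring.
rewrite (mns (xr i) FF) (mns (- xr i) (mn FF)).
rewrite (_ : ev (mn (mn FF)) t 0 = ev (mn FF) t 0); first by ring.
by rewrite /mn mop_mop !ev_mop; apply: eq_bigr => m _ /=; case: eqP => _; rewrite !addr0 ?mulr1 ?mulr0.
Qed.

(* [wt] is the Leray projection of [xi FF] *)
Lemma ti_wt_sum t : (\oint x, \sum_(i < 3) ev (wt i) t x ^+ 2) <= (\oint x, \sum_(i < 3) (xr i * ev FF t x) ^+ 2).
Proof.
have ce F : CP (ev F t) by exact: CP_ev.
pose M i := xr i * ev (mn FF) t 0.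
pose G i x := ev (Df (Ex i) (pp d N a)) t x.
have cG i : CP (G i) by exact: ce.
have cW : CP (fun x => \sum_(i < 3) ev (wt i) t x ^+ 2) by apply: CP_sum => i; apply: CP_exp.
have c1 : CP (fun x => \sum_(i < 3) (M i - G i x) ^+ 2) by apply: CP_sum => i; apply: CP_exp; apply: CPB; [exact: CP_cst|].
have c2 : CP (fun x => \sum_(i < 3) M i * ev (wt i) t x) by apply: CP_sum => i; apply: CPZ.
have c3 : CP (fun x => \sum_(i < 3) ev (wt i) t x * G i x) by apply: CP_sum => i; apply: CPM.
(* [xi FF = wt + M - G] with [M] constant and [G] a gradient. As [wt] is orthogonal to both, the
   square of [xi FF] is the square of [wt] plus a nonnegative term. *)
have z2 : (\oint x, \sum_(i < 3) M i * ev (wt i) t x) = 0.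
  by rewrite ti_sum => [|i]; [rewrite big1// => i _; rewrite tiZ// ti_wt mulr0|apply: CPZ].
have z3 : (\oint x, \sum_(i < 3) ev (wt i) t x * G i x) = 0.
  rewrite (eq_ti (fun x => \sum_(i < 3) ev (Df (Ex i) (mul (wt i) (pp d N a))) t x)) => [|x]; last first.
    under [RHS]eq_bigr do rewrite ev_D_mul.
    by rewrite big_split/= -big_distrl/= ev_wt_div mul0r add0r.
  by rewrite ti_sum => [|i]; [rewrite big1// => i _; exact: ti_Dx|exact: (ce (Df (Ex i) _))].
rewrite (eq_ti (f := fun x => \sum_(i < 3) (xr i * ev FF t x) ^+ 2)
   (fun x => (\sum_(i < 3) ev (wt i) t x ^+ 2 + \sum_(i < 3) (M i - G i x) ^+ 2) + (2 * (\sum_(i < 3) M i * ev (wt i) t x) - 2 * (\sum_(i < 3) ev (wt i) t x * G i x)))) => [|x]; last first.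
  rewrite !big_distrr/= -sumrB -!big_split/=; apply: eq_bigr => i _.
  have -> : ev (wt i) t x = xr i * ev FF t x - M i + G i x.
    rewrite {1}/Submission.wt ev_cat ev_cat (ev_scl (xr i) FF) (ev_scl (- xr i) (mn FF)) /M (ev_mn_cst _ _ x 0) /G; ring.
  by ring.
rewrite tiD; [|exact: CPD|by apply: CPB; exact: CPZ].
rewrite tiB; [|exact: CPZ|exact: CPZ].
rewrite !tiZ// z2 z3 mulr0 subrr addr0 tiD// lerDl; apply: ti_ge0 => x.
by apply: sumr_ge0 => i _; exact: sqr_ge0.
Qed.

Lemma ti_wt2 i t : (\oint x, ev (wt i) t x ^+ 2) <= (K ^+ 14 / X) ^+ 2.
Proof.
have ce F : CP (ev F t) by exact: CP_ev.
apply: (le_tr (\oint x, \sum_(j < 3) ev (wt j) t x ^+ 2)).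
  apply: ti_le; [exact: CP_exp|by apply: CP_sum => j; exact: CP_exp|].
  by move=> x; rewrite (bigD1 i)//= lerDl; apply: sumr_ge0 => j _; exact: sqr_ge0.
apply: le_trans (ti_wt_sum t) _.
apply: (le_tr (\oint x, 3 * ev FF t x ^+ 2)).
  apply: ti_le; [by apply: CP_sum => j; apply: CP_exp; exact: CPZ|by apply: CPZ; exact: CP_exp|].
  move=> x; apply: (le_tr (\sum_(j < 3) ev FF t x ^+ 2)); last by rewrite sumr_const card_ord mulr_natl.
  apply: ler_sum => j _; rewrite exprMn ler_piMl ?sqr_ge0// -[_ ^+ 2]ger0_norm ?sqr_ge0// normrX.
  by rewrite expr_le1// xr_le.
rewrite tiZ; last exact: CP_exp.
apply: (le_tr (3 * (K ^+ 27 / X ^+ 2))); first by rewrite ler_wpM2l// ti_FF2.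
rewrite mulrA expr_div_n -exprM ler_wpM2r ?invr_ge0 ?(ltW (Xe _))//; apply: (@kc 1) => //; lra.
Qed.


(** All wave vectors of the profile are [N] times integer vectors, so antiderivatives gain [1 / N]
    by [n1_pr]. *)
Lemma multiple_Th e : all (multiple X e) Th.
Proof.
have h k (o : R) : multiple X e (m1 (k *+ N) o).
  by apply/asboolP; have [z hz] := kd_int R k e; exists z; rewrite /= kdMn hz.
rewrite /Submission.Th; apply: all_mopP => //.
by apply: multiple_mul; [|apply: multiple_mul]; apply: multiple_P; exact: h.
Qed.

Notation q := (q R d N).
Notation qx := (qx R d N).
Notation qe := (qe R d N).
Notation qz := (qz R d N).
Notation fx := (fx d a).

Lemma multiple_q e : all (multiple X e) q.
Proof.
rewrite /Submission.q all_cat multiple_mul ?multiple_Th//= andbT.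
by apply/asboolP; exists 0; rewrite /kd rv0 dot0l mulr0.
Qed.

Lemma ThTh_ge0 t x : 0 <= ev ThTh t x.
Proof. by rewrite ev_mul -expr2 sqr_ge0. Qed.

Lemma n1_q t : n1 q t <= 2 * K ^+ 3.
Proof.
apply: (le_tr (\oint x, ev ThTh t x + 1)).
  apply: ti_le; [exact: CP_nev|by apply: CPD; [exact: CP_ev|exact: CP_cst]|].
  move=> x; rewrite ev_q; have := ThTh_ge0 t x; rewrite ler_norml => h; apply/andP; split; lra.
rewrite tiD; [|exact: CP_ev|exact: CP_cst].
by rewrite ti_ThTh// ti_cst mul1r; have := vol_le; lra.
Qed.

Lemma pi4_le : pi *+ 4 <= 16 :> R.
Proof. by have := @pihalf_lt2 R; rewrite -mulr_natr; lra. Qed.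

Lemma n1_prX e F t : all (multiple X e) F -> n1 F t <= 2 * K ^+ 3 -> n1 (pr e F) t <= K ^+ 5 / X.
Proof.
move=> mF hF; apply: le_trans (n1_pr t X0 mF) _.
apply: (le_tr (16 / X * (2 * K ^+ 3))).
  apply: ler_pM => //; [|exact: n1_ge0|].
    by apply: divr_ge0; [rewrite mulrn_wge0 ?pi_ge0|exact: ltW].
  by apply: ler_wpM2r; [p0|exact: pi4_le].
rewrite mulrAC ler_wpM2r ?invr_ge0// mulrA; apply: (@kc 2); lra.
Qed.

Lemma n1_qx t : n1 qx t <= K ^+ 5 / X.
Proof. by apply: n1_prX; [exact: multiple_q|exact: n1_q]. Qed.

Lemma n1_qe t : n1 qe t <= K ^+ 5 / X.
Proof.
apply: n1_prX; last by apply: le_trans (n1_av _ _ _) (n1_q t).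
by apply: all_mopP => //; exact: multiple_q.
Qed.

Lemma n1_qz t : n1 qz t <= K ^+ 5 / X.
Proof.
apply: n1_prX; last by apply: le_trans (n1_av _ _ _) _; apply: le_trans (n1_av _ _ _) (n1_q t).
by apply: all_mopP => //; apply: all_mopP => //; exact: multiple_q.
Qed.

Lemma maj_aa : maj dv (fun=> 6 * K) 3 (K * K) (fun _ _ => 1) aa.
Proof.
have [h1 h2] := ha; apply: maj_freq => [i||i]; first by rewrite mulr_ge0 ?(ltW K0).
  by apply: le_trans (nA_mul _ _) _; apply: ler_pM => //; exact: nA_ge0.
apply: sub_all (all_mul h2 h2) => m hm.
case: i => [||||j]; try (rewrite (_ : 6 * K = 3 * (K + K)); [|ring]).
- exact: kd_le (g_xi gd) hm.
- exact: kd_le (g_et gd) hm.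
- exact: kd_le (g_zeta gd) hm.
- by move: hm => /andP[_ /le_trans]; apply => /=; have := K0; lra.
- by apply: kd_le hm => l; rewrite mxE; case: (_ && _).
Qed.

Lemma Daa i t x : `|ev (Df i aa) t x| <= K ^+ 4.
Proof.
apply: le_trans (maj0 (majD i maj_aa) t x) _; rewrite mulr1.
rewrite (_ : _ * _ = 6 * K ^+ 3); last by ring.
by apply: (@kc 1) => //; lra.
Qed.

Lemma DDaa i j t x : `|ev (Df i (Df j aa)) t x| <= K ^+ 6.
Proof.
apply: le_trans (maj0 (majD i (majD j maj_aa)) t x) _; rewrite mulr1.
rewrite (_ : _ * _ = 36 * K ^+ 4); last by ring.
by apply: (@kc 2) => //; lra.
Qed.

Lemma n1_scl (r : R) F t : n1 (scl r F) t = `|r| * n1 F t.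
Proof.
rewrite /n1 -tiZ; last exact: CP_nev.
by apply: eq_ti => x; rewrite ev_scl normrM.
Qed.

Lemma n1_mul (M : R) F G t : 0 <= M -> (forall x, `|ev F t x| <= M) -> n1 (mul F G) t <= M * n1 G t.
Proof.
move=> M0 hF; rewrite /n1 -tiZ; last exact: CP_nev.
apply: ti_le => [||x]; [exact: CP_nev|exact/CPZ/CP_nev|].
by rewrite ev_mul normrM ler_wpM2r.
Qed.

Lemma n1_scl_le (r C : R) F t : `|r| <= 1 -> n1 F t <= C -> n1 (scl r F) t <= C.
Proof. by move=> r1 hF; rewrite n1_scl; apply: le_trans hF; rewrite ler_piMl ?n1_ge0. Qed.

Lemma n1_scl2_le (r s C : R) F t : `|r| <= 1 -> `|s| <= 1 -> n1 F t <= C -> n1 (scl (r + s) F) t <= 2 * C.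
Proof.
move=> r1 s1 hF; rewrite n1_scl; apply: ler_pM => //; first exact: n1_ge0.
by apply: le_normD; lra.
Qed.

Lemma mul_le1 (r s : R) : `|r| <= 1 -> `|s| <= 1 -> `|r * s| <= 1.
Proof. by move=> hr hs; rewrite normrM mulr_ile1. Qed.

Lemma n1_fq F t : n1 F t <= K ^+ 5 / X -> n1 (mul fx F) t <= K ^+ 9 / X.
Proof.
move=> hF; apply: le_trans (n1_mul (M := K ^+ 4) _ _ _) _; [p0|by move=> x; exact: Daa|].
by rewrite (exprD K 4 5) -mulrA ler_wpM2l//; p0.
Qed.

Lemma n1_Dfq i F t : n1 F t <= K ^+ 5 / X -> n1 (mul (Df i fx) F) t <= K ^+ 11 / X.
Proof.
move=> hF; apply: le_trans (n1_mul (M := K ^+ 6) _ _ _) _; [p0|by move=> x; exact: DDaa|].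
by rewrite (exprD K 6 5) -mulrA ler_wpM2l//; p0.
Qed.

Lemma n1_T1 i j t : n1 (T1 d N a i j) t <= K ^+ 10 / X.
Proof.
have hx := xr_le; have he := er_le; have hz := zr_le.
apply: le_trans (n1_cat _ _ _) _.
apply: le_trans (lerD (n1_scl_le (mul_le1 (hx i) (hx j)) (n1_fq (n1_qx t))) (n1_cat _ _ _)) _.
apply: le_trans (lerD (lexx _) (lerD (n1_scl2_le (mul_le1 (hx i) (he j)) (mul_le1 (he i) (hx j)) (n1_fq (n1_qe t)))
  (n1_scl2_le (mul_le1 (hx i) (hz j)) (mul_le1 (hz i) (hx j)) (n1_fq (n1_qz t))))) _.
rewrite (_ : _ + _ = 5 * K ^+ 9 / X); last by ring.
by rewrite ler_wpM2r//; apply: (@kc 1) => //; lra.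
Qed.

Lemma n1_lo i t : n1 (lo d N a i) t <= K ^+ 12 / X.
Proof.
have hx := xr_le i; have he := er_le i; have hz := zr_le i.
have h1 := n1_scl_le hx (le_trans (n1_cat _ _ _) (lerD (n1_Dfq Xi (n1_qx t)) (le_trans (n1_cat _ _ _) (lerD (n1_Dfq Et (n1_qe t)) (n1_Dfq Ze (n1_qz t)))))).
have h2 := n1_scl_le he (n1_Dfq Xi (n1_qe t)).
have h3 := n1_scl_le hz (n1_Dfq Xi (n1_qz t)).
apply: le_trans (n1_cat _ _ _) _.
apply: le_trans (lerD h1 (le_trans (n1_cat _ _ _) (lerD h2 h3))) _.
rewrite (_ : _ + _ = 5 * K ^+ 11 / X); last by ring.
by rewrite ler_wpM2r//; apply: (@kc 1) => //; lra.
Qed.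

Lemma n1_hh t : n1 (hh d N a) t <= K ^+ 7 / X.
Proof.
rewrite /hh n1_scl [K ^+ 7 / X]mulrC; apply: ler_pM; [exact: normr_ge0|exact: n1_ge0| |].
  by rewrite ger0_norm ?Xinv//; p0.
apply: le_trans (n1_mul (M := K ^+ 4) _ _ _) _; [p0|by move=> x; exact: Daa|].
rewrite (exprD K 4 3) ler_wpM2l//; first p0.
rewrite /n1 (eq_ti (ev ThTh t)) ?ti_ThTh ?vol_le// => x.
by rewrite ger0_norm ?ThTh_ge0.
Qed.

Lemma n1_T2 i j t : n1 (T2 d N a i j) t <= K ^+ 15 / X.
Proof.
have h i' : n1 (gg d N a i') t <= K ^+ 13 / X.
  apply: le_trans (n1_cat _ _ _) _.
  have n11 : `|-1| <= 1 :> R by rewrite normrN normr1.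
  apply: le_trans (lerD (n1_scl_le n11 (n1_lo i' t)) (n1_scl_le (xr_le i') (n1_hh t))) _.
  rewrite -mulrDl ler_wpM2r//.
  have := @Ksum2 7 12 isT; lra.
apply: le_trans (n1_Rop _ _ _ _) _.
apply: (le_tr (16 * (K ^+ 13 / X + K ^+ 13 / X))).
  by apply: ler_pM; [rewrite mulrn_wge0 ?pi_ge0|by rewrite addr_ge0 ?n1_ge0|exact: pi4_le|exact: lerD].
rewrite (_ : _ * _ = 32 * K ^+ 13 / X); last by ring.
by rewrite ler_wpM2r//; apply: (@kc 2) => //; lra.
Qed.

Lemma wtf_le i : i = Et \/ i = Xi -> wtf i <= 2 * X ^+ 10.
Proof.
case=> -> //=; rewrite (exprD X 3 7) mulrA; apply: ler_wpM2r; first p0.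
have := X1; have := X9; rewrite !exprS expr0 => h1 h2; nra.
Qed.

(** The time derivative gives [N ^ 9], viscosity [N ^ 10]. This is the only part of the stress that
    relies on the [L^1] size [N ^ -11] of the profile. *)
Lemma f0_le i t x : i = Et \/ i = Xi -> `|ev (Df i (f0 d N a nu)) t x| <= K ^+ 8 * X ^+ 10 * th t x.
Proof.
move=> hi; have hw := wtf_le hi.
have h2 : `|ev (Df i (Df Ti c)) t x| <= 18 * K ^+ 6 * X ^+ 10 * th t x.
  apply: le_trans (c2_le _ _ _ _) _; rewrite ler_wpM2r ?th_ge0//=.
  apply: (le_tr (K ^+ 6 / X ^+ 20 * (9 * X ^+ 19) * (2 * X ^+ 10))); first by rewrite ler_wpM2l//; p0.
  rewrite (_ : _ * _ = 18 * K ^+ 6 * X ^+ 9); last by field; rewrite gt_eqF.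
  by rewrite ler_wpM2l ?Xexp//; p0.
have h3 j : `|ev (Df i (Df (Ex j) (Df (Ex j) c))) t x| <= 8 * K ^+ 6 * X ^+ 10 * th t x.
  apply: le_trans (c3_le _ _ _ _ _) _; rewrite ler_wpM2r ?th_ge0//=.
  apply: (le_tr (K ^+ 6 / X ^+ 20 * (2 * X ^+ 10) * (2 * X ^+ 10) * (2 * X ^+ 10))); first by rewrite ler_wpM2l//; p0.
  by apply: le_of_eq; field; rewrite gt_eqF.
rewrite /f0 ev_D_cat (ev_D_scl (dv i) (- nu) (lapl d c)) /lapl 2!ev_D_cat.
apply: le_normD; rewrite normrM normrN.
have nu1 : `|nu| <= 1 by move: nu01 => /andP[n0 n1']; rewrite ger0_norm.
have h4 : `|nu| * `|ev (Df i (Df (Ex 0) (Df (Ex 0) c))) t x + (ev (Df i (Df (Ex 1) (Df (Ex 1) c))) t x + ev (Df i (Df (Ex 2%:R) (Df (Ex 2%:R) c))) t x)| <=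
   1 * (8 * K ^+ 6 * X ^+ 10 * th t x + (8 * K ^+ 6 * X ^+ 10 * th t x + 8 * K ^+ 6 * X ^+ 10 * th t x)).
  apply: ler_pM => //; apply: le_normD; apply: lerD => //.
  by apply: le_normD; apply: lerD.
apply: le_trans (lerD h2 h4) _.
rewrite [X in X <= _](_ : _ = 42 * K ^+ 6 * (X ^+ 10 * th t x)); last by ring.
rewrite -[leRHS]mulrA ler_wpM2r//; first p0.
by apply: (@kc 2) => //; lra.
Qed.

Lemma Sc_le i j t x : `|ev (Sc d (f0 d N a nu) i j) t x| <= K ^+ 9 * X ^+ 10 * th t x.
Proof.
have h1 := f0_le t x (or_introl erefl : Et = Et \/ Et = Xi); have h2 := f0_le t x (or_intror erefl : Xi = Et \/ Xi = Xi).
rewrite ev_cat !ev_scl; apply: le_normD; rewrite !normrM normrN !normrM.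
have hx := xr_le; have he := er_le.
have e1 : `|xr i * er j + er i * xr j| <= 2.
  by apply: le_normD; have := mul_le1 (hx i) (he j); have := mul_le1 (he i) (hx j); lra.
have e2 : `|2| * `|er i| * `|er j| <= 2 by rewrite ger0_norm// -mulrA ler_piMr// mulr_ile1.
apply: (le_tr (2 * (K ^+ 8 * X ^+ 10 * th t x) + 2 * (K ^+ 8 * X ^+ 10 * th t x))).
  by apply: lerD; apply: ler_pM => //; p0.
rewrite (_ : _ + _ = 4 * K ^+ 8 * (X ^+ 10 * th t x)); last by ring.
rewrite -[leRHS]mulrA ler_wpM2r//; first p0.
by apply: (@kc 1) => //; lra.
Qed.

Notation ct := (ct d N a).

Lemma ct_err t x : `|ev (Df Et (Df Et ct)) t x - ev bb t x * ev cos2L t x| <= K ^+ 11 / X * (th2 t x).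
Proof.
have hk : fr (dv Et) (m1 (kL2 d N) (0 : R)) = 2 * X ^+ 10 by rewrite fr_Mn (g_ye gd) mulr1 natrM natrX.
have h := dd_cos t x hk (mulr_ge0 (ler0n R 2) (ltW (Xe 10))) (maj_leq (isT : (2 <= 3)%N) maj_bb).
rewrite /ct ev_D_scl2 /Submission.Lam /Submission.X.
rewrite (_ : _ - _ = - (4 * X ^+ 20)^-1 * (ev (Df Et (Df Et (mul bb cos2L))) t x + (2 * X ^+ 10) ^+ 2 * (ev bb t x * ev cos2L t x))); last first.
  by rewrite (exprD X 10 10); field; rewrite gt_eqF.
rewrite normrM normrN [`|_^-1|]ger0_norm; last p0.
apply: (le_tr ((4 * X ^+ 20)^-1 * (K ^+ 9 * (81 * X ^+ 18 + 18 * X ^+ 9 * (2 * X ^+ 10)) * (th2 t x)))).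
  by rewrite ler_wpM2l//; p0.
rewrite [X in X <= _]mulrA; apply: ler_wpM2r; first exact: th2_ge0.
apply: (le_tr (12 * K ^+ 9 / X)); last by rewrite ler_wpM2r//; apply: (@kc 2) => //; lra.
rewrite (_ : 12 * K ^+ 9 / X = (4 * X ^+ 20)^-1 * (K ^+ 9 * (12 * X * X ^+ 18 + 18 * X ^+ 9 * (2 * X ^+ 10)))); last first.
  by field; rewrite gt_eqF.
apply: ler_wpM2l; first p0.
apply: ler_wpM2l; first p0.
rewrite lerD2r; apply: ler_wpM2r; first p0.
by have := X9; lra.
Qed.

Lemma ct2_le i j t x : `|ev (Df i (Df j ct)) t x| <= 2 * K ^+ 9 / X ^+ 20 * wtf j * wtf i * (th2 t x).
Proof.
have hb := maj_wt wtf0 wtsf th2_ge0 (ltW (Ke 9)) maj_bb.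
have h := maj_scl (- (4 * Submission.Lam R N ^+ 2)^-1) (maj_mul th2_ge0 one0 hb (maj_cos fr_cos2L)).
apply: le_trans (maj0 (majD i (majD j h)) t x) _.
rewrite [th2 t x * 1]mulr1; apply: ler_wpM2r; first exact: th2_ge0.
apply: ler_wpM2r; first exact: wtf0.
apply: ler_wpM2r; first exact: wtf0.
rewrite normrN ger0_norm; last by rewrite /Submission.Lam /Submission.X; p0.
rewrite /Submission.Lam /Submission.X -exprM; apply: le_of_eq; field; by rewrite gt_eqF.
Qed.

Lemma DF_err i j t x : `|xr i * xr j * (ev bb t x * ev cos2L t x) - ev (DF d ct i j) t x| <= K ^+ 13 / X * (th2 t x).
Proof.
rewrite !ev_cat (ev_scl (xr i * xr j)) (ev_scl (- (xr i * er j + er i * xr j))) (ev_scl (er i * er j)).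
have hx := xr_le; have he := er_le.
rewrite (_ : _ - _ = - (xr i * xr j) * (ev (Df Et (Df Et ct)) t x - ev bb t x * ev cos2L t x) +
   ((xr i * er j + er i * xr j) * ev (Df Xi (Df Et ct)) t x - er i * er j * ev (Df Xi (Df Xi ct)) t x)); last by ring.
have b1 : `|- (xr i * xr j) * (ev (Df Et (Df Et ct)) t x - ev bb t x * ev cos2L t x)| <= 1 * (K ^+ 11 / X * (th2 t x)).
  by rewrite normrM normrN; apply: ler_pM => //; [exact: mul_le1|exact: ct_err].
have b2 : `|(xr i * er j + er i * xr j) * ev (Df Xi (Df Et ct)) t x| <= 2 * (K ^+ 11 / X * (th2 t x)).
  rewrite normrM; apply: ler_pM => //.
    by apply: le_normD; have := mul_le1 (hx i) (he j); have := mul_le1 (he i) (hx j); lra.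
  apply: le_trans (ct2_le _ _ _ _) _; rewrite ler_wpM2r//=.
  rewrite (_ : _ * _ = 36 * K ^+ 9 * (X ^+ 3)^-1); last by field; rewrite gt_eqF.
  by apply: ler_pM; [p0|p0|apply: (@kc 2) => //; lra|exact: Xinv].
have b3 : `|er i * er j * ev (Df Xi (Df Xi ct)) t x| <= 1 * (K ^+ 12 / X * (th2 t x)).
  rewrite normrM; apply: ler_pM => //; first exact: mul_le1.
  apply: le_trans (ct2_le _ _ _ _) _; rewrite ler_wpM2r//=.
  rewrite (_ : _ * _ = 162 * K ^+ 9 * (X ^+ 6)^-1); last by field; rewrite gt_eqF.
  by apply: ler_pM; [p0|p0|apply: (@kc 3) => //; lra|exact: Xinv].
apply: le_normD; apply: le_trans (lerD b1 (le_trans (ler_normB _ _) (lerD b2 b3))) _.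
rewrite (_ : _ + _ = (3 * K ^+ 11 + K ^+ 12) / X * (th2 t x)); last by ring.
rewrite ler_wpM2r// ler_wpM2r//.
have h1 := Kexp (isT : (11 <= 12)%N); have := @kc 1 4 12; rewrite expr1 => h2.
have {h2} : 4 * K ^+ 12 <= K ^+ 13 by apply: h2; lra.
lra.
Qed.

Lemma S4_le i j t x : `|ev (S4 d N a i j) t x| <= K ^+ 11 / X * (th2 t x).
Proof.
have h k : `|ev (Df (Ex k) FF) t x| <= K ^+ 10 / X * (th2 t x).
  apply: le_trans (maj0 (majD (Ex k) maj_FF) t x) _; rewrite ler_wpM2r//=.
  rewrite (_ : _ * _ = 9 * K ^+ 9 * (X ^+ 3)^-1); last by field; rewrite gt_eqF.
  by apply: ler_pM; [p0|p0|apply: (@kc 1) => //; lra|exact: Xinv].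
rewrite ev_cat 2!ev_scl; apply: le_normD; rewrite !(normrM (xr _)).
apply: (le_tr (1 * (K ^+ 10 / X * (th2 t x)) + 1 * (K ^+ 10 / X * (th2 t x)))).
  by apply: lerD; apply: ler_pM => //; exact: xr_le.
rewrite (_ : _ + _ = 2 * K ^+ 10 / X * (th2 t x)); last by ring.
by rewrite ler_wpM2r// ler_wpM2r//; apply: (@kc 1) => //; lra.
Qed.

Lemma beta2 t x : beta t x ^+ 2 = ev bb t x * (1 + ev cos2L t x).
Proof.
have -> : ev cos2L t x = 2 * ev cosL t x ^+ 2 - 1.
  rewrite !ev_cosm (_ : phs (m1 (kL2 d N) 0) t x = phs (m1 (kL d N) 0) t x + phs (m1 (kL d N) 0) t x).
    by rewrite cosD -!expr2 sin2cos2; ring.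
  by rewrite /phs /= /kL2 mul2n -addnn mulrnDr rvD dotDl; ring.
rewrite /beta !exprMn sqr_sqrtr// /Submission.bb ev_mul; ring.
Qed.

Lemma ti_norm_add (f g : pt -> R) : CP f -> CP g ->
  (\oint x, `|f x + g x|) <= (\oint x, `|f x|) + (\oint x, `|g x|).
Proof.
move=> cf cg; rewrite -tiD; try exact: CP_norm.
apply: ti_le => [||x]; [exact/CP_norm/CPD|by apply: CPD; exact: CP_norm|exact: ler_normD].
Qed.

Lemma Kdiv k l : K ^+ (k + l) / X = K ^+ k / X * K ^+ l. Proof. by rewrite exprD mulrAC. Qed.

(** By [beta2] the leading parts of [wp * wp] and [Sh] add up to [a ^ 2 xi * xi], and nine errors
    remain. Products with [wt] are bounded by Cauchy-Schwarz, the linear term by [ti_th], the others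
    by [ti_th2] or by the gain of antiderivatives. *)
Lemma err_main i j t :
  (\oint x, `|ev (w i) t x * ev (w j) t x + ev (Sh i j) t x - xr i * xr j * ev a t x ^+ 2|) <= K ^+ 30 / X.
Proof.
have ce F : CP (ev F t) by exact: CP_ev.
pose g1 x := ev (wp i) t x * ev (wp j) t x - xr i * xr j * beta t x ^+ 2.
pose g2 x := xr i * xr j * (ev bb t x * ev cos2L t x) - ev (DF d ct i j) t x.
pose g3 x := ev (wp i) t x * ev (wt j) t x.
pose g4 x := ev (wp j) t x * ev (wt i) t x.
pose g5 x := ev (wt i) t x * ev (wt j) t x.
pose g6 x := ev (Sc d (f0 d N a nu) i j) t x.
pose g7 x := - nu * ev (S4 d N a i j) t x.
pose g8 x := ev (T1 d N a i j) t x.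
pose g9 x := ev (T2 d N a i j) t x.
have cb : CP (beta t) by apply: CPZ; exact: CPM.
have c1 : CP g1 by apply: CPB; [exact: CPM|apply: CPZ; exact: CP_exp].
have c2 : CP g2 by apply: CPB => //; apply: CPZ; exact: CPM.
have c3 : CP g3 by exact: CPM.
have c4 : CP g4 by exact: CPM.
have c5 : CP g5 by exact: CPM.
have c6 : CP g6 by exact: ce.
have c7 : CP g7 by exact: CPZ.
have c8 : CP g8 by exact: ce.
have c9 : CP g9 by exact: ce.
rewrite (eq_ti (fun x => `|g1 x + (g2 x + (g3 x + (g4 x + (g5 x + (g6 x + (g7 x + (g8 x + g9 x)))))))|)) => [|x]; last first.
  congr (`| _ |); rewrite /Submission.w (ev_cat (wp i)) (ev_cat (wp j)) /Submission.Sh.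
  have g A r1 B r2 C r3 E F G : ev (A ++ (scl r1 B ++ (scl r2 C ++ (scl r3 E ++ (F ++ G))))) t x =
      ev A t x + r1 * ev B t x + r2 * ev C t x + r3 * ev E t x + ev F t x + ev G t x.
    by rewrite !ev_cat !ev_scl !addrA.
  rewrite g ev_sub ev_aa /g1 /g2 /g3 /g4 /g5 /g6 /g7 /g8 /g9 beta2; ring.
have b1 : (\oint x, `|g1 x|) <= K ^+ 25 / X.
  apply: le_trans (ti_le_th (F := tht2) (k := K ^+ 19 / X) (t := t) c1 _) _.
    by move=> x; rewrite ev_tht2; exact: wpwp.
  by rewrite (Kdiv 19 6); apply: ler_wpM2l; [p0|exact: ti_th2].
have b2 : (\oint x, `|g2 x|) <= K ^+ 19 / X.
  apply: le_trans (ti_le_th (F := tht2) (k := K ^+ 13 / X) (t := t) c2 _) _.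
    by move=> x; rewrite ev_tht2; exact: DF_err.
  by rewrite (Kdiv 13 6); apply: ler_wpM2l; [p0|exact: ti_th2].
have b3 : (\oint x, `|g3 x|) <= K ^+ 12 * (K ^+ 14 / X).
  by apply: ti_norm_mul => //; [p0|p0|exact: ti_wp2|exact: ti_wt2].
have b4 : (\oint x, `|g4 x|) <= K ^+ 12 * (K ^+ 14 / X).
  by apply: ti_norm_mul => //; [p0|p0|exact: ti_wp2|exact: ti_wt2].
have b5 : (\oint x, `|g5 x|) <= K ^+ 14 / X * (K ^+ 14 / X).
  by apply: ti_norm_mul => //; [p0|p0|exact: ti_wt2|exact: ti_wt2].
have b6 : (\oint x, `|g6 x|) <= K ^+ 14 / X.
  apply: le_trans (ti_le_th (F := tht) (k := K ^+ 9 * X ^+ 10) (t := t) c6 _) _.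
    by move=> x; exact: Sc_le.
  rewrite (_ : K ^+ 14 / X = K ^+ 9 * X ^+ 10 * (K ^+ 5 / X ^+ 11)).
    by rewrite ler_wpM2l ?ti_th//; p0.
  by field; rewrite gt_eqF.
have b7 : (\oint x, `|g7 x|) <= K ^+ 17 / X.
  apply: le_trans (ti_le_th (F := tht2) (k := K ^+ 11 / X) (t := t) c7 _) _.
    move=> x; rewrite ev_tht2 /g7 normrM normrN; apply: le_trans (S4_le i j t x).
    by move: nu01 => /andP[n0 n1']; rewrite [`|nu|]ger0_norm//; apply: ler_piMl.
  by rewrite (Kdiv 11 6); apply: ler_wpM2l; [p0|exact: ti_th2].
have b8 : (\oint x, `|g8 x|) <= K ^+ 10 / X by exact: n1_T1.
have b9 : (\oint x, `|g9 x|) <= K ^+ 15 / X by exact: n1_T2.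
have d8 := CPD c8 c9; have d7 := CPD c7 d8; have d6 := CPD c6 d7; have d5 := CPD c5 d6.
have d4 := CPD c4 d5; have d3 := CPD c3 d4; have d2 := CPD c2 d3.
have {b8 b9} s8 := le_trans (ti_norm_add c8 c9) (lerD b8 b9).
have {b7 s8} s7 := le_trans (ti_norm_add c7 d8) (lerD b7 s8).
have {b6 s7} s6 := le_trans (ti_norm_add c6 d7) (lerD b6 s7).
have {b5 s6} s5 := le_trans (ti_norm_add c5 d6) (lerD b5 s6).
have {b4 s5} s4 := le_trans (ti_norm_add c4 d5) (lerD b4 s5).
have {b3 s4} s3 := le_trans (ti_norm_add c3 d4) (lerD b3 s4).
have {b2 s3} s2 := le_trans (ti_norm_add c2 d3) (lerD b2 s3).
have {b1 s2} s1 := le_trans (ti_norm_add c1 d2) (lerD b1 s2).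
apply: (le_trans s1).
have bnd k : (k <= 28)%N -> K ^+ k / X <= K ^+ 28 / X by move=> hk; rewrite ler_wpM2r// Kexp.
have h5 : K ^+ 14 / X * (K ^+ 14 / X) <= K ^+ 28 / X.
  rewrite (exprD K 14 14) -[leRHS]mulrA ler_wpM2r//; first p0.
  by rewrite ler_pdivrMr// ler_peMr//; p0.
have h3 : K ^+ 12 * (K ^+ 14 / X) <= K ^+ 28 / X by rewrite mulrA -exprD; exact: bnd.
have hl : 9 * (K ^+ 28 / X) <= K ^+ 30 / X.
  rewrite mulrA ler_wpM2r//; apply: le_trans (Kexp (isT : (29 <= 30)%N)).
  by apply: (@kc 1) => //; lra.
have := bnd 25%N isT; have := bnd 19%N isT; have := bnd 14%N isT; have := bnd 17%N isT; have := bnd 10%N isT; have := bnd 15%N isT.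
lra.
Qed.

Lemma n1_w i t : n1 (w i) t <= K ^+ 30 / X.
Proof.
apply: le_trans (n1_cat _ _ _) _.
have b1 : n1 (wp i) t <= K ^+ 14 / X.
  apply: le_trans (ti_le_th (F := tht) (k := K ^+ 9) (t := t) (CP_ev _ _) _) _.
    by move=> x; exact: wp_le.
  apply: (le_tr (K ^+ 9 * (K ^+ 5 / X ^+ 11))); first by rewrite ler_wpM2l ?ti_th//; p0.
  by rewrite (exprD K 9 5) -mulrA; apply: ler_wpM2l; [p0|apply: ler_wpM2l; [p0|exact: Xinv]].
have b2 : n1 (wt i) t <= K ^+ 14 / X * K ^+ 2.
  rewrite /n1 (eq_ti (fun x => `|ev (wt i) t x * 1|)) => [|x]; last by rewrite mulr1.
  apply: (@ti_norm_mul (ev (wt i) t) (fun=> 1)); [exact: CP_ev|exact: CP_cst|p0|p0|exact: ti_wt2|].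
  rewrite (eq_ti (fun=> 1)) => [|x]; last by rewrite expr1n.
  by rewrite ti_cst mul1r -exprM; apply: le_trans vol_le _; exact: Kexp.
apply: le_trans (lerD b1 b2) _.
rewrite (_ : _ + _ = (K ^+ 14 + K ^+ 16) / X); last by rewrite (exprD K 14 2); ring.
rewrite ler_wpM2r//.
have h1 := Kexp (isT : (14 <= 29)%N); have h3 := Kexp (isT : (16 <= 29)%N); have := @kc 1 2 29; rewrite expr1 => h2.
have {h2} : 2 * K ^+ 29 <= K ^+ 30 by apply: h2; lra.
lra.
Qed.

(** Integration by parts: [q] is a sum of three derivatives of functions of [L^1] size [1 / N], and
    the derivatives move onto the slow [aa]. *)
Lemma ti_aaq t : (\oint x, ev aa t x * ev q t x) <= 3 * (K ^+ 9 / X).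
Proof.
have ce F : CP (ev F t) by exact: CP_ev.
have z i F : (\oint x, ev aa t x * ev (Df i F) t x) = - (\oint x, ev (Df i aa) t x * ev F t x) \/ i = Ti.
  case: (pselect (i = Ti)) => [|hi]; [by right|left].
  apply/eqP; rewrite -subr_eq0 opprK -tiD; try exact: CPM.
  rewrite (eq_ti (ev (Df i (mul aa F)) t)) => [|x]; last by rewrite ev_D_mul addrC.
  by case: i hi => [||||j] // _; rewrite ti_Dx.
have b i F : n1 F t <= K ^+ 5 / X -> - (\oint x, ev (Df i aa) t x * ev F t x) <= K ^+ 9 / X.
  move=> hF; apply: (le_tr (n1 (mul (Df i aa) F) t)).
    rewrite (eq_ti (ev (mul (Df i aa) F) t)) => [|x]; last by rewrite ev_mul.
    by apply: le_trans (ti_norm (ce _)); rewrite -normrN ler_norm.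
  apply: le_trans (n1_mul (M := K ^+ 4) _ _ _) _; [p0|by move=> x; exact: Daa|].
  by rewrite (exprD K 4 5) -mulrA ler_wpM2l//; p0.
rewrite (eq_ti (fun x => ev aa t x * ev (Df Xi qx) t x + (ev aa t x * ev (Df Et qe) t x + ev aa t x * ev (Df Ze qz) t x))) => [|x]; last first.
  by rewrite (q_split gd N1); ring.
rewrite tiD; [|exact: CPM|by apply: CPD; exact: CPM].
rewrite tiD; [|exact: CPM|exact: CPM].
have [-> //|//] := z Xi qx; have [-> //|//] := z Et qe; have [-> //|//] := z Ze qz.
have := b Xi _ (n1_qx t); have := b Et _ (n1_qe t); have := b Ze _ (n1_qz t).
lra.
Qed.

Lemma ti_w2 t : (\oint x, \sum_(i < 3) ev (w i) t x ^+ 2) <= 12 * (\oint x, ev a t x ^+ 2) + K ^+ 30 / X.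
Proof.
have ce F : CP (ev F t) by exact: CP_ev.
have X2 : (X ^+ 2)^-1 <= X^-1 := Xinv 1.
(* From [(p + r + s) ^ 2 <= 2 p ^ 2 + 4 r ^ 2 + 4 s ^ 2] and [p ^ 2 <= 2 bb] for the principal part
   [p]. The three components turn this 4 into 12. *)
have hw2 i x : ev (w i) t x ^+ 2 <= 4 * ev bb t x + (4 * K ^+ 18 / X ^+ 2) * ev tht2 t x + 4 * ev (wt i) t x ^+ 2.
  rewrite ev_cat; set r := ev (wp i) t x - xr i * beta t x.
  have -> : ev (wp i) t x = xr i * beta t x + r by rewrite /r; ring.
  have hr : r ^+ 2 <= K ^+ 18 / X ^+ 2 * (th2 t x).
    rewrite -[r ^+ 2]ger0_norm ?sqr_ge0// normrX.
    rewrite (_ : K ^+ 18 / _ * _ = (K ^+ 9 / X * th t x) ^+ 2); last by field; rewrite gt_eqF.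
    by apply: lerXn2r; rewrite ?nnegrE; [p0|p0|exact: wp_err].
  have hbt : (xr i * beta t x) ^+ 2 <= 2 * ev bb t x.
    rewrite exprMn beta2; have x1 : xr i ^+ 2 <= 1 by rewrite -[_ ^+ 2]ger0_norm ?sqr_ge0// normrX expr_le1// xr_le.
    have bb0 : 0 <= ev bb t x by rewrite ev_mul -expr2 sqr_ge0.
    have /andP[k1 k2] : -1 <= ev cos2L t x <= 1 by rewrite ev_cosm cos_geN1 cos_le1.
    have u0 : 0 <= ev bb t x * (1 + ev cos2L t x) by rewrite mulr_ge0//; lra.
    apply: (le_tr (1 * (ev bb t x * (1 + ev cos2L t x)))); first by rewrite ler_wpM2r.
    by rewrite mul1r mulrC ler_wpM2r//; lra.
  rewrite ev_tht2; move: hr hbt; set p := xr i * beta t x; set s := ev (wt i) t x.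
  rewrite -[4 * K ^+ 18 / _]mulrA -[4 * _ * (_ * _)]mulrA.
  move: (K ^+ 18 / X ^+ 2 * _) (ev bb t x) => u v hr hbt.
  have := sqr_ge0 (p - (r + s)); have := sqr_ge0 (r - s); rewrite !expr2 in hr hbt *; nra.
have c1 : CP (fun x => \sum_(i < 3) ev (w i) t x ^+ 2) by apply: CP_sum => i; apply: CP_exp.
have c2 i : CP (fun x => 4 * ev bb t x + (4 * K ^+ 18 / X ^+ 2) * ev tht2 t x + 4 * ev (wt i) t x ^+ 2).
  by apply: CPD; [apply: CPD; exact: CPZ|apply: CPZ; exact: CP_exp].
apply: (le_tr (\oint x, \sum_(i < 3) (4 * ev bb t x + (4 * K ^+ 18 / X ^+ 2) * ev tht2 t x + 4 * ev (wt i) t x ^+ 2))).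
  by apply: ti_le => // [|x]; [exact: CP_sum|apply: ler_sum].
rewrite ti_sum//.
have hbb : ti (ev bb t) <= (\oint x, ev a t x ^+ 2) + 3 * (K ^+ 9 / X).
  rewrite (eq_ti (fun x => ev a t x ^+ 2 + ev aa t x * ev q t x)) => [|x]; last first.
    by rewrite ev_bb ev_q ev_aa; ring.
  by rewrite tiD; [rewrite lerD2l ti_aaq|exact: CP_exp|exact: CPM].
have hi i : (\oint x, 4 * ev bb t x + (4 * K ^+ 18 / X ^+ 2) * ev tht2 t x + 4 * ev (wt i) t x ^+ 2) <=
    4 * (\oint x, ev a t x ^+ 2) + 20 * (K ^+ 28 / X).
  rewrite tiD; [|by apply: CPD; exact: CPZ|by apply: CPZ; exact: CP_exp].
  rewrite tiD; [|exact: CPZ|exact: CPZ].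
  rewrite !tiZ//; last exact: CP_exp.
  have k1 : 4 * K ^+ 18 / X ^+ 2 * ti (ev tht2 t) <= 4 * (K ^+ 28 / X).
    apply: (le_tr (4 * K ^+ 18 / X ^+ 2 * K ^+ 6)); first by rewrite ler_wpM2l ?ti_th2//; p0.
    rewrite (_ : _ * _ = 4 * (K ^+ 24 / X ^+ 2)); last by rewrite (exprD K 18 6); ring.
    by rewrite ler_wpM2l//; apply: ler_pM; [p0|p0|exact: Kexp|].
  have k2 : 4 * (\oint x, ev (wt i) t x ^+ 2) <= 4 * (K ^+ 28 / X).
    rewrite ler_wpM2l//; apply: le_trans (ti_wt2 i t) _.
    by rewrite expr_div_n -exprM; apply: ler_pM; [p0|p0|exact: Kexp|].
  have k3 : K ^+ 9 / X <= K ^+ 28 / X by rewrite ler_wpM2r// Kexp.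
  have := hbb; lra.
apply: (le_tr (\sum_(i < 3) (4 * (\oint x, ev a t x ^+ 2) + 20 * (K ^+ 28 / X)))); first exact: ler_sum.
rewrite sumr_const card_ord -mulr_natl.
have : 60 * (K ^+ 28 / X) <= K ^+ 30 / X by rewrite mulrA ler_wpM2r//; apply: (@kc 2); lra.
lra.
Qed.


End SubStepEst.
End Est.

(** * Size of the perturbation *)

Section Sizes.
Variable R : realType.
Notation tp := (seq (mono R)).
Implicit Types (F G : tp).

(** The shift to [m.+1] keeps every bound at least [Y >= 9], as the rules for sums and products
    require. *)
Definition PB (Y : R) (m : nat) F := bdd (Y ^+ m.+1) F.

Section PB.
Variable Y : R.
Hypothesis Y9 : 9 <= Y.
Notation PB := (PB Y).

Let Y1 : 1 <= Y. Proof. by apply: le_trans Y9; rewrite ler1n. Qed.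
Let Yp m : 9 <= Y ^+ m.+1.
Proof. by apply: le_trans Y9 _; rewrite -{1}(expr1 Y); apply: ler_weXn2l. Qed.
Let Y0 m : 0 <= Y ^+ m. Proof. by rewrite exprn_ge0// (le_trans _ Y1). Qed.

Lemma PB_le m m' F : (m <= m')%N -> PB m F -> PB m' F.
Proof. by move=> mm hF; apply: bdd_le hF _; apply: ler_weXn2l. Qed.

Lemma PB_cat m m' F G : PB m F -> PB m' G -> PB (m + m').+1 (F ++ G).
Proof.
move=> hF hG; have h := bdd_cat (Y0 _) (Y0 _) hF hG; apply: bdd_le h _.
by rewrite -addnS -addSn exprD; have := Yp m; have := Yp m'; nra.
Qed.

Lemma PB_mul m m' F G : PB m F -> PB m' G -> PB (m + m').+1 (mul F G).
Proof.
move=> hF hG; rewrite /PB -addnS -addSn exprD; apply: bdd_mul => //.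
  by apply: le_trans (Yp m); lra.
by apply: le_trans (Yp m'); lra.
Qed.

Lemma PB_D m o F : small_dir o -> PB m F -> PB (m + m).+2 (D o F).
Proof.
move=> so hF; have h := bdd_D (le_trans (lexx _) _) so hF.
have := h (exprn_ege1 _ Y1) => {}h; apply: bdd_le h _.
rewrite -exprM (_ : (m + m).+3 = (m.+1 * 2).+1)%N; last by lia.
rewrite [leRHS]exprS ler_wpM2r//; have := Y9; lra.
Qed.

Lemma PB_scl m r F : `|r| <= 9 -> PB m F -> PB m.+1 (scl r F).
Proof.
move=> hr hF; rewrite /PB exprS; apply: bdd_scl => //; exact: le_trans Y9.
Qed.

Lemma PB_sclY m k r F : `|r| <= Y ^+ k -> PB m F -> PB (k + m) (scl r F).
Proof.
move=> hr hF; rewrite /PB -addnS exprD; apply: bdd_scl => //; exact: exprn_ege1.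
Qed.

Lemma PB_pr m e F : PB m F -> PB m (pr e F). Proof. exact: bdd_pr. Qed.
Lemma PB_av m e F : PB m F -> PB m (av e F). Proof. exact: bdd_av. Qed.
Lemma PB_mn m F : PB m F -> PB m (mn F).
Proof. by apply: bdd_mop1 => k; case: eqP; rewrite ?normr1 ?normr0. Qed.

Lemma PB_il m F : PB m F -> PB m (il F).
Proof.
apply: bdd_mop1 => k; have [z hz] := kd_int R (wv k) (wv k); rewrite hz.
have [->|z0] := eqVneq z 0; first by rewrite invr0 normr0.
rewrite normfV invf_le1 ?normr_gt0 ?intr_eq0// -intr_norm -[1]/(1%:~R) ler_int.
by move: z0; clear; lia.
Qed.

Lemma PB_Rop m g i j : (forall i, PB m (g i)) -> PB m.+1 (Rop g i j).
Proof.
move=> hg; apply: bdd_le (bdd_Rop i j hg) _; rewrite [leRHS]exprS.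
by have := Y0 m.+1; have := Y9; nra.
Qed.

Lemma PB_one : PB 0 (one R).
Proof.
split; first by rewrite /nA big_cons big_nil normr1 addr0 expr1.
rewrite /= andbT; apply/andP; split; last by rewrite /= normr0.
by apply/forallP => j; rewrite mxE normr0.
Qed.

Lemma PB_P k (o : R) n m m' : dgm (Y ^+ m) (m1 k o) -> n%:R <= 8 * Y ^+ m' -> PB (m + m') (P k o n).
Proof.
move=> hd hn; apply: bdd_le (bdd_P n hd) _; rewrite [leRHS]exprS exprD.
have ab : 1 <= Y ^+ m * Y ^+ m' by rewrite -exprD exprn_ege1.
apply: (le_tr (8 * Y ^+ m' * Y ^+ m + 1)); first by rewrite lerD2r ler_wpM2r.
by rewrite -mulrA [Y ^+ m' * _]mulrC; move: (Y ^+ m * _) ab => z z1; have := Y9; nra.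
Qed.

End PB.

Section Uniform.
Variables (d : dirs) (N : nat) (a : tp) (nu K : R).
Hypothesis gd : good R d.
Hypothesis K9 : 9 <= K.
Hypothesis KN : K <= N%:R.
Hypothesis ha : bdd K a.
Hypothesis nu01 : 0 <= nu <= 1.
Notation Y := (K * N%:R).
Notation X := (N%:R : R).

Lemma X9' : 9 <= X. Proof. exact: le_trans KN. Qed.

Lemma XY : X <= Y. Proof. by have := X9'; have := K9; nra. Qed.
Lemma KY : K <= Y. Proof. by have := X9'; have := K9; nra. Qed.
Lemma Y9 : 9 <= Y. Proof. exact: le_trans X9' XY. Qed.
Lemma XYe k : X ^+ k <= Y ^+ k.
Proof. by apply: lerXn2r; rewrite ?nnegrE ?XY//; apply: le_trans Y9. Qed.

Lemma dgm_m1 k (o : R) n m : small_vec k -> n%:R <= Y ^+ m -> `|o| <= Y ^+ m -> dgm (Y ^+ m) (m1 (k *+ n) o).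
Proof.
move=> hk hn ho; apply/andP; split=> //; apply/forallP => j /=; apply: le_trans hn.
have -> : ((k *+ n) 0 j)%:~R = n%:R * (k 0 j)%:~R :> R.
  have := kdMn R k (delta_mx 0 j) n; by rewrite !kd_delta.
by rewrite normrM ger0_norm// ler_piMr// -intr_norm -[1]/(1%:~R) ler_int.
Qed.

Lemma PB_a : PB Y 0 a. Proof. by apply: bdd_le ha _; rewrite expr1 KY. Qed.

Let Y1 : 1 <= Y. Proof. by apply: le_trans Y9; rewrite ler1n. Qed.

Lemma PB_Pr1 : PB Y (13 + 12) (P (k1 d N) (o1 R N) (8 * nn N)).
Proof.
apply: (PB_P Y9); last by rewrite natrM natrX ler_wpM2l// XYe.
apply: dgm_m1; [exact: g_sv gd| |].
  by apply: le_trans XY _; rewrite -{1}(expr1 Y); apply: ler_weXn2l.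
by rewrite /o1 /Submission.X normrN -exprS ger0_norm ?exprn_ge0// XYe.
Qed.

Lemma PB_Pr2 : PB Y (1 + 16) (P (k2 d N) (0 : R) (8 * Qn N)).
Proof.
apply: (PB_P Y9); last by rewrite natrM natrX ler_wpM2l// XYe.
apply: dgm_m1; [exact: g_yv gd| |]; first by rewrite expr1 XY.
by rewrite normr0 exprn_ge0// (le_trans _ Y1).
Qed.

Lemma PB_Pr3 : PB Y (1 + 16) (P (k3 d N) (0 : R) (8 * Qn N)).
Proof.
apply: (PB_P Y9); last by rewrite natrM natrX ler_wpM2l// XYe.
apply: dgm_m1; [exact: g_zv gd| |]; first by rewrite expr1 XY.
by rewrite normr0 exprn_ge0// (le_trans _ Y1).
Qed.

Lemma Bn_leY : `|Bn R N| <= Y ^+ 13.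
Proof.
rewrite ger0_norm ?Bn_ge0//; apply: le_trans (Bn_le K9 KN) _.
rewrite (exprD Y 2 11); apply: ler_pM; rewrite ?exprn_ge0 ?XYe//; first by apply: le_trans K9.
by apply: lerXn2r; rewrite ?nnegrE ?KY//; [apply: le_trans K9|apply: le_trans Y9].
Qed.

Lemma PB_cos k n m : small_vec k -> n%:R <= 2 * X ^+ m -> PB Y m (cosm (k *+ n) (0 : R)).
Proof.
move=> hk hn; split.
  by rewrite /nA big_cons big_nil /= normr1 addr0 exprn_ege1.
rewrite /= andbT; apply: dgm_m1 => //; last by rewrite normr0 exprn_ge0// (le_trans _ Y1).
apply: le_trans hn _; rewrite exprS; apply: ler_pM; rewrite ?exprn_ge0 ?XYe//.
by apply: le_trans Y9; lra.
Qed.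

Lemma PB_cosL : PB Y 10 (cosL R d N).
Proof. by apply: PB_cos; [exact: g_yv gd|rewrite natrX; have := exprn_ge0 10 (ler0n R N); lra]. Qed.

Lemma PB_cos2L : PB Y 10 (cos2L R d N).
Proof. by apply: PB_cos; [exact: g_yv gd|rewrite natrM natrX]. Qed.

Lemma Xe1 k : 1 <= X ^+ k. Proof. by apply: exprn_ege1; apply: le_trans X9'; rewrite ler1n. Qed.

Lemma sc1 : `|- (Num.sqrt 2 / Lam R N ^+ 2)| <= 9 :> R.
Proof.
have /andP[s0 s2] := @sqrt2_le R; rewrite normrN /Lam /Submission.X -exprM.
rewrite ger0_norm ?divr_ge0 ?exprn_ge0// ler_pdivrMr ?(lt_le_trans ltr01 (Xe1 _))//.
by have := Xe1 (10 * 2); lra.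
Qed.

Lemma sc2 : `|(Submission.X R N ^+ 12)^-1| <= 9 :> R.
Proof.
rewrite /Submission.X ger0_norm ?invr_ge0 ?exprn_ge0//; apply: (le_tr 1); last by lra.
by rewrite invf_le1 ?Xe1 ?(lt_le_trans ltr01 (Xe1 _)).
Qed.

Lemma sc3 : `|- (4 * Lam R N ^+ 2)^-1| <= 9 :> R.
Proof.
rewrite normrN /Lam /Submission.X -exprM ger0_norm ?invr_ge0 ?mulr_ge0 ?exprn_ge0//.
apply: (le_tr 1); last by lra.
have := Xe1 (10 * 2) => h; rewrite invf_le1; lra.
Qed.

Lemma sc4 : `|- nu| <= 9. Proof. by rewrite normrN; case/andP: nu01 => h1 h2; rewrite ger0_norm//; lra. Qed.

Lemma sc5 : `|-1| <= 9 :> R. Proof. by rewrite normrN normr1 ler1n. Qed.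

Lemma sc6 i : `|xr R d i| <= 9. Proof. by apply: le_trans (xr_le gd i) _; rewrite ler1n. Qed.
Lemma sc7 i : `|er R d i| <= 9. Proof. by apply: le_trans (er_le gd i) _; rewrite ler1n. Qed.
Lemma sc8 i : `|zr R d i| <= 9. Proof. by apply: le_trans (zr_le gd i) _; rewrite ler1n. Qed.
Lemma scN (r : R) : `|r| <= 9 -> `|- r| <= 9. Proof. by rewrite normrN. Qed.
Lemma sc9 i j : `|xr R d i * xr R d j| <= 9.
Proof. by apply: le_trans (mul_le1 (xr_le gd i) (xr_le gd j)) _; rewrite ler1n. Qed.
Lemma sc10 i j : `|er R d i * er R d j| <= 9.
Proof. by apply: le_trans (mul_le1 (er_le gd i) (er_le gd j)) _; rewrite ler1n. Qed.
Lemma sc11 i j : `|xr R d i * er R d j + er R d i * xr R d j| <= 9.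
Proof.
apply: le_normD.
by have := mul_le1 (xr_le gd i) (er_le gd j); have := mul_le1 (er_le gd i) (xr_le gd j); lra.
Qed.
Lemma sc12 i j : `|xr R d i * zr R d j + zr R d i * xr R d j| <= 9.
Proof.
apply: le_normD.
by have := mul_le1 (xr_le gd i) (zr_le gd j); have := mul_le1 (zr_le gd i) (xr_le gd j); lra.
Qed.
Lemma sc13 i j : `|2 * er R d i * er R d j| <= 9.
Proof. by rewrite -mulrA normrM; have := mul_le1 (er_le gd i) (er_le gd j); rewrite [`|2|]ger0_norm//; lra. Qed.

End Uniform.

Ltac sc K9 KN := first [exact: sc1 K9 KN | exact: sc2 K9 KN | exact: sc3 K9 KN | exact: sc4 | exact: sc5 | exact: sc6 | exact: sc7
  | exact: sc8 | apply: scN; sc K9 KN | exact: sc9 | exact: sc10 | exact: sc11 | exact: sc12 | exact: sc13].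

Lemma Th_size : exists m, forall (d : dirs) (N : nat) (a : tp) (nu K : R), good R d -> 9 <= K -> K <= N%:R -> bdd K a -> 0 <= nu <= 1 ->
   PB (K * N%:R) m (Th R d N).
Proof.
eexists => d N a nu K gd K9 KN ha nu01; have y9 := Y9 K9 KN.
apply: (PB_sclY y9); first exact: (Bn_leY K9 KN).
by apply: (PB_mul y9); [exact: PB_Pr1 gd K9 KN|apply: (PB_mul y9); [exact: PB_Pr2 gd K9 KN|exact: PB_Pr3 gd K9 KN]].
Qed.

Definition hyp (d : dirs) (N : nat) (a : tp) (nu K : R) := [/\ good R d, 9 <= K, K <= N%:R, bdd K a & 0 <= nu <= 1].

(* The exponent of the bound depends only on how the polynomial is built, so it may be left to unification. *)
Ltac size_of gd K9 KN ha := let y9 := constr:(Y9 K9 KN) in lazymatch goal with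
  | |- PB _ _ (_ ++ _) => apply: (PB_cat y9); size_of gd K9 KN ha
  | |- PB _ _ (mul _ _) => apply: (PB_mul y9); size_of gd K9 KN ha
  | |- PB _ _ (scl _ _) => apply: (PB_scl y9); [sc K9 KN | size_of gd K9 KN ha]
  | |- PB _ _ (D _ _) => apply: (PB_D y9); [exact: sd gd _ | size_of gd K9 KN ha]
  | |- PB _ _ (Rop _ _ _) => apply: (PB_Rop y9) => ?; size_of gd K9 KN ha
  | |- PB _ _ (il _) => apply: PB_il; size_of gd K9 KN ha
  | |- PB _ _ (mn _) => apply: PB_mn; size_of gd K9 KN ha
  | |- PB _ _ (pr _ _) => apply: PB_pr; size_of gd K9 KN ha
  | |- PB _ _ (av _ _) => apply: PB_av; size_of gd K9 KN ha
  | |- PB _ _ (one _) => exact: PB_one y9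
  | |- PB _ _ (Submission.cosL _ _ _) => exact: PB_cosL gd K9 KN
  | |- PB _ _ (Submission.cos2L _ _ _) => exact: PB_cos2L gd K9 KN
  | |- PB _ _ (Submission.Th _ _ _) => by eauto
  | |- _ => exact: PB_a KN ha
  end.

(** The exponent must precede all parameters: it fixes the growth of the constants in a stage,
    uniformly in [nu] and in the number of stages already done. *)
Lemma substep_size : exists m : nat, forall d N a nu K, hyp d N a nu K -> forall i j,
  bdd ((K * N%:R) ^+ m) (w d N a i) /\ bdd ((K * N%:R) ^+ m) (Sh d N a nu i j).
Proof.
have [mT hT] := Th_size.
suff [m [m' hm]] : exists m m', forall d N a nu K, hyp d N a nu K -> forall i j,
    PB (K * N%:R) m (w d N a i) /\ PB (K * N%:R) m' (Sh d N a nu i j).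
  exists (m + m').+1 => d N a nu K h i j; have [_ K9 KN _ _] := h; have y9 := Y9 K9 KN; have [h1 h2] := hm d N a nu K h i j.
  by split; [apply: (PB_le y9 _ h1)|apply: (PB_le y9 _ h2)]; lia.
eexists; eexists => d N a nu K [gd K9 KN ha n01] i j.
have {}hT := hT d N a nu K gd K9 KN ha n01.
split; rewrite /w /wp /wt /pp /Sh /Sc /f0 /c /lapl /bb /b /DF /ct /T1 /T2 /S4 /gg /lo /hh /fx /qx /qe /qz /q /FF
    /bb /b /aa /ThTh.
  by size_of gd K9 KN ha.
by size_of gd K9 KN ha.
Qed.

End Sizes.

(** * The weak formulation *)

Section Lines.
Variable R : realType.

(** Derivability and derivative depend on a function along one line only. This carries them between
    functions of space, of time and of space-time. *)
Lemma quot_eq (V V' W : normedModType R) (f : V -> W) (g : V' -> W) a v b w :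
  (forall h : R, f (h *: v + a) = g (h *: w + b)) ->
  (derivable f a v = derivable g b w) * ('D_v f a = 'D_w g b).
Proof.
move=> fg; have fa : f a = g b by have := fg 0; rewrite !scale0r !add0r.
have E : (fun h : R => h^-1 *: ((f \o shift a) (h *: v) - f a)) = (fun h => h^-1 *: ((g \o shift b) (h *: w) - g b)).
  by apply/funext => h; rewrite /= fg fa.
by rewrite /derivable /derive E.
Qed.

Variables V W : normedModType R.
Implicit Types (f : V -> W) (z v : V).

Lemma line_quot f z v (s : R) : (derivable f (z + s *: v) v = derivable (fun s : R => f (z + s *: v)) s 1) *
  ('D_v f (z + s *: v) = 'D_1 (fun s : R => f (z + s *: v)) s).
Proof.
apply: quot_eq => h; congr f; rewrite (_ : h *: (1 : R) = h); last exact: mulr1.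
by rewrite scalerDl addrCA.
Qed.

Lemma derive_periodic f v p z : (forall y, f (y + p) = f y) -> 'D_v f (z + p) = 'D_v f z.
Proof. by move=> hf; apply: (snd (@quot_eq V V W f f (z + p) v z v _)) => h; rewrite addrA hf. Qed.

End Lines.

Section Weak.
Variable R : realType.
Notation pt := (point R).
Notation tp := (seq (mono R)).
Notation lm := (@lebesgue_measure R).

Lemma is_derive_line (f : pt * R -> 'rV[R]_3) z v (s : R) i : (forall z, derivable f z v) ->
  is_derive s (1 : R) (fun s : R => f (z + s *: v) 0 i) (('D_v f (z + s *: v)) 0 i).
Proof.
move=> hf; have h := hf (z + s *: v); rewrite (line_quot f z v s) in h; apply: DeriveDef.
  exact: (derivable_mxP _ _ _).1 h 0 i.
by rewrite (line_quot f z v s) derive_mx// mxE.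
Qed.

(** The mean value theorem writes each difference quotient as a value of [h'] at a nearby time,
    uniformly close to [h'] at time [t] by the tube lemma. *)
Lemma ti_is_derive (h h' : pt * R -> R) (t : R) : continuous h -> continuous h' ->
  (forall s, torus_periodic (fun x => h (x, s))) -> (forall s, torus_periodic (fun x => h' (x, s))) ->
  (forall x (s : R), is_derive s (1 : R) (fun s => h (x, s)) (h' (x, s))) ->
  is_derive t (1 : R) (fun s => (\oint x, h (x, s))) (\oint x, h' (x, t)).
Proof.
move=> ch ch' ph ph' dh.
have P3 : 0 < tpi ^+ 3 :> R by rewrite exprn_gt0// twopi_gt0.
have cp s : CP (fun x => h (x, s)) by split; [exact: continuous_fst_t|exact: ph].
have cp' s : CP (fun x => h' (x, s)) by split; [exact: continuous_fst_t|exact: ph'].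
suff cv : (fun r : R => r^-1 *: ((\oint x, h (x, r *: 1 + t)) - (\oint x, h (x, t)))) r @[r --> 0^'] --> (\oint x, h' (x, t)).
  by apply: DeriveDef; [apply/cvg_ex; exists (\oint x, h' (x, t))|exact: cvg_lim].
apply/cvgrPdist_le => e e0.
have e1 : 0 < e / tpi ^+ 3 by rewrite divr_gt0.
have [d /= d0 hd] := tube t ch' ph' e1.
exists d => //= r /=; rewrite sub0r normrN => rd r0.
have hr x : `|h' (x, t) - r^-1 * (h (x, r *: 1 + t) - h (x, t))| <= e / tpi ^+ 3.
  have rr : r *: (1 : R) = r by exact: mulr1.
  rewrite rr.
  have cc (a b : R) : {within `[a, b], continuous (fun s => h (x, s))}.
    apply: continuous_subspaceT => s; apply: differentiable_continuous; apply/derivable1_diffP.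
    by have [] := dh x s.
  have [c hc eqc] : exists2 c : R, `|c - t| < d & h (x, r + t) - h (x, t) = h' (x, c) * r.
    have [rp|rn] := ltP 0 r.
      have [|c cin hc] := @MVT R (fun s => h (x, s)) (fun s => h' (x, s)) t (r + t) _ (fun s _ => dh x s) (cc _ _).
        by rewrite ltrDr.
      exists c; last by rewrite hc addrK.
      move: cin; rewrite in_itv/= => /andP[c1 c2]; rewrite gtr0_norm ?subr_gt0//.
      by apply: lt_trans rd; rewrite gtr0_norm// ltrBlDr.
    have rn' : r < 0 by rewrite lt_neqAle r0 rn.
    have [|c cin hc] := @MVT R (fun s => h (x, s)) (fun s => h' (x, s)) (r + t) t _ (fun s _ => dh x s) (cc _ _).
      by rewrite gtrDr.
    exists c; last by rewrite -opprB hc; ring.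
    move: cin; rewrite in_itv/= => /andP[c1 c2]; rewrite distrC gtr0_norm ?subr_gt0//.
    by apply: lt_trans rd; rewrite ltr0_norm// ltrBlDr -ltrBlDl opprK addrC.
  rewrite eqc mulrC mulfK// distrC; apply/ltW; apply: hd => /=.
  by rewrite distrC.
have -> : r^-1 *: ((\oint x, h (x, r *: 1 + t)) - (\oint x, h (x, t))) =
    (\oint x, r^-1 * (h (x, r *: 1 + t) - h (x, t))) by rewrite tiZ ?tiB//; exact: CPB.
rewrite -tiB//; last by apply: CPZ; exact: CPB.
apply: le_trans (ti_abs_le (M := e / tpi ^+ 3) _ hr) _.
  by apply: CPB => //; apply: CPZ; exact: CPB.
by rewrite divfK// gt_eqF.
Qed.

(** * Test fields in coordinates *)

Section TestData.
Variable phi : R -> field R.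

Definition tP (i : 'I_3) (z : pt * R) : R := phi z.2 z.1 0 i.
Definition tT (i : 'I_3) (z : pt * R) : R := derive1 (fun s => phi s z.1) z.2 0 i.
Definition tG (i j : 'I_3) (z : pt * R) : R := ('D_(basis R j) (phi z.2) z.1) 0 i.
Definition tGG (i j : 'I_3) (z : pt * R) : R := ('D_(basis R j) ('D_(basis R j) (phi z.2)) z.1) 0 i.

Let Phi (z : pt * R) : 'rV[R]_3 := phi z.2 z.1.
Notation ex j := (basis R j, 0 : R).

Lemma dxE j (f : R -> field R) z : 'D_(basis R j) (f z.2) z.1 = 'D_(ex j) (fun z => f z.2 z.1) z.
Proof.
apply: (snd (@quot_eq R _ _ _ (f z.2) (fun z : pt * R => f z.2 z.1) z.1 (basis R j) z (ex j) _)) => h /=.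
by rewrite scaler0 add0r.
Qed.

Lemma dtE z : derive1 (fun s => phi s z.1) z.2 = 'D_(0, 1) Phi z.
Proof.
rewrite derive1E; apply: (snd (@quot_eq R _ _ _ (fun s => phi s z.1) Phi z.2 1 z (0, 1) _)) => h.
by rewrite /Phi /= scaler0 add0r.
Qed.

Variables (a b : R).
Hypothesis ab : a < b.
Hypothesis hphi : test_field a b phi.

Let sm : smooth Phi. Proof. by case: hphi. Qed.
Let der v z : derivable Phi z v. Proof. by have [_ /(_ v) []] := sm 1. Qed.
Let smD v : Ck 1 ('D_v Phi). Proof. by have [_ /(_ v) []] := sm 2. Qed.
Let per t : torus_periodic (phi t). Proof. by case: hphi. Qed.

Lemma coord_cont (f : pt * R -> 'rV[R]_3) i : continuous f -> continuous (fun z => f z 0 i).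
Proof.
move=> cf z; apply: (@cvg_comp _ _ _ f (fun y : 'rV[R]_3 => y 0 i) _ (nbhs (f z))); first exact: cf.
exact: coord_continuous.
Qed.

Lemma tP_cont i : continuous (tP i).
Proof. by apply: coord_cont; have [] := sm 1. Qed.

Lemma tT_cont i : continuous (tT i).
Proof.
have -> : tT i = (fun z => 'D_(0, 1) Phi z 0 i) by apply/funext => z; rewrite /tT dtE.
by apply: coord_cont; have [] := smD (0, 1).
Qed.

Let tGE j : (fun z : pt * R => 'D_(basis R j) (phi z.2) z.1) = 'D_(ex j) Phi.
Proof. by apply/funext => z; exact: (dxE j phi z). Qed.

Let tGE' i j z : tG i j z = 'D_(ex j) Phi z 0 i.
Proof. exact: (congr1 (fun u : 'rV[R]_3 => u 0 i) (dxE j phi z)). Qed.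

Let D2 j := 'D_(ex j) ('D_(ex j) Phi).

Let tGGE' i j z : tGG i j z = D2 j z 0 i.
Proof.
have := etrans (dxE j (fun t => 'D_(basis R j) (phi t)) z) (congr1 (fun F : pt * R -> 'rV[R]_3 => 'D_(ex j) F z) (tGE j)).
exact: (congr1 (fun u : 'rV[R]_3 => u 0 i)).
Qed.

Lemma tG_cont i j : continuous (tG i j).
Proof.
have -> : tG i j = (fun z => 'D_(ex j) Phi z 0 i) by apply/funext => z; exact: tGE'.
by apply: coord_cont; have [] := smD (ex j).
Qed.

Lemma tGG_cont i j : continuous (tGG i j).
Proof.
have -> : tGG i j = (fun z => D2 j z 0 i) by apply/funext => z; exact: tGGE'.
by apply: coord_cont; have [_ /(_ (ex j)) []] := smD (ex j).
Qed.

Lemma tP_per i t : torus_periodic (fun x => tP i (x, t)).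
Proof. by move=> k x; rewrite /tP /= per. Qed.

Lemma tG_per i j t : torus_periodic (fun x => tG i j (x, t)).
Proof.
move=> k x; rewrite /tG [LHS]/=.
by rewrite (@derive_periodic R _ _ (phi t) (basis R j) (tpi *: basis R k) x) => [//|y]; exact: per.
Qed.

Lemma tGG_per i j t : torus_periodic (fun x => tGG i j (x, t)).
Proof.
move=> k x; rewrite /tGG [LHS]/=.
have h y := @derive_periodic R _ _ (phi t) (basis R j) (tpi *: basis R k) y (fun y => per t k y).
by rewrite (@derive_periodic R _ _ ('D_(basis R j) (phi t)) (basis R j) _ x h).
Qed.

Lemma tT_per i t : torus_periodic (fun x => tT i (x, t)).
Proof.
move=> k x; rewrite /tT [LHS]/=.
by rewrite (_ : (fun s => phi s (x + _)) = (fun s => phi s x))//; apply/funext => s; exact: per.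
Qed.

Let e_x j x t (r : R) : (x, t) + r *: ex j = (x + r *: basis R j, t).
Proof. by congr pair => /=; rewrite scaler0 addr0. Qed.

Let e_t x (r : R) : (x, 0 : R) + r *: (0 : pt, 1 : R) = (x, r).
Proof. by congr pair => /=; rewrite ?scaler0 ?addr0// add0r [_ *: _]mulr1. Qed.

Lemma tP_dx i j x t (s : R) :
  is_derive s (1 : R) (fun s : R => tP i (x + s *: basis R j, t)) (tG i j (x + s *: basis R j, t)).
Proof.
have := @is_derive_line Phi (x, t) (ex j) s i (@der (ex j)).
rewrite e_x tGE'; congr is_derive.
by apply/funext => r; rewrite e_x.
Qed.

Lemma tG_dx i j x t (s : R) :
  is_derive s (1 : R) (fun s : R => tG i j (x + s *: basis R j, t)) (tGG i j (x + s *: basis R j, t)).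
Proof.
have hd z : derivable ('D_(ex j) Phi) z (ex j) by have [_ /(_ (ex j)) []] := smD (ex j).
have := @is_derive_line ('D_(ex j) Phi) (x, t) (ex j) s i hd.
rewrite e_x tGGE'; congr is_derive.
by apply/funext => r; rewrite e_x tGE'.
Qed.

Lemma tP_dt i x (t : R) : is_derive t (1 : R) (fun s : R => tP i (x, s)) (tT i (x, t)).
Proof.
have := @is_derive_line Phi (x, 0) (0, 1) t i (@der (0, 1)).
rewrite e_t /tT dtE; congr is_derive.
by apply/funext => r; rewrite e_t.
Qed.

Lemma tG_div z : \sum_(j < 3) tG j j z = 0.
Proof. by have [_ _ _ /(_ z.2 z.1)] := hphi. Qed.

Lemma test_supp : exists c d, [/\ a < c, d < b, c <= d & forall t, t \notin `[c, d] -> forall x i j,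
  [/\ tP i (x, t) = 0, tT i (x, t) = 0, tG i j (x, t) = 0 & tGG i j (x, t) = 0]].
Proof.
have [_ _ [c [d [ac db h]]] _] := hphi.
have hz t : t \notin `[c, d] -> phi t = cst 0 by move=> ht; apply/funext => x; exact: h.
have hall t : t \notin `[c, d] -> forall x i j,
  [/\ tP i (x, t) = 0, tT i (x, t) = 0, tG i j (x, t) = 0 & tGG i j (x, t) = 0].
  move=> ht x i j; rewrite /tP /tG /tGG /= (hz t ht).
  have dc (y : pt) : 'D_(basis R j) (cst 0 : pt -> 'rV[R]_3) y = 0 by rewrite derive_cst.
  have -> : 'D_(basis R j) (cst 0 : pt -> 'rV[R]_3) = cst 0 by apply/funext => y; exact: dc.
  rewrite dc /= mxE; split=> //.
  rewrite /tT /= derive1E (@near_eq_derive _ _ _ _ (cst 0)) ?derive_cst ?mxE//.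
  have : \forall s \near t, s \notin `[c, d].
    move: ht; rewrite in_itv/= negb_and -!ltNge => /orP[tc|dt].
      by near=> s; rewrite in_itv/= negb_and -!ltNge; apply/orP; left; near: s; exact: lt_nbhsl.
    by near=> s; rewrite in_itv/= negb_and -!ltNge; apply/orP; right; near: s; exact: lt_nbhsr.
  by apply: filterS => s hs; exact: h.
have [cd|dc] := leP c d; first by exists c, d.
(* If [d < c], the test field vanishes at all times, and any point of []a, b[] serves as the
   interval. *)
exists ((a + b) / 2), ((a + b) / 2); split; [by have := ab; lra|by have := ab; lra|by []|].
move=> t _; apply: hall; rewrite in_itv/=; apply/negP => /andP[h1 h2]; lra.
Unshelve. all: by end_near. Qed.

End TestData.

Opaque torus_int tP tT tG tGG.

Definition jc (f : R -> pt -> R) := continuous (fun z : pt * R => f z.2 z.1) /\ forall t, torus_periodic (f t).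

Lemma jc_CP f t : jc f -> CP (f t).
Proof. by move=> [cf pf]; split=> //; exact: (@continuous_fst_t R (fun z => f z.2 z.1) t cf). Qed.

Lemma jc_cst (k : R) : jc (fun _ _ => k).
Proof. by split=> [z|t j x]; [exact: cst_continuous|]. Qed.

Lemma jcD f g : jc f -> jc g -> jc (fun t x => f t x + g t x).
Proof. by move=> [cf pf] [cg pg]; split=> [z|t j x]; [exact: (cvgD (cf z) (cg z))|rewrite pf pg]. Qed.

Lemma jcM f g : jc f -> jc g -> jc (fun t x => f t x * g t x).
Proof. by move=> [cf pf] [cg pg]; split=> [z|t j x]; [exact: (cvgM (cf z) (cg z))|rewrite pf pg]. Qed.

Lemma jcZ (k : R) f : jc f -> jc (fun t x => k * f t x).
Proof. by apply: jcM; exact: jc_cst. Qed.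

Lemma jcB f g : jc f -> jc g -> jc (fun t x => f t x - g t x).
Proof. by move=> [cf pf] [cg pg]; split=> [z|t j x]; [exact: (cvgB (cf z) (cg z))|rewrite pf pg]. Qed.

Lemma jc_sum n (f : 'I_n -> R -> pt -> R) : (forall i, jc (f i)) -> jc (fun t x => \sum_(i < n) f i t x).
Proof.
elim: n f => [|n IH] f hf.
  by rewrite (_ : (fun _ _ => _) = fun _ _ => 0); [exact: jc_cst|apply/funext => t; apply/funext => x; rewrite big_ord0].
rewrite (_ : (fun _ _ => _) = fun t x => f ord0 t x + \sum_(i < n) f (lift ord0 i) t x).
  by apply: jcD => //; apply: IH.
by apply/funext => t; apply/funext => x; rewrite big_ord_recl.
Qed.

Lemma jc_ev (F : tp) : jc (ev F).
Proof. by split; [exact: continuous_ev|exact: ev_periodic]. Qed.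

Lemma jc_ti f : jc f -> continuous (fun t => ti (f t)).
Proof. by move=> [cf pf]; exact: (ti_continuous cf pf). Qed.

Definition wI (V : 'I_3 -> R -> pt -> R) (S : 'I_3 -> 'I_3 -> R -> pt -> R) (nu : R) (phi : R -> field R) t x : R :=
  \sum_(i < 3) (V i t x * (tT phi i (x, t) + nu * \sum_(j < 3) tGG phi i j (x, t)) +
    \sum_(j < 3) (V i t x * V j t x + S i j t x) * tG phi i j (x, t)).

(* Weak form of the Navier-Stokes equations with the additional stress [S]. *)
Definition NSR (T nu : R) (V : 'I_3 -> R -> pt -> R) (S : 'I_3 -> 'I_3 -> R -> pt -> R) : Prop :=
  forall phi, test_field 0 T phi -> \int[lm]_t ti (wI V S nu phi t) = 0.

Section Update.
Variables (T nu : R).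
Hypothesis T0 : 0 < T.

Section Fixphi.
Variable phi : R -> field R.
Hypothesis hphi : test_field 0 T phi.

Lemma jc_tP i : jc (fun t x => tP phi i (x, t)).
Proof.
split=> [z|t]; last exact: tP_per hphi i t.
by rewrite (_ : (fun _ => _) = tP phi i); [exact: tP_cont hphi i z|apply/funext; case].
Qed.

Lemma jc_tT i : jc (fun t x => tT phi i (x, t)).
Proof.
split=> [z|t]; last exact: tT_per hphi i t.
by rewrite (_ : (fun _ => _) = tT phi i); [exact: tT_cont hphi i z|apply/funext; case].
Qed.

Lemma jc_tG i j : jc (fun t x => tG phi i j (x, t)).
Proof.
split=> [z|t]; last exact: tG_per hphi i j t.
by rewrite (_ : (fun _ => _) = tG phi i j); [exact: tG_cont hphi i j z|apply/funext; case].
Qed.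

Lemma jc_tGG i j : jc (fun t x => tGG phi i j (x, t)).
Proof.
split=> [z|t]; last exact: tGG_per hphi i j t.
by rewrite (_ : (fun _ => _) = tGG phi i j); [exact: tGG_cont hphi i j z|apply/funext; case].
Qed.

Lemma jc_wI V S : (forall i, jc (V i)) -> (forall i j, jc (S i j)) -> jc (wI V S nu phi).
Proof.
move=> hV hS; apply: jc_sum => i; apply: jcD.
  apply: (jcM (hV i)); apply: (jcD (jc_tT i)); apply: (@jcZ nu (fun t x => \sum_(j < 3) tGG phi i j (x, t))).
  exact: (@jc_sum 3 (fun j t x => tGG phi i j (x, t)) (jc_tGG i)).
apply: (@jc_sum 3 (fun j t x => (V i t x * V j t x + S i j t x) * tG phi i j (x, t))) => j.
exact: (jcM (jcD (jcM (hV i) (hV j)) (hS i j)) (jc_tG i j)).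
Qed.

Lemma wI_supp : exists c d, [/\ 0 < c, d < T, c <= d & forall V S t, t \notin `[c, d] -> forall x, wI V S nu phi t x = 0].
Proof.
have [c [d [c0 dT cd h]]] := test_supp T0 hphi; exists c, d; split=> // V S t ht x.
rewrite /wI big1// => i _; rewrite [X in _ + X]big1 ?addr0 => [|j _]; last by have [_ _ -> _] := h t ht x i j; rewrite mulr0.
have [_ -> _ _] := h t ht x i 0; rewrite big1 ?mulr0 ?addr0 ?mulr0// => j _.
by have [_ _ _ ->] := h t ht x i j.
Qed.

Lemma wI_int V S : (forall i, jc (V i)) -> (forall i j, jc (S i j)) ->
  lm.-integrable setT (EFin \o (fun t => ti (wI V S nu phi t))).
Proof.
move=> hV hS; have [c [d [_ _ cd h]]] := wI_supp; apply: (@supp_integrable R c d); split.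
  exact: jc_ti (jc_wI hV hS).
move=> t ht; apply: ti_eq0 => x; exact: h.
Qed.

Section Tps.
Variables (W : 'I_3 -> tp) (Sh : 'I_3 -> 'I_3 -> tp) (q : tp).
Hypothesis hS : forall i t x, \sum_(j < 3) ev (dj j (Sh i j)) t x =
  ev (D None (W i)) t x - nu * (\sum_(j < 3) ev (dj j (dj j (W i))) t x) + ev (dj i q) t x.

Lemma ibp (f f' g g' : R -> pt -> R) j t : CP (f t) -> CP (f' t) -> CP (g t) -> CP (g' t) ->
  (forall x (s : R), is_derive s (1 : R) (fun s : R => f t (x + s *: basis R j)) (f' t (x + s *: basis R j))) ->
  (forall x (s : R), is_derive s (1 : R) (fun s : R => g t (x + s *: basis R j)) (g' t (x + s *: basis R j))) ->
  (\oint x, f t x * g' t x) = - (\oint x, f' t x * g t x).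
Proof.
move=> cf cf' cg cg' df dg; apply/eqP; rewrite -addr_eq0 -tiD; [|exact: CPM|exact: CPM].
apply/eqP; apply: (@ti_deriv0 R (fun x => f t x * g t x) _ (basis R j)); first exact: CPM.
  by apply: CPD; exact: CPM.
move=> x s; have := is_deriveM (df x s) (dg x s); rewrite /GRing.scale/= => h.
by apply: (is_derive_eq h); rewrite [g t _ * _]mulrC.
Qed.

Lemma ev_dx j (F : tp) t x (s : R) : is_derive s (1 : R) (fun s : R => ev F t (x + s *: basis R j)) (ev (dj j F) t (x + s *: basis R j)).
Proof. by have := is_derive_ev (Some (ee j)) F t x s; rewrite /= rv_delta. Qed.

Lemma ev_dt (F : tp) x (t : R) : is_derive t (1 : R) (fun s : R => ev F s x) (ev (D None F) t x).
Proof.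
have := is_derive_ev None F 0 x t; rewrite /= add0r; congr is_derive.
by apply/funext => s; rewrite add0r.
Qed.

Let G t x : R := \sum_(i < 3) (ev (W i) t x * (tT phi i (x, t) + nu * \sum_(j < 3) tGG phi i j (x, t)) -
    \sum_(j < 3) ev (Sh i j) t x * tG phi i j (x, t)).

(** All space derivatives are moved onto [W] and [Sh], where the equation [hS] applies. The pressure
    disappears against the divergence of the test field. *)
Lemma G_int t : ti (G t) = (\oint x, \sum_(i < 3) (ev (D None (W i)) t x * tP phi i (x, t) + ev (W i) t x * tT phi i (x, t))).
Proof.
have cP i : CP (fun x => tP phi i (x, t)) by exact: jc_CP (jc_tP i).
have cT i : CP (fun x => tT phi i (x, t)) by exact: jc_CP (jc_tT i).
have cG i j : CP (fun x => tG phi i j (x, t)) by exact: jc_CP (jc_tG i j).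
have cGG i j : CP (fun x => tGG phi i j (x, t)) by exact: jc_CP (jc_tGG i j).
have ce F : CP (ev F t) by exact: CP_ev.
have i1 i j : (\oint x, ev (W i) t x * tGG phi i j (x, t)) = (\oint x, ev (dj j (dj j (W i))) t x * tP phi i (x, t)).
  have h1 := @ibp (ev (W i)) (ev (dj j (W i))) (fun t x => tG phi i j (x, t)) (fun t x => tGG phi i j (x, t)) j t
    (ce _) (ce _) (cG i j) (cGG i j) (fun x s => ev_dx j (W i) t x s) (fun x s => tG_dx hphi i j x t s).
  have h2 := @ibp (ev (dj j (W i))) (ev (dj j (dj j (W i)))) (fun t x => tP phi i (x, t)) (fun t x => tG phi i j (x, t)) j t
    (ce _) (ce _) (cP i) (cG i j) (fun x s => ev_dx j (dj j (W i)) t x s) (fun x s => tP_dx hphi i j x t s).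
  by rewrite h1 h2 opprK.
have i2 i j : (\oint x, ev (Sh i j) t x * tG phi i j (x, t)) = - (\oint x, ev (dj j (Sh i j)) t x * tP phi i (x, t)).
  exact: (@ibp (ev (Sh i j)) (ev (dj j (Sh i j))) (fun t x => tP phi i (x, t)) (fun t x => tG phi i j (x, t)) j t
    (ce _) (ce _) (cP i) (cG i j) (fun x s => ev_dx j (Sh i j) t x s) (fun x s => tP_dx hphi i j x t s)).
have i3 i : (\oint x, ev q t x * tG phi i i (x, t)) = - (\oint x, ev (dj i q) t x * tP phi i (x, t)).
  exact: (@ibp (ev q) (ev (dj i q)) (fun t x => tP phi i (x, t)) (fun t x => tG phi i i (x, t)) i t
    (ce _) (ce _) (cP i) (cG i i) (fun x s => ev_dx i q t x s) (fun x s => tP_dx hphi i i x t s)).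
have z3 : (\oint x, \sum_(i < 3) ev (dj i q) t x * tP phi i (x, t)) = 0.
  rewrite ti_sum => [|i]; last exact: CPM.
  rewrite (eq_bigr (fun i => - (\oint x, ev q t x * tG phi i i (x, t)))) => [|i _]; last by rewrite i3 opprK.
  rewrite sumrN -ti_sum => [|i]; last exact: CPM.
  rewrite ti_eq0 ?oppr0// => x; by rewrite -big_distrr/= (tG_div hphi) mulr0.
have cS i : CP (fun x => \sum_(j < 3) tGG phi i j (x, t)).
  by apply: (@CP_sum R _ _ _ (fun j x => tGG phi i j (x, t))).
have cWT i : CP (fun x => ev (W i) t x * (tT phi i (x, t) + nu * \sum_(j < 3) tGG phi i j (x, t))).
  exact: (CPM (ce (W i)) (CPD (cT i) (CPZ nu (cS i)))).
have cSG i : CP (fun x => \sum_(j < 3) ev (Sh i j) t x * tG phi i j (x, t)).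
  by apply: (@CP_sum R _ _ _ (fun j x => ev (Sh i j) t x * tG phi i j (x, t))) => j; exact: (CPM (ce _) (cG i j)).
have cWG i : CP (fun x => \sum_(j < 3) ev (W i) t x * tGG phi i j (x, t)).
  by apply: (@CP_sum R _ _ _ (fun j x => ev (W i) t x * tGG phi i j (x, t))) => j; exact: (CPM (ce _) (cGG i j)).
have e1 : ti (G t) = \sum_(i < 3) ((\oint x, ev (W i) t x * tT phi i (x, t)) + nu * \sum_(j < 3) (\oint x, ev (W i) t x * tGG phi i j (x, t)) -
    \sum_(j < 3) (\oint x, ev (Sh i j) t x * tG phi i j (x, t))).
  rewrite /G ti_sum => [|i]; last exact: (CPB (cWT i) (cSG i)).
  apply: eq_bigr => i _; rewrite (tiB (cWT i) (cSG i)).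
  rewrite (@ti_sum R _ _ _ (fun j x => ev (Sh i j) t x * tG phi i j (x, t))) => [|j]; last exact: (CPM (ce _) (cG i j)).
  congr (_ - _); rewrite -(@ti_sum R _ _ _ (fun j x => ev (W i) t x * tGG phi i j (x, t))) => [|j]; last exact: (CPM (ce _) (cGG i j)).
  rewrite -(tiZ nu (cWG i)) -(tiD (CPM (ce (W i)) (cT i)) (CPZ nu (cWG i))).
  by apply: eq_ti => x; rewrite -big_distrr/= mulrDr mulrCA.
have cPP i F : CP (fun x => ev F t x * tP phi i (x, t)) by exact: (CPM (ce F) (cP i)).
have cWTt i : CP (fun x => ev (W i) t x * tT phi i (x, t)) by exact: (CPM (ce (W i)) (cT i)).
rewrite e1 -[RHS]addr0 -[X in _ = _ + X]z3.
rewrite (@ti_sum R _ _ _ (fun i x => ev (D None (W i)) t x * tP phi i (x, t) + ev (W i) t x * tT phi i (x, t))) => [|i]; last exact: (CPD (cPP i _) (cWTt i)).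
rewrite (@ti_sum R _ _ _ (fun i x => ev (dj i q) t x * tP phi i (x, t))) => [|i]; last exact: cPP.
rewrite -big_split/=; apply: eq_bigr => i _.
have E1 : \sum_(j < 3) (\oint x, ev (W i) t x * tGG phi i j (x, t)) =
    (\oint x, \sum_(j < 3) ev (dj j (dj j (W i))) t x * tP phi i (x, t)).
  rewrite (@ti_sum R _ _ _ (fun j x => ev (dj j (dj j (W i))) t x * tP phi i (x, t))) => [|j]; last exact: cPP.
  by apply: eq_bigr => j _; exact: i1.
have E2 : \sum_(j < 3) (\oint x, ev (Sh i j) t x * tG phi i j (x, t)) =
    - (\oint x, \sum_(j < 3) ev (dj j (Sh i j)) t x * tP phi i (x, t)).
  rewrite (@ti_sum R _ _ _ (fun j x => ev (dj j (Sh i j)) t x * tP phi i (x, t))) => [|j]; last exact: cPP.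
  by rewrite -sumrN; apply: eq_bigr => j _; exact: i2.
have aux (k b' c' r1 r2 d' : R) : b' = r1 -> c' = - r2 -> k + nu * r1 + r2 = d' -> k + nu * b' - c' = d'.
  by move=> -> -> <-; rewrite opprK.
apply: (aux _ _ _ _ _ _ E1 E2).
rewrite (tiD (cPP i _) (cWTt i)).
have cs : CP (fun x => \sum_(j < 3) ev (dj j (dj j (W i))) t x * tP phi i (x, t)).
  by apply: (@CP_sum R _ _ _ (fun j x => ev (dj j (dj j (W i))) t x * tP phi i (x, t))) => j; exact: cPP.
rewrite (eq_ti (f := fun x => \sum_(j < 3) ev (dj j (Sh i j)) t x * tP phi i (x, t))
  (fun x => (ev (D None (W i)) t x * tP phi i (x, t) - nu * (\sum_(j < 3) ev (dj j (dj j (W i))) t x * tP phi i (x, t))) +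
     ev (dj i q) t x * tP phi i (x, t))) => [|x]; last first.
  by rewrite -!big_distrl/= hS; ring.
rewrite (tiD (CPB (cPP i _) (CPZ nu cs)) (cPP i _)) (tiB (cPP i _) (CPZ nu cs)) (tiZ nu cs); ring.
Qed.

(** The integrand is the time derivative of the pairing of [W] with the test field, which has
    compact support in time. *)
Lemma G_zero : \int[lm]_t ti (G t) = 0.
Proof.
have [c [d [c0 dT cd h]]] := test_supp T0 hphi.
pose K t := (\oint x, \sum_(i < 3) ev (W i) t x * tP phi i (x, t)).
pose k t := (\oint x, \sum_(i < 3) (ev (D None (W i)) t x * tP phi i (x, t) + ev (W i) t x * tT phi i (x, t))).
have jK : jc (fun t x => \sum_(i < 3) ev (W i) t x * tP phi i (x, t)).
  by apply: jc_sum => i; apply: jcM; [exact: jc_ev|exact: jc_tP].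
have jk : jc (fun t x => \sum_(i < 3) (ev (D None (W i)) t x * tP phi i (x, t) + ev (W i) t x * tT phi i (x, t))).
  by apply: jc_sum => i; apply: jcD; (apply: jcM; first exact: jc_ev); [exact: jc_tP|exact: jc_tT].
under eq_Rintegral do rewrite G_int -/(k _).
apply: (@supp_deriv0 R c d k K) => //.
- split=> [|t ht]; first exact: jc_ti jk.
  rewrite /k (eq_ti (fun=> 0)) => [|x]; first by rewrite ti_cst mul0r.
  by rewrite big1// => i _; have [-> -> _ _] := h t ht x i 0; rewrite !mulr0 addr0.
- split=> [|t ht]; first exact: jc_ti jK.
  rewrite /K (eq_ti (fun=> 0)) => [|x]; first by rewrite ti_cst mul0r.
  by rewrite big1// => i _; have [-> _ _ _] := h t ht x i 0; rewrite mulr0.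
move=> t; apply: (@ti_is_derive (fun z => \sum_(i < 3) ev (W i) z.2 z.1 * tP phi i (z.1, z.2))
   (fun z => \sum_(i < 3) (ev (D None (W i)) z.2 z.1 * tP phi i (z.1, z.2) + ev (W i) z.2 z.1 * tT phi i (z.1, z.2))) t).
- exact: jK.1.
- exact: jk.1.
- exact: jK.2.
- exact: jk.2.
move=> x s /=.
have hi i : is_derive s (1 : R) (fun s => ev (W i) s x * tP phi i (x, s)) (ev (D None (W i)) s x * tP phi i (x, s) + ev (W i) s x * tT phi i (x, s)).
  have := is_deriveM (ev_dt (W i) x s) (tP_dt hphi i x s); rewrite /GRing.scale/= => h'.
  by apply: (is_derive_eq h'); rewrite addrC; congr (_ + _); rewrite mulrC.
have := @is_derive_sum _ _ _ 3 (fun i (s : R) => ev (W i) s x * tP phi i (x, s)) s 1 (fun i => ev (D None (W i)) s x * tP phi i (x, s) + ev (W i) s x * tT phi i (x, s)) hi.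
by congr is_derive; apply/funext => r; rewrite fct_sumE.
Qed.

End Tps.
End Fixphi.

(** [W] satisfies the weak form with the stress [- W W - Sh], which turns its equation into a linear
    one. Adding the two weak forms and completing the product of the sum puts the cross terms into
    the new stress. *)
Lemma NSR_update (V : 'I_3 -> R -> pt -> R) S (W : 'I_3 -> tp) (Sh : 'I_3 -> 'I_3 -> tp) (q : tp) :
  (forall i, jc (V i)) -> (forall i j, jc (S i j)) -> NSR T nu V S ->
  (forall i t x, \sum_(j < 3) ev (dj j (Sh i j)) t x =
    ev (D None (W i)) t x - nu * (\sum_(j < 3) ev (dj j (dj j (W i))) t x) + ev (dj i q) t x) ->
  NSR T nu (fun i t x => V i t x + ev (W i) t x)
    (fun i j t x => S i j t x - (V i t x * ev (W j) t x + ev (W i) t x * V j t x) - (ev (W i) t x * ev (W j) t x + ev (Sh i j) t x)).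
Proof.
move=> hV hS hN hSh phi hphi; have hG := G_zero hphi hSh.
pose Z i j t x : R := - ev (W i) t x * ev (W j) t x - ev (Sh i j) t x.
have jZ i j : jc (Z i j).
  apply: jcB; last exact: jc_ev.
  apply: jcM; last exact: jc_ev.
  by rewrite (_ : (fun _ _ => _) = fun t x => -1 * ev (W i) t x); [exact/jcZ/jc_ev|apply/funext => t; apply/funext => x; rewrite mulN1r].
have jW i : jc (ev (W i)) by exact: jc_ev.
have GE t : ti (wI (fun i => ev (W i)) Z nu phi t) = (\oint x, \sum_(i < 3) (ev (W i) t x * (tT phi i (x, t) + nu * \sum_(j < 3) tGG phi i j (x, t)) -
    \sum_(j < 3) ev (Sh i j) t x * tG phi i j (x, t))).
  apply: eq_ti => x; apply: eq_bigr => i _; congr (_ + _); rewrite -sumrN; apply: eq_bigr => j _.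
  by rewrite /Z; ring.
have hG' : \int[lm]_t ti (wI (fun i => ev (W i)) Z nu phi t) = 0.
  by rewrite -hG; apply: eq_Rintegral => t _; exact: GE.
rewrite -[RHS](addr0 0) -{1}(hN phi hphi) -hG' -RintegralD//; [|exact: wI_int|exact: wI_int].
apply: eq_Rintegral => t _; rewrite -tiD; [|exact: jc_CP (jc_wI hphi hV hS)|exact: jc_CP (jc_wI hphi jW jZ)].
apply: eq_ti => x; rewrite -big_split/=; apply: eq_bigr => i _.
rewrite [RHS]addrACA -mulrDl -big_split/=; congr (_ + _); apply: eq_bigr => j _.
by rewrite /Z -mulrDl; congr (_ * _); ring.
Qed.

(** A multiple of the identity pairs with the divergence of the test field: it is a pressure. *)
Lemma NSR_trace (V : 'I_3 -> R -> pt -> R) S (rho : R -> pt -> R) :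
  NSR T nu V S -> NSR T nu V (fun i j t x => S i j t x + (i == j)%:R * rho t x).
Proof.
move=> hN phi hphi; rewrite -[RHS](hN phi hphi); apply: eq_Rintegral => t _; apply: eq_ti => x.
transitivity (wI V S nu phi t x + rho t x * \sum_(i < 3) tG phi i i (x, t)); last by rewrite (tG_div hphi) mulr0 addr0.
rewrite big_distrr -big_split/=; apply: eq_bigr => i _; rewrite -addrA; congr (_ + _).
rewrite (eq_bigr (fun j => (V i t x * V j t x + S i j t x) * tG phi i j (x, t) + (i == j)%:R * (rho t x * tG phi i j (x, t)))) => [|j _]; last by ring.
rewrite big_split/=; congr (_ + _); rewrite (bigD1 i)//= eqxx mul1r big1 ?addr0// => j ji.
by rewrite eq_sym (negbTE ji) mul0r.
Qed.

End Update.
End Weak.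

(** * Hoelder functions *)

Section Hol.
Variable R : realType.
Notation pt := (point R).
Notation tp := (seq (mono R)).
Implicit Types (f g : R -> pt -> R) (K C : R) (p : nat).

Definition sqd (x y : pt) : R := dot (x - y) (x - y).

Lemma sqd_ge0 x y : 0 <= sqd x y. Proof. exact: dot_ge0. Qed.

(* Hoelder continuity of exponent [1/p], in interpolated form: optimizing over
   [m] gives back a bound by the power [1/p] of the distance. *)
Definition hol C p f := forall m : R, 1 <= m -> forall t s x y,
  `|f t x - f s y| <= C / m * (1 + m ^+ (2 * p) * (sqd x y + (t - s) ^+ 2)).

Definition gf K p f := [/\ forall t, torus_periodic (f t), forall t x, `|f t x| <= K & hol K p f].

Lemma gf_ge0 K p f : gf K p f -> 0 <= K.
Proof. by move=> [_ /(_ 0 0) h _]; exact: le_trans h. Qed.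

Let fac_ge0 (m : R) p t s x y : 1 <= m -> 0 <= 1 + m ^+ (2 * p) * (sqd x y + (t - s) ^+ 2).
Proof.
move=> m1; rewrite addr_ge0// mulr_ge0 ?exprn_ge0 ?(le_trans _ m1)//.
by rewrite addr_ge0 ?sqd_ge0 ?sqr_ge0.
Qed.

Lemma gf_le K K' p f : K <= K' -> gf K p f -> gf K' p f.
Proof.
move=> KK [h1 h2 h3]; split=> // [t x|m m1 t s x y]; first exact: le_trans KK.
apply: le_trans (h3 m m1 t s x y) _; rewrite ler_wpM2r ?fac_ge0// ler_wpM2r// invr_ge0.
exact: le_trans m1.
Qed.

Lemma gfD K K' p f g : gf K p f -> gf K' p g -> gf (K + K') p (fun t x => f t x + g t x).
Proof.
move=> [h1 h2 h3] [k1 k2 k3]; split=> [t j x|t x|m m1 t s x y]; first by rewrite h1 k1.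
  by rewrite (le_trans (ler_normD _ _))// lerD.
have -> : f t x + g t x - (f s y + g s y) = (f t x - f s y) + (g t x - g s y) by ring.
rewrite (le_trans (ler_normD _ _))// mulrDl mulrDl lerD ?h3 ?k3//.
Qed.

Lemma gfM K K' p f g : gf K p f -> gf K' p g -> gf (2 * (K * K')) p (fun t x => f t x * g t x).
Proof.
move=> hf hg; have K0 := gf_ge0 hf; have K0' := gf_ge0 hg; move: hf hg => [h1 h2 h3] [k1 k2 k3].
split=> [t j x|t x|m m1 t s x y]; first by rewrite h1 k1.
  by rewrite normrM; apply: (le_tr (K * K')); [exact: ler_pM|rewrite ler_peMl ?mulr_ge0// ler1n].
have -> : f t x * g t x - f s y * g s y = (f t x - f s y) * g t x + f s y * (g t x - g s y) by ring.
apply: le_normD; rewrite !normrM.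
set A := 1 + _.
rewrite (_ : 2 * (K * K') / m * A = (K / m * A) * K' + K * (K' / m * A)); last by ring.
by apply: lerD; apply: ler_pM => //; [exact: h3|exact: k3].
Qed.

Lemma gf_cst (c : R) p : gf `|c| p (fun _ _ => c).
Proof.
split=> [t j x//|t x//|m m1 t s x y]; rewrite subrr normr0 mulr_ge0 ?fac_ge0// divr_ge0//.
exact: le_trans m1.
Qed.

Lemma gfZ (c C : R) K p f : `|c| <= C -> gf K p f -> gf (C * K) p (fun t x => c * f t x).
Proof.
move=> cC hf; have K0 := gf_ge0 hf; move: hf => [h1 h2 h3].
split=> [t j x|t x|m m1 t s x y]; first by rewrite h1.
  by rewrite normrM ler_pM.
by rewrite -mulrBr normrM -mulrA -mulrA mulrA -mulrA ler_pM// mulrA; exact: h3.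
Qed.

Lemma gfB K K' p f g : gf K p f -> gf K' p g -> gf (K + K') p (fun t x => f t x - g t x).
Proof.
move=> hf hg; have n1 : `|-1| <= 1 :> R by rewrite normrN normr1.
have := gfD hf (gfZ n1 hg); rewrite mul1r; congr gf.
by apply/funext => t; apply/funext => x; rewrite mulN1r.
Qed.

Lemma gf_abs K p f : gf K p f -> gf K p (fun t x => `|f t x|).
Proof.
move=> [h1 h2 h3]; split=> [t j x|t x|m m1 t s x y]; [by rewrite h1|by rewrite normr_id|].
exact: le_trans (ler_dist_dist _ _) (h3 m m1 t s x y).
Qed.

Lemma gf_sum K p n (f : 'I_n -> R -> pt -> R) : 0 <= K -> (forall i, gf K p (f i)) ->
  gf (n%:R * K) p (fun t x => \sum_(i < n) f i t x).
Proof.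
move=> K0; elim: n f => [|n IH] f hf.
  have := gf_cst 0 p; rewrite normr0 mul0r; congr gf.
  by apply/funext => t; apply/funext => x; rewrite big_ord0.
rewrite -natr1 mulrDl mul1r addrC.
have := gfD (hf ord0) (IH _ (fun i => hf (lift ord0 i))); congr gf.
by apply/funext => t; apply/funext => x; rewrite big_ord_recl.
Qed.

Lemma sqrt_sub (a b : R) : 0 <= a -> 0 <= b -> `|Num.sqrt a - Num.sqrt b| <= Num.sqrt `|a - b|.
Proof.
wlog ab : a b / b <= a.
  move=> h a0 b0; have [/h->//|/ltW/h] := leP b a.
  by rewrite distrC [`|b - a|]distrC; exact.
move=> a0 b0; rewrite [`|a - b|]ger0_norm ?subr_ge0// ger0_norm ?subr_ge0 ?ler_wsqrtr//.
have sa := sqrtr_ge0 a; have sb := sqrtr_ge0 b; have sba := ler_wsqrtr ab.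
rewrite -(@ler_pXn2r _ 2) ?nnegrE ?subr_ge0 ?sqrtr_ge0//.
rewrite sqr_sqrtr ?subr_ge0// -{2}(sqr_sqrtr a0) -{2}(sqr_sqrtr b0).
move: (Num.sqrt a) (Num.sqrt b) sa sb sba => u v u0 v0 uv; nra.
Qed.

Lemma sqrt_le_self (a : R) : 1 <= a -> Num.sqrt a <= a.
Proof.
move=> a1; have a0 : 0 <= a by lra.
rewrite -(@ler_pXn2r _ 2) ?nnegrE ?sqrtr_ge0// sqr_sqrtr// expr2; nra.
Qed.

(** By [sqrt_sub], the bound of [f] at the parameter [m ^ 2] gives, after the root, the factor
    [1 / m] and the power [m ^ (4 p)]: the Hoelder exponent is halved. *)
Lemma gf_sqrt K p f : 1 <= K -> (forall t x, 0 <= f t x) -> gf K p f -> gf K (2 * p) (fun t x => Num.sqrt (f t x)).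
Proof.
move=> K1 f0 [h1 h2 h3]; have K0 : 0 <= K by lra.
split=> [t j x|t x|m m1 t s x y]; first by rewrite h1.
  rewrite ger0_norm ?sqrtr_ge0//; apply: le_trans (sqrt_le_self K1); rewrite ler_wsqrtr//.
  by have := h2 t x; rewrite ger0_norm.
have m0 : 0 < m by lra.
have m2 : 1 <= m ^+ 2 by exact: exprn_ege1.
apply: le_trans (sqrt_sub (f0 t x) (f0 s y)) _.
have := h3 _ m2 t s x y; rewrite -exprM mulnA; set A := 1 + _ => h.
have A1 : 1 <= A by rewrite /A lerDl mulr_ge0 ?exprn_ge0 ?(ltW m0)// addr_ge0 ?sqd_ge0 ?sqr_ge0.
apply: le_trans (ler_wsqrtr h) _.
rewrite -(@ler_pXn2r _ 2) ?nnegrE ?sqrtr_ge0//; last by rewrite mulr_ge0 ?divr_ge0 ?(ltW m0)//; lra.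
rewrite sqr_sqrtr; last by rewrite mulr_ge0 ?divr_ge0 ?exprn_ge0 ?(ltW m0)//; lra.
rewrite exprMn expr_div_n; apply: ler_pM; rewrite ?divr_ge0 ?exprn_ge0 ?(ltW m0)//; first lra.
  by rewrite ler_wpM2r ?invr_ge0 ?exprn_ge0 ?(ltW m0)// expr2; nra.
by rewrite expr2; nra.
Qed.

Lemma cos_lip (a b : R) : `|cos a - cos b| <= `|a - b|.
Proof.
wlog ab : a b / a < b.
  move=> h; have [/h//|/h|->] := ltgtP a b; last by rewrite !subrr.
  by rewrite distrC [`|a - b|]distrC.
have [|c _ hc] := @MVT R cos (fun x => - sin x) a b ab (fun x _ => is_derive_cos x).
  by apply: continuous_subspaceT => x; exact: continuous_cos.
rewrite distrC hc normrM normrN [`|a - b|]distrC ler_piMl//.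
exact: sin_max.
Qed.

Lemma sqd3 (x y : pt) : sqd x y = (x 0 0 - y 0 0) ^+ 2 + (x 0 1 - y 0 1) ^+ 2 + (x 0 2%:R - y 0 2%:R) ^+ 2.
Proof. by rewrite /sqd dot3 !mxE !expr2. Qed.

Lemma gf_ev L p F : 1 <= L -> (0 < p)%N -> bdd L F -> gf (L ^+ 2) p (ev F).
Proof.
move=> L1 p0 [hA hd]; have L0 : 0 <= L by lra.
split=> [t|t x|m m1 t s x y]; first exact: ev_periodic.
  by apply: le_trans (ev_le_nA _ _ _) _; apply: le_trans hA _; rewrite expr2 ler_peMl.
have m0 : 0 < m by lra.
pose dl := `|x 0 0 - y 0 0| + `|x 0 1 - y 0 1| + `|x 0 2%:R - y 0 2%:R| + `|t - s|.
have h1 : `|ev F t x - ev F s y| <= nA F * (L * dl).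
  rewrite /ev -sumrB; apply: le_trans (ler_norm_sum _ _ _) _; rewrite /nA big_distrl/=.
  elim: F hd {hA} => [|k F IH] /=; first by rewrite !big_nil.
  move=> /andP[/andP[/forallP hk ho] hF]; rewrite !big_cons; apply: lerD; last exact: IH.
  rewrite -mulrBr normrM ler_wpM2l//; apply: le_trans (cos_lip _ _) _.
  rewrite /phs (_ : _ - _ = dot (rv R (wv k)) (x - y) + om k * (t - s)); last by rewrite dotDr dotNr; ring.
  rewrite dot3 /dl [leRHS]mulrDr; apply: le_normD; apply: lerD; last by rewrite normrM ler_wpM2r.
  rewrite [leRHS]mulrDr [X in _ <= X + _]mulrDr.
  apply: le_normD; apply: lerD; [apply: le_normD; apply: lerD|]; rewrite !mxE normrM ler_wpM2r//; exact: hk.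
apply: le_trans h1 _.
apply: (le_tr (L * (L * dl))); first by rewrite ler_wpM2r// mulr_ge0// !addr_ge0.
rewrite mulrA -expr2 -mulrA ler_wpM2l ?sqr_ge0// ler_pdivlMl//.
apply: (le_tr (1 + m ^+ 2 * (sqd x y + (t - s) ^+ 2))).
  rewrite sqd3 /dl; move: (_ - _) (_ - _) (_ - _) (t - s) => a b c d.
  (* Used for the three space coordinates and time, whose four constants add up to 1. *)
  have q (u : R) : m * `|u| <= 4^-1 + m ^+ 2 * u ^+ 2.
    rewrite -[u ^+ 2]ger0_norm ?sqr_ge0// normrX; move: `|u| => z.
    have := sqr_ge0 (m * z - 2^-1); rewrite !expr2; nra.
  have := q a; have := q b; have := q c; have := q d; lra.
rewrite lerD2l ler_wpM2r ?addr_ge0 ?sqd_ge0 ?sqr_ge0//; apply: ler_weXn2l => //; lia.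
Qed.

Lemma hol_jc K p f : gf K p f -> jc f.
Proof.
move=> [h1 h2 h3]; split=> // z; apply/cvgrPdist_le => e e0.
pose m := 1 + 2 * `|K| / e.
have m1 : 1 <= m by rewrite lerDl divr_ge0 ?mulr_ge0// ltW.
have m0 : 0 < m by lra.
pose d (y : pt * R) := m ^+ (2 * p) * (sqd z.1 y.1 + (z.2 - y.2) ^+ 2).
have cd : d y @[y --> z] --> (0 : R).
  have -> : (0 : R) = d z by rewrite /d /sqd !subrr dot0l expr0n/= addr0 mulr0.
  have cc j : (y.1 : pt) 0 j @[y --> z] --> (z.1 : pt) 0 j.
    by apply: (@cvg_comp _ _ _ (fun x : pt * R => x.1) (fun x : pt => x 0 j) _ (nbhs z.1)); [exact: cvg_fst|exact: coord_continuous].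
  apply: cvgM; first exact: cvg_cst.
  apply: cvgD.
    rewrite sqd3 (_ : (fun y : pt * R => sqd z.1 y.1) = (fun y : pt * R => (z.1 0 0 - y.1 0 0) * (z.1 0 0 - y.1 0 0) + (z.1 0 1 - y.1 0 1) * (z.1 0 1 - y.1 0 1) + (z.1 0 2%:R - y.1 0 2%:R) * (z.1 0 2%:R - y.1 0 2%:R))); last first.
      by apply/funext => y; rewrite sqd3 !expr2.
    by rewrite !expr2; apply: cvgD; [apply: cvgD|]; apply: cvgM; apply: cvgB; try exact: cvg_cst; exact: cc.
  by rewrite expr2 (_ : (fun y : pt * R => (z.2 - y.2) ^+ 2) = (fun y : pt * R => (z.2 - y.2) * (z.2 - y.2))); [apply: cvgM; apply: cvgB; try exact: cvg_cst; exact: cvg_snd|apply/funext => y; rewrite expr2].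
move/cvgrPdist_le : cd => /(_ 1 ltr01); apply: filterS => y /=.
rewrite sub0r normrN => hd; have hd1 : d y <= 1 := le_trans (ler_norm _) hd.
apply: le_trans (h3 m m1 z.2 y.2 z.1 y.1) _; rewrite -/(d y).
have K0 : 0 <= K by have := h2 0 0; apply: le_trans.
apply: (le_tr (K / m * 2)); first by rewrite ler_wpM2l ?divr_ge0 ?(ltW m0)//; lra.
have em : e * m = e + 2 * K by rewrite /m ger0_norm//; field; rewrite gt_eqF.
rewrite mulrAC ler_pdivrMr// em; lra.
Qed.

Lemma sin_half (u : R) : 0 <= u -> u <= pi / 2 -> u / 2 <= sin u.
Proof.
move=> u0 u1; have [->|un0] := eqVneq u 0; first by rewrite sin0 mul0r.
have up : 0 < u by rewrite lt_neqAle eq_sym un0.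
pose v := u / 2; have v0 : 0 < v by rewrite divr_gt0.
have uv : u = v + v by rewrite /v; field.
have [|c cin hc] := @MVT R sin cos 0 v v0 (fun x _ => is_derive_sin x).
  by apply: continuous_subspaceT => x; exact: continuous_sin.
move: hc; rewrite sin0 !subr0 => hc.
have vpi : v <= pi / 2 by lra.
have cv0 : 0 <= cos v by apply: cos_ge0_pihalf; apply/andP; split; lra.
move: cin; rewrite in_itv/= => /andP[c0 cv].
have ccv : cos v <= cos c.
  have [|c' c'in hc'] := @MVT R cos (fun x => - sin x) c v cv (fun x _ => is_derive_cos x).
    by apply: continuous_subspaceT => x; exact: continuous_cos.
  move: c'in; rewrite in_itv/= => /andP[c'0 c'v].
  have s0 : 0 <= sin c' by apply: sin_ge0_pi; apply/andP; split; have := @pi_ge0 R; lra.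
  rewrite -subr_le0 hc'; rewrite mulNr oppr_le0 mulr_ge0//; lra.
have c2 : 2^-1 <= cos v ^+ 2.
  have : 0 <= cos u by apply: cos_ge0_pihalf; apply/andP; split; lra.
  rewrite uv cosD -!expr2 sin2cos2; lra.
rewrite uv sinD hc; have -> : (v + v) / 2 = v by field.
have : cos v * v <= cos c * v by rewrite ler_wpM2r// ltW.
move: (cos v) (cos c) cv0 ccv c2 => a b a0 ab; rewrite expr2; nra.
Qed.

Definition zc (d : R) : R := (1 + cos d) / 2.

(** For [|y| <= pi], [1 - zc y] is the square of [sin (y / 2)], and [sin (|y| / 2) >= |y| / 4]. A
    multiple of the period brings any [d] into this range. *)
Lemma wrap (d : R) : exists k : int, (d + k%:~R * tpi) ^+ 2 <= 16 * (1 - zc d).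
Proof.
have small (y : R) : `|y| <= pi -> y ^+ 2 <= 16 * (1 - zc y).
  move=> hy; rewrite (_ : 16 * (1 - zc y) = (4 * sin (`|y| / 2)) ^+ 2); last first.
    have cy : cos y = cos (`|y| / 2 + `|y| / 2).
      have -> : `|y| / 2 + `|y| / 2 = `|y| by field.
      by case: ger0P => // _; rewrite cosN.
    by rewrite exprMn /zc cy cosD -!expr2 sin2cos2; field.
  have h := @sin_half (`|y| / 2) (divr_ge0 (normr_ge0 _) (ler0n R 2)).
  have {}h : `|y| / 2 / 2 <= sin (`|y| / 2) by apply: h; lra.
  rewrite -[y ^+ 2]ger0_norm ?sqr_ge0// normrX; apply: lerXn2r; rewrite ?nnegrE//.
    by rewrite mulr_ge0// (le_trans _ h)// !divr_ge0.
  lra.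
have p2 := @twopi_gt0 R.
have /andP[m0 m1] := mod2pi_itv d.
have mE : mod2pi d = d + (- Num.floor (d / tpi))%:~R * tpi.
  by rewrite /mod2pi intrN mulNr mulrC.
have pE : tpi = 2 * pi :> R by rewrite mulr_natl.
have [mp|pm] := leP (mod2pi d) pi.
  exists (- Num.floor (d / tpi)); rewrite -mE.
  have -> : zc d = zc (mod2pi d) by rewrite /zc mE cos_addint.
  by apply: small; rewrite ger0_norm.
exists (- Num.floor (d / tpi) - 1); rewrite intrB mulrBl mul1r addrA -mE.
have -> : zc d = zc (mod2pi d - tpi).
  by rewrite /zc mE -[X in _ - X]mul1r -addrA -mulrBl -[1]/(1%:~R) -intrB cos_addint.
by apply: small; rewrite ler0_norm; rewrite pE in m1 *; lra.
Qed.

(** Replaces the squared distance by [1 - zc], whose moments against the kernels [zc ^ n] are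
    explicit. *)
Lemma hol_per K p f (m : R) t s x y : gf K p f -> 1 <= m ->
  `|f t x - f s y| <= K / m * (1 + m ^+ (2 * p) * (16 * \sum_(i < 3) (1 - zc (x 0 i - y 0 i)) + (t - s) ^+ 2)).
Proof.
move=> hf m1; have K0 := gf_ge0 hf; move: hf => [h1 h2 h3].
have m0 : 0 < m by lra.
have [k0 e0] := wrap (x 0 0 - y 0 0); have [k1 e1] := wrap (x 0 1 - y 0 1); have [k2 e2] := wrap (x 0 2%:R - y 0 2%:R).
pose y' := y + (- k0)%:~R *: (tpi *: basis R 0) + (- k1)%:~R *: (tpi *: basis R 1) + (- k2)%:~R *: (tpi *: basis R 2%:R).
have -> : f s y = f s y' by rewrite /y' (periodic_int _ _ (h1 s 2%:R)) (periodic_int _ _ (h1 s 1)) (periodic_int _ _ (h1 s 0)).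
apply: le_trans (h3 m m1 t s x y') _.
rewrite ler_wpM2l ?divr_ge0 ?(ltW m0)// lerD2l ler_wpM2l ?exprn_ge0 ?(ltW m0)// lerD2r.
rewrite sqd3 sum3 mulrDr [X in _ <= X + _]mulrDr.
have c0 : x 0 0 - y' 0 0 = x 0 0 - y 0 0 + k0%:~R * tpi.
  by rewrite /y' !mxE ?eqxx ?ordE /= !mulr1 !mulr0 !addr0 intrN; ring.
have c1 : x 0 1 - y' 0 1 = x 0 1 - y 0 1 + k1%:~R * tpi.
  by rewrite /y' !mxE ?eqxx ?ordE /= !mulr1 !mulr0 !addr0 intrN; ring.
have c2 : x 0 2%:R - y' 0 2%:R = x 0 2%:R - y 0 2%:R + k2%:~R * tpi.
  by rewrite /y' !mxE ?eqxx ?ordE /= !mulr1 !mulr0 !addr0 intrN; ring.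
by rewrite c0 c1 c2; apply: lerD => //; apply: lerD.
Qed.

(* Distance to the set 2 pi Z *)
Definition cdist (s : R) : R := Num.min (mod2pi s) (tpi - mod2pi s).

Lemma cdist_le s (k : int) : cdist s <= `|s + k%:~R * tpi|.
Proof.
have p2 := @twopi_gt0 R; have /andP[m0 m1] := mod2pi_itv s.
pose n := Num.floor (s / tpi).
have sE : s = mod2pi s + n%:~R * tpi by rewrite /mod2pi -/n [n%:~R * _]mulrC subrK.
rewrite {2}sE -addrA -mulrDl -intrD; rewrite /cdist ge_min.
have [h|h] := leP 0 (n + k).
  apply/orP; left; have : 0 <= (n + k)%:~R * tpi :> R by rewrite mulr_ge0 ?ler0z// ltW.
  by move=> h'; apply: le_trans (ler_norm _); lra.
apply/orP; right; rewrite -normrN; apply: le_trans (ler_norm _).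
have : (n + k)%:~R * tpi <= -1 * tpi :> R.
  by rewrite ler_pM2r// -[-1]/((-1)%:~R) ler_int; lia.
lra.
Qed.

Lemma cdist_att s : exists k : int, cdist s = `|s + k%:~R * tpi|.
Proof.
have p2 := @twopi_gt0 R; have /andP[m0 m1] := mod2pi_itv s.
pose n := Num.floor (s / tpi).
have mE : mod2pi s = s + (- n)%:~R * tpi by rewrite /mod2pi -/n intrN mulNr mulrC.
have [h|h] := leP (mod2pi s) (tpi - mod2pi s).
  by exists (- n); rewrite -mE ger0_norm// /cdist; apply/min_idPl.
exists (- n - 1); rewrite intrB mulrBl mul1r addrA -mE /cdist; move/ltW/min_idPr: h => ->.
by rewrite ler0_norm ?opprB//; lra.
Qed.

Lemma cdist_lip s r (k : int) : `|cdist s - cdist r| <= `|s - r + k%:~R * tpi|.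
Proof.
wlog sr : s r k / cdist r <= cdist s.
  move=> h; have [/h//|/ltW/h] := leP (cdist r) (cdist s).
  move=> /(_ (- k)); rewrite distrC => /le_trans; apply; rewrite -normrN.
  by rewrite le_eqVlt intrN mulNr; apply/orP; left; apply/eqP; congr (`| _ |); ring.
rewrite ger0_norm ?subr_ge0// lerBlDr.
have [l ->] := cdist_att r; apply: le_trans (cdist_le s (k + l)) _.
apply: le_trans (ler_normD _ _); rewrite intrD; apply: le_of_eq; congr (`| _ |); ring.
Qed.

Lemma cdist_sq s r : (cdist s - cdist r) ^+ 2 <= 16 * (1 - zc (s - r)).
Proof.
have [k hk] := wrap (s - r); apply: le_trans hk.
rewrite -[leLHS]ger0_norm ?sqr_ge0// -[leRHS]ger0_norm ?sqr_ge0// !normrX.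
by apply: lerXn2r; rewrite ?nnegrE ?cdist_lip.
Qed.

Lemma cdist_id s : 0 <= s -> s <= pi -> cdist s = s.
Proof.
move=> s0 s1; have p2 := @twopi_gt0 R.
have pE : tpi = 2 * pi :> R by rewrite mulr_natl.
apply/eqP; rewrite eq_le; apply/andP; split.
  by have := cdist_le s 0; rewrite mul0r addr0 ger0_norm.
have [k ->] := cdist_att s.
have [h|h] := leP 0 k.
  have : 0 <= k%:~R * tpi :> R by rewrite mulr_ge0 ?ler0z// ltW.
  by move=> h'; apply: le_trans (ler_norm _); lra.
rewrite -normrN; apply: le_trans (ler_norm _).
have : k%:~R * tpi <= -1 * tpi :> R.
  by rewrite ler_pM2r// -[-1]/((-1)%:~R) ler_int; lia.
rewrite pE; lra.
Qed.

End Hol.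

(** * Quasi-interpolation by trigonometric polynomials *)

Section Interp.
Variable R : realType.
Notation pt := (point R).
Notation tp := (seq (mono R)).
Implicit Types (F G : tp) (K T : R) (n M : nat).

Lemma ev_av_ext e F G : (forall t x, ev F t x = ev G t x) ->
  forall t x, ev (av e F) t x = ev (av e G) t x.
Proof.
move=> FG t x; have [M1 h1] := ex_freq_bound e F (@ltr01 R); have [M2 h2] := ex_freq_bound e G (@ltr01 R).
have [M0 hF] := h1 _ (leq_maxl M1 M2); have [_ hG] := h2 _ (leq_maxr M1 M2).
apply: (mulfI (x := (maxn M1 M2)%:R)); first by rewrite pnatr_eq0 -lt0n.
rewrite -!(disc_avg _ _ ltr01 (multiple1 _ _))//; apply: eq_bigr => j _; exact: FG.
Qed.

Lemma av_scl e (c : R) F t x : ev (av e (scl c F)) t x = c * ev (av e F) t x.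
Proof. by rewrite /av /scl mop_mop !ev_mop big_distrr/=; apply: eq_bigr => m _; rewrite !addr0; ring. Qed.

Lemma av_cat e F G t x : ev (av e (F ++ G)) t x = ev (av e F) t x + ev (av e G) t x.
Proof. by rewrite /av mop_cat ev_cat. Qed.

Lemma av_D e F t x : ev (av e (D (Some e) F)) t x = 0.
Proof.
rewrite ev_mop big_map big1// => m _ /=; have [->|k0] := eqVneq (kd R (wv m) e) 0.
  by rewrite mulr0 !mul0r.
by rewrite mulr0 mul0r.
Qed.

Lemma av_P n t x : ev (av (ee 0) (P (ee 0) (0 : R) n)) t x = wal R n.
Proof.
have f1 : fr (Some (ee 0)) (m1 (ee 0) (0 : R)) = 1 by rewrite /= kd_delta !mxE eqxx.
elim: n => [|n IH].
  rewrite /av ev_mop /P /= big_seq1 /phs /= /kd rv0 !dot0l mul0r !addr0 eqxx cos0 !mulr1.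
  by rewrite /wal big_ord0.
have /= := av_D (ee 0) (Sn (ee 0) (0 : R) n) t x.
rewrite (ev_av_ext (ee 0) (G := scl (2 * n%:R + 2) (P (ee 0) (0 : R) n.+1) ++ scl (- (2 * n%:R + 1)) (P (ee 0) (0 : R) n))); last first.
  by move=> s y; rewrite ev_cat !ev_scl ev_D_Sn f1; ring.
rewrite av_cat (av_scl (ee 0) (2 * n%:R + 2)) (av_scl (ee 0) (- (2 * n%:R + 1))) IH => h.
have n2 : 2 * n%:R + 2 != 0 :> R by rewrite gt_eqF// ltr_wpDl// mulr_ge0.
rewrite walS; apply: (mulfI n2).
by rewrite (_ : _ * (wal R n * _) = (2 * n%:R + 1) * wal R n); [move: h; rewrite mulNr => /eqP; rewrite subr_eq0 => /eqP|field].
Qed.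

Lemma zcN (d : R) : zc (- d) = zc d. Proof. by rewrite /zc cosN. Qed.

Lemma zc_itv (d : R) : 0 <= zc d <= 1.
Proof. by have := cos_le1 d; have := cos_geN1 d; rewrite /zc => h1 h2; apply/andP; split; lra. Qed.

(** The kernel has degree [n < M], so its sum over [M] equally spaced nodes is exactly [M] times its
    mean. *)
Lemma zc_sum n M (X : R) : (n < M)%N ->
  \sum_(j < M) zc (X - tpi * j%:R / M%:R) ^+ n = M%:R * wal R n.
Proof.
move=> nM; pose x : pt := (- X) *: rv R (ee 0).
have k1 : dot (rv R (ee 0)) (rv R (ee 0)) = 1 by rewrite -/(kd R _ _) kd_delta !mxE eqxx.
rewrite -(@av_P n 0 x) -(disc_avg (sg := 1) _ _ ltr01 (multiple1 _ _)).
  apply: eq_bigr => j _; rewrite mul1r ev_P; congr (_ ^+ _).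
  rewrite -zcN /zf /zc /phs/= /x dotDr !dotZr k1 mul0r !addr0; congr ((1 + cos _) / 2); ring.
have d1 : dgm 1 (m1 (ee 0) (0 : R)).
  apply/andP; split; last by rewrite /= normr0.
  by apply/forallP => j; rewrite /= mxE eqxx/=; case: (_ == _) => /=; rewrite ?normr0 ?normr1.
have := dgm_P n d1; rewrite mulr1; apply: sub_all => m /andP[/forallP/(_ 0) h _].
by rewrite kd_delta mul1r (le_lt_trans h)// ltr_nat.
Qed.

Lemma zc_sum2 n M (X : R) : (n.+1 < M)%N ->
  \sum_(j < M) (1 - zc (X - tpi * j%:R / M%:R)) * zc (X - tpi * j%:R / M%:R) ^+ n =
  M%:R * wal R n / (2 * n%:R + 2).
Proof.
move=> nM; transitivity (M%:R * wal R n - M%:R * wal R n.+1).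
  rewrite -(@zc_sum n M X (ltnW nM)) -(@zc_sum n.+1 M X nM) -sumrB; apply: eq_bigr => j _.
  by rewrite exprS; ring.
rewrite walS; field; rewrite gt_eqF// ltr_wpDl// mulr_ge0//.
Qed.

Definition shp (z : pt) (s : R) F : tp :=
  [seq Mono (amp m) (wv m) (om m) (ph m + dot (rv R (wv m)) z + om m * s) | m <- F].

Lemma ev_shp z s F t x : ev (shp z s F) t x = ev F (t + s) (x + z).
Proof.
rewrite /ev big_map; apply: eq_bigr => m _ /=; congr (_ * cos _).
by rewrite /phs/= dotDr; ring.
Qed.

Lemma nA_shp z s F : nA (shp z s F) = nA F. Proof. by rewrite /nA big_map. Qed.

Lemma dgm_shp L z s F : all (dgm L) (shp z s F) = all (dgm L) F.
Proof. by rewrite /shp all_map; apply: eq_all. Qed.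

Lemma ler_wsum (I : finType) (w h : I -> R) (W B : R) : (forall f, 0 <= w f) ->
  \sum_f w f = W -> 0 < W -> \sum_f w f * h f <= B * W -> \sum_f w f / W * h f <= B.
Proof.
move=> w0 _ W0 h1; rewrite (_ : \sum_f _ = (\sum_f w f * h f) / W) ?ler_pdivrMr//.
by rewrite big_distrl/=; apply: eq_bigr => f _; ring.
Qed.

Section Quasi.
Variables (T K : R) (p : nat) (g : R -> pt -> R) (n : nat).
Hypotheses (T0 : 0 < T) (hg : gf K p g).
Notation M := n.+2.
Notation o := (pi / T).
Notation I := {ffun 'I_4 -> 'I_M}.

Definition node (f : I) (k : 'I_4) : R := tpi * (f k)%:R / M%:R.
Definition node_x (f : I) : pt := \row_i node f (widen_ord (leqnSn 3) i).
Definition node_t (f : I) : R := node f ord_max.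

(** Even reflection of [g] from [[0, T]] to a function of period [tpi] in the rescaled time. It
    keeps the Hoelder bounds, as [cdist] is 1-Lipschitz, and needs no condition linking the two end
    times. *)
Definition gper (s : R) (x : pt) : R := g (T / pi * cdist s) x.

Definition kern : tp :=
  mul (mul (P (ee 0) (0 : R) n) (P (ee 1) (0 : R) n)) (mul (P (ee 2%:R) (0 : R) n) (P 0 o n)).

(** Sum of the values of [g] on a grid in space-time times translates of a nonnegative kernel. By
    [zc_sum] the weights add up to 1 exactly, so bounds on [g] are preserved. *)
Definition quasi : tp :=
  flatten [seq scl (gper (node_t f) (node_x f) / (M%:R * wal R n) ^+ 4) (shp (- node_x f) (- (node_t f / o)) kern) | f : I].

Definition wgt (X : 'I_4 -> R) (f : I) : R := \prod_(k < 4) zc (X k - node f k) ^+ n.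

Definition crd (t : R) (x : pt) (k : 'I_4) : R := if unlift ord_max k is Some i then x 0 i else o * t.

Lemma wgt_ge0 X f : 0 <= wgt X f.
Proof. by apply: prodr_ge0 => k _; rewrite exprn_ge0//; case/andP: (zc_itv (X k - node f k)). Qed.

Lemma wgt_sum X : \sum_f wgt X f = (M%:R * wal R n) ^+ 4.
Proof.
rewrite /wgt /node -(bigA_distr_bigA (fun k (j : 'I_M) => zc (X k - tpi * j%:R / M%:R) ^+ n)).
by rewrite (eq_bigr (fun=> M%:R * wal R n)) => [|k _]; rewrite ?prodr_const ?card_ord// zc_sum//; lia.
Qed.

Lemma wgt_sum2 X l : \sum_f wgt X f * (1 - zc (X l - node f l)) = (M%:R * wal R n) ^+ 4 / (2 * n%:R + 2).
Proof.
pose F k (j : 'I_M) := (if k == l then 1 - zc (X k - tpi * j%:R / M%:R) else 1) * zc (X k - tpi * j%:R / M%:R) ^+ n.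
transitivity (\sum_(f : I) \prod_(k < 4) F k (f k)).
  apply: eq_bigr => f _; rewrite /wgt /F big_split/= mulrC; congr (_ * _).
  by rewrite -big_mkcond/= big_pred1_eq.
rewrite -bigA_distr_bigA (bigD1 l)//= /F eqxx zc_sum2//.
rewrite (eq_bigr (fun=> M%:R * wal R n)) => [|k /negbTE ->]; last first.
  by rewrite -(@zc_sum n M (X k)); [apply: eq_bigr => j _; rewrite mul1r|lia].
by rewrite prodr_const cardC1 card_ord /= exprS; ring.
Qed.

Let pi0 : 0 < pi :> R. Proof. exact: pi_gt0. Qed.
Let W : R := (M%:R * wal R n) ^+ 4.
Let W0 : 0 < W. Proof. by rewrite exprn_gt0// mulr_gt0 ?wal_gt0. Qed.

Let wid i : widen_ord (leqnSn 3) i = lift ord_max i.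
Proof. by apply/val_inj => /=; rewrite /bump leqNgt ltn_ord. Qed.

Lemma crd_x t x i : crd t x (widen_ord (leqnSn 3) i) = x 0 i.
Proof. by rewrite /crd wid liftK. Qed.

Lemma crd_t t x : crd t x ord_max = o * t.
Proof. by rewrite /crd unlift_none. Qed.

Lemma ev_kern f t x : ev (shp (- node_x f) (- (node_t f / o)) kern) t x = wgt (crd t x) f.
Proof.
have dE i (y : pt) : dot (rv R (ee i)) y = y 0 i.
  rewrite rv_delta /dot (bigD1 i)//= mxE !eqxx mul1r big1 ?addr0// => j ji.
  by rewrite mxE eqxx/= (negbTE ji) mul0r.
rewrite ev_shp /kern !ev_mul !ev_P /zf /phs/= !dE rv0 dot0l !mul0r !addr0 add0r.
rewrite /wgt big_ord_recr big_ord_recr big_ord_recr big_ord_recr big_ord0/= mul1r.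
have nE i : (x - node_x f) 0 i = crd t x (widen_ord (leqnSn 3) i) - node f (widen_ord (leqnSn 3) i).
  by rewrite crd_x !mxE.
have E (a b c d : R) : a * b * (c * d) = a * b * c * d by ring.
rewrite E !nE crd_t -/(node_t f) /zc.
congr (_ * _ * _ * _); congr (((1 + cos _) / 2) ^+ n); try by congr (crd _ _ _ - node _ _); apply/val_inj.
by rewrite mulrBr [X in _ - X]mulrCA mulfV ?mulr1// gt_eqF// divr_gt0.
Qed.

Lemma ev_quasi t x : ev quasi t x = \sum_(f : I) wgt (crd t x) f / W * gper (node_t f) (node_x f).
Proof.
rewrite /quasi ev_flatten big_map big_enum/=; apply: eq_bigr => f _.
by rewrite ev_scl ev_kern /W; ring.
Qed.

Lemma quasi_bound t x : `|ev quasi t x| <= K.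
Proof.
rewrite ev_quasi; apply: le_trans (ler_norm_sum _ _ _) _.
rewrite (eq_bigr (fun f => wgt (crd t x) f / W * `|gper (node_t f) (node_x f)|)) => [|f _]; last first.
  by rewrite normrM ger0_norm// divr_ge0 ?wgt_ge0// ltW.
apply: ler_wsum (wgt_sum (crd t x)) W0 _; first exact: wgt_ge0.
rewrite -[X in _ * X](wgt_sum (crd t x)) mulrC big_distrl/=; apply: ler_sum => f _.
by rewrite ler_wpM2l ?wgt_ge0//; have [_ h _] := hg; exact: h.
Qed.

(** The Hoelder bound is averaged against the weights; each of the four coordinates contributes the
    moment [1 / (2 n + 2)] of [1 - zc]. *)
Lemma quasi_err (m : R) t x : 1 <= m -> 0 <= t <= T ->
  `|ev quasi t x - g t x| <= K / m * (1 + m ^+ (2 * p) * (16 * (1 + (T / pi) ^+ 2) * (4 / (2 * n%:R + 2)))).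
Proof.
move=> m1 /andP[t0 tT]; have K0 := gf_ge0 hg; have m0 : 0 < m by lra.
have gE : g t x = gper (o * t) x.
  rewrite /gper cdist_id.
  - by congr g; rewrite mulrA -[_ * o]mulrA [_ * (pi / T)]mulrA mulVf ?gt_eqF// mul1r mulfV ?gt_eqF// mul1r.
  - by rewrite mulr_ge0// divr_ge0// ltW.
  - by rewrite mulrAC ler_pdivrMr// ler_pM2l.
rewrite gE ev_quasi.
have -> : gper (o * t) x = \sum_(f : I) wgt (crd t x) f / W * gper (o * t) x.
  by rewrite -big_distrl/= -big_distrl/= wgt_sum mulfV ?mul1r// gt_eqF.
rewrite -sumrB; apply: le_trans (ler_norm_sum _ _ _) _.
rewrite (eq_bigr (fun f => wgt (crd t x) f / W * `|gper (node_t f) (node_x f) - gper (o * t) x|)) => [|f _]; last first.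
  by rewrite -mulrBr normrM ger0_norm// divr_ge0 ?wgt_ge0// ltW.
apply: ler_wsum (wgt_sum (crd t x)) W0 _; first exact: wgt_ge0.
pose c := m ^+ (2 * p) * (16 * (1 + (T / pi) ^+ 2)).
have c0 : 0 <= c by rewrite !mulr_ge0 ?exprn_ge0 ?(ltW m0)// addr_ge0 ?sqr_ge0.
have zc1 (d : R) : 0 <= 1 - zc d by rewrite subr_ge0; case/andP: (zc_itv d).
have pt f : `|gper (node_t f) (node_x f) - gper (o * t) x| <=
    K / m * (1 + c * \sum_(k < 4) (1 - zc (crd t x k - node f k))).
  rewrite distrC; apply: le_trans (hol_per _ _ _ _ hg m1) _.
  rewrite ler_wpM2l ?divr_ge0 ?(ltW m0)// lerD2l /c -[leRHS]mulrA ler_wpM2l ?exprn_ge0 ?(ltW m0)//.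
  rewrite [X in _ <= _ * X]big_ord_recr/= [leRHS]mulrDr; apply: lerD.
    rewrite (eq_bigr (fun i => 1 - zc (crd t x (widen_ord (leqnSn 3) i) - node f (widen_ord (leqnSn 3) i)))) => [|i _].
      by apply: ler_wpM2r; [exact: sumr_ge0|rewrite ler_peMr// lerDl sqr_ge0].
    by rewrite crd_x mxE.
  rewrite -mulrBr exprMn crd_t -/(node_t f).
  apply: le_trans (ler_wpM2l (sqr_ge0 _) (cdist_sq _ _)) _.
  by rewrite mulrCA -[leRHS]mulrA ler_wpM2l// ler_wpM2r// lerDr.
apply: (le_tr (\sum_f wgt (crd t x) f * (K / m * (1 + c * \sum_(k < 4) (1 - zc (crd t x k - node f k)))))).
  by apply: ler_sum => f _; rewrite ler_wpM2l ?wgt_ge0.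
rewrite (eq_bigr (fun f => K / m * (wgt (crd t x) f + c * (\sum_(k < 4) wgt (crd t x) f * (1 - zc (crd t x k - node f k)))))) => [|f _]; last first.
  by rewrite -big_distrr/=; ring.
rewrite -big_distrr/= big_split/= wgt_sum -big_distrr/= exchange_big/=.
rewrite (eq_bigr (fun=> W / (2 * n%:R + 2))) => [|k _]; last by rewrite wgt_sum2.
rewrite sumr_const card_ord -/W -[X in X <= _]mulr1; apply: le_of_eq.
rewrite -[_ *+ 4]mulr_natl /c; ring.
Qed.

(** The number [M ^ 4] of nodes cancels against the normalization, and [(4 n) ^ 2] bounds
    [wal n ^ -4]. *)
Lemma bdd_quasi L : (0 < n)%N -> 1 <= L -> o <= L -> 1 <= K -> bdd (K * (4 * n%:R) ^+ 2 * L + 4 * n%:R * L) quasi.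
Proof.
move=> n0 L1 oL K1; have L0 : 0 <= L by lra.
have nR : 1 <= n%:R :> R by rewrite ler1n.
have A0 : 0 <= K * (4 * n%:R) ^+ 2 * L by rewrite !mulr_ge0 ?exprn_ge0 ?mulr_ge0//; lra.
have B0 : 0 <= 4 * n%:R * L by rewrite !mulr_ge0.
have hk : nA kern <= 1.
  rewrite /kern; apply: le_trans (nA_mul _ _) _; apply: mulr_ile1; rewrite ?nA_ge0//;
  by apply: le_trans (nA_mul _ _) _; apply: mulr_ile1; rewrite ?nA_ge0// nA_P.
have hd : all (dgm (4 * n%:R * L)) kern.
  have de i : dgm L (m1 (ee i) (0 : R)).
    apply/andP; split; last by rewrite /= normr0.
    apply/forallP => j; rewrite /= mxE eqxx/=; case: (_ == _) => /=; rewrite ?normr0 ?normr1//.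
  have dt : dgm L (m1 0 o).
    apply/andP; split; last by rewrite /= ger0_norm// divr_ge0// ltW.
    by apply/forallP => j; rewrite /= mxE normr0.
  rewrite (_ : 4 * n%:R * L = (n%:R * L + n%:R * L) + (n%:R * L + n%:R * L)); last by ring.
  by do 2 apply: all_mul; exact: dgm_P.
split.
  apply: (le_tr (K * (4 * n%:R) ^+ 2 * L)); last by rewrite lerDl.
  apply: (le_tr (K * (4 * n%:R) ^+ 2)); last by rewrite ler_peMr// !mulr_ge0 ?exprn_ge0 ?mulr_ge0//; lra.
  have fl (s : seq I) : nA (flatten [seq scl (gper (node_t f) (node_x f) / (M%:R * wal R n) ^+ 4) (shp (- node_x f) (- (node_t f / o)) kern) | f <- s]) <= (size s)%:R * (K / W).
    elim: s => [|f s IH] /=; first by rewrite /nA big_nil mul0r.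
    rewrite nA_cat (_ : (size s).+1%:R * (K / W) = K / W + (size s)%:R * (K / W)); last by rewrite -natr1; ring.
    apply: lerD => //.
    apply: le_trans (@nA_mop R (K / W) (fun=> gper (node_t f) (node_x f) / (M%:R * wal R n) ^+ 4) 0 _ _ _) _.
    - by rewrite divr_ge0 ?(ltW W0)//; lra.
    - rewrite -(eq_all (a1 := predT)) ?all_predT// => m; symmetry; rewrite -/W normrM [`|W^-1|]gtr0_norm ?invr_gt0// ler_pM2r ?invr_gt0//.
      by have [_ h _] := hg; exact: h.
    rewrite nA_shp ler_piMr// divr_ge0 ?(ltW W0)//; lra.
  apply: le_trans (fl _) _.
  rewrite -cardE card_ffun !card_ord natrX /W exprMn.
  rewrite (_ : M%:R ^+ 4 * (K / (M%:R ^+ 4 * wal R n ^+ 4)) = K * (wal R n ^+ 2)^-1 ^+ 2); last first.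
    by field; rewrite !gt_eqF ?wal_gt0.
  rewrite ler_wpM2l//; first lra.
  apply: lerXn2r; rewrite ?nnegrE ?invr_ge0 ?sqr_ge0 ?mulr_ge0//.
  by rewrite -[leLHS]mulr1 ler_pdivrMl ?exprn_gt0 ?wal_gt0// wal_lb.
apply: dgm_le (_ : all (dgm (4 * n%:R * L)) quasi); first by rewrite lerDr.
rewrite /quasi all_flatten all_map; apply/allP => f _ /=.
by rewrite all_mop dgm_shp.
Qed.

End Quasi.

(** The Hoelder bound is used with [m = K ^ q.+2]. A kernel exponent [n] of order
    [m ^ (2 p) * K ^ 5] makes the moment term at most 1, and the error at most
    [2 K / m <= K ^ -q]. *)
Lemma interp (p q : nat) : exists r : nat, forall (T K : R) (g : R -> pt -> R), 0 < T ->
  9 <= K -> 1 + T <= K -> pi / T <= K -> gf K p g ->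
  exists a, [/\ bdd (K ^+ r) a, forall t x, `|ev a t x| <= K &
    forall t x, 0 <= t <= T -> `|ev a t x - g t x| <= (K ^+ q)^-1].
Proof.
(* [m ^ (2 p) = K ^ m0]. The extra [K ^ 5] in [Z0] absorbs the numerical constants and the
   dependence on [T]. *)
pose m0 := (2 * p * q.+2)%N; exists (4 * (m0 + 7))%N => T K g T0 K9 TK oK hg.
have K1 : 1 <= K by lra.
have K0 : 0 < K by lra.
have Kp j : 1 <= K ^+ j by exact: exprn_ege1.
pose Z0 := K ^+ m0 * K ^+ 5.
have Z1 : 1 <= Z0 by rewrite -[1]mulr1 ler_pM.
pose n := (Num.trunc Z0).+1.
have n1 : Z0 <= n%:R by apply/ltW; rewrite /n truncnS_gt.
have n2 : n%:R <= 2 * Z0.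
  rewrite /n -natr1 mulr2n mulrDl mul1r lerD//.
  by have /andP[] := truncn_itv (le_trans ler01 Z1).
have q0 : (0 < n)%N by [].
clearbody n.
exists (quasi T g n); split.
- apply: bdd_le (bdd_quasi T0 hg q0 K1 oK K1) _.
  have Kj i j : K ^+ (i + j) = K ^+ i * K ^+ j by rewrite exprD.
  apply: (le_tr (K * (4 * (2 * Z0)) ^+ 2 * K + 4 * (2 * Z0) * K)).
    apply: lerD; rewrite ler_wpM2r ?(ltW K0)// ler_wpM2l ?(ltW K0)//.
    by apply: lerXn2r; rewrite ?nnegrE ?mulr_ge0 ?exprn_ge0 ?(ltW K0)// ler_wpM2l.
  have -> : K ^+ (4 * (m0 + 7)) = Z0 ^+ 2 * K ^+ 2 * (K ^+ 2 * K ^+ (2 * m0 + 14)).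
    by rewrite /Z0 exprMn -!exprM -!exprD; congr (_ ^+ _); lia.
  have Z := Z1; have Y := Kp (2 * m0 + 14)%N.
  have ZK : K ^+ 2 * 81 <= K ^+ 2 * (K ^+ 2 * K ^+ (2 * m0 + 14)).
    rewrite ler_wpM2l ?sqr_ge0//; apply: (le_tr (K ^+ 2)); last by rewrite ler_peMr ?sqr_ge0.
    by rewrite expr2; nra.
  move: Z ZK; clear n1 n2 Z1; move: Z0 (K ^+ (2 * m0 + 14)) => Z Y' Z1 ZK.
  rewrite -[leRHS]mulrA; apply: (le_tr (Z ^+ 2 * (K ^+ 2 * 81))); last by rewrite ler_wpM2l ?sqr_ge0.
  have z2 : Z * K <= Z ^+ 2 * K ^+ 2.
    by rewrite -exprMn expr2 ler_peMl ?mulr_ge0//; [lra|lra|rewrite -[1]mulr1 ler_pM//; lra].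
  rewrite (_ : _ + _ = 64 * (Z ^+ 2 * K ^+ 2) + 8 * (Z * K)); last by ring.
  rewrite (_ : Z ^+ 2 * (K ^+ 2 * 81) = 81 * (Z ^+ 2 * K ^+ 2)); last by ring.
  move: z2; move: (Z ^+ 2 * K ^+ 2) (Z * K) (mulr_ge0 (sqr_ge0 Z) (sqr_ge0 K)) => u v u0 uv; lra.
- by apply: quasi_bound; eassumption.
move=> t x tT; have mq : 1 <= K ^+ q.+2 := Kp _.
apply: le_trans (quasi_err n T0 hg x mq tT) _.
have TP : (T / pi) ^+ 2 <= (K - 1) ^+ 2.
  apply: lerXn2r; rewrite ?nnegrE ?divr_ge0 ?pi_ge0 ?(ltW T0)//; first lra.
  rewrite ler_pdivrMr ?pi_gt0//; have := pi_ge2 R; nra.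
have h1 : K ^+ q.+2 ^+ (2 * p) * (16 * (1 + (T / pi) ^+ 2) * (4 / (2 * n%:R + 2))) <= 1.
  have N0 : 0 < 2 * n%:R + 2 :> R by rewrite ltr_wpDl// mulr_ge0.
  rewrite -(exprM K q.+2) -[(q.+2 * _)%N]mulnC -/m0.
  rewrite !mulrA ler_pdivrMr// mul1r.
  have z1 := Kp m0; have k2 : 16 * (1 + (T / pi) ^+ 2) * 4 <= K ^+ 5.
    apply: (le_tr (64 * K ^+ 2)); first by move: TP; rewrite !expr2; nra.
    rewrite (_ : 5%N = (3 + 2)%N)// exprD ler_wpM2r ?sqr_ge0// !exprS expr0 mulr1; nra.
  have : K ^+ m0 * (16 * (1 + (T / pi) ^+ 2) * 4) <= K ^+ m0 * K ^+ 5 by rewrite ler_wpM2l// (le_trans _ z1).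
  rewrite -/Z0 !mulrA => h; apply: le_trans h (le_trans n1 _); lra.
apply: (le_tr (K / K ^+ q.+2 * 2)).
  by rewrite ler_wpM2l ?divr_ge0 ?(ltW K0) ?(le_trans _ mq)//; lra.
rewrite !exprS (_ : K / _ * 2 = 2 / K / K ^+ q); last by field; rewrite !gt_eqF ?exprn_gt0.
rewrite -[leRHS]mul1r ler_wpM2r ?invr_ge0 ?(le_trans _ (Kp q))// ler_pdivrMr//; lra.
Qed.

End Interp.

(** * One stage of the iteration *)

Section Stage.
Variable R : realType.
Notation pt := (point R).
Notation tp := (seq (mono R)).
Notation scalf := (R -> pt -> R).
Implicit Types (T K nu : R) (n p : nat) (V : 'I_3 -> scalf) (S : 'I_3 -> 'I_3 -> scalf) (W : 'I_3 -> tp).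

Definition vld T nu K p V S := [/\ forall i, gf K p (V i), forall i j, gf K p (S i j),
  forall i j t x, S i j t x = S j i t x & NSR T nu V S].

Definition divm W := (forall t x, \sum_(j < 3) ev (dj j (W j)) t x = 0) /\
  (forall i t, ti (ev (W i) t) = 0).

Notation addW V W := (fun i t x => V i t x + ev (W i) t x).

Lemma divm_cat W W' : divm W -> divm W' -> divm (fun i => W i ++ W' i).
Proof.
move=> [h1 h2] [h1' h2']; split=> [t x|i t].
  by under eq_bigr do rewrite D_cat ev_cat; rewrite big_split/= h1 h1' addr0.
rewrite (eq_ti (fun x => ev (W i) t x + ev (W' i) t x)) => [|x]; last by rewrite ev_cat.
by rewrite tiD ?h2 ?h2' ?addr0//; exact: CP_ev.
Qed.

Lemma gf_CP K p f t : gf K p f -> CP (f t).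
Proof. by move=> /hol_jc /jc_CP; exact. Qed.

Lemma ti_normM_le K (f g : pt -> R) : CP f -> CP g -> (forall x, `|f x| <= K) ->
  (\oint x, `|f x * g x|) <= K * (\oint x, `|g x|).
Proof.
move=> cf cg h; rewrite -tiZ; last exact: CP_norm.
apply: ti_le => [||x]; [exact/CP_norm/CPM|exact/CPZ/CP_norm|].
by rewrite normrM ler_wpM2r.
Qed.

Lemma ti_norm3 (f g h : pt -> R) : CP f -> CP g -> CP h ->
  (\oint x, `|f x + g x + h x|) <=
  (\oint x, `|f x|) + (\oint x, `|g x|) + (\oint x, `|h x|).
Proof.
move=> cf cg ch; have cn (u : pt -> R) : CP u -> CP (fun x => `|u x|) by exact: CP_norm.
rewrite -(tiD (cn _ cf) (cn _ cg)) -(tiD (CPD (cn _ cf) (cn _ cg)) (cn _ ch)).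
apply: ti_le => [||x]; [exact: (cn _ (CPD (CPD cf cg) ch))|exact: (CPD (CPD (cn _ cf) (cn _ cg)) (cn _ ch))|].
by apply: le_normD; rewrite lerD2r ler_normD.
Qed.

Lemma ex_nat_pow (Z : R) : 1 <= Z -> exists n : nat, Z <= n%:R <= 2 * Z.
Proof.
move=> Z1; exists (Num.trunc Z).+1; rewrite (ltW (truncnS_gt Z))/= -natr1 mulr2n mulrDl mul1r lerD//.
by have /andP[] := truncn_itv (le_trans ler01 Z1).
Qed.

Lemma pol1 (l K : R) : 1 <= l -> 9 <= K -> l * K + l <= l * K ^+ 2.
Proof. by move=> l1 K9; rewrite -[X in _ + X]mulr1 -mulrDr ler_wpM2l ?(le_trans _ l1)// expr2; nra. Qed.

Lemma pol2 (l l' K : R) : 1 <= l -> l' <= l -> 9 <= K ->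
  K + (2 * (K * l') + 2 * (l' * K)) + (2 * l + l') <= l * K ^+ 2.
Proof.
move=> l1 ll K9; have K0 : 0 <= K by lra.
have h1 := ler_wpM2l K0 ll; have h2 := ler_wpM2l K0 l1; rewrite mulr1 in h2.
apply: (le_tr (l * (5 * K + 3))).
  by rewrite [l' * K]mulrC; move: h1 h2; rewrite [_ * (5 * K + 3)]mulrDr [l * (5 * K)]mulrCA [K * l]mulrC; lra.
by rewrite ler_wpM2l ?(le_trans _ l1)// expr2; nra.
Qed.

Lemma substep p : (0 < p)%N -> exists B : nat, forall T nu K V S d a, 0 < T -> 0 <= nu <= 1 ->
  9 <= K -> good R d -> bdd K a -> vld T nu K p V S -> exists W S',
  [/\ forall i, bdd (K ^+ B) (W i), divm W, vld T nu (K ^+ B) p (addW V W) S',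
      forall t i j, (\oint x, `|S' i j t x - (S i j t x - xr R d i * xr R d j * ev a t x ^+ 2)|) <= K^-1 &
      forall t, (\oint x, \sum_(i < 3) ev (W i) t x ^+ 2) <= 12 * (\oint x, ev a t x ^+ 2) + K^-1].
Proof.
move=> p0; have [m hm] := substep_size R; have mE : (144 * m = 36 * m * 4)%N by lia.
exists (144 * m + 2)%N => T nu K V S d a T0 nu01 K9 gd ha [hV hS Ss hN].
have K1 : 1 <= K by lra.
have K0 : 0 < K by lra.
(* The total error [(2 K + 1) K ^ 30 / N] must be at most [1 / K], whence [34 = 30 + 4]. Then
   [K N <= 2 K ^ 35 <= K ^ 36], the source of the 36 in [L]. *)
have [N /andP[N1 N2]] := ex_nat_pow (exprn_ege1 34 K1).
have Kp j : 1 <= K ^+ j by exact: exprn_ege1.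
have KN : K <= N%:R by apply: le_trans N1; rewrite exprS ler_peMr ?(ltW K0).
have N0 : 0 < N%:R :> R by exact: lt_le_trans KN.
have Nn : (0 < N)%N by rewrite -(ltr0n R).
have hy : hyp d N a nu K by [].
pose W := w d N a; pose Sh := Sh d N a nu; pose L := K ^+ (36 * m).
have L1 : 1 <= L := Kp _.
have NL : (K * N%:R) ^+ m <= L.
  rewrite /L exprM; apply: lerXn2r; rewrite ?nnegrE ?mulr_ge0 ?exprn_ge0 ?(ltW K0) ?(ltW N0)//.
  apply: (le_tr (K * (2 * K ^+ 34))); first by rewrite ler_wpM2l ?(ltW K0).
  by rewrite (exprS K 35) ler_wpM2l ?(ltW K0)// (exprS K 34) ler_wpM2r ?exprn_ge0 ?(ltW K0)//; lra.
have bW i : bdd L (W i) by apply: bdd_le NL; case: (hm _ _ _ _ _ hy i i).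
have bS i j : bdd L (Sh i j) by apply: bdd_le NL; case: (hm _ _ _ _ _ hy i j).
have LB : L ^+ 4 * K ^+ 2 = K ^+ (144 * m + 2) by rewrite (exprD K) mE (exprM K).
have LL n n' : (n <= n')%N -> L ^+ n <= L ^+ n' by move=> nn; exact: ler_weXn2l.
have gW i : gf (L ^+ 2) p (ev (W i)) by exact: gf_ev.
have gS i j : gf (L ^+ 2) p (ev (Sh i j)) by exact: gf_ev.
have l24 := LL 2%N 4%N isT; have l04 := LL 0%N 4%N isT; rewrite expr0 in l04.
have kk : 81 <= K ^+ 2 by rewrite expr2; nra.
exists W, (fun i j t x => S i j t x - (V i t x * ev (W j) t x + ev (W i) t x * V j t x) - (ev (W i) t x * ev (W j) t x + ev (Sh i j) t x)).
split.
- move=> i; apply: bdd_le (bW i) _; rewrite -LB; have := LL 1%N 4%N isT; rewrite expr1.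
  by move: (L ^+ 4) l04 => l l1 Ll; nra.
- split=> [t x|i t]; [exact: w_div|exact: w_mean].
- split.
  + move=> i; apply: gf_le (gfD (hV i) (gW i)); rewrite -LB.
    apply: (le_tr (L ^+ 4 * K + L ^+ 4)); first by apply: lerD => //; rewrite ler_peMl// ltW.
    exact: pol1.
  + move=> i j; have VW i' j' := gfM (hV i') (gW j'); have WV i' j' := gfM (gW i') (hV j').
    apply: gf_le (gfB (gfB (hS i j) (gfD (VW i j) (WV i j))) (gfD (gfM (gW i) (gW j)) (gS i j))).
    by rewrite -LB -[L ^+ 2 * L ^+ 2]exprD; exact: pol2.
  + by move=> i j t x; rewrite (Ss i j) /Sh (Sh_sym d N a nu i j); ring.
  + refine (@NSR_update R T nu T0 V S W Sh (ppi d N a nu) (fun i => hol_jc (hV i)) (fun i j => hol_jc (hS i j)) hN _).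
    by move=> i t x; rewrite (div_Sh a nu gd Nn) ev_lapl.
- move=> t i j; set r := xr R d i * xr R d j.
  have cV k : CP (V k t) := gf_CP t (hV k).
  have cW k : CP (ev (W k) t) := CP_ev _ _.
  have cE : CP (fun x => ev (W i) t x * ev (W j) t x + ev (Sh i j) t x - r * ev a t x ^+ 2).
    by apply: CPB; [apply: CPD; [exact: CPM|exact: CP_ev]|apply: CPZ; apply: CP_exp; exact: CP_ev].
  rewrite (eq_ti (fun x => `|V i t x * ev (W j) t x + V j t x * ev (W i) t x + (ev (W i) t x * ev (W j) t x + ev (Sh i j) t x - r * ev a t x ^+ 2)|)) => [|x]; last first.
    by rewrite -[LHS]normrN; congr (`| _ |); ring.
  apply: le_trans (ti_norm3 (CPM (cV i) (cW j)) (CPM (cV j) (cW i)) cE) _.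
  have e1 := err_main gd K9 KN ha nu01 i j t; rewrite -/W -/Sh -/r in e1.
  have nw k : (\oint x, `|ev (W k) t x|) <= K ^+ 30 / N%:R := n1_w gd K9 KN ha k t.
  have vb k : forall x, `|V k t x| <= K by move=> x; have [_ h _] := hV k; exact: h.
  have v1 := le_trans (ti_normM_le (cV i) (cW j) (vb i)) (ler_wpM2l (ltW K0) (nw j)).
  have v2 := le_trans (ti_normM_le (cV j) (cW i) (vb j)) (ler_wpM2l (ltW K0) (nw i)).
  apply: le_trans (lerD (lerD v1 v2) e1) _.
  rewrite (_ : _ + _ = (2 * K + 1) * K ^+ 30 / N%:R); last by ring.
  rewrite ler_pdivrMr// ler_pdivlMl//; apply: le_trans N1.
  rewrite (exprD K 4 30) mulrA ler_wpM2r ?exprn_ge0 ?(ltW K0)//.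
  by rewrite !exprS expr0 mulr1; move: kk; rewrite expr2; nra.
move=> t; apply: le_trans (ti_w2 gd K9 KN ha t) _; rewrite lerD2l.
rewrite ler_pdivrMr// ler_pdivlMl//; apply: le_trans N1.
by rewrite -exprS; exact: ler_weXn2l.
Qed.

Lemma ti_sq_cat W W' t :
  (\oint x, \sum_(i < 3) ev (W i ++ W' i) t x ^+ 2) <=
  2 * (\oint x, \sum_(i < 3) ev (W i) t x ^+ 2) + 2 * (\oint x, \sum_(i < 3) ev (W' i) t x ^+ 2).
Proof.
have cs (U : 'I_3 -> tp) : CP (fun x => \sum_(i < 3) ev (U i) t x ^+ 2).
  by apply: (@CP_sum R _ _ _ (fun i x => ev (U i) t x ^+ 2)) => i; apply: CP_exp; exact: CP_ev.
rewrite -!tiZ// -tiD; try exact: CPZ.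
apply: ti_le => [||x]; [exact: cs|by apply: CPD; exact: CPZ|].
rewrite !big_distrr -big_split/=; apply: ler_sum => i _; rewrite ev_cat.
have := sqr_ge0 (ev (W i) t x - ev (W' i) t x); rewrite !expr2; lra.
Qed.

(** The perturbations already added count as part of the velocity in the next substep, which runs
    with [K ^ B] in place of [K]. Exponents multiply, while the new errors are smaller than
    [1 / K]. *)
Lemma substeps p n : (0 < p)%N -> exists B : nat, exists C : R, [/\ (0 < B)%N, 0 <= C &
  forall T nu K V S (d : nat -> dirs) (a : nat -> tp), 0 < T -> 0 <= nu <= 1 ->
  9 <= K -> (forall k, (k < n)%N -> good R (d k) /\ bdd K (a k)) -> vld T nu K p V S -> exists W S',
  [/\ forall i, bdd (K ^+ B) (W i), divm W, vld T nu (K ^+ B) p (addW V W) S',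
      forall t i j, (\oint x, `|S' i j t x - (S i j t x - \sum_(k < n) xr R (d k) i * xr R (d k) j * ev (a k) t x ^+ 2)|) <= n%:R / K &
      forall t, (\oint x, \sum_(i < 3) ev (W i) t x ^+ 2) <= C * (\sum_(k < n) (\oint x, ev (a k) t x ^+ 2) + K^-1)]].
Proof.
move=> p0; elim: n => [|n [B [C [B0 C0 IH]]]].
  exists 1%N, 0; split=> // T nu K V S d a T0 nu01 K9 _ hv; exists (fun=> [::]), S.
  have K0 : 0 < K by lra.
  have z (c : R) : ti (fun=> c) = c * tpi ^+ 3 by rewrite ti_cst.
  split.
  - by move=> i; split=> //; rewrite /nA big_nil expr1 ltW.
  - split=> [t x|i t]; first by rewrite big1// => j _; rewrite ev_nil.
    by rewrite (eq_ti (fun=> 0)) ?z ?mul0r// => x; rewrite ev_nil.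
  - rewrite expr1 (_ : addW V _ = V)//; apply/funext => i; apply/funext => t; apply/funext => x.
    by rewrite ev_nil addr0.
  - move=> t i j; rewrite (eq_ti (fun=> 0)) ?z ?mul0r// => x.
    by rewrite big_ord0 subr0 subrr normr0.
  - move=> t; rewrite mul0r (eq_ti (fun=> 0)) ?z ?mul0r// => x.
    by rewrite big1// => i _; rewrite ev_nil expr0n.
have [B1 hB1] := substep p0; exists (B * (B1 + 2))%N, (2 * C + 26).
split=> [||T nu K V S d a T0 nu01 K9 hda hv]; [by rewrite muln_gt0 B0 addn2|lra|].
have K1 : 1 <= K by lra.
have K0 : 0 < K by lra.
have [k kn|W [S1 [bW dW v1 e1 w1]]] := IH T nu K V S d a T0 nu01 K9 _ hv; first by apply: hda; rewrite ltnS ltnW.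
have [gn an] := hda n (ltnSn n).
have KB : K <= K ^+ B by rewrite -(prednK B0) exprS ler_peMr ?(ltW K0)// exprn_ege1.
have KB0 : 0 < K ^+ B by exact: exprn_gt0.
have [W' [S2 [bW' dW' v2 e2 w2]]] := hB1 T nu (K ^+ B) _ _ (d n) (a n) T0 nu01 (le_trans K9 KB) gn (bdd_le an KB) v1.
have inv : (K ^+ B)^-1 <= K^-1 by rewrite lef_pV2 ?posrE.
have BB : K ^+ B ^+ B1 <= K ^+ (B * (B1 + 2)) by rewrite -exprM; apply: ler_weXn2l => //; rewrite leq_mul2l leq_addr orbT.
exists (fun i => W i ++ W' i), S2; split.
- move=> i; have L0 k : 0 <= K ^+ k by rewrite exprn_ge0// ltW.
  apply: bdd_le (bdd_cat _ _ (bW i) (bW' i)) _ => //; first by rewrite -exprM.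
  rewrite exprM exprD.
  have h1 : 1 <= K ^+ B ^+ B1 by rewrite -exprM exprn_ege1.
  have h2 : 81 <= K ^+ B ^+ 2 by rewrite expr2; nra.
  have h3 : K ^+ B * 9 <= K ^+ B ^+ 2 by rewrite expr2 ler_wpM2l//; lra.
  move: (K ^+ B ^+ B1) (K ^+ B ^+ 2) h1 h2 h3 => u v; nra.
- exact: divm_cat.
- have [q1 q2 q3 q4] := v2; split.
  + move=> i; apply: gf_le BB _; have := q1 i; congr gf; apply/funext => t; apply/funext => x.
    by rewrite ev_cat addrA.
  + by move=> i j; apply: gf_le BB _.
  + exact: q3.
  + have E : (fun i t x => V i t x + ev (W i ++ W' i) t x) = addW (addW V W) W'.
      by apply/funext => i; apply/funext => t; apply/funext => x; rewrite ev_cat addrA.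
    by rewrite E.
- move=> t i j; have [_ q2 _ _] := v2; have [_ r2 _ _] := v1; have [_ s2 _ _] := hv.
  set g := fun x => _.
  have ca k : CP (fun x => xr R (d k) i * xr R (d k) j * ev (a k) t x ^+ 2).
    by apply: CPZ; apply: CP_exp; exact: CP_ev.
  have c2 : CP (fun x => S2 i j t x - (S1 i j t x - xr R (d n) i * xr R (d n) j * ev (a n) t x ^+ 2)).
    by apply: (CPB (gf_CP t (q2 i j))); exact: (CPB (gf_CP t (r2 i j)) (ca n)).
  have c1 : CP (fun x => S1 i j t x - (S i j t x - \sum_(k < n) xr R (d k) i * xr R (d k) j * ev (a k) t x ^+ 2)).
    apply: (CPB (gf_CP t (r2 i j))); apply: (CPB (gf_CP t (s2 i j))).
    exact: (@CP_sum R _ _ _ (fun (k : 'I_n) x => xr R (d k) i * xr R (d k) j * ev (a k) t x ^+ 2)).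
  have gE x : g x = `|(S1 i j t x - (S i j t x - \sum_(k < n) xr R (d k) i * xr R (d k) j * ev (a k) t x ^+ 2)) + (S2 i j t x - (S1 i j t x - xr R (d n) i * xr R (d n) j * ev (a n) t x ^+ 2))|.
    by rewrite /g big_ord_recr/=; congr (`| _ |); ring.
  rewrite (eq_ti _ gE); apply: le_trans (ti_norm_add c1 c2) _.
  rewrite -natr1 mulrDl mul1r lerD//; exact: le_trans (e2 t i j) inv.
move=> t; apply: le_trans (ti_sq_cat W W' t) _.
have A0 : 0 <= \sum_(k < n) (\oint x, ev (a k) t x ^+ 2).
  by apply: sumr_ge0 => k _; apply: ti_ge0 => x; rewrite sqr_ge0.
have a0 : 0 <= (\oint x, ev (a n) t x ^+ 2).
  by apply: ti_ge0 => x; rewrite sqr_ge0.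
have i0 : 0 <= K^-1 by rewrite invr_ge0 ltW.
rewrite big_ord_recr/=; have := w1 t; have := w2 t.
move: (ti _) (ti _) (ti _) (\sum_(k < n) _) (K^-1) A0 a0 i0 inv.
by move=> x1 x2 x3 y k y0 x0 k0; nra.
Qed.
End Stage.

(** * Decomposition of the stress and the complete stage *)

Section Stage.
Variable R : realType.
Notation pt := (point R).
Notation tp := (seq (mono R)).
Notation scalf := (R -> pt -> R).
Implicit Types (T K nu : R) (n p : nat) (V : 'I_3 -> scalf) (S : 'I_3 -> 'I_3 -> scalf) (W : 'I_3 -> tp).
Notation addW V W := (fun i t x => V i t x + ev (W i) t x).

Section Decomp.
Variable S : 'I_3 -> 'I_3 -> scalf.
Hypothesis Ss : forall i j t x, S i j t x = S j i t x.

(** Added to the diagonal, [rho] makes all coefficients nonnegative. As a multiple of the identity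
    it is a pressure, and its integral is controlled by the [L^1] size of the stress. *)
Definition rho t x : R := \sum_(i < 3) \sum_(j < 3) `|S i j t x|.

(** Coefficient of [xi = e_i + s e_j] in [S + rho], [l] being the third index. The difference of the
    cases [s = 1] and [s = -1] restores [S i j]; their sums over the two pairs containing [i]
    restore [S i i + rho]. *)
Definition cf (i j l : 'I_3) (s : int) t x : R :=
  2^-1 * (2^-1 * (rho t x + S i i t x + S j j t x - S l l t x) + s%:~R * S i j t x).

Definition tri (k : nat) : 'I_3 * 'I_3 * 'I_3 * int :=
  match k with
  | 0 => (0, 1, 2%:R, 1) | 1 => (0, 1, 2%:R, -1) | 2 => (0, 2%:R, 1, 1)
  | 3 => (0, 2%:R, 1, -1) | 4 => (1, 2%:R, 0, 1) | _ => (1, 2%:R, 0, -1)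
  end.

Definition dk k := let: (i, j, l, s) := tri k in mkdir i j l s.
Definition ck k := let: (i, j, l, s) := tri k in cf i j l s.

Lemma good_dk k : good R (dk k).
Proof.
rewrite /dk; case: k => [|[|[|[|[|k]]]]] /=; apply: good_mkdir => //; by [left|right].
Qed.

Lemma xr_mkdir i j l s m : xr R (mkdir i j l s) m = (m == i)%:R + s%:~R * (m == j)%:R.
Proof. by rewrite /xr /= !mxE eqxx/= intrD intrM !natz -!pmulrn. Qed.

Lemma decomp i j t x : \sum_(k < 6) xr R (dk k) i * xr R (dk k) j * ck k t x = S i j t x + (i == j)%:R * rho t x.
Proof.
rewrite !big_ord_recr big_ord0 /= /dk /ck /= !xr_mkdir /cf.
by case: (ord3P i); case: (ord3P j); rewrite ?eqxx ?ordE /=; rewrite ?(Ss 1 0) ?(Ss 2%:R 0) ?(Ss 2%:R 1); field.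
Qed.

Let ab i j t x : (- `|S i j t x| <= S i j t x) * (S i j t x <= `|S i j t x|).
Proof. by split; [rewrite lerNl -normrN ler_norm|exact: ler_norm]. Qed.

Lemma ck_itv k t x : 0 <= ck k t x <= rho t x.
Proof.
have h i j := ab i j t x; have [h0 h0'] := h 0 0; have [h1 h1'] := h 1 1; have [h2 h2'] := h 2%:R 2%:R.
have [g0 g0'] := h 0 1; have [g1 g1'] := h 0 2%:R; have [g2 g2'] := h 1 2%:R.
rewrite /ck /cf; case: k => [|[|[|[|[|k]]]]] /=;
rewrite /rho !sum3 (Ss 1 0) (Ss 2%:R 0) (Ss 2%:R 1) ?mulr1z ?mulrNz ?mulN1r ?mul1r; apply/andP; split; lra.
Qed.

Lemma gf_rho K p : (forall i j, gf K p (S i j)) -> gf (9 * K) p rho.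
Proof.
move=> h; have K0 := gf_ge0 (h 0 0).
have := @gf_sum R (3 * K) p 3 (fun i t x => \sum_(j < 3) `|S i j t x|) (mulr_ge0 (ler0n R 3) K0)
  (fun i => @gf_sum R K p 3 (fun j t x => `|S i j t x|) K0 (fun j => gf_abs (h i j))).
by apply: gf_le; lra.
Qed.

Lemma gf_ck K p k : (forall i j, gf K p (S i j)) -> gf (4 * K) p (ck k).
Proof.
move=> h; have K0 := gf_ge0 (h 0 0).
have hc i j l (s : int) : `|s%:~R| <= 1 :> R -> gf (4 * K) p (cf i j l s).
  move=> s1; have h2 : `|2^-1| <= 2^-1 :> R by rewrite ger0_norm.
  apply: gf_le (gfZ h2 (gfD (gfZ h2 (gfB (gfD (gfD (gf_rho h) (h i i)) (h j j)) (h l l))) (gfZ s1 (h i j)))).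
  lra.
rewrite /ck; case: k => [|[|[|[|[|k]]]]] /=; apply: hc; rewrite ?mulrNz ?mulr1z ?normrN normr1//.
Qed.

End Decomp.

(** The amplitudes should be the roots of the coefficients [ck], which are only Hoelder continuous,
    with half the exponent. They are replaced by interpolants accurate on [[0, T]], the reason why
    the new bounds hold for these times only. *)
Lemma stage p : (0 < p)%N -> exists B : nat, exists C : R, 0 <= C /\
  forall T nu K delta V S, 0 < T -> 0 <= nu <= 1 -> 9 <= K -> 1 + T <= K -> pi / T <= K -> vld T nu K p V S ->
  (forall t i j, 0 <= t <= T -> (\oint x, `|S i j t x|) <= delta) -> exists W S',
  [/\ forall i, bdd (K ^+ B) (W i), divm W, vld T nu (K ^+ B) p (addW V W) S',
      forall t i j, 0 <= t <= T -> (\oint x, `|S' i j t x|) <= K^-1 &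
      forall t, 0 <= t <= T -> (\oint x, \sum_(i < 3) ev (W i) t x ^+ 2) <= C * (delta + K^-1)].
Proof.
move=> p0; have [r hr] := interp R (2 * p) 4; have [B [C [B0 C0 hB]]] := @substeps R p 6 p0.
(* [54 = 6 * 9]: six directions, and [rho] sums nine entries of the stress. *)
exists (3 * r.+1 * B)%N, (54 * C); split; first lra.
move=> T nu K delta V S T0 nu01 K9 TK oK hv hdel; have [hV hS Ss hN] := hv.
have K1 : 1 <= K by lra.
have K0 : 0 < K by lra.
have K81 : 81 <= K ^+ 2 by rewrite expr2; nra.
(* A power with room to spare: the interpolation error, integrated, and the substep error each stay
   below half of [1 / K]. *)
pose K2 := K ^+ 3.
have K2E : K2 = K ^+ 2 * K by rewrite /K2 exprSr.
have KK2 : 81 * K <= K2 by rewrite K2E ler_wpM2r// ltW.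
have gc k : gf K2 (2 * p) (fun t x => Num.sqrt (ck S k t x)).
  apply: gf_sqrt => [|t x|]; [lra|by have /andP[] := ck_itv Ss k t x|apply: gf_le (gf_ck k hS); lra].
have ha k : exists a, [/\ bdd (K2 ^+ r) a, forall t x, `|ev a t x| <= K2 &
    forall t x, 0 <= t <= T -> `|ev a t x - Num.sqrt (ck S k t x)| <= (K2 ^+ 4)^-1].
  by apply: hr => //; lra.
have [a ha'] := choice ha.
pose Ka := K2 ^+ r.+1.
have K21 : 1 <= K2 by lra.
have rK : K2 ^+ r <= Ka by apply: ler_weXn2l.
have KKa : 81 * K <= Ka by apply: le_trans KK2 _; rewrite /Ka exprS ler_peMr ?exprn_ege1//; lra.
pose S1 i j t x := S i j t x + (i == j)%:R * rho S t x.
have v1 : vld T nu Ka p V S1.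
  split.
  - by move=> i; apply: gf_le (hV i); lra.
  - move=> i j; have n1 : `|(i == j)%:R| <= 1 :> R by case: (i == j) => /=; rewrite ?normr1 ?normr0.
    apply: gf_le (gfD (hS i j) (gfZ n1 (gf_rho hS))); lra.
  - by move=> i j t x; rewrite /S1 Ss eq_sym.
  - exact: NSR_trace hN.
have hda k : (k < 6)%N -> good R (dk k) /\ bdd Ka (a k).
  by move=> _; split; [exact: good_dk|have [h _ _] := ha' k; exact: bdd_le h rK].
have Ka9 : 9 <= Ka by lra.
have [W [S' [bW dW v2 e2 w2]]] := hB T nu Ka V S1 dk a T0 nu01 Ka9 hda v1.
have KaB : Ka ^+ B = K ^+ (3 * r.+1 * B) by rewrite !exprM.
pose e := 2 / K2 ^+ 3.
have e0 : 0 <= e by rewrite divr_ge0// exprn_ge0//; lra.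
have pw k t x : 0 <= t <= T -> `|ck S k t x - ev (a k) t x ^+ 2| <= e.
  move=> tT; have [_ a1 a2] := ha' k; have /andP[c0 _] := ck_itv Ss k t x.
  have [_ s1 _] := gc k; rewrite -{1}(sqr_sqrtr c0) subr_sqr normrM.
  apply: (le_tr ((K2 ^+ 4)^-1 * (K2 + K2))).
    apply: ler_pM => //; first by rewrite distrC; exact: a2.
    by apply: le_normD; apply: lerD; [exact: s1|exact: a1].
  by rewrite /e; apply: le_of_eq; field; rewrite gt_eqF//; lra.
have vE : e * tpi ^+ 3 <= 2 / K2 ^+ 2.
  apply: (le_tr (e * K2)); first by rewrite ler_wpM2l// vol_le.
  by rewrite /e; apply: le_of_eq; field; rewrite gt_eqF//; lra.
clearbody e Ka K2.
have K20 : 0 < K2 by clear -KK2 K0; lra.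
have Ka0 : 0 < Ka by lra.
have K2i : 12 / K2 ^+ 2 <= 2^-1 * K^-1.
  rewrite -invfM ler_pdivrMr ?exprn_gt0// [leRHS]mulrC ler_pdivlMr ?mulr_gt0//.
  by rewrite expr2; nra.
have Kai : 6 / Ka <= 2^-1 * K^-1.
  by rewrite -invfM ler_pdivrMr// [leRHS]mulrC ler_pdivlMr ?mulr_gt0//; lra.
rewrite -KaB; exists W, S'; split=> //.
  move=> t i j tT; have [_ hS' _ _] := v2; have [_ hS1 _ _] := v1.
  pose g x : R := \sum_(k < 6) xr R (dk k) i * xr R (dk k) j * ev (a k) t x ^+ 2.
  have cg : CP g.
    apply: (@CP_sum R _ _ _ (fun (k : 'I_6) x => xr R (dk k) i * xr R (dk k) j * ev (a k) t x ^+ 2)) => k.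
    by apply: CPZ; apply: CP_exp; exact: CP_ev.
  have c1 : CP (fun x => S' i j t x - (S1 i j t x - g x)).
    by apply: (CPB (gf_CP t (hS' i j))); exact: (CPB (gf_CP t (hS1 i j)) cg).
  have c2 : CP (fun x => S1 i j t x - g x) by exact: (CPB (gf_CP t (hS1 i j)) cg).
  rewrite (eq_ti (fun x => `|(S' i j t x - (S1 i j t x - g x)) + (S1 i j t x - g x)|)) => [|x]; last by rewrite subrK.
  apply: le_trans (ti_norm_add c1 c2) _.
  apply: (le_tr (6 / Ka + 6 * (e * tpi ^+ 3))); last by rewrite -[2 / _]mulr1 in vE; clear -vE K2i Kai; lra.
  apply: lerD; first exact: e2 t i j.
  rewrite mulrA -ti_cst; apply: ti_le => [||x]; [exact: CP_norm|exact: CP_cst|].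
  rewrite /S1 -(decomp Ss) /g -sumrB; apply: le_trans (ler_norm_sum _ _ _) _.
  apply: (le_tr (\sum_(k < 6) e)); last by rewrite sumr_const card_ord mulr_natl.
  apply: ler_sum => k _; rewrite -mulrBr normrM -[leRHS]mul1r; apply: ler_pM => //; last exact: pw.
  by rewrite normrM mulr_ile1// xr_le//; exact: good_dk.
move=> t tT; apply: le_trans (w2 t) _.
have ca k : CP (fun x => ev (a k) t x ^+ 2) by apply: CP_exp; exact: CP_ev.
have cr : CP (rho S t) := gf_CP t (gf_rho hS).
have trho : ti (rho S t) <= 9 * delta.
  rewrite /rho ti_sum => [|i]; last first.
    by apply: (@CP_sum R _ _ _ (fun j x => `|S i j t x|)) => j; exact: CP_norm (gf_CP t (hS i j)).
  apply: (le_tr (\sum_(i < 3) (3 * delta))); last by rewrite sumr_const card_ord -mulr_natl; clear; lra.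
  apply: ler_sum => i _; rewrite (@ti_sum R _ _ _ (fun j x => `|S i j t x|)) => [|j]; last exact: CP_norm (gf_CP t (hS i j)).
  apply: (le_tr (\sum_(j < 3) delta)); last by rewrite sumr_const card_ord mulr_natl.
  by apply: ler_sum => j _; exact: hdel.
have ta k : (\oint x, ev (a k) t x ^+ 2) <= 9 * delta + 2 / K2 ^+ 2.
  apply: (le_tr (ti (rho S t) + e * tpi ^+ 3)); last exact: lerD.
  rewrite -ti_cst -tiD//; last exact: CP_cst.
  apply: ti_le => [||x]; [exact: ca|by apply: CPD => //; exact: CP_cst|].
  have := pw k t x tT; have /andP[_] := ck_itv Ss k t x; rewrite ler_norml => h1 /andP[h2 _]; clear -h1 h2; lra.
have d0 : 0 <= delta by apply: le_trans (hdel t 0 0 tT); apply: ti_ge0.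
rewrite mulrAC [X in _ <= X]mulrC ler_wpM2l//.
have h : \sum_(k < 6) (\oint x, ev (a k) t x ^+ 2) <= 6 * (9 * delta + 2 / K2 ^+ 2).
  apply: (le_tr (\sum_(k < 6) (9 * delta + 2 / K2 ^+ 2))); last by rewrite sumr_const card_ord -[leLHS]mulr_natl.
  by apply: ler_sum => k _.
have i0 : 0 < K^-1 by rewrite invr_gt0.
have ka0 : 0 < Ka^-1 by rewrite invr_gt0; lra.
move: (\sum_(k < 6) _) (K2 ^+ 2)^-1 (K^-1) (Ka^-1) h K2i Kai i0 ka0 => X Y Z Z' h K2i Kai i0 ka0; clear -h K2i Kai i0 ka0; lra.
Qed.

End Stage.

(** * Mollification *)

Section Conv.
Variable R : realType.
Notation pt := (point R).
Notation tp := (seq (mono R)).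
Notation vol := (tpi ^+ 3 : R).
Implicit Types (f g : pt -> R) (F G : tp) (x y : pt) (t : R).

Lemma tubeZ (Z : topologicalType) (h : pt * Z -> R) (t0 : Z) (e : R) : continuous h ->
  (forall t : Z, torus_periodic (fun x => h (x, t))) -> 0 < e ->
  \forall t \near t0, forall x, `|h (x, t) - h (x, t0)| < e.
Proof.
move=> ch ph e0.
have : \forall t \near t0, @box R `<=` (fun x => `|h (x, t) - h (x, t0)| < e).
  apply: (proj1 (compact_near_coveringP _) (@compact_box R) Z (nbhs t0) (fun (t : Z) x => `|h (x, t) - h (x, t0)| < e)) => x _.
  have h2 : 0 < e / 2 by rewrite divr_gt0.
  have /cvgrPdist_lt/(_ _ h2)[[/= A B] [nA nB] AB] := ch (x, t0).
  exists (A, B) => //= -[y t] [/= Ay Bt].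
  have := AB (y, t); have := AB (y, t0); rewrite /= => /(_ (conj Ay (nbhs_singleton nB))) a1 /(_ (conj Ay Bt)) a2.
  have := ler_distD (h (x, t0)) (h (y, t)) (h (y, t0)).
  rewrite [`|h (y, t) - h (x, t0)|]distrC; move: (`|_|) (`|_|) (`|_|) a1 a2 => a b c; lra.
apply: filterS => t ht x.
have := ht _ (tobox_in x).
by rewrite (tobox_per x (ph t)) (tobox_per x (ph t0)).
Qed.

Lemma ti_continuousZ (Z : topologicalType) (h : pt * Z -> R) : continuous h ->
  (forall t : Z, torus_periodic (fun x => h (x, t))) -> continuous (fun t : Z => (\oint x, h (x, t))).
Proof.
move=> ch ph t0; have P3 : 0 < vol by exact: vol_gt0.
have ct (t : Z) : CP (fun x => h (x, t)).
  split; last exact: ph.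
  move=> x; apply: (@cvg_comp _ _ _ (fun x => (x, t)) h (nbhs x) (nbhs (x, t))); last exact: ch.
  exact: (cvg_pair cvg_id (cvg_cst t)).
apply/cvgrPdist_le => e e0.
have e1 : 0 < e / vol by rewrite divr_gt0.
apply: filterS (tubeZ t0 ch ph e1) => t ht.
rewrite -tiB//; apply: le_trans (ti_abs_le (M := e / vol) _ _) _.
- exact: CPB.
- by move=> x; rewrite distrC ltW.
- by rewrite divfK// gt_eqF.
Qed.

(** Convolution in space only, with [G] frozen at time 0. Time is untouched, so that test fields
    keep their support in time. *)
Definition cv G f x : R := (\oint y, f (x + y) * ev G 0 y).

Lemma CP_shl f x : CP f -> CP (fun y => f (x + y)).
Proof. by move=> /(CP_shift x); congr CP; apply/funext => y; rewrite addrC. Qed.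

Lemma CP_cv_in G f x : CP f -> CP (fun y => f (x + y) * ev G 0 y).
Proof. by move=> cf; apply: (CPM (CP_shl x cf)); exact: CP_ev. Qed.

Lemma cvE G f x : CP f -> cv G f x = (\oint y, f y * ev G 0 (y - x)).
Proof.
move=> cf; rewrite /cv -[RHS](ti_shift x); last exact: (CPM cf (CP_shift (- x) (CP_ev G 0))).
by apply: eq_ti => y; rewrite addrK addrC.
Qed.

Lemma cv_jc G (f : R -> pt -> R) : jc f -> jc (fun t => cv G (f t)).
Proof.
move=> [cf pf]; split; last by move=> t j x; apply: eq_ti => y; rewrite addrAC pf.
apply: (@ti_continuousZ _ (fun q : pt * (pt * R) => f q.2.2 (q.2.1 + q.1) * ev G 0 q.1)); last first.
  by move=> [x t] j y /=; rewrite addrA pf; congr (_ * _); exact: ev_periodic.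
move=> q; apply: cvgM.
  apply: (@cvg_comp _ _ _ (fun q : pt * (pt * R) => (q.2.1 + q.1, q.2.2)) (fun z : pt * R => f z.2 z.1) _ (nbhs (q.2.1 + q.1, q.2.2))); last exact: (cf (q.2.1 + q.1, q.2.2)).
  have c1 : (q'.1 : pt) @[q' --> q] --> q.1 by exact: cvg_fst.
  have c21 : (q'.2.1 : pt) @[q' --> q] --> q.2.1.
    by apply: (@cvg_comp _ _ _ (fun q' : pt * (pt * R) => q'.2) fst _ (nbhs q.2)); [exact: cvg_snd|exact: cvg_fst].
  have c22 : (q'.2.2 : R) @[q' --> q] --> q.2.2.
    by apply: (@cvg_comp _ _ _ (fun q' : pt * (pt * R) => q'.2) snd _ (nbhs q.2)); [exact: cvg_snd|exact: cvg_snd].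
  exact: (cvg_pair (cvgD c21 c1) c22).
apply: (@cvg_comp _ _ _ fst (ev G 0) _ (nbhs q.1)); first exact: cvg_fst.
by have [c _] := CP_ev G 0; exact: c.
Qed.

Lemma CP_cv G f : CP f -> CP (cv G f).
Proof.
move=> [c p]; apply: (jc_CP 0 (cv_jc G (f := fun _ => f) _)); split=> // z.
by apply: (@cvg_comp _ _ _ fst f _ (nbhs z.1)); [exact: cvg_fst|exact: c].
Qed.

Definition ngt G : tp := [seq Mono (amp m) (- wv m) (om m) (ph m) | m <- G].

Lemma ev_ngt G t x : ev (ngt G) t x = ev G t (- x).
Proof. by rewrite /ev big_map; apply: eq_bigr => m _; rewrite /phs/= rvN dotNl -dotNr. Qed.

(** Fubini for a trigonometric kernel: by the addition formula each mode of [G] at [y - x] is a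
    finite sum of products of functions of [x] and of [y], and induction on the modes suffices. *)
Lemma cv_swap0 G f g : CP f -> CP g ->
  (\oint x, g x * (\oint y, f y * ev G 0 (y - x))) =
  (\oint y, f y * (\oint x, g x * ev G 0 (y - x))).
Proof.
move=> cf cg; elim: G => [|m G IH].
  have z h : ti (fun x : pt => h x * (\oint y, (0 : R))) = 0.
    by rewrite (eq_ti (fun=> 0)) => [|x]; rewrite ti_cst ?mul0r ?mulr0.
  rewrite [LHS](eq_ti (fun x => g x * (\oint y, (0 : R)))) => [|x].
    rewrite [RHS](eq_ti (fun y => f y * (\oint x, (0 : R)))) => [|y]; first by rewrite !z.
    by congr (_ * _); apply: eq_ti => x; rewrite ev_nil mulr0.
  by congr (_ * _); apply: eq_ti => y; rewrite ev_nil mulr0.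
pose mc : tp := [:: Mono 1 (wv m) 0 0]; pose ms : tp := [:: Mono 1 (wv m) 0 (- (pi / 2))].
pose pc := [:: Mono (amp m) (wv m) 0 (ph m)]; pose ps := [:: Mono (amp m) (wv m) 0 (ph m - pi / 2)].
have key x y : ev (m :: G) 0 (y - x) = ev pc 0 y * ev mc 0 x + ev ps 0 y * ev ms 0 x + ev G 0 (y - x).
  rewrite !ev_cons !ev_nil /phs/= !mulr0 !addr0 !mul1r; congr (_ + _).
  rewrite -mulrA -mulrA -mulrDr; congr (_ * _).
  by rewrite addrA !cosBpihalf -cosB dotDr dotNr; congr cos; ring.
have cG (x : pt) : CP (fun y => ev G 0 (y - x)) by exact: CP_shift (CP_ev G 0).
have cG' (y : pt) : CP (fun x => ev G 0 (y - x)).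
  have := CP_shift (- y) (CP_ev (ngt G) 0); congr CP; apply/funext => x.
  by rewrite ev_ngt opprB.
have ce F : CP (ev F 0) by exact: CP_ev.
have cG1 : CP (fun x => (\oint y, f y * ev G 0 (y - x))).
  by have := CP_cv G cf; congr CP; apply/funext => x; rewrite cvE.
have cG2 : CP (fun y => (\oint x, g x * ev G 0 (y - x))).
  suff -> : (fun y => (\oint x, g x * ev G 0 (y - x))) = cv (ngt G) g by exact: CP_cv.
  apply/funext => y; rewrite (cvE (ngt G) y cg).
  by congr torus_int; apply/funext => x; rewrite ev_ngt opprB.
have eL x : (\oint y, f y * ev (m :: G) 0 (y - x)) =
    (\oint y, f y * ev pc 0 y) * ev mc 0 x + (\oint y, f y * ev ps 0 y) * ev ms 0 x + (\oint y, f y * ev G 0 (y - x)).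
  rewrite (eq_ti (fun y => ev mc 0 x * (f y * ev pc 0 y) + ev ms 0 x * (f y * ev ps 0 y) + f y * ev G 0 (y - x))) => [|y]; last by rewrite key; ring.
  rewrite tiD; [|exact: (CPD (CPZ _ (CPM cf (ce pc))) (CPZ _ (CPM cf (ce ps))))|exact: (CPM cf (cG x))].
  rewrite tiD; [|exact: (CPZ _ (CPM cf (ce pc)))|exact: (CPZ _ (CPM cf (ce ps)))].
  by rewrite (tiZ _ (CPM cf (ce pc))) (tiZ _ (CPM cf (ce ps))); ring.
have eR y : (\oint x, g x * ev (m :: G) 0 (y - x)) =
    (\oint x, g x * ev mc 0 x) * ev pc 0 y + (\oint x, g x * ev ms 0 x) * ev ps 0 y + (\oint x, g x * ev G 0 (y - x)).
  rewrite (eq_ti (fun x => ev pc 0 y * (g x * ev mc 0 x) + ev ps 0 y * (g x * ev ms 0 x) + g x * ev G 0 (y - x))) => [|x]; last by rewrite key; ring.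
  rewrite tiD; [|exact: (CPD (CPZ _ (CPM cg (ce mc))) (CPZ _ (CPM cg (ce ms))))|exact: (CPM cg (cG' y))].
  rewrite tiD; [|exact: (CPZ _ (CPM cg (ce mc)))|exact: (CPZ _ (CPM cg (ce ms)))].
  by rewrite (tiZ _ (CPM cg (ce mc))) (tiZ _ (CPM cg (ce ms))); ring.
have split3 (h : pt -> R) (A B : R) (F F' : tp) (k : pt -> R) : CP h -> CP k ->
    (\oint x, h x * (A * ev F 0 x + B * ev F' 0 x + k x)) =
    A * (\oint x, h x * ev F 0 x) + B * (\oint x, h x * ev F' 0 x) + (\oint x, h x * k x).
  move=> ch ck; rewrite (eq_ti (fun x => A * (h x * ev F 0 x) + B * (h x * ev F' 0 x) + h x * k x)) => [|x]; last by ring.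
  rewrite tiD; [|exact: (CPD (CPZ _ (CPM ch (ce F))) (CPZ _ (CPM ch (ce F'))))|exact: (CPM ch ck)].
  rewrite tiD; [|exact: (CPZ _ (CPM ch (ce F)))|exact: (CPZ _ (CPM ch (ce F')))].
  by rewrite (tiZ _ (CPM ch (ce F))) (tiZ _ (CPM ch (ce F'))).
rewrite [LHS](eq_ti _ (fun x => congr1 (fun r => g x * r) (eL x))) [RHS](eq_ti _ (fun y => congr1 (fun r => f y * r) (eR y))).
rewrite [LHS](split3 g _ _ mc ms _ cg cG1) [RHS](split3 f _ _ pc ps _ cf cG2) IH.
by congr (_ + _ + _); exact: mulrC.
Qed.

Lemma cv_swap G f g : (forall x, ev G 0 (- x) = ev G 0 x) -> CP f -> CP g ->
  (\oint x, f x * cv G g x) = (\oint x, cv G f x * g x).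
Proof.
move=> evn cf cg.
have E y : cv G g y = (\oint x, g x * ev G 0 (y - x)).
  by rewrite (cvE G y cg); congr torus_int; apply/funext => z; rewrite -[ev G 0 (z - y)]evn opprB.
rewrite (eq_ti (fun y => f y * (\oint x, g x * ev G 0 (y - x)))) => [|y]; last by rewrite E.
by rewrite -(cv_swap0 G cf cg); apply: eq_ti => x; rewrite mulrC (cvE G x cf).
Qed.

Lemma cv_sum G n (f : 'I_n -> pt -> R) x : (forall i, CP (f i)) ->
  cv G (fun y => \sum_(i < n) f i y) x = \sum_(i < n) cv G (f i) x.
Proof.
move=> cf; rewrite /cv -ti_sum => [|i]; last exact: CP_cv_in.
by apply: eq_ti => y; rewrite big_distrl.
Qed.

Lemma cv_le K G f x : CP f -> (forall y, `|f y| <= K) -> `|cv G f x| <= K * n1 G 0.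
Proof.
move=> cf hf; apply: le_trans (ti_norm (CP_cv_in G x cf)) _.
apply: (ti_normM_le (f := fun y => f (x + y))) => //; [exact: CP_shl|exact: CP_ev].
Qed.

Lemma gf_cv K p G (f : R -> pt -> R) : gf K p f -> gf (K * n1 G 0) p (fun t => cv G (f t)).
Proof.
move=> hf; have jf := hol_jc hf; have cf t := jc_CP t jf; have [h1 h2 h3] := hf.
split=> [t||m m1 t s x y]; [by have [] := CP_cv G (cf t)|by move=> t x; exact: cv_le|].
rewrite {2}/cv {1}/cv -tiB; try exact: CP_cv_in.
have cd : CP (fun z => f t (x + z) - f s (y + z)) by apply: CPB; exact: CP_shl.
rewrite (eq_ti (fun z => (f t (x + z) - f s (y + z)) * ev G 0 z)) => [|z]; last by rewrite mulrBl.
apply: le_trans (ti_norm (CPM cd (CP_ev G 0))) _.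
rewrite (_ : K * n1 G 0 / m * _ = K / m * (1 + m ^+ (2 * p) * (sqd x y + (t - s) ^+ 2)) * n1 G 0); last by ring.
apply: ti_normM_le => //; [exact: CP_ev|move=> z].
have := h3 m m1 t s (x + z) (y + z); rewrite /sqd (_ : x + z - (y + z) = x - y)//.
by rewrite opprD addrACA subrr addr0.
Qed.

(** The mollifier: nonnegative, even, of integral one, and itself a trigonometric polynomial. *)
Definition kn n : tp := scl (vol * wal R n ^+ 3)^-1 (mul (P (ee 0) (0 : R) n) (mul (P (ee 1) (0 : R) n) (P (ee 2%:R) (0 : R) n))).

Let dE i (y : pt) : dot (rv R (ee i)) y = y 0 i.
Proof.
rewrite rv_delta /dot (bigD1 i)//= mxE !eqxx mul1r big1 ?addr0// => j ji.
by rewrite mxE eqxx/= (negbTE ji) mul0r.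
Qed.

Lemma ev_kn n x : ev (kn n) 0 x = (vol * wal R n ^+ 3)^-1 * (zc (x 0 0) ^+ n * (zc (x 0 1) ^+ n * zc (x 0 2%:R) ^+ n)).
Proof. by rewrite /kn ev_scl !ev_mul !ev_P /zf /zc /phs/= !dE !mul0r !addr0. Qed.

Lemma kn_even n x : ev (kn n) 0 (- x) = ev (kn n) 0 x.
Proof. by rewrite !ev_kn !mxE !zcN. Qed.

Lemma kn_ge0 n x : 0 <= ev (kn n) 0 x.
Proof.
have z i : 0 <= zc (x 0 i) ^+ n by rewrite exprn_ge0//; have /andP[] := zc_itv (x 0 i).
rewrite ev_kn; apply: mulr_ge0; last exact: mulr_ge0 (z 0) (mulr_ge0 (z 1) (z 2%:R)).
by rewrite invr_ge0 mulr_ge0 ?exprn_ge0 ?(ltW (wal_gt0 R n)) ?(ltW (twopi_gt0 R)).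
Qed.

Lemma ti_P3 (a b c : nat) : ti (ev (mul (P (ee 0) (0 : R) a) (mul (P (ee 1) (0 : R) b) (P (ee 2%:R) (0 : R) c))) 0) =
  wal R a * (wal R b * (wal R c * vol)).
Proof.
have f1 (i : 'I_3) : fr (Some (ee i)) (m1 (ee i) (0 : R)) != 0 by rewrite /= kd_delta !mxE !eqxx oner_eq0.
have f0 (i j : 'I_3) : i != j -> fr (Some (ee i)) (m1 (ee j) (0 : R)) = 0.
  by move=> ij; rewrite /= kd_delta !mxE eqxx/= (negbTE ij).
have D0 (i j : 'I_3) n x : i != j -> ev (dj i (P (ee j) (0 : R) n)) 0 x = 0.
  by move=> ij; rewrite ev_D_P f0// mulr0 mul0r oppr0.
rewrite (@ti_P R _ _ (ee 0)) ?f1// => [|x]; last by rewrite ev_D_mul !D0// mulr0 mul0r addr0.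
rewrite (@ti_P R _ _ (ee 1)) ?f1// => [|x]; last by rewrite D0.
congr (_ * (_ * _)); rewrite (eq_ti (ev (mul (P (ee 2%:R) (0 : R) c) (one R)) 0)) => [|x]; last by rewrite ev_mul ev_one mulr1.
rewrite (@ti_P R _ _ (ee 2%:R)) ?f1// => [|x].
  by rewrite (eq_ti (fun=> 1)) ?ti_cst ?mul1r// => x; rewrite ev_one.
by rewrite ev_D big_seq1 /= /kd rv0 dot0l mulr0 mul0r oppr0.
Qed.

Let w0 n : wal R n != 0. Proof. by rewrite gt_eqF ?wal_gt0. Qed.
Let v0 : vol != 0. Proof. by rewrite gt_eqF ?vol_gt0. Qed.

Lemma ti_kn n : ti (ev (kn n) 0) = 1.
Proof.
rewrite (eq_ti _ (fun x => ev_scl _ _ 0 x)) tiZ; last exact: CP_ev.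
by rewrite ti_P3; move: (wal R n) (w0 n) vol v0 => w hw v hv; field; rewrite hw hv.
Qed.

Lemma n1_kn n : n1 (kn n) 0 = 1.
Proof. by rewrite -(ti_kn n); apply: eq_ti => x; rewrite ger0_norm ?kn_ge0. Qed.

Lemma ti_kn2 n : ti (fun y : pt => (\sum_(i < 3) (1 - zc (y 0 i))) * ev (kn n) 0 y) = 3 / (2 * n%:R + 2).
Proof.
pose c := (vol * wal R n ^+ 3)^-1.
pose P3 (a b e : nat) := mul (P (ee 0) (0 : R) a) (mul (P (ee 1) (0 : R) b) (P (ee 2%:R) (0 : R) e)).
pose F := scl (3 * c) (P3 n n n) ++ (scl (- c) (P3 n.+1 n n) ++ (scl (- c) (P3 n n.+1 n) ++ scl (- c) (P3 n n n.+1))).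
rewrite (eq_ti (ev F 0)) => [|y]; last first.
  have pE a b e : ev (P3 a b e) 0 y = zc (y 0 0) ^+ a * (zc (y 0 1) ^+ b * zc (y 0 2%:R) ^+ e).
    by rewrite /P3 !ev_mul !ev_P /zf /zc /phs/= !dE !mul0r !addr0.
  by rewrite ev_kn -/c /F !ev_cat !ev_scl !pE sum3 !exprS; ring.
rewrite /F (eq_ti (fun y => 3 * c * ev (P3 n n n) 0 y + (- c * ev (P3 n.+1 n n) 0 y + (- c * ev (P3 n n.+1 n) 0 y + - c * ev (P3 n n n.+1) 0 y)))) => [|y]; last first.
  by rewrite !ev_cat !ev_scl.
have ce (k : R) G : CP (fun y => k * ev G 0 y) by apply: CPZ; exact: CP_ev.
rewrite (tiD (ce _ _) (CPD (ce _ _) (CPD (ce _ _) (ce _ _)))) (tiD (ce _ _) (CPD (ce _ _) (ce _ _))) (tiD (ce _ _) (ce _ _)).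
rewrite !tiZ; try exact: CP_ev.
rewrite !ti_P3 walS /c; have n2 : 2 * n%:R + 2 != 0 :> R by rewrite gt_eqF// ltr_wpDl// mulr_ge0.
by move: (wal R n) (w0 n) vol v0 => w hw v hv; field; rewrite hw hv n2.
Qed.

Lemma cv_err K p n (m : R) (f : R -> pt -> R) t x : gf K p f -> 1 <= m ->
  `|cv (kn n) (f t) x - f t x| <= K / m * (1 + m ^+ (2 * p) * (48 / (2 * n%:R + 2))).
Proof.
move=> hf m1; have cf := jc_CP t (hol_jc hf).
have -> : f t x = (\oint y, f t x * ev (kn n) 0 y) by rewrite tiZ ?ti_kn ?mulr1//; exact: CP_ev.
rewrite /cv -tiB; [|exact: CP_cv_in|apply: CPZ; exact: CP_ev].
have cd : CP (fun y => f t (x + y) - f t x) by apply: CPB; [exact: CP_shl|exact: CP_cst].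
rewrite (eq_ti (fun y => (f t (x + y) - f t x) * ev (kn n) 0 y)) => [|y]; last by rewrite mulrBl.
apply: le_trans (ti_norm (CPM cd (CP_ev _ 0))) _.
have cz i : CP (fun y : pt => 1 - zc (y 0 i)).
  have -> : (fun y : pt => 1 - zc (y 0 i)) = ev (one R ++ scl (-1) (P (ee i) (0 : R) 1)) 0.
    apply/funext => y; rewrite ev_cat ev_one ev_scl ev_P expr1 /zf /phs/= dE !mul0r !addr0 -/(zc _); ring.
  exact: CP_ev.
have cs : CP (fun y : pt => \sum_(i < 3) (1 - zc (y 0 i))) by exact: CP_sum.
have ck := CP_ev (kn n) 0.
apply: (le_tr ((\oint y, K / m * (ev (kn n) 0 y + m ^+ (2 * p) * 16 * ((\sum_(i < 3) (1 - zc (y 0 i))) * ev (kn n) 0 y))))).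
  apply: ti_le => [||y]; [exact: CP_norm (CPM cd ck)|exact: (CPZ _ (CPD ck (CPZ _ (CPM cs ck))))|].
  rewrite normrM [`|ev _ _ _|]ger0_norm ?kn_ge0//.
  rewrite (_ : K / m * _ = K / m * (1 + m ^+ (2 * p) * (16 * \sum_(i < 3) (1 - zc (y 0 i)))) * ev (kn n) 0 y); last by ring.
  rewrite ler_wpM2r ?kn_ge0//; have := hol_per t t (x + y) x hf m1.
  by rewrite subrr expr0n addr0 /=; under eq_bigr do rewrite mxE addrAC subrr add0r.
rewrite (tiZ _ (CPD ck (CPZ _ (CPM cs ck)))) (tiD ck (CPZ _ (CPM cs ck))) (tiZ _ (CPM cs ck)) ti_kn ti_kn2.
by apply: le_of_eq; ring.
Qed.

(** The derivative falls on the kernel. The sign is negative because [x] enters the kernel through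
    [y - x]. *)
Lemma cv_dx G f j x (s : R) : CP f ->
  is_derive s (1 : R) (fun s : R => cv G f (x + s *: basis R j)) (- cv (dj j G) f (x + s *: basis R j)).
Proof.
move=> [cf pf]; rewrite cvE// -tiN; last exact: (CPM (conj cf pf) (CP_shift _ (CP_ev _ 0))).
rewrite (_ : (fun s : R => _) = fun s => (\oint y, f y * ev G 0 (y - (x + s *: basis R j)))); last first.
  by apply/funext => r; rewrite cvE.
have cs F : continuous (fun z : pt * R => ev F 0 (z.1 - (x + z.2 *: basis R j))).
  move=> z; apply: (@cvg_comp _ _ _ (fun z : pt * R => z.1 - (x + z.2 *: basis R j)) (ev F 0) _ (nbhs (z.1 - (x + z.2 *: basis R j)))).
    apply: cvgB; first exact: cvg_fst.
    by apply: cvgD; [exact: cvg_cst|apply: cvgZr_tmp; exact: cvg_snd].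
  by have [c _] := CP_ev F 0; exact: c.
have cf' : continuous (fun z : pt * R => f z.1).
  by move=> z; apply: (@cvg_comp _ _ _ fst f _ (nbhs z.1)); [exact: cvg_fst|exact: cf].
have pp F (r : R) : torus_periodic (fun y => f y * ev F 0 (y - (x + r *: basis R j))).
  by have [_] := CPM (conj cf pf) (CP_shift (- (x + r *: basis R j)) (CP_ev F 0)).
apply: (@ti_is_derive R (fun z => f z.1 * ev G 0 (z.1 - (x + z.2 *: basis R j))) (fun z => - (f z.1 * ev (dj j G) 0 (z.1 - (x + z.2 *: basis R j))))).
- by move=> z; exact: (cvgM (cf' z) (cs G z)).
- by move=> z; exact: (cvgN (cvgM (cf' z) (cs _ z))).
- by move=> r; exact: pp.
- by move=> r k y; have := pp (dj j G) r k y; move=> /= ->.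
move=> y r /=.
have h1 := ev_dx j G 0 (y - x) (- r).
have h2 : is_derive r (1 : R) (fun r : R => - r) (- 1) by exact: is_deriveN.
have h3 := @is_derive1_comp R (fun s : R => ev G 0 (y - x + s *: basis R j)) (fun r : R => - r) r _ _ h1 h2.
have := is_deriveZ (f y) h3; rewrite mulrN1 => h4.
have e F (q : R) : ev F 0 (y - x + - q *: basis R j) = ev F 0 (y - (x + q *: basis R j)) by rewrite scaleNr opprD addrA.
move: h4; rewrite e /GRing.scale/= mulrN; congr is_derive.
by apply/funext => q /=; rewrite e.
Qed.

End Conv.

(** * Convolution of test fields *)

Section ConvTest.
Variable R : realType.
Notation pt := (point R).
Notation tp := (seq (mono R)).
Variable G : tp.
Notation vf := (pt * R -> 'rV[R]_3).
Implicit Types (f : vf) (v z : pt * R).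

Definition cvv f z : 'rV[R]_3 := \row_i cv G (fun x => f (x, z.2) 0 i) z.1.

Definition perF f := forall t, torus_periodic (fun x => f (x, t)).

Lemma row_continuous (Z : topologicalType) (f : Z -> 'rV[R]_3) :
  (forall i, continuous (fun z : Z => f z 0 i)) -> continuous f.
Proof.
move=> cf; rewrite (_ : f = fun z : Z => f z 0 0 *: basis R 0 + f z 0 1 *: basis R 1 + f z 0 2%:R *: basis R 2%:R).
  by move=> z; apply: cvgD; [apply: cvgD|]; apply: cvgZr_tmp; exact: cf.
by apply/funext => z; exact: rowE3.
Qed.

Let perc f i : perF f -> forall t, torus_periodic (fun x => f (x, t) 0 i).
Proof. by move=> pf t j x; have /= -> := pf t j x. Qed.

Let jcc f i : continuous f -> perF f -> jc (fun t x => f (x, t) 0 i).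
Proof.
move=> cf pf; split; last exact: perc.
rewrite (_ : (fun _ => _) = fun z => f z 0 i); last by apply/funext; case.
by move=> z; exact: coord_cont.
Qed.

Lemma cvv_cont f : continuous f -> perF f -> continuous (cvv f).
Proof.
move=> cf pf; apply: row_continuous => i.
rewrite (_ : (fun _ => _) = fun z => cv G (fun x => f (x, z.2) 0 i) z.1); last by apply/funext => z; rewrite mxE.
by have [] := cv_jc G (jcc i cf pf).
Qed.

Lemma cvv_per f : continuous f -> perF f -> perF (cvv f).
Proof.
move=> cf pf t j x; apply/rowP => i; rewrite !mxE.
by have [_ /(_ t j x)] := cv_jc G (jcc i cf pf).
Qed.

Lemma perF_D f v : perF f -> perF ('D_v f).
Proof.
move=> pf t j x.
have := @derive_periodic R _ _ f v (tpi *: basis R j, 0) (x, t).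
rewrite (_ : (x, t) + _ = (x + tpi *: basis R j, t)); last by congr pair => /=; rewrite addr0.
apply=> y; rewrite -[LHS]/(f (y.1 + tpi *: basis R j, y.2 + 0)) addr0.
by have /= -> := pf y.2 j y.1; case: (y).
Qed.

Lemma cvv_der f v z : continuous f -> perF f -> (forall z, derivable f z v) -> continuous ('D_v f) ->
  derivable (cvv f) z v /\ 'D_v (cvv f) z = cvv ('D_v f) z.
Proof.
move=> cf pf df cD.
have pD := perF_D v pf.
have cl (g : vf) i : continuous g -> continuous (fun q : pt * R => g (z.1 + q.2 *: v.1 + q.1, z.2 + q.2 *: v.2) 0 i * ev G 0 q.1).
  move=> cg q; apply: cvgM.
    apply: (@cvg_comp _ _ _ (fun q : pt * R => (z.1 + q.2 *: v.1 + q.1, z.2 + q.2 *: v.2)) (fun z => g z 0 i) _ (nbhs (z.1 + q.2 *: v.1 + q.1, z.2 + q.2 *: v.2))); last first.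
      exact: (@coord_cont R g i cg (z.1 + q.2 *: v.1 + q.1, z.2 + q.2 *: v.2)).
    have h (W : normedModType R) (a b : W) : a + q'.2 *: b @[q' --> q] --> a + q.2 *: b.
      by apply: cvgD; [exact: cvg_cst|apply: cvgZr_tmp; exact: cvg_snd].
    have h1 : (q'.1 : pt) @[q' --> q] --> q.1 by exact: cvg_fst.
    exact: (cvg_pair (cvgD (h _ z.1 v.1) h1) (h _ z.2 v.2)).
  apply: (@cvg_comp _ _ _ fst (ev G 0) _ (nbhs q.1)); first exact: cvg_fst.
  by have [c _] := CP_ev G 0; exact: c.
have pl (g : vf) i (s : R) : perF g -> torus_periodic (fun y => g (z.1 + s *: v.1 + y, z.2 + s *: v.2) 0 i * ev G 0 y).
  move=> pg j y /=; have /= h := pg (z.2 + s *: v.2) j (z.1 + s *: v.1 + y).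
  by rewrite addrA h ev_periodic.
have key i (s : R) : is_derive s (1 : R) (fun s : R => cvv f (z + s *: v) 0 i) (cvv ('D_v f) (z + s *: v) 0 i).
  have := @ti_is_derive R (fun q => f (z.1 + q.2 *: v.1 + q.1, z.2 + q.2 *: v.2) 0 i * ev G 0 q.1)
    (fun q => ('D_v f) (z.1 + q.2 *: v.1 + q.1, z.2 + q.2 *: v.2) 0 i * ev G 0 q.1) s (cl f i cf) (cl _ i cD)
    (fun s => pl f i s pf) (fun s => pl _ i s pD).
  rewrite mxE /cv /= => h.
  rewrite (_ : (fun s : R => cvv f (z + s *: v) 0 i) = fun s => (\oint y, f (z.1 + s *: v.1 + y, z.2 + s *: v.2) 0 i * ev G 0 y)); last first.
    by apply/funext => r; rewrite mxE.
  apply: h => y r.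
  have E (g : vf) (q : R) : g (z.1 + q *: v.1 + y, z.2 + q *: v.2) = g ((z.1 + y, z.2) + q *: v).
    by congr g; congr pair => /=; rewrite addrAC.
  have h0 := @is_derive_line R f (z.1 + y, z.2) v r i df.
  have h1 := is_deriveZ (ev G 0 y) h0.
  rewrite (E ('D_v f) r) [_ * ev G 0 y]mulrC.
  rewrite (_ : (fun s : R => f (z.1 + s *: v.1 + y, z.2 + s *: v.2) 0 i * ev G 0 y) = ev G 0 y \*: (fun s : R => f ((z.1 + y, z.2) + s *: v) 0 i)) //.
  by apply/funext => q /=; rewrite (E f q) mulrC.
have dl i : derivable (fun z => cvv f z 0 i) z v /\ 'D_v (fun z => cvv f z 0 i) z = cvv ('D_v f) z 0 i.
  have [h1 h2] := key i 0; have [e1 e2] := line_quot (fun z => cvv f z 0 i) z v 0.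
  have z0 : z + (0 : R) *: v = z by rewrite scale0r addr0.
  rewrite z0 in h2 e1 e2; split; first by rewrite e1.
  by rewrite e2; exact: h2.
have dv : derivable (cvv f) z v.
  by apply/derivable_mxP => i j; rewrite (ord1 i); have [] := dl j.
split=> //; rewrite derive_mx//; apply/rowP => i; rewrite mxE; have [_ ->] := dl i; by rewrite !mxE.
Qed.

Lemma cvv_D f v : continuous f -> perF f -> (forall z, derivable f z v) -> continuous ('D_v f) ->
  'D_v (cvv f) = cvv ('D_v f).
Proof. by move=> cf pf df cD; apply/funext => z; have [] := cvv_der z cf pf df cD. Qed.

Lemma Ck_cont k f : Ck k f -> continuous f. Proof. by case: k => [|k] // []. Qed.

Lemma Ck_cvv k f : Ck k f -> perF f -> Ck k (cvv f).
Proof.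
elim: k f => [|k IH] f; first exact: cvv_cont.
move=> [cf hf] pf; split=> [|v]; first exact: cvv_cont.
have [df hD] := hf v; have cD := Ck_cont hD; split=> [z|]; first by have [] := cvv_der z cf pf df cD.
by rewrite cvv_D//; apply: IH => //; exact: perF_D.
Qed.

Section Test.
Variables (T a b : R) (phi : R -> field R).
Hypothesis T0 : 0 < T.
Hypothesis aT : a <= 0.
Hypothesis bT : T <= b.
Hypothesis hphi : test_field 0 T phi.

Let Phi z : 'rV[R]_3 := phi z.2 z.1.
Definition cvt t x : 'rV[R]_3 := cvv (fun z => phi z.2 z.1) (x, t).

Let sm : smooth Phi. Proof. by case: hphi. Qed.
Let cP : continuous Phi. Proof. exact: (sm 0). Qed.
Let pP : perF Phi. Proof. by move=> t j x; have [_ /(_ t j x)] := hphi. Qed.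
Let cvtE : (fun z => cvt z.2 z.1) = cvv Phi. Proof. by apply/funext; case. Qed.
Let dP v z : derivable Phi z v. Proof. by have [_ /(_ v) []] := sm 1. Qed.
Let cD v : continuous ('D_v Phi). Proof. by have [_ /(_ v) [_]] := sm 1. Qed.

Let tGE psi i j z : tG psi i j z = ('D_(basis R j, 0 : R) (fun z => psi z.2 z.1) z) 0 i.
Proof. by rewrite /tG (@dxE R j psi z). Qed.

Let tTE psi i z : tT psi i z = ('D_(0, 1 : R) (fun z => psi z.2 z.1) z) 0 i.
Proof. by rewrite /tT dtE. Qed.

Let DE v : 'D_v (fun z => cvt z.2 z.1) = cvv ('D_v Phi).
Proof. by rewrite cvtE; exact: (cvv_D cP pP (@dP v) (@cD v)). Qed.

Lemma cvt_T i t x : tT cvt i (x, t) = cv G (fun y => tT phi i (y, t)) x.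
Proof.
transitivity (cvv ('D_(0, 1 : R) Phi) (x, t) 0 i); first by rewrite tTE -DE.
rewrite mxE /=.
have -> // : (fun y => tT phi i (y, t)) = (fun y => ('D_(0, 1 : R) Phi (y, t)) 0 i).
by apply/funext => y; exact: tTE.
Qed.

Lemma cvt_G i j t x : tG cvt i j (x, t) = cv G (fun y => tG phi i j (y, t)) x.
Proof.
transitivity (cvv ('D_(basis R j, 0 : R) Phi) (x, t) 0 i); first by rewrite tGE -DE.
rewrite mxE /=.
have -> // : (fun y => tG phi i j (y, t)) = (fun y => ('D_(basis R j, 0 : R) Phi (y, t)) 0 i).
by apply/funext => y; exact: tGE.
Qed.

(** A test field on []0, T[], once mollified in space, is admissible for the Euler equations on the
    larger interval; the divergence vanishes because convolution commutes with derivatives. *)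
Lemma cvt_test : test_field a b cvt.
Proof.
split.
- by move=> k; rewrite cvtE; exact: Ck_cvv.
- by move=> t; have := cvv_per cP pP; exact.
- have [_ _ [c [d [c0 dT h]]] _] := hphi; exists c, d; split; [exact: le_lt_trans c0|exact: lt_le_trans bT|].
  move=> t ht x; apply/rowP => i; rewrite !mxE /cv /=.
  apply: ti_eq0 => y; by rewrite h// mxE mul0r.
move=> t x; transitivity (\sum_(j < 3) tG cvt j j (x, t)); first by [].
under eq_bigr do rewrite cvt_G.
rewrite -(@cv_sum R G 3 (fun j y => tG phi j j (y, t))) => [|j]; last exact: (jc_CP t (jc_tG hphi j j)).
rewrite /cv (eq_ti (fun=> 0)) => [|y]; first by rewrite ti_cst mul0r.
by rewrite (tG_div hphi) mul0r.
Qed.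

End Test.
End ConvTest.

(** * The initial approximation *)

Section Init.
Variable R : realType.
Notation pt := (point R).
Notation tp := (seq (mono R)).
Notation lm := (@lebesgue_measure R).
Notation vol := (tpi ^+ 3 : R).
Implicit Types (F G : tp) (t : R) (x y v : pt).

(* [v]-derivatives of [ev F t] are time derivatives of the tp with the
   frequencies [k . v] in time. *)
Definition line_tp (v : pt) (t : R) F : tp := [seq Mono (amp m) (wv m) (dot (rv R (wv m)) v) (ph m + om m * t) | m <- F].

Lemma ev_line_tp v t F (s : R) x : ev (line_tp v t F) s x = ev F t (x + s *: v).
Proof.
rewrite /ev big_map; apply: eq_bigr => m _ /=; congr (_ * cos _).
by rewrite /phs/= dotDr dotZr; ring.
Qed.

Lemma ev_D_dir F t x v : derivable (ev F t) x v /\ 'D_v (ev F t) x = ev (D None (line_tp v t F)) 0 x.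
Proof.
have [h1 h2] := ev_dt (line_tp v t F) x 0.
have E : (fun s : R => ev (line_tp v t F) s x) = (fun s : R => ev F t (x + s *: v)).
  by apply/funext => s; exact: ev_line_tp.
have [e1 e2] := line_quot (ev F t) x v 0.
have z0 : x + (0 : R) *: v = x by rewrite scale0r addr0.
rewrite z0 in e1 e2; rewrite E in h1 h2.
by split; [rewrite e1|rewrite e2].
Qed.

Lemma smooth_ev F t : smooth (ev F t).
Proof.
move=> k; elim: k F t => [|k IH] F t; first by have [] := CP_ev F t.
split; first by have [] := CP_ev F t.
move=> v; split=> [x|]; first by have [] := ev_D_dir F t x v.
have -> : 'D_v (ev F t) = ev (D None (line_tp v t F)) 0 by apply/funext => x; have [] := ev_D_dir F t x v.
exact: IH.
Qed.

Lemma grad_ev F t x j : grad (ev F t) x 0 j = ev (dj j F) t x.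
Proof.
rewrite /grad mxE; have [h1 h2] := ev_dx j F t x 0.
have [_ e2] := line_quot (ev F t) x (basis R j) 0.
have z0 : x + (0 : R) *: basis R j = x by rewrite scale0r addr0.
by rewrite z0 in e2 h2; rewrite e2 h2.
Qed.

Lemma grad_line (g : pt -> R) : smooth g -> torus_periodic g ->
  (forall j, CP (fun x => grad g x 0 j)) /\
  (forall j x (s : R), is_derive s (1 : R) (fun s : R => g (x + s *: basis R j)) (grad g (x + s *: basis R j) 0 j)).
Proof.
move=> sg pg; have [_ sg1] := sg 1%N; split=> j.
  have E : (fun x => grad g x 0 j) = 'D_(basis R j) g by apply/funext => x; rewrite mxE.
  rewrite E; split; first by have [] := sg1 (basis R j).
  by move=> k x; exact: (@derive_periodic R _ _ g _ _ x (pg k)).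
move=> x s; have [h _] := sg1 (basis R j); have [e1 e2] := line_quot g x (basis R j) s.
by apply: DeriveDef; [rewrite -e1|rewrite -e2 mxE].
Qed.

Lemma div_grad (F F' : 'I_3 -> R -> pt -> R) t (g : pt -> R) : (forall j, CP (F j t)) -> (forall j, CP (F' j t)) ->
  (forall j x (s : R), is_derive s (1 : R) (fun s : R => F j t (x + s *: basis R j)) (F' j t (x + s *: basis R j))) ->
  (forall x, \sum_(j < 3) F' j t x = 0) -> smooth g -> torus_periodic g ->
  (\oint x, \sum_(j < 3) F j t x * grad g x 0 j) = 0.
Proof.
move=> cF cF' dF F0 sg pg; have [cg dg] := grad_line sg pg.
have cgg : CP g by split=> //; exact: (sg 0).
rewrite (@ti_sum R _ _ _ (fun j x => F j t x * grad g x 0 j)) => [|j]; last exact: CPM (cF j) (cg j).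
rewrite (eq_bigr (fun j => - (\oint x, F' j t x * g x))) => [|j _]; last first.
  exact: (@ibp R (F j) (F' j) (fun _ => g) (fun _ x => grad g x 0 j) j t (cF j) (cF' j) cgg (cg j) (dF j) (fun x s => dg j x s)).
rewrite sumrN -(@ti_sum R _ _ _ (fun j x => F' j t x * g x)) => [|j]; last exact: CPM (cF' j) cgg.
rewrite ti_eq0 ?oppr0// => x; by rewrite -big_distrl/= F0 mul0r.
Qed.

Lemma coord_norm (x : 'rV[R]_3) i : `|x 0 i| <= `|x|.
Proof.
rewrite [leRHS]mx_normrE; exact: (le_bigmax _ (fun ij : 'I_1 * 'I_3 => `|x ij.1 ij.2|) (0, i)).
Qed.

Lemma norm_sq_le (x : 'rV[R]_3) : `|x| ^+ 2 <= dot x x.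
Proof.
have [->|x0] := eqVneq `|x| 0; first by rewrite expr0n dot_ge0.
have [[i j] h] := @mx_norm_neq0 _ _ _ x x0.
rewrite [`|x|]h /= (ord1 i) -normrX ger0_norm ?sqr_ge0// /dot (bigD1 j)//= expr2 lerDl.
by apply: sumr_ge0 => k _; rewrite -expr2 sqr_ge0.
Qed.

(** If [d <= 1] and [m d ^ bb > 1], the quantity [m d ^ bb] is at most its power [2 p], hence at
    most [m ^ (2 p) d ^ 2]. For [d > 1] the uniform bound [M] suffices. *)
Lemma hoelder_interp (C M bb d m z : R) (p : nat) : (0 < p)%N -> 0 < bb -> 2 <= bb * (2 * p)%:R ->
  0 <= C -> 0 <= M -> 0 <= d -> 1 <= m -> z <= C * d `^ bb -> z <= M -> z <= (C + M) / m * (1 + m ^+ (2 * p) * d ^+ 2).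
Proof.
move=> p0 bb0 hN C0 M0 d0 m1 hC hM.
have m0 : 0 < m by lra.
have A0 : 0 <= m ^+ (2 * p) * d ^+ 2 by rewrite mulr_ge0 ?exprn_ge0// ltW.
have p2 : (0 < 2 * p)%N by rewrite muln_gt0.
have [d1|d1] := leP d 1.
  apply: (le_tr (C / m * (1 + m ^+ (2 * p) * d ^+ 2))); last first.
    by rewrite ler_wpM2r ?addr_ge0// ler_wpM2r ?invr_ge0 ?(ltW m0)// lerDl.
  apply: le_trans hC _; rewrite -mulrA ler_wpM2l// ler_pdivlMl//.
  have e0 : 0 <= d `^ bb by exact: powR_ge0.
  have [me|/ltW me] := leP (m * d `^ bb) 1; first by rewrite (le_trans me)// lerDl.
  apply: (le_tr (m ^+ (2 * p) * d ^+ 2)); last by rewrite lerDr.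
  apply: (le_tr ((m * d `^ bb) ^+ (2 * p))).
    by rewrite -(prednK p2) exprS ler_peMr ?mulr_ge0 ?(ltW m0)// exprn_ege1.
  rewrite exprMn ler_wpM2l ?exprn_ge0 ?(ltW m0)//.
  have [->|dn0] := eqVneq d 0.
    by rewrite powR0 ?gt_eqF// expr0n/= -(prednK p2) exprS mul0r.
  rewrite -[leLHS]powR_mulrn// -powRrM -[leRHS]powR_mulrn//; apply: ger_powR => //.
  by rewrite d1 lt_neqAle eq_sym dn0 d0.
apply: le_trans hM _; apply: (le_tr (M / m * m)); first by rewrite divfK// gt_eqF.
apply: ler_pM; rewrite ?divr_ge0 ?(ltW m0)//; first by rewrite ler_wpM2r ?invr_ge0 ?(ltW m0)// lerDr.
apply: (le_tr (m ^+ (2 * p) * d ^+ 2)); last by rewrite lerDr.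
rewrite -(prednK p2) exprS -mulrA ler_peMr ?(ltW m0)// -[1]mulr1; apply: ler_pM => //.
  exact: exprn_ege1.
by rewrite exprn_ege1// ltW.
Qed.

(** * Mollification of the given Euler solution *)

Section Given.
Variables (T bb : R) (u : R -> field R).
Hypothesis T0 : 0 < T.
Hypothesis bb0 : 0 < bb.
Hypothesis hu : hoelder_tx bb (- (2 * T)) (2 * T) u.
Hypothesis eu : weak_solution 0 (- (2 * T)) (2 * T) u.

(** Freezes [u] before time 0 and after time [T], which gives a Hoelder function of all times. Test
    fields for the Navier-Stokes equations see only [[0, T]], where nothing changes. *)
Definition clamp t : R := Num.max 0 (Num.min t T).
Definition uh i t x : R := u (clamp t) x 0 i.

Lemma clamp_itv t : 0 <= clamp t <= T.
Proof. by rewrite /clamp le_max lexx/= ge_max (ltW T0)/= ge_min lexx orbT. Qed.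

Lemma clamp_in t : clamp t \in `[- (2 * T), 2 * T].
Proof. by have /andP[h1 h2] := clamp_itv t; rewrite in_itv/=; apply/andP; split; lra. Qed.

Lemma clamp_id t : 0 <= t <= T -> clamp t = t.
Proof. by move=> /andP[t0 tT]; rewrite /clamp (min_idPl tT); apply/max_idPr. Qed.

Lemma clamp_lip t s : `|clamp t - clamp s| <= `|t - s|.
Proof.
rewrite /clamp; wlog ts : t s / s <= t.
  move=> h; have [/h//|/ltW/h] := leP s t.
  by rewrite distrC [`|s - t|]distrC.
rewrite [leRHS]ger0_norm ?subr_ge0//.
have [tT|tT] := leP t T; have [sT|sT] := leP s T.
- have [a|a] := leP 0 t; have [b|b] := leP 0 s; rewrite ler_norml; lra.
- lra.
- have [a|a] := leP 0 T; have [b|b] := leP 0 s; rewrite ler_norml; lra.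
- rewrite subrr normr0; lra.
Qed.

Lemma gf_uh : exists K p, [/\ 1 <= K, (0 < p)%N & forall i, gf K p (uh i)].
Proof.
have [hp [C hC]] := hu.
pose p := (Num.trunc (bb^-1)).+1.
have pb : 1 <= bb * p%:R by rewrite -ler_pdivrMl// mulr1 ltW// /p truncnS_gt.
pose C' := `|C|; pose D := tpi + T; pose M := C' * D `^ bb + `|u 0 0|.
have D0 : 0 <= D by rewrite addr_ge0 ?(ltW T0)// ltW// twopi_gt0.
have M0 : 0 <= M by apply: addr_ge0; [apply: mulr_ge0; [exact: normr_ge0|exact: powR_ge0]|exact: normr_ge0].
have C'0 : 0 <= C' by exact: normr_ge0.
have hC' t s x y : `|u (clamp t) x - u (clamp s) y| <= C' * `|(x, clamp t) - (y, clamp s)| `^ bb.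
  apply: le_trans (hC _ _ x y (clamp_in t) (clamp_in s)) _.
  by rewrite ler_wpM2r ?powR_ge0// ler_norm.
have bd t x : `|u (clamp t) x| <= M.
  rewrite -(tobox_per x (hp _ (clamp_in t))).
  rewrite -[u _ _](subrK (u 0 0)); apply: le_trans (ler_normD _ _) _; rewrite lerD2r.
  have := hC' t 0 (tobox x) 0; rewrite (clamp_id (t := 0)) ?lexx ?(ltW T0)// => /le_trans; apply.
  rewrite ler_wpM2l//; apply: ge0_ler_powR; rewrite ?nnegrE// ?(ltW bb0)//.
  rewrite !subr0 prod_normE /= ge_max; apply/andP; split.
    rewrite [leLHS]mx_normrE; apply: bigmax_le => // -[i j] _ /=; rewrite (ord1 i).
    have := tobox_in x j; rewrite /= in_itv/= => /andP[a b]; rewrite ger0_norm// (le_trans b)//.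
    by rewrite /D lerDl ltW.
  have /andP[a b] := clamp_itv t; rewrite ger0_norm// (le_trans b)//.
  by rewrite /D lerDr ltW// twopi_gt0.
exists (C' + 2 * M + 1), p; split=> [||i]; [by lra|by []|].
have nb t x : `|uh i t x| <= M by exact: le_trans (coord_norm _ i) (bd t x).
split=> [t j x|t x|m m1 t s x y]; first by rewrite /uh hp ?clamp_in.
  by apply: le_trans (nb t x) _; lra.
have m0 : 0 < m by lra.
pose d := `|(x, clamp t) - (y, clamp s)|.
have d0 : 0 <= d by exact: normr_ge0.
have d2 : d ^+ 2 <= sqd x y + (t - s) ^+ 2.
  rewrite /d prod_normE /=; have [a|a] := leP `|x - y| `|clamp t - clamp s|.
    apply: (le_tr ((t - s) ^+ 2)); last by rewrite lerDr sqd_ge0.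
    rewrite -[leRHS]ger0_norm ?sqr_ge0// normrX; apply: lerXn2r; rewrite ?nnegrE//; exact: clamp_lip.
  by apply: (le_tr (sqd x y)); [exact: norm_sq_le|rewrite lerDl sqr_ge0].
apply: (le_tr ((C' + 2 * M) / m * (1 + m ^+ (2 * p) * d ^+ 2))).
  apply: (@hoelder_interp C' (2 * M) bb) => //; [by rewrite natrM mulrCA; lra|lra| |].
    apply: le_trans (hC' t s x y); have := coord_norm (u (clamp t) x - u (clamp s) y) i.
    by rewrite !mxE.
  by apply: le_trans (ler_normB _ _) _; have := nb t x; have := nb s y; lra.
have A0 : 0 <= m ^+ (2 * p) * d ^+ 2 by rewrite mulr_ge0 ?exprn_ge0// ltW.
apply: ler_pM; rewrite ?divr_ge0 ?(ltW m0) ?addr_ge0//; try lra.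
  by rewrite ler_wpM2r ?invr_ge0 ?(ltW m0)//; lra.
by rewrite lerD2l ler_wpM2l ?exprn_ge0 ?(ltW m0).
Qed.

Section Mollified.
Variables (Ku : R) (p : nat).
Hypothesis Ku1 : 1 <= Ku.
Hypothesis p0 : (0 < p)%N.
Hypothesis gu : forall i, gf Ku p (uh i).
Variables (n : nat) (nu : R).
Notation G := (kn R n).

Let ju i : jc (uh i) := hol_jc (gu i).
Let cu i t : CP (uh i t) := jc_CP t (ju i).

Definition V0 i t x : R := cv G (uh i t) x.
Definition DV i j t x : R := - cv (dj j G) (uh i t) x.
(** Commutator of mollification and product, plus [nu] times the symmetric gradient, which offsets
    the viscous term missing from the Euler equations. *)
Definition S0 i j t x : R := cv G (fun y => uh i t y * uh j t y) x - V0 i t x * V0 j t x + nu * (DV i j t x + DV j i t x).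

Lemma CP_V0 i t : CP (V0 i t). Proof. exact: CP_cv. Qed.
Lemma CP_DV i j t : CP (DV i j t). Proof. by apply: CPN; exact: CP_cv. Qed.

Lemma V0_dx i j t x (s : R) : is_derive s (1 : R) (fun s : R => V0 i t (x + s *: basis R j)) (DV i j t (x + s *: basis R j)).
Proof. exact: cv_dx. Qed.

Lemma DV_dx i j k t x (s : R) : is_derive s (1 : R) (fun s : R => DV i j t (x + s *: basis R k))
  (cv (dj k (dj j G)) (uh i t) (x + s *: basis R k)).
Proof.
have h := cv_dx (dj j G) k x s (cu i t).
have := @is_deriveN R R R (fun s : R => cv (dj j G) (uh i t) (x + s *: basis R k)) s 1 _ h.
by rewrite opprK.
Qed.

(** The translated kernel is itself an admissible test function for weak incompressibility. *)
Lemma cv_div F t x : \sum_(j < 3) cv (dj j F) (uh j t) x = 0.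
Proof.
under eq_bigr do rewrite cvE//.
rewrite -(@ti_sum R _ _ _ (fun j y => uh j t y * ev (dj j F) 0 (y - x))) => [|j]; last exact: CPM (cu j t) (CP_shift _ (CP_ev _ 0)).
have [_ hd _] := eu; have [hd1 _] := hd _ (clamp_in t).
rewrite -[RHS](hd1 (ev (shp (- x) 0 F) 0) (smooth_ev _ _) (@ev_periodic R _ _)).
apply: eq_ti => y; rewrite /dot; apply: eq_bigr => j _; congr (_ * _).
rewrite grad_ev -[in LHS](addr0 (0 : R)) -(ev_shp (- x) 0 (dj j F)).
by congr ev; rewrite /D /mop /shp -!map_comp; apply: eq_map => m /=; congr Mono; ring.
Qed.

Lemma V0_div t x : \sum_(j < 3) DV j j t x = 0.
Proof. by rewrite sumrN cv_div oppr0. Qed.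

Lemma V0_mean i t : ti (V0 i t) = 0.
Proof.
have c1 : CP (fun=> (1 : R)) by exact: CP_cst.
rewrite (eq_ti (fun x => cv G (uh i t) x * 1)) => [|x]; last by rewrite mulr1.
rewrite -(cv_swap (@kn_even R n) (cu i t) c1).
rewrite (eq_ti (uh i t)) => [|x]; first by have [_ hd _] := eu; have [_ h] := hd _ (clamp_in t); exact: h.
rewrite /cv (eq_ti (ev G 0)) => [|y]; last by rewrite mul1r.
by rewrite ti_kn mulr1.
Qed.

Lemma V0_wdiv t (g : pt -> R) : smooth g -> torus_periodic g ->
  (\oint x, \sum_(j < 3) V0 j t x * grad g x 0 j) = 0.
Proof.
exact: (@div_grad V0 (fun j => DV j j) t g (fun j => CP_V0 j t) (fun j => CP_DV j j t) (fun j => V0_dx j j t) (V0_div t)).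
Qed.

Section Eq.
Variable phi : R -> field R.
Hypothesis hphi : test_field 0 T phi.

Let cP i t : CP (fun x => tP phi i (x, t)) := jc_CP t (jc_tP hphi i).
Let cT i t : CP (fun x => tT phi i (x, t)) := jc_CP t (jc_tT hphi i).
Let cG i j t : CP (fun x => tG phi i j (x, t)) := jc_CP t (jc_tG hphi i j).
Let cGG i j t : CP (fun x => tGG phi i j (x, t)) := jc_CP t (jc_tGG hphi i j).

(** The gradient part cancels the Laplacian after one integration by parts. The transposed part
    becomes the gradient of the divergence of the mollified field, which is zero. *)
Lemma visc_zero t : (\oint x, \sum_(i < 3) \sum_(j < 3) (V0 i t x * tGG phi i j (x, t) + (DV i j t x + DV j i t x) * tG phi i j (x, t))) = 0.
Proof.
have i1 i j : (\oint x, V0 i t x * tGG phi i j (x, t)) = - (\oint x, DV i j t x * tG phi i j (x, t)).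
  exact: (@ibp R (V0 i) (DV i j) (fun t x => tG phi i j (x, t)) (fun t x => tGG phi i j (x, t)) j t (CP_V0 i t) (CP_DV i j t) (cG i j t) (cGG i j t)
    (fun x s => V0_dx i j t x s) (fun x s => tG_dx hphi i j x t s)).
pose DDV i j x := cv (dj j (dj i G)) (uh j t) x.
have cDDV i j : CP (DDV i j) by exact: CP_cv.
have i2 i j : (\oint x, DV j i t x * tG phi i j (x, t)) = - (\oint x, DDV i j x * tP phi i (x, t)).
  exact: (@ibp R (DV j i) (fun _ => DDV i j) (fun t x => tP phi i (x, t)) (fun t x => tG phi i j (x, t)) j t (CP_DV j i t) (cDDV i j) (cP i t) (cG i j t)
    (fun x s => DV_dx j i j t x s) (fun x s => tP_dx hphi i j x t s)).
have c1 i j : CP (fun x => V0 i t x * tGG phi i j (x, t)) := CPM (CP_V0 i t) (cGG i j t).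
have c2 i j : CP (fun x => DV i j t x * tG phi i j (x, t)) := CPM (CP_DV i j t) (cG i j t).
have c3 i j : CP (fun x => DV j i t x * tG phi i j (x, t)) := CPM (CP_DV j i t) (cG i j t).
have c4 i j : CP (fun x => DDV i j x * tP phi i (x, t)) := CPM (cDDV i j) (cP i t).
have c5 i j : CP (fun x => V0 i t x * tGG phi i j (x, t) + (DV i j t x + DV j i t x) * tG phi i j (x, t)).
  exact: CPD (c1 i j) (CPM (CPD (CP_DV i j t) (CP_DV j i t)) (cG i j t)).
rewrite (@ti_sum R _ _ _ (fun i x => \sum_(j < 3) (V0 i t x * tGG phi i j (x, t) + (DV i j t x + DV j i t x) * tG phi i j (x, t)))) => [|i]; last first.
  exact: (@CP_sum R _ _ _ (fun j x => V0 i t x * tGG phi i j (x, t) + (DV i j t x + DV j i t x) * tG phi i j (x, t))).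
rewrite big1// => i _.
rewrite (@ti_sum R _ _ _ (fun j x => V0 i t x * tGG phi i j (x, t) + (DV i j t x + DV j i t x) * tG phi i j (x, t))) => [|j]; last exact: c5.
rewrite (eq_bigr (fun j => - (\oint x, DDV i j x * tP phi i (x, t)))) => [|j _]; last first.
  rewrite -i2 (eq_ti (fun x => (V0 i t x * tGG phi i j (x, t) + DV i j t x * tG phi i j (x, t)) + DV j i t x * tG phi i j (x, t))) => [|x]; last by rewrite mulrDl addrA.
  by rewrite (tiD (CPD (c1 i j) (c2 i j)) (c3 i j)) (tiD (c1 i j) (c2 i j)) i1 addNr add0r.
rewrite sumrN -(@ti_sum R _ _ _ (fun j x => DDV i j x * tP phi i (x, t))) => [|j]; last exact: c4.
rewrite ti_eq0 ?oppr0// => x; by rewrite -big_distrl/= cv_div mul0r.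
Qed.

(** The mollifier is even, hence self-adjoint, and passes from [u] and [u u] to the test field; the
    viscous terms drop out by [visc_zero]. *)
Lemma wI_V0 t : 0 <= t <= T -> ti (wI V0 S0 nu phi t) =
  (\oint x, dot (u t x) (derive1 (fun s => cvt G phi s x) t + advect (u t) (cvt G phi t) x + 0 *: laplace (cvt G phi t) x)).
Proof.
move=> t01; pose uu i j x := uh i t x * uh j t x.
have cuu i j : CP (uu i j) := CPM (cu i t) (cu j t).
pose A i x := V0 i t x * tT phi i (x, t) + \sum_(j < 3) cv G (uu i j) x * tG phi i j (x, t).
pose B i x := uh i t x * tT (cvt G phi) i (x, t) + \sum_(j < 3) uu i j x * tG (cvt G phi) i j (x, t).
have cc i j : CP (fun x => cv G (uu i j) x * tG phi i j (x, t)) := CPM (CP_cv G (cuu i j)) (cG i j t).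
have cA1 i : CP (fun x => V0 i t x * tT phi i (x, t)) := CPM (CP_V0 i t) (cT i t).
have cA i : CP (A i).
  apply: (CPD (cA1 i)); exact: (@CP_sum R _ _ _ (fun j x => cv G (uu i j) x * tG phi i j (x, t))).
have cTt i : CP (fun x => tT (cvt G phi) i (x, t)).
  by have := CP_cv G (cT i t); congr CP; apply/funext => x; rewrite (cvt_T G hphi).
have cGt i j : CP (fun x => tG (cvt G phi) i j (x, t)).
  by have := CP_cv G (cG i j t); congr CP; apply/funext => x; rewrite (cvt_G G hphi).
have cB1 i : CP (fun x => uh i t x * tT (cvt G phi) i (x, t)) := CPM (cu i t) (cTt i).
have cB2 i j : CP (fun x => uu i j x * tG (cvt G phi) i j (x, t)) := CPM (cuu i j) (cGt i j).
have cB i : CP (B i).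
  apply: (CPD (cB1 i)); exact: (@CP_sum R _ _ _ (fun j x => uu i j x * tG (cvt G phi) i j (x, t))).
have AB i : ti (A i) = ti (B i).
  rewrite (tiD (cA1 i) (@CP_sum R _ _ _ (fun j x => cv G (uu i j) x * tG phi i j (x, t)) (cc i))).
  rewrite (tiD (cB1 i) (@CP_sum R _ _ _ (fun j x => uu i j x * tG (cvt G phi) i j (x, t)) (cB2 i))).
  have addE (a b c d : R) : a = b -> c = d -> a + c = b + d by move=> -> ->.
  apply: addE.
    by rewrite -(cv_swap (@kn_even R n) (cu i t) (cT i t)); apply: eq_ti => x; rewrite (cvt_T G hphi).
  rewrite (@ti_sum R _ _ _ (fun j x => cv G (uu i j) x * tG phi i j (x, t))) => [|j]; last exact: cc.
  rewrite (@ti_sum R _ _ _ (fun j x => uu i j x * tG (cvt G phi) i j (x, t))) => [|j]; last exact: cB2.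
  apply: eq_bigr => j _; rewrite -(cv_swap (@kn_even R n) (cuu i j) (cG i j t)).
  by apply: eq_ti => x; rewrite (cvt_G G hphi).
transitivity (\oint x, \sum_(i < 3) B i x); last first.
  apply: eq_ti => x; rewrite scale0r addr0 /dot; apply: eq_bigr => i _.
  rewrite /B /uu /uh (clamp_id t01) !mxE mulrDr; congr (_ + _).
  rewrite /advect summxE big_distrr/=; apply: eq_bigr => j _.
  by rewrite mxE mulrA.
rewrite (@ti_sum R _ _ _ B)// -(eq_bigr _ (fun i _ => AB i)) -(@ti_sum R _ _ _ A)//.
pose C x := \sum_(i < 3) \sum_(j < 3) (V0 i t x * tGG phi i j (x, t) + (DV i j t x + DV j i t x) * tG phi i j (x, t)).
have cC : CP C.
  apply: (@CP_sum R _ _ _ (fun i x => \sum_(j < 3) (V0 i t x * tGG phi i j (x, t) + (DV i j t x + DV j i t x) * tG phi i j (x, t)))) => i.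
  apply: (@CP_sum R _ _ _ (fun j x => V0 i t x * tGG phi i j (x, t) + (DV i j t x + DV j i t x) * tG phi i j (x, t))) => j.
  exact: CPD (CPM (CP_V0 i t) (cGG i j t)) (CPM (CPD (CP_DV i j t) (CP_DV j i t)) (cG i j t)).
rewrite (eq_ti (fun x => \sum_(i < 3) A i x + nu * C x)) => [|x].
  rewrite (tiD (@CP_sum R _ _ _ A cA) (CPZ nu cC)) (tiZ nu cC) -/C.
  by rewrite [ti C]visc_zero mulr0 addr0.
rewrite /wI /C big_distrr -big_split/=; apply: eq_bigr => i _; rewrite /A mulrDr -!addrA; congr (_ + _).
rewrite mulrCA !big_distrr/= -!big_split/=; apply: eq_bigr => j _; rewrite /S0 /uu.
move: (cv G (fun y => _)) (V0 i t x) (V0 j t x) (DV i j t x) (DV j i t x) (tG _ i j _) (tGG _ i j _) => q v v' e e' g h; ring.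
Qed.

End Eq.

Lemma NSR_V0 : NSR T nu V0 S0.
Proof.
move=> phi hphi; have a0 : - (2 * T) <= 0 by rewrite oppr_le0 mulr_ge0// ltW.
have b0 : T <= 2 * T by rewrite ler_peMl ?(ltW T0)// ler1n.
have [_ _ he] := eu; have ht := cvt_test G a0 b0 hphi.
rewrite -[RHS](he _ ht); apply: eq_Rintegral => t _.
have [t01|t01] := boolP (0 <= t <= T); first exact: wI_V0.
have [c [d [c0 dT cd h]]] := test_supp T0 hphi.
have tn : t \notin `[c, d].
  by apply: contra t01; rewrite in_itv/= => /andP[h1 h2]; apply/andP; split; lra.
rewrite (eq_ti (fun=> 0)) => [|x]; last first.
  rewrite /wI big1// => i _; have [_ -> _ _] := h t tn x i 0; rewrite !big1 ?mulr0 ?addr0 ?mulr0// => j _; by have [_ _ e1 e2] := h t tn x i j; rewrite ?e1 ?e2 ?mulr0.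
rewrite [RHS](eq_ti (fun=> 0)) // => x; rewrite scale0r addr0 /dot big1// => i _.
have z1 : (derive1 (fun s => cvt G phi s x) t) 0 i = 0.
  rewrite -[LHS]/(tT (cvt G phi) i (x, t)) (cvt_T G hphi) /cv (eq_ti (fun=> 0)) => [|y]; first by rewrite ti_cst mul0r.
  by have [_ -> _ _] := h t tn (x + y) i 0; rewrite mul0r.
have z2 : advect (u t) (cvt G phi t) x 0 i = 0.
  rewrite /advect summxE big1// => j _; rewrite mxE -/(tG (cvt G phi) i j (x, t)) (cvt_G G hphi) /cv (eq_ti (fun=> 0)) => [|y]; first by rewrite ti_cst mul0r mulr0.
  by have [_ _ -> _] := h t tn (x + y) i j; rewrite mul0r.
by rewrite mxE z1 z2 addr0 mulr0.
Qed.

End Mollified.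

(** The order of the choices matters: [K] and [p] depend on [u] alone, the mollifier on [eps], and
    [nu] comes last, so small that it compensates the derivatives of the mollified field. *)
Lemma init : exists K p, (0 < p)%N /\ forall eps, 0 < eps -> exists nu V S,
  [/\ 0 < nu <= 1 /\ nu <= eps, vld T nu K p V S,
      forall t i j, 0 <= t <= T -> (\oint x, `|S i j t x|) <= eps,
      (forall t i, ti (V i t) = 0) /\
      (forall t (g : pt -> R), smooth g -> torus_periodic g -> (\oint x, \sum_(j < 3) V j t x * grad g x 0 j) = 0) &
      forall t i x, 0 <= t <= T -> `|V i t x - u t x 0 i| <= eps].
Proof.
have [Ku [p [Ku1 p0 gu]]] := gf_uh.
exists (4 * Ku ^+ 2 + Ku + 2), p; split=> // eps eps0.
have K0 : 0 < Ku by lra.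
have [vv [vE vol0]] : exists vv, vv = vol /\ 0 < vv by exists vol; split=> //; exact: vol_gt0.
pose m := 1 + (16 * Ku ^+ 2 + 2 * Ku) * (vv + 1) / eps.
have Q0 : 0 <= 16 * Ku ^+ 2 + 2 * Ku by rewrite addr_ge0// mulr_ge0// ?sqr_ge0// ltW.
have m1 : 1 <= m by rewrite lerDl mulr_ge0 ?invr_ge0 ?(ltW eps0)// mulr_ge0// addr_ge0// ltW.
have m0 : 0 < m by lra.
have me : (16 * Ku ^+ 2 + 2 * Ku) * (vv + 1) <= eps * m.
  by rewrite (_ : eps * m = eps + (16 * Ku ^+ 2 + 2 * Ku) * (vv + 1)); [rewrite lerDr ltW|rewrite /m; field; rewrite gt_eqF].
clearbody m.
have m24 : 1 <= 24 * m ^+ (2 * p) by have := exprn_ege1 (2 * p) m1; lra.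
have [n /andP[hn _]] := ex_nat_pow m24.
have en K : 0 <= K -> K / m * (1 + m ^+ (2 * p) * (48 / (2 * n%:R + 2))) <= 2 * K / m.
  move=> KK; rewrite -[2 * K / m]mulrA [leRHS]mulrC ler_wpM2l ?divr_ge0 ?(ltW m0)//.
  rewrite -[2]/(1 + 1) lerD2l mulrA ler_pdivrMr; last by rewrite ltr_wpDl// mulr_ge0.
  by rewrite mul1r; lra.
(* Bounds the gradient of the mollified field together with its Hoelder constant. It grows with [n]
   and is neutralized by the choice of [nu]. *)
pose gn := Ku * \sum_(j < 3) n1 (dj j (kn R n)) 0 + 1.
have gn0 j : Ku * n1 (dj j (kn R n)) 0 <= gn.
  rewrite /gn (bigD1 j)//= mulrDr -addrA lerDl addr_ge0// mulr_ge0 ?(ltW K0)//.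
  by apply: sumr_ge0 => k _; exact: n1_ge0.
have gn1 : 1 <= gn.
  by rewrite /gn lerDr mulr_ge0 ?(ltW K0)//; apply: sumr_ge0 => k _; exact: n1_ge0.
clearbody gn.
pose nu := Num.min 1 eps / (4 * gn * (vv + 1)).
have me0 : 0 < Num.min 1 eps by rewrite lt_min ltr01.
have me1 : Num.min 1 eps <= 1 by rewrite ge_min lexx.
have me2 : Num.min 1 eps <= eps by rewrite ge_min lexx orbT.
have den : 1 <= 4 * gn * (vv + 1) by nra.
have den0 : 0 < 4 * gn * (vv + 1) by lra.
have nu0 : 0 < nu by rewrite divr_gt0.
have num : nu <= Num.min 1 eps by rewrite ler_pdivrMr// ler_peMr// ltW.
have nug : nu * gn * (4 * (vv + 1)) = Num.min 1 eps.
  by rewrite -mulrA (_ : gn * _ = 4 * gn * (vv + 1)) ?divfK ?gt_eqF//; ring.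
clearbody nu.
have gV i : gf Ku p (V0 n i) by have := gf_cv (kn R n) (gu i); rewrite n1_kn mulr1.
have guu i j : gf (2 * (Ku * Ku)) p (fun t x => uh i t x * uh j t x) := gfM (gu i) (gu j).
have gcu i j : gf (2 * (Ku * Ku)) p (fun t => cv (kn R n) (fun x => uh i t x * uh j t x)).
  by have := gf_cv (kn R n) (guu i j); rewrite n1_kn mulr1.
have gD i j : gf gn p (DV n i j).
  have h := gf_le (gn0 j) (gf_cv (dj j (kn R n)) (gu i)).
  have m11 : `|-1| <= 1 :> R by rewrite normrN normr1.
  have := gfZ m11 h; rewrite mul1r; congr gf; apply/funext => t; apply/funext => x; by rewrite mulN1r.
have nug1 : nu * (gn + gn) <= 2^-1.
  have h : nu * gn * 4 <= Num.min 1 eps.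
    have ng0 : 0 <= nu * gn by rewrite mulr_ge0 ?(ltW nu0)//; lra.
    by rewrite -nug; apply: (ler_wpM2l ng0); lra.
  by move: h me1; rewrite mulrDr; lra.
have nuN : `|nu| <= nu by rewrite gtr0_norm.
have gS i j : gf (4 * Ku ^+ 2 + Ku + 2) p (S0 n nu i j).
  apply: gf_le (gfD (gfB (gcu i j) (gfM (gV i) (gV j))) (gfZ nuN (gfD (gD i j) (gD j i)))).
  by rewrite expr2; lra.
exists nu, (V0 n), (S0 n nu); split.
- by rewrite nu0/=; split; [exact: le_trans me1|exact: le_trans me2].
- split.
  + by move=> i; apply: gf_le (gV i); have := sqr_ge0 Ku; lra.
  + exact: gS.
  + move=> i j t x; rewrite /S0 [V0 n j t x * _]mulrC [DV n j i t x + _]addrC; congr (_ - _ + _).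
    by congr cv; apply/funext => y; rewrite mulrC.
  + exact: NSR_V0 gu n nu.
- move=> t i j t01.
  have cS : CP (S0 n nu i j t) := gf_CP t (gS i j).
  pose b := eps / (vv + 1).
  have vv1 : 0 < vv + 1 by clear -hu eu T0 bb0 vol0; lra.
  have bv : b * vv <= eps.
    by rewrite /b mulrAC ler_pdivrMr// ler_wpM2l ?(ltW eps0)// lerDl.
  apply: le_trans bv; rewrite vE -ti_cst; apply: ti_le => [||x]; [exact: CP_norm|exact: CP_cst|].
  have e1 := le_trans (cv_err n t x (guu i j) m1) (en _ (mulr_ge0 (ler0n R 2) (mulr_ge0 (ltW K0) (ltW K0)))).
  have e2 k := le_trans (cv_err n t x (gu k) m1) (en _ (ltW K0)).
  have [_ bu _] := gu j; have [_ bV _] := gV i; have [_ bD _] := gD i j; have [_ bD' _] := gD j i.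
  have := bu t x; have := bV t x; have := e2 i; have := e2 j; have := bD t x; have := bD' t x; move: e1.
  rewrite /S0 -!/(V0 n _ _ _); set cuu := cv _ _ _; set v1 := V0 n i t x; set v2 := V0 n j t x; set u1 := uh i t x; set u2 := uh j t x.
  set d1 := DV n i j t x; set d2 := DV n j i t x => e1 hd2 hd1 h2 h1 hv1 hu2.
  have -> : cuu - v1 * v2 + nu * (d1 + d2) = (cuu - u1 * u2) - (v1 - u1) * u2 - v1 * (v2 - u2) + nu * (d1 + d2).
    by clear -hu eu T0 bb0; move: cuu v1 v2 u1 u2 d1 d2 (nu) => c a a' b b' e e' v; ring.
  have q1 : `|(v1 - u1) * u2| <= 2 * Ku / m * Ku by rewrite normrM ler_pM.
  have q2 : `|v1 * (v2 - u2)| <= Ku * (2 * Ku / m) by rewrite normrM ler_pM.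
  have q3 : `|nu * (d1 + d2)| <= nu * (gn + gn).
    rewrite normrM (gtr0_norm nu0); apply: (ler_wpM2l (ltW nu0)).
    exact: le_trans (ler_normD _ _) (lerD hd1 hd2).
  apply: (le_tr (2 * (2 * (Ku * Ku)) / m + 2 * Ku / m * Ku + Ku * (2 * Ku / m) + nu * (gn + gn))).
    apply: le_normD; apply: lerD => //.
    apply: le_trans (ler_normB _ _) _; apply: lerD => //.
    by apply: le_trans (ler_normB _ _) _; apply: lerD.
  rewrite /b ler_pdivlMr//.
  rewrite mulrDl (_ : nu * (gn + gn) * (vv + 1) = 2^-1 * (nu * gn * (4 * (vv + 1)))); last by field.
  rewrite nug (_ : _ * (vv + 1) = 8 * Ku ^+ 2 * (vv + 1) / m); last by field; rewrite gt_eqF.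
  have : 8 * Ku ^+ 2 * (vv + 1) / m <= 2^-1 * eps.
    rewrite (ler_pdivrMr _ _ m0); have h := mulr_ge0 (mulr_ge0 (ler0n R 2) (ltW K0)) (ltW vv1).
    by clear -hu eu T0 bb0 me h; move: me; rewrite mulrDl; lra.
  by clear -hu eu T0 bb0 me2; lra.
- split=> [t i|t g sg pg]; [exact: V0_mean gu n i t|exact: V0_wdiv gu n t g sg pg].
- move=> t i x t01; have uE : uh i t x = u t x 0 i by rewrite /uh clamp_id.
  rewrite -uE; apply: le_trans (le_trans (cv_err n t x (gu i) m1) (en _ (ltW K0))) _.
  rewrite ler_pdivrMr//; apply: le_trans me.
  have h1 := mulr_ge0 (mulr_ge0 (ler0n R 16) (sqr_ge0 Ku)) (ltW vol0).
  have h2 := mulr_ge0 (mulr_ge0 (ler0n R 2) (ltW K0)) (ltW vol0).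
  by have h3 := sqr_ge0 Ku; clear -hu eu T0 bb0 h1 h2 h3; lra.
Qed.

End Given.
End Init.

(** * Fourier coefficients *)

Section Fourier.
Variable R : realType.
Notation pt := (point R).
Notation tp := (seq (mono R)).
Notation vol := (tpi ^+ 3 : R).
Implicit Types (f g : pt -> R) (F G : tp) (k l : ivec) (x : pt) (t : R) (ks : seq ivec).

Definition cosw k : tp := [:: Mono 1 k 0 0].
Definition sinw k : tp := [:: Mono 1 k 0 (- (pi / 2))].

Lemma ev_ct k t x : ev (cosw k) t x = cos (dot (rv R k) x).
Proof. by rewrite ev_cons ev_nil /phs/= mul0r mul1r !addr0. Qed.

Lemma ev_st k t x : ev (sinw k) t x = sin (dot (rv R k) x).
Proof. by rewrite ev_cons ev_nil /phs/= mul0r mul1r !addr0 cosBpihalf. Qed.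

Definition fc f k : R := (\oint x, f x * cos (dot (rv R k) x)) / vol.
Definition fs f k : R := (\oint x, f x * sin (dot (rv R k) x)) / vol.
Definition fsq f k : R := fc f k ^+ 2 + fs f k ^+ 2.

Lemma fsq_ge0 f k : 0 <= fsq f k. Proof. by rewrite addr_ge0 ?sqr_ge0. Qed.

Let vol0 : 0 < vol := @vol_gt0 R.

Let ce F t : CP (ev F t) := CP_ev F t.
Lemma CP_cosk k : CP (fun x => cos (dot (rv R k) x)).
Proof. by have := ce (cosw k) 0; congr CP; apply/funext => x; rewrite ev_ct. Qed.
Lemma CP_sink k : CP (fun x => sin (dot (rv R k) x)).
Proof. by have := ce (sinw k) 0; congr CP; apply/funext => x; rewrite ev_st. Qed.

Lemma fsqD f g k : S2 f -> S2 g -> fsq (fun x => f x + g x) k <= 2 * fsq f k + 2 * fsq g k.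
Proof.
move=> hf hg; have hc := CP_S2 (CP_cosk k); have hs := CP_S2 (CP_sink k).
have ec : fc (fun x => f x + g x) k = fc f k + fc g k.
  rewrite /fc -mulrDl -mti_D; [|exact: s2M|exact: s2M].
  by congr (_ / _); apply: eq_ti => x; rewrite mulrDl.
have es : fs (fun x => f x + g x) k = fs f k + fs g k.
  rewrite /fs -mulrDl -mti_D; [|exact: s2M|exact: s2M].
  by congr (_ / _); apply: eq_ti => x; rewrite mulrDl.
rewrite /fsq ec es; have := sq_add (fc f k) (fc g k); have := sq_add (fs f k) (fs g k).
by move: (fc f k) (fc g k) (fs f k) (fs g k) => a b c d; lra.
Qed.

Lemma ti_ev F t : ti (ev F t) = ev (mn F) t 0 * vol.
Proof. by rewrite (ti_mn F t 0) mulrC. Qed.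

Lemma ev_mn_mul1 (m m' : mono R) t : ev (mn (mul [:: m] [:: m'])) t 0 =
  amp m * amp m' / 2 * ((wv m + wv m' == 0)%:R * cos ((om m + om m') * t + (ph m + ph m')) + (wv m - wv m' == 0)%:R * cos ((om m - om m') * t + (ph m - ph m'))).
Proof.
rewrite /mn ev_mop /mul /= !big_cons big_nil /= /phs/= !dot0r !add0r !addr0.
ring.
Qed.

Lemma ti_cc k l : (\oint x, cos (dot (rv R k) x) * cos (dot (rv R l) x)) = vol / 2 * ((k + l == 0)%:R + (k - l == 0)%:R).
Proof.
rewrite (eq_ti (ev (mul (cosw k) (cosw l)) 0)) => [|x]; last by rewrite ev_mul !ev_ct.
by rewrite ti_ev ev_mn_mul1 /= !(mulr0, subr0, addr0) cos0; move: vol => v; ring.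
Qed.

Lemma ti_ss k l : (\oint x, sin (dot (rv R k) x) * sin (dot (rv R l) x)) = vol / 2 * ((k - l == 0)%:R - (k + l == 0)%:R).
Proof.
rewrite (eq_ti (ev (mul (sinw k) (sinw l)) 0)) => [|x]; last by rewrite ev_mul !ev_st.
rewrite ti_ev ev_mn_mul1 /= !mulr0 !add0r subrr cos0 (_ : - (pi / 2) - pi / 2 = - pi :> R); last by field.
by rewrite cosN cospi; ring.
Qed.

Lemma ti_cs k l : (\oint x, cos (dot (rv R k) x) * sin (dot (rv R l) x)) = 0.
Proof.
rewrite (eq_ti (ev (mul (cosw k) (sinw l)) 0)) => [|x]; last by rewrite ev_mul ev_ct ev_st.
rewrite ti_ev ev_mn_mul1 /= !mulr0 !add0r opprK cosN cos_pihalf; ring.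
Qed.

Lemma fcN f k : fc f (- k) = fc f k.
Proof. by rewrite /fc; congr (_ / _); apply: eq_ti => x; rewrite rvN dotNl cosN. Qed.

Lemma fsN f k : CP f -> fs f (- k) = - fs f k.
Proof.
move=> cf; rewrite /fs -mulNr -tiN; last exact: CPM cf (CP_sink k).
by congr (_ / _); apply: eq_ti => x; rewrite rvN dotNl sinN mulrN.
Qed.

(** The real modes [e k] and [e (- k)] coincide, so each [e k] pairs with at most two members of the
    list. Each pairing carries the factor [1/2], and expanding the square of [f - P] still gives the
    constant one. *)
Lemma bessel f ks : CP f -> uniq ks -> \sum_(k <- ks) fsq f k <= (\oint x, f x ^+ 2) / vol.
Proof.
move=> cf uks.
pose e k x : R := fc f k * cos (dot (rv R k) x) + fs f k * sin (dot (rv R k) x).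
pose P x : R := \sum_(k <- ks) e k x.
have cek k : CP (e k) := CPD (CPZ _ (CP_cosk k)) (CPZ _ (CP_sink k)).
have cP : CP P by exact: (@CP_sum R _ ks _ e).
have fe k : (\oint x, f x * e k x) = vol * fsq f k.
  rewrite (eq_ti (fun x => fc f k * (f x * cos (dot (rv R k) x)) + fs f k * (f x * sin (dot (rv R k) x)))) => [|x]; last by rewrite /e; ring.
  rewrite tiD; [|exact: CPZ (CPM cf (CP_cosk k))|exact: CPZ (CPM cf (CP_sink k))].
  rewrite (tiZ _ (CPM cf (CP_cosk k))) (tiZ _ (CPM cf (CP_sink k))) /fsq.
  have -> : (\oint x, f x * cos (dot (rv R k) x)) = vol * fc f k by rewrite /fc mulrC divfK// gt_eqF.
  have -> : (\oint x, f x * sin (dot (rv R k) x)) = vol * fs f k by rewrite /fs mulrC divfK// gt_eqF.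
  by rewrite !expr2; ring.
have ee k l : (\oint x, e k x * e l x) = vol / 2 * fsq f k * ((l == k)%:R + (l == - k)%:R).
  have cc := CPM (CP_cosk k) (CP_cosk l); have ss := CPM (CP_sink k) (CP_sink l).
  have cs := CPM (CP_cosk k) (CP_sink l); have sc := CPM (CP_cosk l) (CP_sink k).
  rewrite (eq_ti (fun x => (fc f k * fc f l) * (cos (dot (rv R k) x) * cos (dot (rv R l) x)) +
    ((fs f k * fs f l) * (sin (dot (rv R k) x) * sin (dot (rv R l) x)) + ((fc f k * fs f l) * (cos (dot (rv R k) x) * sin (dot (rv R l) x)) +
     (fs f k * fc f l) * (cos (dot (rv R l) x) * sin (dot (rv R k) x)))))) => [|x]; last by rewrite /e; ring.
  rewrite (tiD (CPZ _ cc) (CPD (CPZ _ ss) (CPD (CPZ _ cs) (CPZ _ sc)))) (tiD (CPZ _ ss) (CPD (CPZ _ cs) (CPZ _ sc))) (tiD (CPZ _ cs) (CPZ _ sc)).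
  rewrite (tiZ _ cc) (tiZ _ ss) (tiZ _ cs) (tiZ _ sc) ti_cc ti_ss !ti_cs !mulr0 !addr0.
  rewrite [k + l]addrC addr_eq0 subr_eq0 [k == l]eq_sym /fsq; move: vol => v.
  have e1 := fcN f k; have e2 := fsN k cf.
  case: (eqVneq l (- k)) => [->|_]; last first.
    by case: (eqVneq l k) => [->|_] /=; move: (fc f k) (fs f k) => a b; rewrite !expr2; field.
  case: (eqVneq (- k) k) => [kk|_]; rewrite e1 e2 /=.
    have e3 : fs f k = 0 by move: e2; rewrite kk; lra.
    by rewrite e3; move: (fc f k) => a; rewrite !expr2; field.
  by move: (fc f k) (fs f k) => a b; rewrite !expr2; field.
have h0 : 0 <= (\oint x, (f x - P x) ^+ 2) by apply: ti_ge0 => x; rewrite sqr_ge0.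
have fP : (\oint x, f x * P x) = vol * \sum_(k <- ks) fsq f k.
  rewrite (eq_ti (fun x => \sum_(k <- ks) f x * e k x)) => [|x]; last by rewrite big_distrr.
  rewrite (@ti_sum R _ ks _ (fun k x => f x * e k x)) => [|k]; last exact: CPM cf (cek k).
  by rewrite big_distrr; apply: eq_bigr => k _; exact: fe.
have PP : (\oint x, P x * P x) <= vol * \sum_(k <- ks) fsq f k.
  rewrite (eq_ti (fun x => \sum_(k <- ks) e k x * P x)) => [|x]; last by rewrite big_distrl.
  rewrite (@ti_sum R _ ks _ (fun k x => e k x * P x)) => [|k]; last exact: CPM (cek k) cP.
  rewrite big_distrr; apply: ler_sum => k _.
  rewrite (eq_ti (fun x => \sum_(l <- ks) e k x * e l x)) => [|x]; last by rewrite big_distrr.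
  rewrite (@ti_sum R _ ks _ (fun l x => e k x * e l x)) => [|l]; last exact: CPM (cek k) (cek l).
  rewrite (eq_bigr _ (fun l _ => ee k l)) -big_distrr/= big_split/=.
  have one1 (m : ivec) : \sum_(l <- ks) (l == m)%:R <= 1 :> R.
    rewrite -natr_sum (ler_nat R _ 1) (_ : (\sum_(l <- ks) (l == m))%N = count (pred1 m) ks).
      by rewrite count_uniq_mem//; case: (_ \in _).
    by rewrite -sum1_count [RHS]big_mkcond; apply: eq_bigr => l _ /=; case: (l == m).
  rewrite -[leRHS]mulr1 -[vol * fsq f k * 1](_ : vol / 2 * fsq f k * (1 + 1) = _); last by field.
  have v2 : 0 <= vol / 2 * fsq f k by apply: mulr_ge0; [apply: divr_ge0; [exact: ltW vol0|]|exact: fsq_ge0].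
  by apply: (ler_wpM2l v2); apply: lerD.
have cfP : CP (fun x => f x * P x) := CPM cf cP.
have e0 : (\oint x, (f x - P x) ^+ 2) = (\oint x, f x ^+ 2) - 2 * (\oint x, f x * P x) + (\oint x, P x * P x).
  rewrite -(tiZ 2 cfP) -(tiB (CP_exp 2 cf) (CPZ 2 cfP)) -(tiD (CPB (CP_exp 2 cf) (CPZ 2 cfP)) (CPM cP cP)).
  by apply: eq_ti => x; rewrite !expr2; ring.
rewrite ler_pdivlMr// mulrC; move: h0; rewrite e0 fP; lra.
Qed.

Lemma mul_wv0 k (F : tp) (D : R) (a : R) : all (dgm D) F -> (exists j, D < `|(k 0 j)%:~R|) ->
  all (fun m => wv m != 0) (mul F [:: Mono 1 k 0 a]).
Proof.
move=> hF [j hj]; elim: F hF => // m F IH /= /andP[/andP[/forallP hm _] hF].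
have h (s : int) : s = 1 \/ s = -1 -> wv m + s *: k != 0.
  move=> hs; apply/eqP => /rowP/(_ j); rewrite !mxE => /eqP; rewrite addr_eq0 => /eqP e.
  have := hm j; rewrite e intrN normrN intrM normrM (_ : `|s%:~R| = 1 :> R) ?mul1r ?leNgt ?hj//.
  by case: hs => ->; rewrite ?mulrNz ?mulr1z ?normrN normr1.
have h1 := h 1 (or_introl erefl); have h2 := h (-1) (or_intror erefl).
rewrite scale1r in h1; rewrite scaleN1r in h2.
by rewrite /mul /=; apply/and3P; split=> //; exact: IH.
Qed.

Lemma fsq_high k F D t : all (dgm D) F -> (exists j, D < `|(k 0 j)%:~R|) -> fsq (ev F t) k = 0.
Proof.
move=> hF hk.
have z a : ti (ev (mul F [:: Mono 1 k 0 a]) t) = 0.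
  rewrite ti_ev; have := mul_wv0 a hF hk; elim: (mul _ _) => [|m G IH]; first by rewrite ev_nil mul0r.
  move=> /= /andP[m0 /IH h]; rewrite /mn /mop /= ev_cons /= (negbTE m0) mulr0 mul0r add0r; exact: h.
rewrite /fsq /fc /fs (eq_ti (ev (mul F (cosw k)) t)) => [|x]; last by rewrite ev_mul ev_ct.
rewrite z (eq_ti (ev (mul F (sinw k)) t)) => [|x]; last by rewrite ev_mul ev_st.
by rewrite z mul0r expr0n addr0.
Qed.

Definition wt2 (gm : R) k : R := (1 + dot (rv R k) (rv R k)) `^ gm.

Lemma wt2_ge0 gm k : 0 <= wt2 gm k. Proof. exact: powR_ge0. Qed.

Lemma wt_base_ge1 k : 1 <= 1 + dot (rv R k) (rv R k). Proof. by rewrite lerDl dot_ge0. Qed.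

Lemma wt2_le gm gm' k : gm <= gm' -> wt2 gm k <= wt2 gm' k.
Proof. by move=> h; apply: ler_powR => //; exact: wt_base_ge1. Qed.

Lemma fsq_tp F D gm t ks : 1 <= D -> 0 <= gm -> all (dgm D) F -> uniq ks ->
  \sum_(k <- ks) wt2 gm k * fsq (ev F t) k <= (1 + 3 * D ^+ 2) `^ gm * ((\oint x, ev F t x ^+ 2) / vol).
Proof.
move=> D1 g0 hF uks; apply: (le_tr ((1 + 3 * D ^+ 2) `^ gm * \sum_(k <- ks) fsq (ev F t) k)); last first.
  by rewrite ler_wpM2l ?powR_ge0// bessel.
rewrite big_distrr; apply: ler_sum => k _ /=.
have [hk|hk] := pselect (exists j, D < `|(k 0 j)%:~R|); first by rewrite (fsq_high t hF hk) !mulr0.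
have D0 : 0 <= D by lra.
rewrite ler_wpM2r ?fsq_ge0// /wt2; apply: ge0_ler_powR; rewrite ?nnegrE ?addr_ge0 ?dot_ge0 ?mulr_ge0 ?sqr_ge0//.
rewrite lerD2l dot3 -!expr2 !mxE.
have h j : ((k 0 j)%:~R : R) ^+ 2 <= D ^+ 2.
  rewrite -[leLHS]ger0_norm ?sqr_ge0// normrX; apply: lerXn2r; rewrite ?nnegrE//.
  by rewrite leNgt; apply/negP => a; apply: hk; exists j.
by have := h 0; have := h 1; have := h 2%:R; lra.
Qed.

(** Cauchy-Schwarz with the weights [2 ^ -(q + 1)], of total mass at most one. *)
Lemma wsum_sq (x : nat -> R) Q : (\sum_(q < Q) x q) ^+ 2 <= \sum_(q < Q) 2 ^+ q.+1 * x q ^+ 2.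
Proof.
elim: Q x => [|Q IH] x; first by rewrite !big_ord0 expr0n.
rewrite !big_ord_recl/= expr1; apply: le_trans (sq_add _ _) _; rewrite lerD2l.
apply: le_trans (ler_wpM2l (ler0n R 2) (IH (fun q => x q.+1))) _.
by rewrite big_distrr/=; apply: ler_sum => q _; rewrite /bump/= add1n [2 ^+ q.+2]exprS mulrA.
Qed.

Lemma fsq_sum (f : nat -> pt -> R) Q k : (forall q, CP (f q)) ->
  fsq (fun x => \sum_(q < Q) f q x) k <= \sum_(q < Q) 2 ^+ q.+1 * fsq (f q) k.
Proof.
move=> cf.
have e1 : fc (fun x => \sum_(q < Q) f q x) k = \sum_(q < Q) fc (f q) k.
  rewrite /fc (eq_ti (fun x => \sum_(q < Q) f q x * cos (dot (rv R k) x))) => [|x]; last by rewrite big_distrl.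
  rewrite (@ti_sum R _ _ _ (fun (q : 'I_Q) x => f q x * cos (dot (rv R k) x))) ?big_distrl// => q; exact: CPM (cf q) (CP_cosk k).
have e2 : fs (fun x => \sum_(q < Q) f q x) k = \sum_(q < Q) fs (f q) k.
  rewrite /fs (eq_ti (fun x => \sum_(q < Q) f q x * sin (dot (rv R k) x))) => [|x]; last by rewrite big_distrl.
  rewrite (@ti_sum R _ _ _ (fun (q : 'I_Q) x => f q x * sin (dot (rv R k) x))) ?big_distrl// => q; exact: CPM (cf q) (CP_sink k).
rewrite /fsq e1 e2; apply: le_trans (lerD (wsum_sq (fun q => fc (f q) k) Q) (wsum_sq (fun q => fs (f q) k) Q)) _.
by rewrite -big_split/=; apply: ler_sum => q _; rewrite mulrDr.
Qed.

Lemma geo_half Q : \sum_(q < Q) (2^-1 : R) ^+ q.+1 <= 1.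
Proof.
suff -> : \sum_(q < Q) (2^-1 : R) ^+ q.+1 = 1 - 2^-1 ^+ Q by rewrite gerBl exprn_ge0.
elim: Q => [|Q IH]; first by rewrite big_ord0 expr0 subrr.
by rewrite big_ord_recr/= IH exprS; lra.
Qed.

(** Littlewood-Paley style bound: growth of the degrees is offset by decay of the [L^2] norms. The
    spare factor [2 ^ q.+1] pays for the missing orthogonality of the blocks. *)
Lemma series_H (F : nat -> tp) (D e : nat -> R) gm c t ks Q : 0 <= gm -> uniq ks ->
  (forall q, 1 <= D q /\ all (dgm (D q)) (F q)) -> (forall q, (\oint x, ev (F q) t x ^+ 2) <= e q) ->
  (forall q, 2 ^+ q.+1 * ((1 + 3 * D q ^+ 2) `^ gm * e q) <= c * 2^-1 ^+ q.+1) ->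
  \sum_(k <- ks) wt2 gm k * fsq (fun x => \sum_(q < Q) ev (F q) t x) k <= c / vol.
Proof.
move=> g0 uks hD he hc.
have c0 : 0 <= c.
  have := hc 0%N; have e0 : 0 <= e 0%N by apply: le_trans (he 0%N); apply: ti_ge0 => x; rewrite sqr_ge0.
  by have := mulr_ge0 (powR_ge0 (1 + 3 * D 0%N ^+ 2) gm) e0; rewrite !expr1; lra.
apply: (le_tr (\sum_(q < Q) \sum_(k <- ks) 2 ^+ q.+1 * (wt2 gm k * fsq (ev (F q) t) k))).
  rewrite exchange_big/=; apply: ler_sum => k _; apply: le_trans (ler_wpM2l (wt2_ge0 gm k) (fsq_sum Q k (fun q => ce (F q) t))) _.
  by rewrite big_distrr/=; apply: ler_sum => q _; rewrite mulrCA.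
apply: (le_tr (\sum_(q < Q) c / vol * 2^-1 ^+ q.+1)); last first.
  by rewrite -big_distrr/= ler_piMr ?geo_half// divr_ge0// ltW.
apply: ler_sum => q _; rewrite -big_distrr/=; have [D1 hF] := hD q.
apply: le_trans (ler_wpM2l (exprn_ge0 _ (ler0n R 2)) (fsq_tp t D1 g0 hF uks)) _.
have E (x y z v : R) : x * (y * (z / v)) = x * (y * z) / v by rewrite -!mulrA.
rewrite [c / vol * _]mulrAC E ler_pM2r ?invr_gt0//; apply: le_trans (hc q).
by rewrite ler_wpM2l ?exprn_ge0// ler_wpM2l ?powR_ge0.
Qed.


(* Weighted Fourier sums of Hoelder functions, by telescoping over their
   quasi-interpolants with constants [K0 4^j]. *)
Lemma gf_H p T K : 0 < T -> exists gm M : R, 0 < gm /\ forall f : R -> pt -> R, gf K p f ->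
  forall t ks, 0 <= t <= T -> uniq ks -> \sum_(k <- ks) wt2 gm k * fsq (f t) k <= M.
Proof.
move=> T0; have [r hr] := interp R p 1.
pose K0 := `|K| + 9 + (1 + T) + pi / T.
have pT : 0 < pi / T by rewrite divr_gt0// pi_gt0.
have K09 : 9 <= K0 by rewrite /K0; have := normr_ge0 K; lra.
have KK0 : K <= K0 by rewrite /K0; have := ler_norm K; lra.
pose Kj j := K0 * 4 ^+ j : R.
have p4 j : 1 <= 4 ^+ j :> R by apply: exprn_ege1; lra.
have Kj0 j : K0 <= Kj j by rewrite /Kj ler_peMr//; lra.
(* With this exponent the Sobolev weight of a block is at most [4 Kj], whereas its squared norm is
   of order [Kj ^ -2]. *)
pose gm : R := (3 * r.+1%:R)^-1.
have g0 : 0 < gm by rewrite invr_gt0 mulr_gt0.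
have D3 (D : R) j : 1 <= Kj j -> D = (4 * Kj j) ^+ r.+1 -> (1 + 3 * D ^+ 2) `^ gm <= 4 * Kj j.
  move=> wt_base_ge1' ->; have D4 : 4 <= (4 * Kj j) ^+ r.+1.
    by rewrite exprS; apply: (le_tr (4 * 1)); [lra|apply: ler_pM => //; [lra|apply: exprn_ege1; lra]].
  apply: (le_tr (((4 * Kj j) ^+ r.+1 ^+ 3) `^ gm)).
    apply: ge0_ler_powR; rewrite ?nnegrE ?(ltW g0)//.
    - by rewrite addr_ge0// mulr_ge0// sqr_ge0.
    - by rewrite exprn_ge0// (le_trans _ D4).
    - by move: D4; move: (_ ^+ r.+1) => D' hD; rewrite !exprS expr0 mulr1; nra.
  rewrite -exprM -powR_mulrn; last by rewrite mulr_ge0//; lra.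
  have n0 : 3 * r.+1%:R != 0 :> R by rewrite mulf_neq0// pnatr_eq0.
  rewrite -powRrM natrM [r.+1%:R * 3]mulrC mulfV// powRr1//; lra.
pose c0 : R := 2 * (32 * K0 ^+ 3 * vol).
exists gm, (2 * (c0 + 1024 * vol) / vol + 2); split=> // f hf t ks tT uks.
have ha j : exists a, [/\ bdd (Kj j ^+ r) a, forall t x, `|ev a t x| <= Kj j &
    forall t x, 0 <= t <= T -> `|ev a t x - f t x| <= (Kj j ^+ 1)^-1].
  have h := Kj0 j; apply: hr => //; [lra|rewrite /K0 in h; have := normr_ge0 K; lra|rewrite /K0 in h; have := normr_ge0 K; lra|apply: gf_le hf; lra].
have [a ha'] := choice ha.
have cf : CP (f t) := gf_CP t hf.
have Kp j : 0 < Kj j by have := Kj0 j; lra.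
have err j x : `|ev (a j) t x - f t x| <= (Kj j)^-1 by have [_ _ h] := ha' j; have := h t x tT; rewrite expr1.
pose F q : tp := if q is q'.+1 then a q ++ scl (-1) (a q') else a 0%N.
have FE q : (fun x => \sum_(j < q.+1) ev (F j) t x) = ev (a q) t.
  apply/funext => x; elim: q => [|q IH]; first by rewrite big_ord_recl big_ord0 addr0.
  by rewrite big_ord_recr/= IH /= ev_sub; ring.
pose D q : R := if q is q'.+1 then (4 * Kj q') ^+ r.+1 else (4 * Kj 0) ^+ r.+1.
have KS q : Kj q.+1 = 4 * Kj q by rewrite /Kj exprS; ring.
have rr q : Kj q ^+ r <= (4 * Kj q) ^+ r.+1.
  apply: (le_tr ((4 * Kj q) ^+ r)); first by apply: lerXn2r; rewrite ?nnegrE ?mulr_ge0 ?(ltW (Kp q))//; have := Kp q; lra.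
  by apply: ler_weXn2l => //; have := Kj0 q; lra.
have D1 q : 1 <= D q /\ all (dgm (D q)) (F q).
  split; first by case: q => [|q]; apply: exprn_ege1; [have := Kj0 0%N|have := Kj0 q]; lra.
  case: q => [|q] /=; first by have [[_ h] _ _] := ha' 0%N; exact: dgm_le (rr 0%N) h.
  rewrite all_cat all_mop; have [[_ h1] _ _] := ha' q.+1; have [[_ h2] _ _] := ha' q.
  rewrite (dgm_le (rr q) h2) andbT; apply: dgm_le h1.
  by rewrite KS; apply: ler_weXn2l => //; have := Kj0 q; lra.
pose e q : R := if q is q'.+1 then 4 / Kj q' ^+ 2 * vol else K0 ^+ 2 * vol.
have tile (g : pt -> R) (b : R) : CP g -> 0 <= b -> (forall x, `|g x| <= b) -> (\oint x, g x ^+ 2) <= b ^+ 2 * vol.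
  move=> cg b0 hb; rewrite -ti_cst; apply: ti_le => [||x]; [exact: CP_exp|exact: CP_cst|].
  by rewrite -[leLHS]ger0_norm ?sqr_ge0// normrX; apply: lerXn2r; rewrite ?nnegrE.
have he q : (\oint x, ev (F q) t x ^+ 2) <= e q.
  case: q => [|q] /=.
    by apply: tile; [exact: ce|lra|move=> x; have [_ h _] := ha' 0%N; have := h t x; rewrite /Kj expr0 mulr1].
  rewrite (_ : 4 / Kj q ^+ 2 = (2 / Kj q) ^+ 2); last by rewrite expr_div_n; congr (_ / _); rewrite expr2; ring.
  apply: tile; [exact: ce|by rewrite divr_ge0// ltW|move=> x; rewrite ev_sub].
  have := err q x; have := err q.+1 x; rewrite KS invfM.
  have i0 : 0 < (Kj q)^-1 by rewrite invr_gt0.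
  move=> e1 e2; rewrite (_ : _ - _ = (ev (a q.+1) t x - f t x) - (ev (a q) t x - f t x)); last by ring.
  apply: le_trans (ler_normB _ _) _; lra.
have hc q : 2 ^+ q.+1 * ((1 + 3 * D q ^+ 2) `^ gm * e q) <= (c0 + 1024 * vol) * 2^-1 ^+ q.+1.
  have K1 j : 1 <= Kj j by have := Kj0 j; lra.
  case: q => [|q] /=.
    rewrite !expr1; apply: (le_tr (2 * (4 * Kj 0 * (K0 ^+ 2 * vol)))).
      have kv : 0 <= K0 ^+ 2 * vol := mulr_ge0 (sqr_ge0 _) (ltW vol0).
      by rewrite ler_wpM2l//; apply: (ler_wpM2r kv); exact: (D3 _ 0%N (K1 0%N) erefl).
    have K00 : 0 <= K0 by lra.
    rewrite /Kj expr0 mulr1 /c0; have := mulr_ge0 (exprn_ge0 3 K00) (ltW vol0).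
    have := vol0; move: vol => v v1; rewrite !exprS expr0 !mulr1; lra.
  apply: (le_tr (2 ^+ q.+2 * (4 * Kj q * (4 / Kj q ^+ 2 * vol)))).
    have kv : 0 <= 4 / Kj q ^+ 2 * vol by apply: mulr_ge0; [apply: divr_ge0; [|exact: sqr_ge0]|exact: ltW vol0].
    by rewrite ler_wpM2l ?exprn_ge0//; apply: (ler_wpM2r kv); exact: (D3 _ q (K1 q) erefl).
  have k0 : K0 != 0 by rewrite gt_eqF//; lra.
  have f4 : 4 ^+ q = 2 ^+ q * 2 ^+ q :> R by rewrite -exprMn; congr (_ ^+ _); ring.
  have t0 : 2 ^+ q != 0 :> R by rewrite expf_neq0.
  rewrite (_ : 2 ^+ q.+2 * _ = 64 * vol / (K0 * 2 ^+ q)); last first.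
    by rewrite /Kj f4 !exprS expr0 !mulr1; move: (2 ^+ q) t0 vol => z z0 v; field; rewrite z0 k0.
  rewrite exprVn (_ : _ / 2 ^+ q.+2 = (c0 + 1024 * vol) / 4 / 2 ^+ q); last first.
    by rewrite !exprS; move: (2 ^+ q) t0 => z z0; field.
  rewrite invfM mulrA ler_pM2r ?invr_gt0 ?exprn_gt0//.
  rewrite ler_pdivrMr; last lra.
  have K00 : 0 <= K0 by lra.
  have : 0 <= c0 by rewrite /c0 -mulrA; have := mulr_ge0 (exprn_ge0 3 K00) (ltW vol0); lra.
  have := vol0; move: vol => v v0 c00; nra.
pose W := \sum_(k <- ks) wt2 gm k.
have W0 : 0 <= W by apply: sumr_ge0 => k _; exact: wt2_ge0.
(* [J] depends on the list [ks]: the interpolation error, squared and weighted, stays below 1. The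
   resulting bound is independent of the list. *)
have [J hJ] : exists J, W <= Kj J.
  exists (Num.trunc W).+1; apply: le_trans (ltW (truncnS_gt W)) _; rewrite /Kj.
  apply: (le_tr (4 ^+ (Num.trunc W).+1)); last by rewrite ler_peMl ?exprn_ge0//; lra.
  by rewrite -natrX ler_nat ltnW// ltn_expl.
have cd : CP (fun x => f t x - ev (a J) t x) by exact: CPB.
have split_f : f t = (fun x => ev (a J) t x + (f t x - ev (a J) t x)) by apply/funext => x; rewrite addrC subrK.
have b1 : \sum_(k <- ks) wt2 gm k * fsq (ev (a J) t) k <= (c0 + 1024 * vol) / vol.
  by rewrite -FE; exact: (series_H J.+1 (ltW g0) uks D1 he hc).
have b2 : \sum_(k <- ks) wt2 gm k * fsq (fun x => f t x - ev (a J) t x) k <= 1.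
  have fb k : fsq (fun x => f t x - ev (a J) t x) k <= (Kj J)^-1.
    have uk : uniq [:: k] by [].
    have := bessel cd uk; rewrite big_seq1 => h; apply: le_trans h _.
    rewrite ler_pdivrMr//; apply: le_trans (tile _ ((Kj J)^-1) cd _ _) _.
    - by rewrite invr_ge0 ltW.
    - by move=> x; rewrite distrC.
    - rewrite ler_wpM2r ?(ltW vol0)// expr2 ler_piMl ?invr_ge0 ?(ltW (Kp J))// invf_le1//; have := Kj0 J; lra.
  apply: (le_tr (W * (Kj J)^-1)); last by rewrite ler_pdivrMr// mul1r.
  by rewrite /W big_distrl/=; apply: ler_sum => k _; rewrite ler_wpM2l ?wt2_ge0.
apply: (le_tr (2 * (\sum_(k <- ks) wt2 gm k * fsq (ev (a J) t) k) + 2 * (\sum_(k <- ks) wt2 gm k * fsq (fun x => f t x - ev (a J) t x) k))).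
  rewrite !big_distrr -big_split/=; apply: ler_sum => k _.
  rewrite {1}split_f [2 * (_ * fsq (ev _ _) k)]mulrCA [2 * (_ * fsq (fun x => f t x - _) k)]mulrCA -mulrDr ler_wpM2l ?wt2_ge0//.
  exact: fsqD (CP_S2 _) (CP_S2 _).
rewrite -mulrA; move: (_ / vol) b1 => q b1; lra.
Qed.

End Fourier.

(** * The iteration *)

Section Iter.
Variable R : realType.
Notation pt := (point R).
Notation tp := (seq (mono R)).
Notation scalf := (R -> pt -> R).
Notation addW V W := (fun i t x => V i t x + ev (W i) t x).

(** A stage is run with [K = Lq ^ E], which is the next [Lq]: the new stress is at most its inverse,
    and the new constants [K ^ B] are at most its power [E], since [E = B + 2]. *)
Lemma iterate T p : 0 < T -> (0 < p)%N -> exists E : nat, exists C : R, [/\ (1 < E)%N, 0 <= C &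
  forall nu L (V : 'I_3 -> scalf) S, 0 <= nu <= 1 -> 9 <= L -> 1 + T <= L -> pi / T <= L ->
  vld T nu (L ^+ E) p V S -> (forall t i j, 0 <= t <= T -> (\oint x, `|S i j t x|) <= L^-1) ->
  exists (w : nat -> 'I_3 -> tp) (Sq : nat -> 'I_3 -> 'I_3 -> scalf), forall q, let Lq := L ^+ (E ^ q) in
  [/\ vld T nu (Lq ^+ E) p (fun i t x => V i t x + \sum_(k < q) ev (w k i) t x) (Sq q),
      forall t i j, 0 <= t <= T -> (\oint x, `|Sq q i j t x|) <= Lq^-1,
      forall i, bdd (Lq ^+ (E * E)) (w q i), divm (w q) &
      forall t, 0 <= t <= T -> (\oint x, \sum_(i < 3) ev (w q i) t x ^+ 2) <= 2 * C / Lq]].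
Proof.
move=> T0 p0; have [B [C [C0 hst]]] := stage R p0.
pose E := (B + 2)%N; exists E, C; split=> //; first by rewrite /E addn2.
move=> nu L V S nu01 L9 TL pL hv hS.
have L1 : 1 <= L by lra.
have L0 : 0 < L by lra.
pose Lq q := L ^+ (E ^ q).
have E0 q : (0 < E ^ q)%N by rewrite expn_gt0 /E addn2.
have Lq1 q : 1 <= Lq q by exact: exprn_ege1.
have LLq q : L <= Lq q by rewrite /Lq -(prednK (E0 q)) exprS ler_peMr ?(ltW L0)// exprn_ege1.
have LqS q : Lq q.+1 = Lq q ^+ E by rewrite /Lq expnSr exprM.
pose St := (('I_3 -> scalf) * ('I_3 -> 'I_3 -> scalf))%type.
pose Inv q (s : St) := vld T nu (Lq q ^+ E) p s.1 s.2 /\ forall t i j, 0 <= t <= T -> (\oint x, `|s.2 i j t x|) <= (Lq q)^-1.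
(* The invariant is a premise inside the existential, so that choice yields a function on all
   states, which can then be iterated. *)
have step (x : nat * St) : exists y : ('I_3 -> tp) * ('I_3 -> 'I_3 -> scalf), Inv x.1 x.2 ->
    [/\ Inv x.1.+1 (addW x.2.1 y.1, y.2), forall i, bdd (Lq x.1 ^+ (E * E)) (y.1 i), divm y.1 &
      forall t, 0 <= t <= T -> (\oint z, \sum_(i < 3) ev (y.1 i) t z ^+ 2) <= 2 * C / Lq x.1].
  case: x => q [V' S'] /=; have [hI|nI] := pselect (Inv q (V', S')); last by exists ((fun=> [::]), S').
  have [v1 s1] := hI; rewrite /= in v1 s1.
  have LK : Lq q <= Lq q ^+ E by rewrite /E addn2 exprS ler_peMr ?exprn_ege1// (le_trans ler01).
  have K9 := le_trans L9 (le_trans (LLq q) LK).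
  have [W [S'' [bW dW v2 s2 w2]]] := hst T nu (Lq q ^+ E) ((Lq q)^-1) V' S' T0 nu01 K9
    (le_trans TL (le_trans (LLq q) LK)) (le_trans pL (le_trans (LLq q) LK)) v1 s1.
  have BE : Lq q ^+ E ^+ B <= Lq q.+1 ^+ E.
    by rewrite LqS; apply: ler_weXn2l; [exact: exprn_ege1|rewrite /E leq_addr].
  have bW' i : bdd (Lq q ^+ (E * E)) (W i) by apply: bdd_le (bW i) _; have -> : Lq q ^+ (E * E) = Lq q.+1 ^+ E by rewrite LqS exprM.
  have v2' : vld T nu (Lq q.+1 ^+ E) p (addW V' W) S''.
    have [a1 a2 a3 a4] := v2; split; [move=> i|move=> i j|exact: a3|exact: a4].
      exact: (gf_le BE (a1 i)).
    exact: (gf_le BE (a2 i j)).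
  exists (W, S'') => _; split; [|exact: bW'|exact: dW|].
    by split; [exact: v2'|move=> t i j tT; rewrite LqS; exact: s2].
  move=> t tT; apply: le_trans (w2 t tT) _; rewrite [2 * C]mulrC -mulrA ler_wpM2l//.
  have : (Lq q ^+ E)^-1 <= (Lq q)^-1 by rewrite lef_pV2 ?posrE ?exprn_gt0// (lt_le_trans ltr01).
  lra.
have [f hf] := choice step.
pose st := fix st q : St := if q is q'.+1 then (addW (st q').1 (f (q', st q')).1, (f (q', st q')).2) else (V, S).
pose w q := (f (q, st q)).1.
have I0 q : Inv q (st q).
  elim: q => [|q IH]; first by split=> /=; rewrite /Lq expn0 expr1.
  by have [] := hf (q, st q) IH.
have sE q : (st q).1 = fun i t x => V i t x + \sum_(k < q) ev (w k i) t x.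
  elim: q => [|q IH] /=; apply/funext => i; apply/funext => t; apply/funext => x.
    by rewrite big_ord0 addr0.
  by rewrite IH big_ord_recr/= addrA.
exists w, (fun q => (st q).2) => q Lq'; have [v1 s1] := I0 q.
have [_ b1 d1 w1] := hf (q, st q) (I0 q).
by split; [rewrite -sE; exact: v1|exact: s1|exact: b1|exact: d1|exact: w1].
Qed.

End Iter.

(** * The limit *)

Section Limit.
Variable R : realType.
Notation pt := (point R).
Notation mR := (measurableTypeR R).
Notation mT := (mR * mR * mR)%type.
Notation mu := (@torus_measure R).
Notation vol := ((tpi : R) ^+ 3).
Implicit Types f g : pt -> R.

Lemma tail_sq (x : nat -> R) c m Q : (Q <= m)%N -> (forall m, \sum_(q < m) 2 ^+ q.+1 * x q ^+ 2 <= c) ->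
  (\sum_(q < m) x q - \sum_(q < Q) x q) ^+ 2 <= c / 2 ^+ Q.
Proof.
move=> Qm h; have h2 : 0 < (2 : R) ^+ Q by rewrite exprn_gt0.
have sp (y : nat -> R) : \sum_(q < m) y q = \sum_(q < Q) y q + \sum_(k < m - Q) y (Q + k)%N.
  by move: (m - Q)%N (subnKC Qm) => d <-; rewrite big_split_ord.
rewrite sp addrC addKr; apply: le_trans (wsum_sq (fun k => x (Q + k)%N) _) _.
rewrite ler_pdivlMr// mulrC big_distrr/=; apply: le_trans (h m).
rewrite (sp (fun q => 2 ^+ q.+1 * x q ^+ 2)) -[leLHS]add0r lerD//.
  by apply: sumr_ge0 => q _; rewrite mulr_ge0 ?sqr_ge0 ?exprn_ge0.
by apply: ler_sum => k _; rewrite mulrA -exprD addnS.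
Qed.

Lemma lim_num (a : R) (x : nat -> R) c : (forall m, \sum_(q < m) 2 ^+ q.+1 * x q ^+ 2 <= c) ->
  let l := fine (limn_esup (fun n => (a + \sum_(q < n) x q)%:E)) in
  forall Q, (l - (a + \sum_(q < Q) x q)) ^+ 2 <= c / 2 ^+ Q.
Proof.
move=> h; pose s n := a + \sum_(q < n) x q.
have c0 : 0 <= c by have := h 0%N; rewrite big_ord0.
have hs m Q : (Q <= m)%N -> (s m - s Q) ^+ 2 <= c / 2 ^+ Q.
  by move=> Qm; rewrite (_ : s m - s Q = \sum_(q < m) x q - \sum_(q < Q) x q); [exact: tail_sq|rewrite /s; ring].
have g0 : c / 2 ^+ n @[n --> \oo] --> 0.
  rewrite -(mulr0 c); apply: cvgM; first exact: cvg_cst.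
  under eq_fun do rewrite -exprVn; apply: cvg_expr.
  by rewrite ger0_norm// invf_lt1// ltr1n.
have cs : cvgn s.
  apply/cauchy_cvgP/cauchy_exP => e e0.
  have e2 : 0 < e ^+ 2 by rewrite exprn_gt0.
  have [Q _ hQ] := cvgr0_norm_lt _ g0 _ e2.
  exists (s Q); suff: \forall m \near \oo, ball (s Q) e (s m) by [].
  near=> m.
  have Qm : (Q <= m)%N by near: m; exact: nbhs_infty_ge.
  rewrite /ball/= distrC -(ltr_pXn2r (n := 2))// ?nnegrE ?(ltW e0)// real_normK ?num_real//.
  apply: le_lt_trans (hs _ _ Qm) _; have := hQ Q (leqnn Q); rewrite /= ger0_norm//.
  by rewrite divr_ge0 ?exprn_ge0.
rewrite /=; have se : (s n)%:E @[n --> \oo] --> (limn s)%:E by apply: cvg_EFin => //; exact: nearW.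
have -> : limn_esup (fun n => (a + \sum_(q < n) x q)%:E) = (limn s)%:E by have [_] := cvg_limn_einf_sup se.
move=> Q /=.
have cq : (s m - s Q) ^+ 2 @[m --> \oo] --> (limn s - s Q) ^+ 2.
  by rewrite expr2; under eq_fun do rewrite expr2; apply: cvgM; apply: cvgB => //; exact: cvg_cst.
apply: (cvgr_to_le cq); near=> m; apply: hs; near: m; exact: nbhs_infty_ge.
Unshelve. all: by end_near. Qed.

(** The upper limit is defined everywhere and measurable. It is the limit wherever the weighted
    series of squares is finite, so no exceptional null set has to be chosen. *)
Definition limf (f0 : pt -> R) (F : nat -> pt -> R) x : R :=
  fine (limn_esup (fun n => (f0 x + \sum_(q < n) F q x)%:E)).

(** The series of [2 ^ q.+1 * F q ^ 2] has integral at most [A], by summation of the integrals. It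
    dominates pointwise [2 ^ Q] times the squared distance of the limit from the partial sum of
    order [Q]. *)
Lemma limfP (f0 : pt -> R) F A : CP f0 -> (forall q, CP (F q)) ->
  (forall q, (\oint x, F q x ^+ 2) <= A / 4 ^+ q.+1) ->
  [/\ torus_periodic (limf f0 F), S2 (limf f0 F) &
    forall Q, (\oint x, (limf f0 F x - (f0 x + \sum_(q < Q) F q x)) ^+ 2) <= A / 2 ^+ Q].
Proof.
move=> c0 cF hA.
have cV Q : CP (fun x => f0 x + \sum_(q < Q) F q x).
  by apply: CPD => //; apply: (@CP_sum R _ _ _ (fun (q : 'I_Q) x => F q x)).
have mv : measurable_fun [set: mT] (fun p : mT => limf f0 F (row3 p)).
  apply: (measurableT_comp (fine_measurable measurableT)).
  apply: measurable_fun_limn_esup => n; apply/measurable_EFinP; exact: measurable_row3 (cV n).1.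
pose g q (p : mT) : \bar R := (2 ^+ q.+1 * F q (row3 p) ^+ 2)%:E.
have g0 q p : (0 <= g q p)%E by rewrite lee_fin mulr_ge0 ?sqr_ge0 ?exprn_ge0.
have cg q : CP (fun x => 2 ^+ q.+1 * F q x ^+ 2) by apply: CPZ; exact: CP_exp.
have mg q : measurable_fun [set: mT] (g q) by apply/measurable_EFinP; exact: measurable_row3 (cg q).1.
have A0 : 0 <= A.
  have := le_trans (ti_ge0 (fun x => sqr_ge0 (F 0 x))) (hA 0%N); rewrite pmulr_lge0// invr_gt0; lra.
have iG : (\int[mu]_p (\sum_(q <oo) g q p) <= A%:E)%E.
  rewrite integral_nneseries//.
  apply: lime_le; first by apply: is_cvg_nneseries => q _ _; exact: integral_ge0.
  apply: nearW => n; rewrite (eq_bigr (fun q => (2 ^+ q.+1 * (\oint x, F q x ^+ 2))%:E)); last first.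
    move=> q _; rewrite -tiZ; last exact: CP_exp.
    by rewrite /torus_int/Rintegral fineK//; exact: (integrable_fin_num measurableT (CP_integrable (cg q))).
  rewrite sumEFin lee_fin.
  apply: (le_tr (\sum_(0 <= q < n) A * 2^-1 ^+ q.+1)).
    apply: ler_sum => q _; rewrite (_ : A * 2^-1 ^+ q.+1 = 2 ^+ q.+1 * (A / 4 ^+ q.+1)).
      by rewrite ler_wpM2l ?exprn_ge0.
    have -> : (4 : R) = 2 * 2 by lra.
    by rewrite exprMn exprVn; field; rewrite expf_neq0.
  by rewrite big_mkord -big_distrr/= ler_piMr// geo_half.
have mG : measurable_fun [set: mT] (fun p => (\sum_(q <oo) g q p)%E).
  by apply: ge0_emeasurable_sum => // q p _ _; exact: g0.
(* Where the series is infinite, the bound is vacuous, and the value of [limf] does not matter. *)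
have ptw Q p : (((limf f0 F (row3 p) - (f0 (row3 p) + \sum_(q < Q) F q (row3 p))) ^+ 2)%:E <=
    (2 ^+ Q)^-1%:E * \sum_(q <oo) g q p)%E.
  have h2 : 0 < (2 ^+ Q : R)^-1 by rewrite invr_gt0 exprn_gt0.
  have G0 : (0 <= \sum_(q <oo) g q p)%E by exact: nneseries_ge0.
  case: (\sum_(q <oo) g q p)%E G0 (fun k => nneseries_lim_ge (m := 0%N) (P := xpredT) k (fun n _ _ => g0 n p)) => [c||] //= G0 hG.
    rewrite -EFinM lee_fin mulrC; apply: (@lim_num (f0 (row3 p)) (fun q => F q (row3 p)) c) => m; have := hG m.
    by rewrite big_mkord sumEFin lee_fin.
  by rewrite mulry gtr0_sg// mul1e leey.
have sD Q : S2 (fun x => limf f0 F x - (f0 x + \sum_(q < Q) F q x)) /\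
    (\oint x, (limf f0 F x - (f0 x + \sum_(q < Q) F q x)) ^+ 2) <= A / 2 ^+ Q.
  have md : measurable_fun [set: mT] (fun p : mT => limf f0 F (row3 p) - (f0 (row3 p) + \sum_(q < Q) F q (row3 p))).
    apply: measurable_funB => //; exact: measurable_row3 (cV Q).1.
  have md2 : measurable_fun [set: mT] (fun p : mT => ((limf f0 F (row3 p) - (f0 (row3 p) + \sum_(q < Q) F q (row3 p))) ^+ 2)%:E).
    by apply/measurable_EFinP; exact: measurable_funX.
  have le : (\int[mu]_p ((limf f0 F (row3 p) - (f0 (row3 p) + \sum_(q < Q) F q (row3 p))) ^+ 2)%:E <= (A / 2 ^+ Q)%:E)%E.
    apply: (le_tr (\int[mu]_p ((2 ^+ Q)^-1%:E * \sum_(q <oo) g q p))%E).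
      apply: ge0_le_integral => //; [by move=> p _; rewrite lee_fin sqr_ge0|exact: measurable_funeM].
    rewrite ge0_integralZl//; last by move=> p _; exact: nneseries_ge0.
    by rewrite mulrC EFinM lee_wpmul2l// lee_fin invr_ge0 exprn_ge0.
  have i2 : (0 <= \int[mu]_p ((limf f0 F (row3 p) - (f0 (row3 p) + \sum_(q < Q) F q (row3 p))) ^+ 2)%:E)%E.
    by apply: integral_ge0 => p _; rewrite lee_fin sqr_ge0.
  split; last first.
    rewrite /torus_int /Rintegral; move: le i2; case: (\int[mu]_p _)%E => [r||] //=; rewrite lee_fin//.
  split=> //; apply/integrableP; split=> //.
  apply: le_lt_trans (ltry (A / 2 ^+ Q)); apply: le_trans le.
  by under eq_integral do rewrite gee0_abs ?lee_fin ?sqr_ge0//.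
split.
- move=> j x; rewrite /limf; congr (fine (limn_esup _)); apply/funext => n.
  by have := (cV n).2 j x => /= ->.
- have := s2D (sD 0%N).1 (CP_S2 (cV 0%N)); congr S2; apply/funext => x; by rewrite subrK.
- by move=> Q; exact: (sD Q).2.
Qed.

End Limit.

(** * [L^2] and Sobolev norms of square integrable fields *)

Section Norms.
Variable R : realType.
Notation pt := (point R).
Notation mR := (measurableTypeR R).
Notation mT := (mR * mR * mR)%type.
Notation mu := (@torus_measure R).
Notation vol := ((tpi : R) ^+ 3).
Implicit Types (f g : pt -> R) (F : field R) (k : 'rV[int]_3).
Notation rv := (map_mx intr).

Lemma fsq_S2 f k : S2 f -> fsq f k <= 2 * (\oint x, f x ^+ 2) / vol.
Proof.
move=> hf; have v0 := vol_gt0 R.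
have key (h : pt -> R) : CP h -> (forall x, `|h x| <= 1) -> ((\oint x, f x * h x) / vol) ^+ 2 <= (\oint x, f x ^+ 2) / vol.
  move=> ch h1; have a := ti_CS hf (CP_S2 ch).
  have b : (\oint x, h x ^+ 2) <= vol.
    rewrite -[leRHS]mul1r -ti_cst; apply: ti_le => [||x]; [exact: CP_exp|exact: CP_cst|].
    by rewrite -real_normK ?num_real// expr_le1.
  have c : 0 <= (\oint x, f x ^+ 2) by apply: ti_ge0 => x; exact: sqr_ge0.
  move: v0 a b c; move: (ti _) (ti _) (ti _) vol => X Y Z v v0 a b c.
  rewrite expr_div_n ler_pdivrMr ?exprn_gt0//.
  have -> : Y / v * v ^+ 2 = Y * v by field; lra.
  by apply: le_trans a _; rewrite ler_wpM2l.
have e1 := key _ (@CP_cosk R k); have e2 := key _ (@CP_sink R k).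
rewrite /fsq /fc /fs -mulrA; apply: (le_tr ((\oint x, f x ^+ 2) / vol + (\oint x, f x ^+ 2) / vol)).
  apply: lerD; [apply: e1 => x|apply: e2 => x]; rewrite ler_norml; last by rewrite sin_geN1 sin_le1.
  by rewrite cos_geN1 cos_le1.
by rewrite mulrDl !mul1r.
Qed.

Lemma fsq_apx f g k : S2 f -> CP g -> fsq f k <= 2 * fsq g k + 4 * (\oint x, (f x - g x) ^+ 2) / vol.
Proof.
move=> hf cg; have hg := CP_S2 cg; have hd := s2B hf hg.
have -> : f = fun x => g x + (f x - g x) by apply/funext => x; rewrite addrCA subrr addr0.
apply: le_trans (fsqD k hg hd) _.
rewrite (_ : (fun x => _ ^+ 2) = fun x => (f x - g x) ^+ 2); last by apply/funext => x; rewrite addrAC subrr add0r.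
by have := fsq_S2 k hd; rewrite -!mulrA; move: (_ / _) => X; lra.
Qed.

(** Bessel's inequality for limits, obtained from continuous approximants with an error divided by
    the number of frequencies; the constant 4 is not optimal. *)
Lemma bessel_S2 f ks : S2 f -> (forall e, 0 < e -> exists g, CP g /\ (\oint x, (f x - g x) ^+ 2) <= e) ->
  uniq ks -> \sum_(k <- ks) fsq f k <= 4 * (\oint x, f x ^+ 2) / vol.
Proof.
move=> hf apx uks; have v0 := vol_gt0 R; apply/ler_addgt0Pr => e e0.
have N0 : 0 < 4 + 4 * (size ks)%:R :> R by have := ler0n R (size ks); lra.
have [g [cg hg]] := apx (e * vol / (4 + 4 * (size ks)%:R)) (divr_gt0 (mulr_gt0 e0 v0) N0).
have hd := s2B hf (CP_S2 cg).
set del := (\oint x, (f x - g x) ^+ 2) in hg.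
have d0 : 0 <= del by apply: ti_ge0 => x; exact: sqr_ge0.
have g2 : (\oint x, g x ^+ 2) <= 2 * (\oint x, f x ^+ 2) + 2 * del.
  rewrite /del -!mti_Z; [|exact: hd.2|exact: hf.2].
  rewrite -mti_D; [|exact: miZ hf.2|exact: miZ hd.2].
  apply: mti_le; [exact: (CP_S2 cg).2|exact: miD (miZ _ hf.2) (miZ _ hd.2)|move=> x].
  by have := sq_add (f x) (- (f x - g x)); rewrite sqrrN (_ : f x - (f x - g x) = g x)//; ring.
apply: (le_tr (\sum_(k <- ks) (2 * fsq g k + 4 * del / vol))).
  by apply: ler_sum => k _; exact: fsq_apx.
rewrite big_split/= -big_distrr/= big_const_seq count_predT iter_addr_0.
have b := bessel cg uks.
have hg' : (4 + 4 * (size ks)%:R) * del <= e * vol by move: hg; rewrite ler_pdivlMr// mulrC.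
rewrite -[(_ / _) *+ _]mulr_natr; move: g2 b hg' v0; move: (\sum_(k <- ks) _) (ti _) (ti _) (size ks)%:R vol => B F G n v g2 b hg' v0.
have b' : B * v <= G by rewrite -ler_pdivlMr.
rewrite -(ler_pM2r v0) mulrDl.
have -> : 4 * del / v * n * v = 4 * n * del by field; lra.
have -> : (4 * F / v + e) * v = 4 * F + e * v by field; lra.
lra.
Qed.

Lemma s2_int f : S2 f -> (\int[mu]_p ((f (row3 p)) ^+ 2)%:E = (\oint x, f x ^+ 2)%:E)%E.
Proof. by move=> hf; rewrite /torus_int/Rintegral fineK//; exact: (integrable_fin_num measurableT hf.2). Qed.

Lemma L2_S2 F : torus_periodic F -> (forall i, S2 (fun x => F x 0 i)) -> L2 F.
Proof.
move=> pF hF; split=> [j x|i]; first by rewrite /= (pF j x).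
rewrite inE; apply/andP; split; apply: mem_set; first exact: (hF i).1.
rewrite /finite_norm unlock/= (eq_integral (fun p : mT => ((F (row3 p) 0 i) ^+ 2)%:E)) => [|p _].
  by rewrite (s2_int (hF i)) poweR_EFin ltry.
by rewrite (powR_mulrn 2)// real_normK ?num_real.
Qed.

Lemma L2norm_le F e : 0 <= e -> (forall i, S2 (fun x => F x 0 i)) ->
  \sum_(i < 3) (\oint x, F x 0 i ^+ 2) <= e ^+ 2 -> (L2norm F <= e%:E)%E.
Proof.
move=> e0 hF h.
have hs : MI (fun x => \sum_(i < 3) F x 0 i ^+ 2) /\ (\oint x, \sum_(i < 3) F x 0 i ^+ 2) = \sum_(i < 3) (\oint x, F x 0 i ^+ 2).
  have m01 := miD (hF 0).2 (miD (hF 1).2 (hF 2%:R).2).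
  have E : (fun x => \sum_(i < 3) F x 0 i ^+ 2) = (fun x => F x 0 0 ^+ 2 + (F x 0 1 ^+ 2 + F x 0 2%:R ^+ 2)).
    apply/funext => x; rewrite !big_ord_recl big_ord0 addr0; congr (F x 0 _ ^+ 2 + (F x 0 _ ^+ 2 + F x 0 _ ^+ 2)); exact/val_inj.
  rewrite E; split=> //; rewrite mti_D; [|exact: (hF 0).2|exact: miD (hF 1).2 (hF 2%:R).2].
  rewrite mti_D; [|exact: (hF 1).2|exact: (hF 2%:R).2].
  rewrite !big_ord_recl big_ord0 addr0.
  have e1 : lift ord0 ord0 = 1 :> 'I_3 by exact/val_inj.
  have e2 : lift ord0 (lift ord0 ord0) = 2%:R :> 'I_3 by exact/val_inj.
  by rewrite e1 e2.
rewrite /L2norm unlock/= (eq_integral (fun p : mT => (\sum_(i < 3) F (row3 p) 0 i ^+ 2)%:E)) => [|p _]; last first.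
  have E : dot (F (row3 p)) (F (row3 p)) = \sum_(i < 3) F (row3 p) 0 i ^+ 2 by apply: eq_bigr => i _; rewrite expr2.
  have d0 : 0 <= \sum_(i < 3) F (row3 p) 0 i ^+ 2 by apply: sumr_ge0 => i _; exact: sqr_ge0.
  by rewrite (powR_mulrn 2)// real_normK ?num_real// sqr_sqrtr E.
rewrite (_ : (\int[mu]_p _)%E = (\oint x, \sum_(i < 3) F x 0 i ^+ 2)%:E); last first.
  by rewrite /torus_int/Rintegral fineK//; exact: (integrable_fin_num measurableT hs.1).
rewrite hs.2 poweR_EFin lee_fin powR12_sqrt; last by apply: sumr_ge0 => i _; apply: ti_ge0 => x; exact: sqr_ge0.
by rewrite -[leRHS](ger0_norm e0) -sqrtr_sqr ler_wsqrtr.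
Qed.

Lemma Hnorm_le beta F e : 0 <= e ->
  (forall ks : seq 'rV[int]_3, uniq ks -> \sum_(k <- ks) wt2 beta k * fourier_sq F k <= e ^+ 2) -> (Hnorm beta F <= e%:E)%E.
Proof.
move=> e0 h; rewrite /Hnorm.
have hs : (\esum_(k in [set: 'rV[int]_3]) ((1 + dot (rv k) (rv k)) `^ beta * fourier_sq F k)%:E <= (e ^+ 2)%:E)%E.
  apply: ub_ereal_sup => _ [A [fA _] <-]; rewrite fsbig_finite//= sumEFin lee_fin.
  exact: h (finmap.fset_uniq _).
have s0 : (0 <= \esum_(k in [set: 'rV[int]_3]) ((1 + dot (rv k) (rv k)) `^ beta * fourier_sq F k)%:E)%E.
  apply: esum_ge0 => k _; rewrite lee_fin mulr_ge0 ?powR_ge0//.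
  by apply: sumr_ge0 => i _; rewrite addr_ge0 ?sqr_ge0.
apply: (le_tr ((e ^+ 2)%:E `^ 2^-1)%E).
  by apply: gt0_ler_poweR; rewrite ?in_itv/= ?andbT ?s0 ?leey// lee_fin ?sqr_ge0 ?leey ?invr_ge0.
by rewrite poweR_EFin lee_fin powR12_sqrt ?sqr_ge0// sqrtr_sqr ger0_norm.
Qed.

Lemma fourier_fsq F k : fourier_sq F k = \sum_(i < 3) fsq (fun x => F x 0 i) k.
Proof. by []. Qed.

Lemma ereal_cvg0 (I : Type) (G : set_system I) (FG : Filter G) (f : I -> \bar R) : (forall x, 0 <= f x)%E ->
  (forall e : R, 0 < e -> \forall x \near G, (f x <= e%:E)%E) -> f x @[x --> G] --> 0%E.
Proof.
move=> f0 h; apply/fine_cvgP; split.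
  near=> x; rewrite ge0_fin_numE//; apply: le_lt_trans (ltry (1 : R)); near: x; exact: h.
apply/cvgrPdist_le => e e0; near=> x; rewrite sub0r normrN/=.
have hx : (f x <= e%:E)%E by near: x; exact: h.
have fx : f x \is a fin_num by rewrite ge0_fin_numE//; apply: le_lt_trans hx (ltry _).
by rewrite ger0_norm ?fine_ge0// -lee_fin fineK.
Unshelve. all: by end_near. Qed.

End Norms.

(** * The limit velocity and its continuity in time *)

Section Sol.
Variable R : realType.
Notation pt := (point R).
Notation tp := (seq (mono R)).
Notation vol := ((tpi : R) ^+ 3).
Variables (T A : R) (V : 'I_3 -> R -> pt -> R) (w : nat -> 'I_3 -> tp).
Hypothesis T0 : 0 < T.
Hypothesis hV : forall i, jc (V i).
Hypothesis hw : forall q i t, 0 <= t <= T -> (\oint x, ev (w q i) t x ^+ 2) <= A / 4 ^+ q.+1.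

Definition VQ Q i t x := V i t x + \sum_(k < Q) ev (w k i) t x.
Definition vl (t : R) : field R := fun x => \row_i limf (V i t) (fun q => ev (w q i) t) x.
Definition vc i t x := vl t x 0 i.

Lemma jc_VQ Q i : jc (VQ Q i).
Proof. by apply: (jcD (hV i)); apply: (@jc_sum R Q (fun k => ev (w k i))) => k; exact: jc_ev. Qed.

Lemma vcP i t : 0 <= t <= T -> [/\ torus_periodic (vc i t), S2 (vc i t) &
  forall Q, (\oint x, (vc i t x - VQ Q i t x) ^+ 2) <= A / 2 ^+ Q].
Proof.
move=> tT; have -> : vc i t = limf (V i t) (fun q => ev (w q i) t) by apply/funext => x; rewrite /vc mxE.
exact: (limfP (jc_CP t (hV i)) (fun q => jc_CP t (jc_ev (w q i))) (fun q => hw q i tT)).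
Qed.

Lemma A_ge0 : 0 <= A.
Proof.
have t0 : 0 <= (0 : R) <= T by rewrite lexx ltW.
have := le_trans (ti_ge0 (fun x => sqr_ge0 (ev (w 0 0) 0 x))) (hw 0 0 t0).
by rewrite pmulr_lge0// invr_gt0 exprn_gt0.
Qed.

Lemma half_small (c e : R) : 0 < e -> exists Q, c / 2 ^+ Q <= e.
Proof.
move=> e0; pose n := Num.trunc (`|c| / e); exists n.+1; rewrite ler_pdivrMr ?exprn_gt0//.
have h : `|c| / e < n.+1%:R by exact: truncnS_gt.
have h2 : n.+1%:R <= 2 ^+ n.+1 :> R by rewrite -natrX ler_nat ltnW// ltn_expl.
rewrite mulrC -ler_pdivrMr//; apply: le_trans h2; apply: le_trans (ltW h).
by rewrite ler_pM2r ?invr_gt0// ler_norm.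
Qed.

(** The partial sums approximate the limit uniformly in time and are themselves continuous in
    time. *)
Lemma vc_close t (e : R) : 0 <= t <= T -> 0 < e -> \forall s \near nbhs t, 0 <= s <= T ->
  forall i, (\oint x, (vc i s x - vc i t x) ^+ 2) <= e.
Proof.
move=> tT e0; have [Q hQ] := half_small (6 * A) (divr_gt0 e0 (ltr0n R 2)).
have e6 : 0 < e / 6 by rewrite divr_gt0.
have near i : \forall s \near nbhs t, (\oint x, (VQ Q i s x - VQ Q i t x) ^+ 2) < e / 6.
  have j1 : jc (fun s x => (VQ Q i s x - VQ Q i t x) * (VQ Q i s x - VQ Q i t x)).
    have j2 : jc (fun s x => VQ Q i s x - VQ Q i t x).
      apply: (jcB (jc_VQ Q i)); split=> [z|s]; last exact: (jc_CP t (jc_VQ Q i)).2.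
      apply: (continuous_comp (f := fst)); first exact: cvg_fst.
      exact: (jc_CP t (jc_VQ Q i)).1.
    exact: jcM.
  have c0 := @jc_ti R _ j1 t.
  have z : (\oint x, (VQ Q i t x - VQ Q i t x) * (VQ Q i t x - VQ Q i t x)) = 0.
    by rewrite (eq_ti (fun=> 0)) => [|x]; [rewrite ti_cst mul0r|rewrite subrr mul0r].
  have c1 : (\oint x, (VQ Q i s x - VQ Q i t x) * (VQ Q i s x - VQ Q i t x)) @[s --> t] --> (0 : R).
    by rewrite -z; exact: c0.
  apply: filterS (cvgr0_norm_lt _ c1 _ e6) => s; apply: le_lt_trans; exact: ler_norm.
have nall : \forall s \near nbhs t, forall i, (\oint x, (VQ Q i s x - VQ Q i t x) ^+ 2) < e / 6 by exact: filter_forall.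
apply: filterS nall => s hs sT i; have hs' := hs i.
have [_ Ss bs] := vcP i sT; have [_ St bt] := vcP i tT; have bs' := bs Q; have bt' := bt Q.
have cs := jc_CP s (jc_VQ Q i); have ct := jc_CP t (jc_VQ Q i).
have d1 := s2B Ss (CP_S2 cs); have d2 := s2B St (CP_S2 ct); have d3 := CP_S2 (CPB cs ct).
apply: (le_tr (3 * (\oint x, (vc i s x - VQ Q i s x) ^+ 2) + (3 * (\oint x, (vc i t x - VQ Q i t x) ^+ 2) +
    3 * (\oint x, (VQ Q i s x - VQ Q i t x) ^+ 2)))).
  rewrite -(mti_Z _ d1.2) -(mti_Z _ d2.2) -(mti_Z _ d3.2) -(mti_D (miZ 3 d2.2) (miZ 3 d3.2)).
  rewrite -(mti_D (miZ 3 d1.2) (miD (miZ 3 d2.2) (miZ 3 d3.2))).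
  apply: mti_le; [exact: (s2B Ss St).2|exact: miD (miZ 3 d1.2) (miD (miZ 3 d2.2) (miZ 3 d3.2))|move=> x].
  move: (vc i s x) (vc i t x) (VQ Q i s x) (VQ Q i t x) => a b c d.
  have := sqr_ge0 (a - c + (b - d)); have := sqr_ge0 (a - c - (c - d)); have := sqr_ge0 (b - d + (c - d)); nra.
move: hQ bs' bt' hs'; rewrite -mulrA; move: (A / 2 ^+ Q) => B; lra.
Qed.

Lemma fsqB_S2 (f g : pt -> R) k : S2 f -> S2 g -> fsq (fun x => f x - g x) k <= 2 * fsq f k + 2 * fsq g k.
Proof.
move=> hf hg; have hc := CP_S2 (@CP_cosk R k); have hs := CP_S2 (@CP_sink R k).
have := fsqD k hf (s2Z (-1) hg).
have -> : fsq (fun x => -1 * g x) k = fsq g k.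
  have E (h : pt -> R) : S2 h -> (\oint x, -1 * g x * h x) = - (\oint x, g x * h x).
    move=> hh; rewrite (eq_ti (fun x => -1 * (g x * h x))) => [|x]; last by rewrite mulrA.
    by rewrite mti_Z ?mulN1r//; exact: s2M.
  by rewrite /fsq /fc /fs !E// !mulNr !sqrrN.
by rewrite (_ : (fun x => f x + -1 * g x) = (fun x => f x - g x))//; apply/funext => x; rewrite mulN1r.
Qed.

Section Sobolev.
Variables gm M : R.
Hypothesis gm0 : 0 < gm.
Hypothesis hM : forall t i ks Q, 0 <= t <= T -> uniq ks -> \sum_(k <- ks) wt2 gm k * fsq (VQ Q i t) k <= M.

Lemma M_ge0 : 0 <= M.
Proof.
have t0 : 0 <= (0 : R) <= T by rewrite lexx ltW.
by have := hM 0 0 t0 (isT : uniq [::]); rewrite big_nil; exact.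
Qed.

Lemma vc_H t i ks : 0 <= t <= T -> uniq ks -> \sum_(k <- ks) wt2 gm k * fsq (vc i t) k <= 2 * M + 1.
Proof.
move=> tT uks; have [_ St bt] := vcP i tT; have v0 := vol_gt0 R.
pose N := \sum_(k <- ks) wt2 gm k.
have N0 : 0 <= N by apply: sumr_ge0 => k _; exact: wt2_ge0.
have [Q hQ] := half_small (N * 4 / vol * A) (ltr01 : 0 < (1 : R)).
apply: (le_tr (\sum_(k <- ks) (2 * (wt2 gm k * fsq (VQ Q i t) k) + wt2 gm k * (4 * (A / 2 ^+ Q) / vol)))).
  apply: ler_sum => k _; rewrite mulrCA -mulrDr; apply: ler_wpM2l; first exact: wt2_ge0.
  apply: le_trans (fsq_apx k St (jc_CP t (jc_VQ Q i))) _; rewrite lerD2l ler_pM2r ?invr_gt0//.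
  by rewrite ler_pM2l.
rewrite big_split/= -big_distrr -big_distrl/= -/N; apply: lerD; first by rewrite ler_pM2l//; exact: hM.
by move: hQ; rewrite -[X in X <= 1]mulrA; move: (A / 2 ^+ Q) vol => B v; congr (_ <= _); ring.
Qed.

(** Young's inequality, mode by mode: it interpolates between [L^2] and [H^gm]. *)
Lemma wt2_half k (eta : R) : 0 < eta -> wt2 (gm / 2) k <= eta * wt2 gm k + eta^-1.
Proof.
move=> e0; have -> : wt2 gm k = wt2 (gm / 2) k ^+ 2.
  by rewrite /wt2 -(powR_mulrn 2) ?powR_ge0// -powRrM divfK.
move: (wt2 _ k) => a; rewrite -(ler_pM2l e0) mulrDr mulfV ?gt_eqF//.
have := sqr_ge0 (eta * a - 1); have := sqr_ge0 (eta * a); nra.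
Qed.

Lemma vl_diff t s i : (fun x => (vl s \- vl t) x 0 i) = (fun x => vc i s x - vc i t x).
Proof. by apply/funext => x; rewrite /vc !mxE. Qed.

Lemma S2_vl t s : 0 <= t <= T -> 0 <= s <= T -> forall i, S2 (fun x => (vl s \- vl t) x 0 i).
Proof.
move=> tT sT i; have [_ St _] := vcP i tT; have [_ Ss _] := vcP i sT; rewrite vl_diff; exact: s2B.
Qed.

Lemma L2_vl t : 0 <= t <= T -> L2 (vl t).
Proof.
move=> tT; apply: L2_S2 => [j x|i]; last by have [] := vcP i tT.
apply/rowP => i; have [h _ _] := vcP i tT; exact: h j x.
Qed.

Lemma C0_L2 : C0 (@L2 R) (@L2norm R) 0 T vl.
Proof.
move=> t; rewrite in_itv/= => tT; split; first exact: L2_vl.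
apply: ereal_cvg0 => [s|e e0]; first exact: Lnorm_ge0.
have e3 : 0 < e ^+ 2 / 3 by rewrite divr_gt0// exprn_gt0.
rewrite /within /=; apply: filterS (vc_close tT e3) => s hs; rewrite in_itv/= => sT.
apply: (L2norm_le (ltW e0)); first exact: S2_vl.
apply: (le_tr (\sum_(i < 3) e ^+ 2 / 3)); last by rewrite sumr_const card_ord -[leLHS]mulr_natl; lra.
apply: ler_sum => i _; rewrite (eq_ti (fun x => (vc i s x - vc i t x) ^+ 2)) => [|x]; first exact: hs.
by rewrite /vc !mxE.
Qed.

Lemma Hnorm_vl t : 0 <= t <= T -> (Hnorm (gm / 2) (vl t) <= (1 + 3 * (2 * M + 1))%:E)%E.
Proof.
move=> tT; have M0 := M_ge0; apply: Hnorm_le => [|ks uks]; first lra.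
have g2 : gm / 2 <= gm by have := gm0; move: (gm) => g; lra.
apply: (le_tr (\sum_(i < 3) \sum_(k <- ks) wt2 gm k * fsq (vc i t) k)).
  rewrite exchange_big/=; apply: ler_sum => k _; rewrite fourier_fsq -big_distrr/=.
  by apply: ler_wpM2r; [apply: sumr_ge0 => i _; exact: fsq_ge0|exact: wt2_le].
apply: (le_tr (\sum_(i < 3) (2 * M + 1))); first by apply: ler_sum => i _; exact: vc_H.
rewrite sumr_const card_ord -[leLHS]mulr_natl; nra.
Qed.

(** Boundedness in [H^gm] alone gives no continuity there. Half the exponent is given up, and
    interpolation with the continuity in [L^2] does the rest. *)
Lemma C0_H : C0 (Hsob (gm / 2)) (Hnorm (gm / 2)) 0 T vl.
Proof.
move=> t; rewrite in_itv/= => tT; split.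
  by split; [exact: L2_vl|apply: le_lt_trans (Hnorm_vl tT) (ltry _)].
apply: ereal_cvg0 => [s|e e0]; first exact: poweR_ge0.
have M0 := M_ge0.
have l1 (x y m : R) : x <= m -> y <= m -> 2 * x + 2 * y <= 4 * m by lra.
have l6 (x : R) : x / 6 + x / 6 <= x / 3 by lra.
have m1 : 2 * M + 1 != 0 by rewrite gt_eqF//; lra.
have v0 := vol_gt0 R.
(* Each component may use [e ^ 2 / 3]: half of it for the high norm, half for the [L^2]
   difference. *)
have [eta [eta0 etaE]] : exists eta, 0 < eta /\ eta * (24 * (2 * M + 1)) = e ^+ 2.
  exists (e ^+ 2 / (24 * (2 * M + 1))); split; last by rewrite divfK// mulf_neq0.
  by rewrite divr_gt0 ?exprn_gt0// mulr_gt0// lt_def m1; lra.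
have l4 : eta * (4 * (2 * M + 1)) = e ^+ 2 / 6 by rewrite -etaE; lra.
have l5 (v : R) : 0 < v -> eta^-1 * (4 * (e ^+ 2 * eta * v / 24) / v) = e ^+ 2 / 6.
  by move=> v1; field; rewrite !gt_eqF.
have d0 : 0 < e ^+ 2 * eta * vol / 24 by rewrite divr_gt0// (mulr_gt0 (mulr_gt0 (exprn_gt0 2 e0) eta0) v0).
rewrite /within /=; apply: filterS (vc_close tT d0) => s hs; rewrite in_itv/= => sT.
apply: (Hnorm_le (ltW e0)) => ks uks.
have one i : \sum_(k <- ks) wt2 (gm / 2) k * fsq (fun x => (vl s \- vl t) x 0 i) k <= e ^+ 2 / 3.
  rewrite vl_diff; have [_ St bt] := vcP i tT; have [_ Ss bs] := vcP i sT.
  have hd := s2B Ss St.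
  apply: (le_tr (\sum_(k <- ks) (eta * (2 * (wt2 gm k * fsq (vc i s) k) + 2 * (wt2 gm k * fsq (vc i t) k)) + eta^-1 * fsq (fun x => vc i s x - vc i t x) k))).
    apply: ler_sum => k _; apply: le_trans (ler_wpM2r (fsq_ge0 _ k) (wt2_half k eta0)) _.
    have := ler_wpM2l (mulr_ge0 (ltW eta0) (wt2_ge0 gm k)) (fsqB_S2 k Ss St).
    move: (fsq _ k) (fsq _ k) (fsq _ k) (wt2 gm k) eta^-1 => a b c x y; lra.
  have apx d : 0 < d -> exists g, CP g /\ (\oint x, (vc i s x - vc i t x - g x) ^+ 2) <= d.
    move=> dp; have [Q hQ] := half_small (4 * A) dp.
    have cs := jc_CP s (jc_VQ Q i); have ct := jc_CP t (jc_VQ Q i).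
    exists (fun x => VQ Q i s x - VQ Q i t x); split; first exact: CPB.
    have d1 := s2B Ss (CP_S2 cs); have d2 := s2B St (CP_S2 ct).
    apply: (le_tr (2 * (\oint x, (vc i s x - VQ Q i s x) ^+ 2) + 2 * (\oint x, (vc i t x - VQ Q i t x) ^+ 2))).
      rewrite -(mti_Z _ d1.2) -(mti_Z _ d2.2) -(mti_D (miZ 2 d1.2) (miZ 2 d2.2)).
      apply: mti_le; [exact: (s2B hd (CP_S2 (CPB cs ct))).2|exact: miD (miZ 2 d1.2) (miZ 2 d2.2)|move=> x].
      have := sq_add (vc i s x - VQ Q i s x) (- (vc i t x - VQ Q i t x)); rewrite sqrrN.
      by congr (_ ^+ 2 <= _); ring.
    have := bs Q; have := bt Q; move: hQ; rewrite -mulrA; move: (A / 2 ^+ Q) => B; lra.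
  have B := bessel_S2 hd apx uks.
  have sumE (a b d : 'rV[int]_3 -> R) (x y : R) : \sum_(k <- ks) (x * (2 * a k + 2 * b k) + y * d k) =
      x * (2 * (\sum_(k <- ks) a k) + 2 * (\sum_(k <- ks) b k)) + y * \sum_(k <- ks) d k.
    by elim: (ks) => [|k l IH]; [rewrite !big_nil|rewrite !big_cons IH]; ring.
  rewrite (sumE (fun k => wt2 gm k * fsq (vc i s) k) (fun k => wt2 gm k * fsq (vc i t) k)).
  have h1 := vc_H i sT uks; have h2 := vc_H i tT uks; have h3 := hs sT i.
  have p1 := ler_wpM2l (ltW eta0) (l1 _ _ _ h1 h2).
  have p3 : 4 * (\oint x, (vc i s x - vc i t x) ^+ 2) <= 4 * (e ^+ 2 * eta * vol / 24) by rewrite ler_pM2l.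
  have iv : 0 <= vol^-1 by rewrite invr_ge0 ltW.
  have p2 := le_trans B (ler_wpM2r iv p3).
  have ie : 0 <= eta^-1 by rewrite invr_ge0 ltW.
  have p4 := ler_wpM2l ie p2.
  apply: le_trans (lerD p1 p4) _; rewrite l4.
  have -> : eta^-1 * (4 * (e ^+ 2 * eta * vol / 24) / vol) = e ^+ 2 / 6.
    exact: l5.
  exact: l6.
under eq_bigr do rewrite fourier_fsq big_distrr/=.
rewrite exchange_big/=; apply: (le_tr (\sum_(i < 3) e ^+ 2 / 3)); first by apply: ler_sum => i _; exact: one.
by rewrite sumr_const card_ord -[leLHS]mulr_natl; lra.
Qed.

End Sobolev.
End Sol.

(** * Passage to the limit in the weak formulation *)

Section Weak.
Variable R : realType.
Notation pt := (point R).
Notation tp := (seq (mono R)).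
Notation vol := ((tpi : R) ^+ 3).
Notation lm := (@lebesgue_measure R).

Definition BI (e : R) (f : pt -> R) := MI f /\ `|ti f| <= e.

Lemma BID a b f g : BI a f -> BI b g -> BI (a + b) (fun x => f x + g x).
Proof.
move=> [mf hf] [mg hg]; split; first exact: miD.
by rewrite mti_D// (le_trans (ler_normD _ _))// lerD.
Qed.

Lemma BI_sum n (a : R) (f : 'I_n -> pt -> R) : (forall i, BI a (f i)) -> BI (a *+ n) (fun x => \sum_(i < n) f i x).
Proof.
elim: n f => [|n IH] f hf.
  rewrite (_ : (fun _ => _) = fun=> 0); last by apply/funext => x; rewrite big_ord0.
  by split; [exact: CP_MI (CP_cst 0)|rewrite ti_cst mul0r normr0].
rewrite (_ : (fun _ => _) = fun x => f ord0 x + \sum_(i < n) f (lift ord0 i) x); last by apply/funext => x; rewrite big_ord_recl.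
by rewrite mulrS; apply: BID => //; exact: IH.
Qed.

Lemma BI_N a f : BI a f -> BI a (fun x => - f x).
Proof.
move=> [mf hf]; have E : (fun x => - f x) = (fun x => -1 * f x) by apply/funext => x; rewrite mulN1r.
by rewrite E; split; [exact: miZ|rewrite mti_Z// mulN1r normrN].
Qed.

(* By the inequality [2 |f g| <= f^2 / e + e g^2]. *)
Lemma BI_triple (f g h : pt -> R) (e b G : R) : 0 < e -> S2 f -> S2 g -> CP h -> (forall x, `|h x| <= G) ->
  (\oint x, f x ^+ 2) <= e ^+ 2 -> (\oint x, g x ^+ 2) <= b ->
  BI (G * (e * (1 + b))) (fun x => f x * g x * h x).
Proof.
move=> e0 hf hg ch hG fe gb.
have G0 : 0 <= G := le_trans (normr_ge0 _) (hG 0).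
have g0 : 0 <= (\oint x, g x ^+ 2) by apply: ti_ge0 => x; exact: sqr_ge0.
pose d x := G * (e^-1 * f x ^+ 2 + e * g x ^+ 2).
have mB := miD (miZ e^-1 hf.2) (miZ e hg.2); have md : MI d := miZ G mB.
have pw x : `|f x * g x * h x| <= d x.
  rewrite normrM mulrC /d; apply: ler_pM => //.
  have -> : e^-1 * f x ^+ 2 + e * g x ^+ 2 = e^-1 * (f x ^+ 2 + (e * g x) ^+ 2) by field; lra.
  rewrite ler_pdivlMl//; have -> : e * `|f x * g x| = `|f x * (e * g x)| by rewrite -[X in X * `|_|](gtr0_norm e0) -normrM; congr `|_|; ring.
  move: (f x) (e * g x) => u v; rewrite ler_norml; apply/andP; split; have := sqr_ge0 (u + v); have := sqr_ge0 (u - v); have := sqr_ge0 u; have := sqr_ge0 v; nra.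
have mF : MI (fun x => f x * g x * h x).
  apply: mi_le pw md; apply: measurable_funM; last exact: measurable_row3 ch.1.
  by apply: measurable_funM; [exact: hf.1|exact: hg.1].
split=> //; apply: (le_tr (ti d)).
  apply: (le_tr (\oint x, `|f x * g x * h x|)).
    exact: (le_normr_Rintegral measurableT mF).
  apply: mti_le => //; apply: mi_le md => [|x]; last by rewrite normr_id.
  by have /measurable_int/measurable_EFinP h1 := mF; exact: (measurableT_comp (@normr_measurable R setT) h1).
rewrite (mti_Z G mB) (mti_D (miZ e^-1 hf.2) (miZ e hg.2)) (mti_Z _ hf.2) (mti_Z _ hg.2).
apply: ler_wpM2l => //; rewrite mulrDr mulr1; apply: lerD; last by rewrite ler_pM2l.
rewrite mulrC ler_pdivrMr//; by rewrite -expr2.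
Qed.

Lemma jc_bounded (f : R -> pt -> R) (T : R) : 0 < T -> jc f -> exists G, forall t x, 0 <= t <= T -> `|f t x| <= G.
Proof.
move=> T0 [cf pf].
have cK : compact (@box R `*` `[0, T]) := compact_setX (@compact_box R) (@segment_compact R 0 T).
have ck : {within (@box R `*` `[0, T]), continuous (fun z : pt * R => `|f z.2 z.1|)}.
  by apply: continuous_subspaceT => z; exact: (cvg_norm (cf z)).
have [G hG] := compact_bounded (continuous_compact ck cK).
exists (G + 1) => t x tT; rewrite -(tobox_per x (pf t)).
have := hG.2 (G + 1); rewrite ltrDl ltr01 => /(_ isT (`|f t (tobox x)|)) /=; rewrite normr_id; apply.
by exists (tobox x, t) => //; split; [exact: tobox_in|rewrite /= in_itv].
Qed.

Lemma uniform_continuous (I : R -> R) :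
  (forall e, 0 < e -> exists J : R -> R, continuous J /\ forall t, `|I t - J t| <= e) -> continuous I.
Proof.
move=> h t0; apply/cvgrPdist_le => e e0; have e3 : 0 < e / 3 by rewrite divr_gt0.
have [J [cJ hJ]] := h _ e3; have /cvgrPdist_le/(_ _ e3) := cJ t0; apply: filterS => t.
have := hJ t; have := hJ t0; rewrite !ler_norml.
by move: (I t) (I t0) (J t) (J t0) => a a' b b' /andP[h1 h2] /andP[h3 h4] /andP[h5 h6]; apply/andP; split; lra.
Qed.

Variables (T A B nu : R) (V : 'I_3 -> R -> pt -> R) (w : nat -> 'I_3 -> tp) (Sq : nat -> 'I_3 -> 'I_3 -> R -> pt -> R).
Hypothesis T0 : 0 < T.
Hypothesis hV : forall i, jc (V i).
Hypothesis hw : forall q i t, 0 <= t <= T -> (\oint x, ev (w q i) t x ^+ 2) <= A / 4 ^+ q.+1.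
Hypothesis hB : forall i t, 0 <= t <= T -> (\oint x, V i t x ^+ 2) <= B.
Hypothesis hS : forall Q i j, jc (Sq Q i j).
Hypothesis hL : forall Q t i j, 0 <= t <= T -> (\oint x, `|Sq Q i j t x|) <= 1 / 2 ^+ Q.
Hypothesis hN : forall Q, NSR T nu (VQ V w Q) (Sq Q).
Hypothesis hmean : forall Q i t, ti (VQ V w Q i t) = 0.
Hypothesis hdiv : forall Q t (g : pt -> R), smooth g -> torus_periodic g ->
  (\oint x, \sum_(j < 3) VQ V w Q j t x * grad g x 0 j) = 0.

Notation vc := (vc V w).
Notation vl := (vl V w).
Notation VQ := (VQ V w).
Let vP := vcP hV hw.
Let cQ Q i t : CP (VQ Q i t) := jc_CP t (jc_VQ w hV Q i).

Lemma choose_Q e : 0 < e -> exists Q, A / 2 ^+ Q <= e ^+ 2 /\ 1 / 2 ^+ Q <= e.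
Proof.
move=> e0; have e2 : 0 < e ^+ 2 by rewrite exprn_gt0.
have A0 := A_ge0 T0 hw.
have m0 : 0 < Num.min (e ^+ 2) e by rewrite lt_min e2.
have [Q hQ] := half_small (A + 1) m0.
have q0 : 0 <= (2 ^+ Q : R)^-1 by rewrite invr_ge0 exprn_ge0.
exists Q; move: hQ; rewrite le_min => /andP[h1 h2]; split.
  by apply: le_trans h1; rewrite ler_wpM2r// lerDl.
by apply: le_trans h2; rewrite ler_wpM2r// lerDr.
Qed.

Lemma small_eq0 (x K : R) : (forall e, 0 < e -> `|x| <= K * e) -> x = 0.
Proof.
move=> h; apply/eqP; rewrite -normr_le0; apply/ler_addgt0Pr => e e0; rewrite add0r.
have K1 : 0 < `|K| + 1 by rewrite ltr_wpDl.
apply: le_trans (h (e / (`|K| + 1)) (divr_gt0 e0 K1)) _.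
rewrite mulrCA ger_pMr// ler_pdivrMr// mul1r; apply: le_trans (ler_norm _) _; by rewrite lerDl.
Qed.

Lemma vl_zero_mean t : 0 <= t <= T -> zero_mean (vl t).
Proof.
move=> tT i; apply: (@small_eq0 _ (1 + vol)) => e e0; have [Q [hQ _]] := choose_Q e0.
have [_ Sv hv] := vP i tT; have Sd := s2B Sv (CP_S2 (cQ Q i t)).
have h1 : ti (fun _ : pt => (1 : R) ^+ 2) <= vol by rewrite ti_cst expr1n mul1r.
have n1x (x : pt) : `|1 : R| <= 1 by rewrite normr1.
have [_] := BI_triple e0 Sd (CP_S2 (CP_cst 1)) (CP_cst 1) n1x (le_trans (hv Q) hQ) h1.
rewrite mul1r mulrC (eq_ti (fun x => vc i t x - VQ Q i t x)) => [|x]; last by rewrite !mulr1.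
by rewrite (mti_B (s2_mi Sv) (CP_MI (cQ Q i t))) hmean subr0.
Qed.

Lemma vl_div_free t : 0 <= t <= T -> weakly_div_free (vl t).
Proof.
move=> tT g sg pg; have [cg _] := grad_line sg pg.
have [G hG] : exists G, forall j x, `|grad g x 0 j| <= G.
  have b j := CP_bounded (cg j); have [f hf] := choice (fun j => let: ex_intro2 m _ h := b j in ex_intro _ m h).
  exists (\sum_j `|f j|) => j x; apply: le_trans (hf j x) _; apply: le_trans (ler_norm _) _.
  by rewrite (bigD1 j)//= lerDl sumr_ge0.
apply: (@small_eq0 _ (G * (1 + vol) *+ 3)) => e e0; have [Q [hQ _]] := choose_Q e0.
have h1 : ti (fun _ : pt => (1 : R) ^+ 2) <= vol by rewrite ti_cst expr1n mul1r.
have b j : BI (G * (e * (1 + vol))) (fun x => (vc j t x - VQ Q j t x) * 1 * grad g x 0 j).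
  have [_ Sv hv] := vP j tT; have Sd := s2B Sv (CP_S2 (cQ Q j t)).
  exact: (BI_triple e0 Sd (CP_S2 (CP_cst 1)) (cg j) (hG j) (le_trans (hv Q) hQ) h1).
have [m1 b1] := BI_sum b.
have cV : CP (fun x => \sum_(j < 3) VQ Q j t x * grad g x 0 j).
  by apply: (@CP_sum R _ _ _ (fun j x => VQ Q j t x * grad g x 0 j)) => j; exact: CPM.
rewrite (eq_ti (fun x => \sum_(j < 3) (vc j t x - VQ Q j t x) * 1 * grad g x 0 j + \sum_(j < 3) VQ Q j t x * grad g x 0 j)) => [|x]; last first.
  by rewrite -big_split/=; apply: eq_bigr => j _; rewrite mulr1 -mulrDl subrK.
rewrite (mti_D m1 (CP_MI cV)) hdiv// addr0; apply: le_trans b1 _.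
by apply: le_of_eq; rewrite -mulrnAl -!mulrnAl; ring.
Qed.

Section Phi.
Variable phi : R -> field R.
Hypothesis hphi : test_field 0 T phi.
Notation P i t x := (tT phi i (x, t) + nu * \sum_(j < 3) tGG phi i j (x, t)).
Notation G i j t x := (tG phi i j (x, t)).
Notation wv := (wI vc (fun _ _ _ _ => 0) nu phi).

(** With [d = v - V], [v_i v_j - V_i V_j = d_i v_j + d_j v_i - d_i d_j]. For each component there
    are one linear term and three groups of four, the stress included, and [39 = 3 * 13]. *)
Lemma wI_close : exists K, forall e, 0 < e <= 1 -> exists Q, forall t, 0 <= t <= T ->
  `|ti (wv t) - ti (wI (VQ Q) (Sq Q) nu phi t)| <= K * e.
Proof.
have jP i : jc (fun t x => P i t x).
  apply: (jcD (jc_tT hphi i)); apply: (@jcZ R nu (fun t x => \sum_(j < 3) tGG phi i j (x, t))).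
  exact: (@jc_sum R 3 (fun j t x => tGG phi i j (x, t)) (jc_tGG hphi i)).
have [gb hgb] := choice (fun i => jc_bounded T0 (jP i)).
have [gd hgd] := choice (fun ij : 'I_3 * 'I_3 => jc_bounded T0 (jc_tG hphi ij.1 ij.2)).
pose g := \sum_i `|gb i| + \sum_ij `|gd ij|.
have s1 : 0 <= \sum_i `|gb i| by exact: sumr_ge0.
have s2 : 0 <= \sum_ij `|gd ij| by exact: sumr_ge0.
have hP t i x : 0 <= t <= T -> `|P i t x| <= g.
  move=> tT; apply: le_trans (hgb i t x tT) _; apply: le_trans (ler_norm _) _.
  by rewrite /g (bigD1 i)//= -addrA lerDl addr_ge0// sumr_ge0.
have hG t i j x : 0 <= t <= T -> `|G i j t x| <= g.
  move=> tT; apply: le_trans (hgd (i, j) t x tT) _; apply: le_trans (ler_norm _) _.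
  by rewrite /g [X in _ + X](bigD1 (i, j))//= addrCA lerDl addr_ge0// sumr_ge0.
pose b := 2 * A + 2 * B + vol + 1.
have A0 := A_ge0 T0 hw; have v0 := vol_gt0 R.
have B0 : 0 <= B.
  have t0 : 0 <= (0 : R) <= T by rewrite lexx ltW.
  by apply: le_trans (hB 0 t0); apply: ti_ge0 => x; exact: sqr_ge0.
have ab0 : 0 <= 2 * A + 2 * B by rewrite addr_ge0// mulr_ge0.
have bA : 2 * A + 2 * B <= b by rewrite /b -addrA lerDl addr_ge0// ltW.
have bv : vol <= b by rewrite /b -addrA [vol + 1]addrC addrA lerDr !addr_ge0// mulr_ge0.
have b1 : 1 <= b by rewrite /b lerDr addr_ge0// ltW.
pose m e := g * (e * (1 + b)).
exists (g * (1 + b) *+ 39) => e /andP[e0 e1]; have [Q [hQ hq]] := choose_Q e0; exists Q => t tT.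
have S i : S2 (vc i t) by have [] := vP i tT.
have d2 i : (\oint x, (vc i t x - VQ Q i t x) ^+ 2) <= e ^+ 2.
  by have [_ _ h] := vP i tT; exact: le_trans (h Q) hQ.
have d2b i : (\oint x, (vc i t x - VQ Q i t x) ^+ 2) <= b.
  by apply: le_trans (d2 i) _; apply: le_trans b1; rewrite expr_le1// ltW.
have Sd i : S2 (fun x => vc i t x - VQ Q i t x) := s2B (S i) (CP_S2 (cQ Q i t)).
have v2 i : (\oint x, vc i t x ^+ 2) <= b.
  have [_ _ h] := vP i tT; have h0 := h 0%N; rewrite expr0 divr1 in h0.
  have Sd0 := s2B (S i) (CP_S2 (cQ 0%N i t)); have SV := CP_S2 (jc_CP t (hV i)).
  apply: le_trans bA; apply: (le_tr (2 * (\oint x, (vc i t x - VQ 0%N i t x) ^+ 2) + 2 * (\oint x, V i t x ^+ 2))).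
    rewrite -(mti_Z _ Sd0.2) -(mti_Z _ SV.2) -(mti_D (miZ 2 Sd0.2) (miZ 2 SV.2)).
    apply: mti_le; [exact: (S i).2|exact: miD (miZ 2 Sd0.2) (miZ 2 SV.2)|move=> x].
    have := sq_add (vc i t x - VQ 0%N i t x) (V i t x); congr (_ ^+ 2 <= _).
    by rewrite /VQ big_ord0 addr0 subrK.
  by apply: lerD; rewrite ler_pM2l//; exact: hB.
have cP i : CP (fun x => P i t x) := jc_CP t (jP i).
have cG i j : CP (fun x => G i j t x) := jc_CP t (jc_tG hphi i j).
have cS i j : CP (fun x => Sq Q i j t x) := jc_CP t (hS Q i j).
have g0 : 0 <= g := addr_ge0 s1 s2.
have BP i : BI (m e) (fun x => (vc i t x - VQ Q i t x) * 1 * P i t x).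
  apply: (BI_triple e0 (Sd i) (CP_S2 (CP_cst 1)) (cP i) (fun x => hP t i x tT) (d2 i)).
  by rewrite ti_cst expr1n mul1r.
have BG1 i j : BI (m e) (fun x => (vc i t x - VQ Q i t x) * vc j t x * G i j t x).
  exact: (BI_triple e0 (Sd i) (S j) (cG i j) (fun x => hG t i j x tT) (d2 i) (v2 j)).
have BG2 i j : BI (m e) (fun x => (vc j t x - VQ Q j t x) * vc i t x * G i j t x).
  exact: (BI_triple e0 (Sd j) (S i) (cG i j) (fun x => hG t i j x tT) (d2 j) (v2 i)).
have BG3 i j : BI (m e) (fun x => (vc i t x - VQ Q i t x) * (vc j t x - VQ Q j t x) * G i j t x).
  exact: (BI_triple e0 (Sd i) (Sd j) (cG i j) (fun x => hG t i j x tT) (d2 i) (d2b j)).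
have BS i j : BI (m e) (fun x => Sq Q i j t x * G i j t x).
  have cSG := CPM (cS i j) (cG i j); split; first exact: CP_MI.
  apply: le_trans (ti_norm cSG) _; apply: (le_tr (\oint x, g * `|Sq Q i j t x|)).
    apply: ti_le => [||x]; [exact: CP_norm|exact: CPZ (CP_norm (cS i j))|].
    by rewrite normrM mulrC ler_wpM2r// hG.
  rewrite (tiZ _ (CP_norm (cS i j))) /m; apply: ler_wpM2l => //.
  apply: le_trans (hL Q i j tT) _; apply: le_trans hq _; rewrite ler_peMr ?(ltW e0)// lerDl.
  exact: le_trans b1.
pose E i j x := (vc i t x - VQ Q i t x) * vc j t x * G i j t x + ((vc j t x - VQ Q j t x) * vc i t x * G i j t x +
     (- ((vc i t x - VQ Q i t x) * (vc j t x - VQ Q j t x) * G i j t x) + - (Sq Q i j t x * G i j t x))).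
have Bi i : BI (m e *+ 13) (fun x => (vc i t x - VQ Q i t x) * 1 * P i t x + \sum_(j < 3) E i j x).
  rewrite mulrS; apply: BID; first exact: BP.
  rewrite (_ : m e *+ 12 = (m e *+ 4) *+ 3); last by rewrite -mulrnA.
  apply: (@BI_sum 3 (m e *+ 4) (E i)) => j.
  rewrite (_ : m e *+ 4 = m e + (m e + (m e + m e))); last by rewrite !mulrS mulr0n addr0.
  exact: BID (BG1 i j) (BID (BG2 i j) (BID (BI_N (BG3 i j)) (BI_N (BS i j)))).
have [mD bD] := BI_sum Bi.
have cJ : CP (wI (VQ Q) (Sq Q) nu phi t) := jc_CP t (jc_wI nu hphi (jc_VQ w hV Q) (hS Q)).
rewrite (eq_ti (f := wv t) (fun x => \sum_(i < 3) ((vc i t x - VQ Q i t x) * 1 * P i t x + \sum_(j < 3) E i j x) + wI (VQ Q) (Sq Q) nu phi t x)) => [|x]; last first.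
  rewrite /wI -big_split/=; apply: eq_bigr => i _; rewrite addrACA -big_split/=; congr (_ + _); first by ring.
  by apply: eq_bigr => j _; rewrite /E; ring.
rewrite (mti_D mD (CP_MI cJ)) addrK; apply: le_trans bD _.
apply: le_of_eq.
by rewrite -mulrnA /m (mulrCA g) mulrC mulrnAl.
Qed.

(** The integrands in time converge uniformly and share a compact support. The limit is therefore
    continuous and integrable, and its integral is a limit of zeros. *)
Lemma vl_weak : \int[lm]_t ti (wv t) = 0.
Proof.
have [c [d [c0 dT cd hz]]] := wI_supp nu T0 hphi; have [K hK] := wI_close.
pose I t := ti (wv t); pose J Q t := ti (wI (VQ Q) (Sq Q) nu phi t).
have z W S t : t \notin `[c, d] -> ti (wI W S nu phi t) = 0.
  by move=> ht; rewrite (eq_ti (fun=> 0)) => [|x]; [rewrite ti_cst mul0r|exact: hz].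
have K0 : 0 <= `|K| by [].
have close e : 0 < e <= 1 -> exists Q, forall t, `|I t - J Q t| <= `|K| * e.
  move=> e01; have [Q hQ] := hK e e01; exists Q => t; have /andP[e0 _] := e01.
  have [ht|ht] := boolP (t \in `[c, d]); last by rewrite /I /J !z// subr0 normr0 mulr_ge0// ltW.
  apply: le_trans (hQ t _) _; first by move: ht; rewrite in_itv/= => /andP[h1 h2]; apply/andP; split; lra.
  by rewrite ler_wpM2r ?ler_norm// ltW.
have small e : 0 < e -> exists Q, forall t, `|I t - J Q t| <= e.
  move=> e0; have K1 : 0 < `|K| + 1 by rewrite ltr_wpDl.
  pose e' := Num.min 1 (e / (`|K| + 1)).
  have e1 : 0 < e' <= 1 by rewrite lt_min ltr01 divr_gt0//= ge_min lexx.
  have [Q hQ] := close e' e1; exists Q => t; apply: le_trans (hQ t) _.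
  have h : e' <= e / (`|K| + 1) by rewrite ge_min lexx orbT.
  apply: le_trans (ler_wpM2l K0 h) _; rewrite mulrCA ger_pMr// ler_pdivrMr// mul1r lerDl//.
have cJ Q : continuous (J Q) := jc_ti (jc_wI nu hphi (jc_VQ w hV Q) (hS Q)).
have sJ Q : supp c d (J Q) by split; [exact: cJ|move=> t ht; exact: z].
have sI : supp c d I.
  split; last by move=> t ht; exact: z.
  apply: uniform_continuous => e e0; have [Q hQ] := small e e0; by exists (J Q).
apply: (@small_eq0 _ (d - c)) => e e0; have [Q hQ] := small e e0.
have sD : supp c d (fun t => I t - J Q t).
  split; first by move=> t; apply: cvgB; [exact: sI.1|exact: cJ].
  by move=> t ht; rewrite sI.2// (sJ Q).2// subr0.
rewrite -/I; have := supp_bound sD cd hQ.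
by rewrite (RintegralB measurableT (supp_integrable sI) (supp_integrable (sJ Q))) (hN Q hphi) subr0 mulrC.
Qed.

End Phi.

Lemma vl_weak_solution : C0 (@L2 R) (@L2norm R) 0 T vl -> weak_solution nu 0 T vl.
Proof.
move=> hC; split=> // [t|phi hphi].
  by rewrite in_itv/= => tT; split; [exact: vl_div_free|exact: vl_zero_mean].
rewrite -[RHS](vl_weak hphi); apply: eq_Rintegral => t _; apply: eq_ti => x.
rewrite /wI /dot; apply: eq_bigr => i _; rewrite !mxE -/(vc i t x).
have -> : advect (vl t) (phi t) x 0 i = \sum_(j < 3) vc j t x * tG phi i j (x, t).
  by rewrite /advect summxE; apply: eq_bigr => j _; rewrite mxE.
have -> : laplace (phi t) x 0 i = \sum_(j < 3) tGG phi i j (x, t) by rewrite /laplace summxE.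
have -> : limf (V i t) (fun q => ev (w q i) t) x = vc i t x by rewrite /vc mxE.
rewrite -/(tT phi i (x, t)) [X in _ = _ + X](eq_bigr (fun j => vc i t x * (vc j t x * tG phi i j (x, t)))) => [|j _]; last by rewrite addr0 mulrA.
by rewrite -mulr_sumr; ring.
Qed.

End Weak.

(** * Conclusion *)

Section Final.
Variable R : realType.
Notation pt := (point R).
Notation tp := (seq (mono R)).
Notation vol := ((tpi : R) ^+ 3).

Lemma divm_grad (W : 'I_3 -> tp) t (g : pt -> R) : divm W -> smooth g -> torus_periodic g ->
  (\oint x, \sum_(j < 3) ev (W j) t x * grad g x 0 j) = 0.
Proof.
move=> [dW _]; apply: (@div_grad R (fun j => ev (W j)) (fun j => ev (dj j (W j)))) => *.
- exact: jc_CP (jc_ev _).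
- exact: jc_CP (jc_ev _).
- exact: ev_dx.
- exact: dW.
Qed.

Section Sums.
Variables (V : 'I_3 -> R -> pt -> R) (w : nat -> 'I_3 -> tp).
Hypothesis hV : forall i, jc (V i).
Hypothesis dw : forall q, divm (w q).

Lemma VQ_mean : (forall t i, torus_int (V i t) = 0) -> forall Q i t, torus_int (VQ V w Q i t) = 0.
Proof.
move=> h Q i t; have cw (k : 'I_Q) : CP (ev (w k i) t) := jc_CP t (jc_ev (w k i)).
rewrite /VQ (tiD (jc_CP t (hV i)) (@CP_sum R _ _ _ (fun (k : 'I_Q) x => ev (w k i) t x) cw)) h add0r.
rewrite (@ti_sum R _ _ _ (fun (k : 'I_Q) x => ev (w k i) t x) cw) big1// => k _; have [_ e] := dw k; exact: e.
Qed.

Lemma VQ_div : (forall t (g : pt -> R), smooth g -> torus_periodic g -> (\oint x, \sum_(j < 3) V j t x * grad g x 0 j) = 0) ->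
  forall Q t (g : pt -> R), smooth g -> torus_periodic g -> (\oint x, \sum_(j < 3) VQ V w Q j t x * grad g x 0 j) = 0.
Proof.
move=> h Q t g sg pg; have [cg _] := grad_line sg pg.
elim: Q => [|Q IH].
  by rewrite -[RHS](h t g sg pg); apply: eq_ti => x; apply: eq_bigr => j _; rewrite /VQ big_ord0 addr0.
rewrite (eq_ti (fun x => \sum_(j < 3) VQ V w Q j t x * grad g x 0 j + \sum_(j < 3) ev (w Q j) t x * grad g x 0 j)) => [|x]; last first.
  by rewrite -big_split/=; apply: eq_bigr => j _; rewrite /VQ big_ord_recr/= addrA mulrDl.
rewrite tiD.
- by rewrite IH (divm_grad t (dw Q) sg pg) addr0.
- apply: (@CP_sum R _ _ _ (fun j x => VQ V w Q j t x * grad g x 0 j)) => j; exact: CPM (jc_CP t (jc_VQ w hV Q j)) (cg j).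
- apply: (@CP_sum R _ _ _ (fun j x => ev (w Q j) t x * grad g x 0 j)) => j; exact: CPM (jc_CP t (jc_ev _)) (cg j).
Qed.

End Sums.

Lemma Lq_ge (L : R) (E q : nat) : (1 < E)%N -> 1 <= L -> L ^+ q.+1 <= L ^+ (E ^ q).
Proof.
move=> E1 L1; apply: ler_weXn2l => //.
exact: ltn_expl.
Qed.

Lemma ler_pXn (a b : R) n : 0 <= a -> a <= b -> a ^+ n <= b ^+ n.
Proof. by move=> a0 ab; rewrite lerXn2r ?nnegrE// (le_trans a0). Qed.

(** [1 + 3 D ^ 2 <= D ^ 3 = Lq ^ (3 E ^ 2)], and [gm] reduces this exponent to at most [1/2]. *)
Lemma powR_half (gm D Lq : R) (E : nat) : 0 < gm -> (0 < E)%N -> gm * (6 * (E * E)%:R) <= 1 -> 4 <= Lq -> D = Lq ^+ (E * E) ->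
  (1 + 3 * D ^+ 2) `^ gm <= Num.sqrt Lq.
Proof.
move=> g0 E0 gE L4 ->; have L0 : 0 <= Lq by lra.
have [m mE] : exists m, (E * E = m.+1)%N by exists (E * E).-1; rewrite prednK// muln_gt0 E0.
have D4 : 4 <= Lq ^+ (E * E).
  rewrite mE exprS; apply: (le_tr (4 * 1)); first lra.
  by apply: ler_pM => //; apply: exprn_ege1; lra.
apply: (le_tr ((Lq ^+ (E * E) ^+ 3) `^ gm)).
  apply: ge0_ler_powR; rewrite ?nnegrE ?(ltW g0)//.
  - by rewrite addr_ge0// mulr_ge0// sqr_ge0.
  - by rewrite exprn_ge0// (le_trans _ D4).
  - by move: D4; move: (Lq ^+ _) => D' hD; rewrite !exprS expr0 mulr1; nra.
rewrite -exprM -powR_mulrn// -powRrM -powR12_sqrt//; apply: ler_powR; first lra.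
by rewrite natrM mulrC; move: (E * E)%:R gE => x; lra.
Qed.

(** [L] measures closeness. All exponents and bounds are quantified before it, which makes the
    regularity uniform along the sequence of viscosities. *)
Lemma solution_near (T bb : R) (u : R -> field R) : 0 < T -> 0 < bb -> hoelder_tx bb (- (2 * T)) (2 * T) u ->
  weak_solution 0 (- (2 * T)) (2 * T) u -> exists beta M c L0 : R, 0 < beta /\ forall L, L0 <= L -> 0 < L ->
  exists nu v, [/\ 0 < nu <= 1 /\ nu <= L^-1, C0 (Hsob beta) (Hnorm beta) 0 T v,
    forall t, 0 <= t <= T -> (Hnorm beta (v t) <= M%:E)%E, weak_solution nu 0 T v &
    forall t e, 0 <= t <= T -> 0 <= e -> c / L <= e ^+ 2 -> (L2norm (v t \- u t)%R <= e%:E)%E].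
Proof.
move=> T0 bb0 hu eu; have [K [p [p0 hinit]]] := init T0 bb0 hu eu.
have [E [C [E1 C0' hit]]] := iterate T0 p0.
have [gm0 [M0 [gm00 hgf]]] := gf_H p K T0.
have [Ku [pu [_ _ gu]]] := gf_uh T0 bb0 hu.
have [vv [vE vol0]] : exists vv, vv = vol /\ 0 < vv by exists vol; split=> //; exact: vol_gt0.
have E0 : (0 < E)%N by exact: ltnW.
have EE : 0 < (E * E)%:R :> R by rewrite ltr0n muln_gt0 E0.
(* The first exponent serves the mollified velocity, the second the series of perturbations. *)
pose gm := Num.min gm0 (6 * (E * E)%:R)^-1.
have gp : 0 < gm by rewrite lt_min gm00 invr_gt0 mulr_gt0.
have gE : gm * (6 * (E * E)%:R) <= 1 by rewrite -ler_pdivlMr ?mulr_gt0// mul1r ge_min lexx orbT.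
have ggm : gm <= gm0 by rewrite ge_min lexx.
pose M := 2 * M0 + 2 * (2 * C / vol).
exists (gm / 2), (1 + 3 * (2 * M + 1)), (48 * C + 6 * vv), (16 + T + pi / T + `|K|); split; first by rewrite divr_gt0.
move=> L LL Lp.
have pT : 0 < pi / T by rewrite divr_gt0// pi_gt0.
have [L16 TL pL KL] : [/\ 16 <= L, 1 + T <= L, pi / T <= L & K <= L].
  have := normr_ge0 K; have := ler_norm K; move: LL pT T0; move: (pi / T) => z; move: (`|K|) => k h1 h2 h3 h4 h5.
  by clear -h1 h2 h3 h4 h5; split; lra.
clear LL; have L9 : 9 <= L by clear -L16; lra.
have L1 : 1 <= L by clear -L16; lra.
have L4 : 4 <= L by clear -L16; lra.
have Li : 0 < L^-1 by rewrite invr_gt0.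
have [nu [V [S [[nu01 nuL] hv hS [hm hd] hVu]]]] := hinit L^-1 Li.
have KLE : K <= L ^+ E by apply: le_trans KL _; rewrite -(prednK E0) exprS ler_peMr ?(ltW Lp)// exprn_ege1.
have [v1 v2 v3 v4] := hv.
have hv' : vld T nu (L ^+ E) p V S.
  split; [by move=> i; exact: (gf_le KLE (v1 i))|by move=> i j; exact: (gf_le KLE (v2 i j))|exact: v3|exact: v4].
have nu01' : 0 <= nu <= 1 by have /andP[a b] := nu01; rewrite (ltW a).
have [w [Sq hq]] := hit nu L V S nu01' L9 TL pL hv' hS.
have hVj i : jc (V i) := hol_jc (v1 i).
pose Lq q := L ^+ (E ^ q).
have LqL q : L ^+ q.+1 <= Lq q := Lq_ge q E1 L1.
have Lq0 q : 0 < Lq q by rewrite exprn_gt0.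
have wi q i t : 0 <= t <= T -> (\oint x, ev (w q i) t x ^+ 2) <= 2 * C / Lq q.
  move=> tT; have [_ _ _ _ h] := hq q; apply: le_trans (h t tT).
  have c2 j : CP (fun x => ev (w q j) t x ^+ 2) by apply: CP_exp; exact: jc_CP t (jc_ev _).
  apply: ti_le; [exact: c2|exact: (@CP_sum R _ _ _ (fun j x => ev (w q j) t x ^+ 2))|move=> x].
  by rewrite (bigD1 i)//= lerDl sumr_ge0// => j _; exact: sqr_ge0.
pose A := 8 * C / L.
have hw q i t : 0 <= t <= T -> (\oint x, ev (w q i) t x ^+ 2) <= A / 4 ^+ q.+1.
  move=> tT; apply: le_trans (wi q i t tT) _.
  have l1 : L * 4 ^+ q <= Lq q.
    by apply: le_trans (LqL q); rewrite exprS (ler_pM2l Lp); exact: ler_pXn.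
  have q4 : 0 < (4 : R) ^+ q by rewrite exprn_gt0.
  have -> : A / 4 ^+ q.+1 = 2 * C / (L * 4 ^+ q).
    by rewrite /A exprS; field; rewrite !gt_eqF.
  by rewrite ler_wpM2l ?mulr_ge0// lef_pV2 ?posrE ?mulr_gt0.
pose B := (L ^+ E) ^+ 2 * vol.
have hB i t : 0 <= t <= T -> (\oint x, V i t x ^+ 2) <= B.
  move=> _; rewrite /B -ti_cst; apply: ti_le; [by apply: CP_exp; exact: jc_CP t (hVj i)|exact: CP_cst|move=> x].
  have [a1 _ _ _] := hv'; have [_ h _] := a1 i; have hx := h t x.
  by rewrite -[V i t x ^+ 2]real_normK ?num_real// lerXn2r ?nnegrE// (le_trans (normr_ge0 _) hx).
have hSj Q i j : jc (Sq Q i j) by have [[_ a _ _] _ _ _ _] := hq Q; exact: hol_jc (a i j).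
have hLS Q t i j : 0 <= t <= T -> (\oint x, `|Sq Q i j t x|) <= 1 / 2 ^+ Q.
  move=> tT; have [_ h _ _ _] := hq Q; apply: le_trans (h t i j tT) _; rewrite mul1r lef_pV2 ?posrE ?exprn_gt0//.
  apply: le_trans (LqL Q); rewrite exprS; apply: (le_tr (1 * 2 ^+ Q)); first by rewrite mul1r.
  by apply: ler_pM => //; apply: ler_pXn => //; clear -L4; lra.
have hN Q : NSR T nu (VQ V w Q) (Sq Q) by have [[_ _ _ h] _ _ _ _] := hq Q; exact: h.
have dw q : divm (w q) by have [] := hq q.
have hM t i ks Q : 0 <= t <= T -> uniq ks -> \sum_(k <- ks) wt2 gm k * fsq (VQ V w Q i t) k <= M.
  move=> tT uks.
  have cw (k : 'I_Q) : CP (ev (w k i) t) := jc_CP t (jc_ev (w k i)).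
  have cs : CP (fun x => \sum_(q < Q) ev (w q i) t x) by exact: (@CP_sum R _ _ _ (fun (k : 'I_Q) x => ev (w k i) t x) cw).
  apply: (le_tr (\sum_(k <- ks) (2 * (wt2 gm0 k * fsq (V i t) k) + 2 * (wt2 gm k * fsq (fun x => \sum_(q < Q) ev (w q i) t x) k)))).
    apply: ler_sum => k _; apply: le_trans (ler_wpM2l (wt2_ge0 gm k) (fsqD k (CP_S2 (jc_CP t (hVj i))) (CP_S2 cs))) _.
    have := ler_wpM2r (fsq_ge0 (V i t) k) (wt2_le k ggm).
    move: (fsq _ k) (fsq _ k) (wt2 gm k) (wt2 gm0 k) => a b c d h; clear -h; lra.
  rewrite big_split/= -!mulr_sumr; apply: lerD; rewrite ler_pM2l//; first exact: hgf.
  apply: (@series_H R (fun q => w q i) (fun q => Lq q ^+ (E * E)) (fun q => 2 * C / Lq q) gm _ t ks Q (ltW gp) uks) => q.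
  - split; first by rewrite exprn_ege1// exprn_ege1.
    by have [_ _ b _ _] := hq q; have [_] := b i.
  - exact: wi.
  have Lq4 : 4 <= Lq q.
    apply: le_trans (LqL q); rewrite exprS; apply: (le_trans L4).
    by rewrite ler_peMr ?(ltW Lp)// exprn_ege1.
  have x1 := powR_half gp E0 gE Lq4 erefl.
  set x := (_ `^ gm) in x1 *; set s := Num.sqrt (Lq q) in x1.
  have ss : s ^+ 2 = Lq q by rewrite sqr_sqrtr// ltW.
  have s0 : 0 < s by rewrite sqrtr_gt0.
  (* [Lq >= L ^ q.+1 >= 16 ^ q.+1], the reason for asking [L >= 16]. *)
  have s4 : 4 ^+ q.+1 <= s.
    rewrite -(ler_pXn2r (n := 2))// ?nnegrE ?exprn_ge0 ?(ltW s0)// ss exprAC.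
    apply: le_trans (LqL q); apply: ler_pXn; first exact: exprn_ge0.
    by clear -L16; rewrite expr2; lra.
  rewrite -ss exprVn ler_pdivlMr ?exprn_gt0//.
  have -> : 2 ^+ q.+1 * (x * (2 * C / s ^+ 2)) * 2 ^+ q.+1 = 2 * C * (4 ^+ q.+1 / s * (x / s)).
    have -> : (4 : R) = 2 * 2 by clear; lra.
    by clear -s0; rewrite exprMn; field; rewrite gt_eqF.
  rewrite ler_piMr ?mulr_ge0//; apply: mulr_ile1; rewrite ?divr_ge0 ?exprn_ge0 ?powR_ge0 ?(ltW s0)// ler_pdivrMr// mul1r//.
have cL2 := C0_L2 hVj hw.
exists nu, (vl V w); split; [by []|exact: (C0_H T0 hVj hw gp hM)|move=> t tT; exact: (Hnorm_vl T0 hVj hw gp hM)| |].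
  exact: (vl_weak_solution T0 hVj hw hB hSj hLS hN (VQ_mean hVj dw hm) (VQ_div hVj dw hd) cL2).
move=> t e tT e0 he.
have cu i : CP (fun x => u t x 0 i).
  by have := gf_CP t (gu i); congr CP; apply/funext => x; rewrite /uh (clamp_id tT).
have comp i : S2 (fun x => (vl V w t \- u t) x 0 i) /\ (\oint x, (vl V w t \- u t) x 0 i ^+ 2) <= e ^+ 2 / 3.
  have [_ Sv hA] := vcP hVj hw i tT; have h0 := hA 0%N; rewrite expr0 divr1 in h0.
  have cV := jc_CP t (jc_VQ w hVj 0 i).
  have Eq : (fun x => (vl V w t \- u t) x 0 i) = (fun x => vc V w i t x - u t x 0 i) by apply/funext => x; rewrite /vc !mxE.
  have E2 : (\oint x, (vl V w t \- u t) x 0 i ^+ 2) = (\oint x, (vc V w i t x - u t x 0 i) ^+ 2).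
    by apply: eq_ti => x; rewrite /vc !mxE.
  have S3 := s2B Sv (CP_S2 (cu i)); rewrite Eq E2; split=> //.
  have d1 := s2B Sv (CP_S2 cV); have c2 := CPB cV (cu i); have d2 := CP_S2 c2.
  apply: (le_tr (2 * (\oint x, (vc V w i t x - VQ V w 0 i t x) ^+ 2) + 2 * (\oint x, (VQ V w 0 i t x - u t x 0 i) ^+ 2))).
    rewrite -(mti_Z _ d1.2) -(mti_Z _ d2.2) -(mti_D (miZ 2 d1.2) (miZ 2 d2.2)).
    apply: mti_le; [exact: S3.2|exact: miD (miZ 2 d1.2) (miZ 2 d2.2)|move=> x].
    by have := sq_add (vc V w i t x - VQ V w 0 i t x) (VQ V w 0 i t x - u t x 0 i); rewrite addrA subrK.
  have h2 : (\oint x, (VQ V w 0 i t x - u t x 0 i) ^+ 2) <= L^-1 * vv.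
    rewrite vE -ti_cst; apply: ti_le; [exact: CP_exp|exact: CP_cst|move=> x].
    have hx := hVu t i x tT; rewrite /VQ big_ord0 addr0 -real_normK ?num_real//.
    have i1 : L^-1 <= 1 by rewrite invf_le1.
    apply: (le_tr (L^-1 ^+ 2)); first by rewrite lerXn2r ?nnegrE// ltW.
    by rewrite expr2 ger_pMr.
  have h3 : (48 * C + 6 * vv) / L = 6 * A + 6 * (L^-1 * vv) by rewrite /A; ring.
  rewrite h3 in he; move: h0 h2 he; move: (torus_int _) (torus_int _) (L^-1 * vv) (e ^+ 2) => a b c d h h' h''; clear -h h' h''; lra.
apply: (L2norm_le e0) => [i|]; first by have [] := comp i.
apply: (le_tr (\sum_(i < 3) e ^+ 2 / 3)); first by apply: ler_sum => i _; have [] := comp i.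
by rewrite sumr_const card_ord -[leLHS]mulr_natl; clear; lra.
Qed.

End Final.

Theorem theorem1p3 (R : realType) (T : R) (hT : 0 < T)
    (beta_bar : R) (hbeta_bar : 0 < beta_bar) (u : R -> field R)
    (hu : hoelder_tx beta_bar (- (2 * T)) (2 * T) u)
    (hu_euler : weak_solution 0 (- (2 * T)) (2 * T) u) :
  exists beta : R, 0 < beta /\
  exists (nu : nat -> R) (v : nat -> R -> field R),
    [/\ (forall n, 0 < nu n <= 1) /\ nu n @[n --> \oo] --> 0,
        forall n, C0 (Hsob beta) (Hnorm beta) 0 T (v n),
        (exists M : R, forall n, (C0norm (Hnorm beta) 0 T (v n) <= M%:E)%E),
        forall n, weak_solution (nu n) 0 T (v n) &
        C0norm (@L2norm R) 0 T (fun t => v n t \- u t) @[n --> \oo] --> 0%E].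
Proof.
have [beta [M [c [L0 [b0 h]]]]] := solution_near hT hbeta_bar hu hu_euler.
pose L n := `|L0| + n.+1%:R.
have Ln n : L0 <= L n by apply: le_trans (ler_norm L0) _; rewrite lerDl.
have Lp n : 0 < L n by rewrite ltr_wpDl.
have [nu hnu] := choice (fun n => h (L n) (Ln n) (Lp n)).
have [v hv] := choice hnu.
have Li n : (L n)^-1 <= n.+1%:R^-1 by rewrite lef_pV2 ?posrE// lerDr.
exists beta; split=> //; exists nu, v; split.
- split=> [n|]; first by have [[]] := hv n.
  apply: (@squeeze_cvgr _ _ _ _ (fun=> 0) (fun n => n.+1%:R^-1)); [|exact: cvg_cst|exact: cvg_harmonic].
  by apply: nearW => n; have [[/andP[a _] b] _ _ _ _] := hv n; rewrite (ltW a) (le_trans b).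
- by move=> n; have [] := hv n.
- exists M => n; apply: ub_ereal_sup => _ [t /= tT <-]; have [_ _ hn _ _] := hv n; apply: hn.
  by move: tT; rewrite in_itv.
- by move=> n; have [] := hv n.
apply: ereal_cvg0 => [n|e e0].
  (* The supremum is nonnegative because the time interval is not empty. *)
  have t0 : (0 : R) \in `[0, T] by rewrite in_itv/= lexx ltW.
  apply: le_trans (Lnorm_ge0 _ _ _) (ereal_sup_ubound (ex_intro2 _ _ 0 t0 erefl)).
near=> n; apply: ub_ereal_sup => _ [t /= tT <-]; have [_ _ _ _ hn] := hv n.
apply: hn; [by move: tT; rewrite in_itv|exact: ltW|].
rewrite ler_pdivrMr//; have e2 : 0 < e ^+ 2 by rewrite exprn_gt0.
rewrite -ler_pdivrMl//; apply: (le_tr n.+1%:R); last by rewrite lerDr.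
apply: (le_tr n%:R); last by rewrite ler_nat.
near: n; exact: nbhs_infty_ger.
Unshelve. all: by end_near. Qed.
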